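(* Suppose that, under $\mathbb P_{\mathfrak a}$, the cycle increment $Y_1$ has an exponential moment ($\mathbb E_{\mathfrak a}[e^{\theta|Y_1|_1}]<\infty$ for some $\theta>0$), mean vector $m\in(0,\infty)^d$, positive definite covariance matrix $\Gamma$, and that the difference subgroup $\mathcal L\subset\mathbb Z^d$ of the support of $Y_1$ has rank $d$ (so that the support of $Y_1$ is contained in the coset $y_0+\mathcal L$ and $Y_1$ is aperiodic on this coset). Then for every exponentially summable finite signed measure $r$ on $\mathbb N^d$ and every compact set $K\subset\mathbb R^d$, $$\sup_{k\in\mathcal W_a(K)}\left|a^{(d-1)/2}U_r(k)-r([k])\,\phi^{\perp,*}_{m,\Gamma}\left(\frac{k-am}{\sqrt a}\right)\right|\xrightarrow[a\to\infty]{}0,$$ where $\mathcal W_a(K)=\{k\in\mathbb N^d:(k-am)/\sqrt a\in K\}$.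
   Context: Notation: $\mathbb N=\{0,1,2,\dots\}$, $d\ge1$; $0_d$ is the zero vector; $|k|_1=\sum_j|k_j|$. Markov renewal chain. $(\mathsf X,\mathcal X)$ is a standard Borel space and $q=(q_k)_{k\in\mathbb N^d}$ is a family of non-negative kernels on $\mathsf X$ with $\sum_{k}q_k(x,\mathsf X)=1$ for all $x$, assumed strict: $q_{0_d}=0$. The chain $(J_n,S_n)_{n\ge0}$ in $\mathsf X\times\mathbb N^d$ has $S_0=0_d$ and, with $X_{n+1}=S_{n+1}-S_n$, $\mathbb P(J_{n+1}\in A,X_{n+1}=k\mid J_0,S_0,\dots,J_n,S_n)=q_k(J_n,A)$. Put $P(x,A)=\sum_kq_k(x,A)$ and $Q(x,A\times B)=\sum_{k\in B}q_k(x,A)$. Standing assumptions. (i) $P$ is positive Harris recurrent with invariant probability $\pi$, and $0<\int_{\mathsf X}\sum_kk_rq_k(x,\mathsf X)\,\pi(dx)<\infty$ for $r=1,\dots,d$. (ii) There are $C\in\mathcal X$ with $\pi(C)>0$, $\varepsilon\in(0,1]$ and a probability measure $\vartheta$ on $\mathsf X\times\mathbb N^d$ with $Q(x,\cdot)\ge\varepsilon\vartheta(\cdot)$ for $x\in C$. Split chain. $\widehat J_n=(J_n,\chi_n)$ lives in $(\mathsf X\times\{0\})\cup(C\times\{1\})$. Given $\widehat J_n=(x,1)$, $(J_{n+1},X_{n+1})$ has law $\vartheta$; given $(x,0)$ with $x\in C$ it has law $(Q(x,\cdot)-\varepsilon\vartheta)/(1-\varepsilon)$ (not used when $\varepsilon=1$);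 given $(x,0)$ with $x\notin C$ it has law $Q(x,\cdot)$. Then, given $J_{n+1}=y$, independently of the past, $\chi_{n+1}=1$ with probability $\varepsilon$ and $0$ otherwise if $y\in C$, and $\chi_{n+1}=0$ if $y\notin C$. The set $\mathfrak a=C\times\{1\}$ is an atom. $\mathbb P_{\mathfrak a}$ is the law of the split chain started from the normalized restriction to $\mathfrak a$ of its invariant probability (so $J_0\sim\pi(\cdot\cap C)/\pi(C)$, $\chi_0=1$, $S_0=0_d$). Cycles. $T_0=0$, $T_{j+1}=\inf\{n>T_j:\widehat J_n\in\mathfrak a\}$; $Y_j=S_{T_j}-S_{T_{j-1}}$; $C_n=Y_1+\cdots+Y_n$, $C_0=0_d$. Lattices. $\mathcal S=\{y\in\mathbb N^d:\mathbb P_{\mathfrak a}(Y_1=y)>0\}$, $y_0\in\mathcal S$ is fixed, $\mathcal L$ is the subgroup of $\mathbb Z^d$ generated by $\{y-y':y,y'\in\mathcal S\}$, $\mathcal L_*=\mathcal L+\mathbb Zy_0$, $\mathcal G_*=\mathbb Z^d/\mathcal L_*$, $[k]\in\mathcal G_*$ is the class of $k$, and $h_*=|\mathbb Z^d/\mathcal L_*|$. Renewal masses. $U_C(k)=\sum_{n\ge0}\mathbb P_{\mathfrak a}(C_n=k)$ for $k\in\mathbb N^d$ and $U_C(v)=0$ for $v\notin\mathbb N^d$. A finite signed measure $r$ on $\mathbb N^d$ is exponentially summable if $\sum_ue^{\eta|u|_1}|r|(u)<\infty$ for some $\eta>0$. For such $r$: $U_r(k)=\sum_{u\in\mathbb N^d}U_C(k-u)r(u)$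 and, for $\gamma\in\mathcal G_*$, $r(\gamma)=\sum_{u\in\mathbb N^d:[u]=\gamma}r(u)$. Transverse density. $\Pi_{m,\Gamma}=\Gamma^{-1}-\dfrac{\Gamma^{-1}mm^T\Gamma^{-1}}{m^T\Gamma^{-1}m}$, $\phi^\perp_{m,\Gamma}(w)=(2\pi)^{-(d-1)/2}\det(\Gamma)^{-1/2}(m^T\Gamma^{-1}m)^{-1/2}\exp\{-\frac12w^T\Pi_{m,\Gamma}w\}$ for $w\in\mathbb R^d$ (equal to $1/m$ when $d=1$), and $\phi^{\perp,*}_{m,\Gamma}(w)=h_*\phi^\perp_{m,\Gamma}(w)$. *)

(* Defs.v *)
From HB Require Import structures.
From mathcomp Require Import all_boot all_order all_algebra finmap.
From mathcomp Require Import all_classical all_reals all_analysis.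
Set Implicit Arguments.
Unset Strict Implicit.
Unset Printing Implicit Defensive.
Import Order.TTheory GRing.Theory Num.Theory.
Import numFieldNormedType.Exports.
Local Open Scope classical_set_scope.
Local Open Scope ring_scope.

(* N^d, Z^d and R^d are 'cV[nat]_d, 'cV[int]_d and 'cV[R]_d; N^d carries the
   discrete sigma-algebra. *)
HB.instance Definition _ (d : nat) := @isMeasurable.Build
  default_measure_display 'cV[nat]_d discrete_measurable
  discrete_measurable0 discrete_measurableC discrete_measurableU.

Definition toZ (d : nat) (k : 'cV[nat]_d) : 'cV[int]_d := map_mx Posz k.

Definition toR (R : realType) (d : nat) (k : 'cV[nat]_d) : 'cV[R]_d :=
  map_mx (fun n : nat => n%:R) k.

Definition norm1 (d : nat) (k : 'cV[nat]_d) : nat := (\sum_(i < d) k i ord0)%N.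

(* Entrywise truncated subtraction; only used below for u >= v. *)
Definition subNd (d : nat) (u v : 'cV[nat]_d) : 'cV[nat]_d :=
  \matrix_(i, j) (u i j - v i j)%N.

Definition is_metric (R : realType) (X : Type) (rho : X -> X -> R) : Prop :=
  [/\ forall x y, 0 <= rho x y,
      forall x y, rho x y = 0 <-> x = y,
      forall x y, rho x y = rho y x &
      forall x y z, rho x z <= rho x y + rho y z].

Definition metric_complete (R : realType) (X : Type) (rho : X -> X -> R) : Prop :=
  forall u : nat -> X,
    (forall e, 0 < e -> exists N, forall m n, (N <= m)%N -> (N <= n)%N ->
       rho (u m) (u n) < e) ->
    exists x, forall e, 0 < e -> exists N, forall n, (N <= n)%N -> rho (u n) x < e.

Definition metric_separable (R : realType) (X : Type) (rho : X -> X -> R) : Prop :=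
  exists2 D : set X, countable D &
    forall x e, 0 < e -> exists2 y, D y & rho x y < e.

Definition metric_open (R : realType) (X : Type) (rho : X -> X -> R) (U : set X) : Prop :=
  forall x, U x -> exists2 e, 0 < e & forall y, rho x y < e -> U y.

Definition standard_borel (R : realType) (dX : measure_display)
    (X : measurableType dX) : Prop :=
  exists rho : X -> X -> R,
    [/\ is_metric rho, metric_complete rho, metric_separable rho &
        @measurable dX X = <<s [set U | metric_open rho U] >>].

Definition filtration (dO dE : measure_display) (Omega : measurableType dO)
    (E : measurableType dE) (Z : nat -> Omega -> E) (n : nat) : set (set Omega) :=
  <<s \bigcup_(i in [set i | (i <= n)%N])
        preimage_set_system setT (Z i) measurable >>.

Definition markov_chain_from (R : realType) (dX dO : measure_display)
    (X : measurableType dX) (Omega : measurableType dO)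
    (P : X -> set X -> \bar R) (x : X)
    (Pr : probability Omega R) (J : nat -> Omega -> X) : Prop :=
  [/\ forall n, measurable_fun setT (J n),
      forall A, measurable A -> Pr (J 0%N @^-1` A) = \d_x A &
      forall n F A, filtration J n F -> measurable A ->
        Pr (F `&` J n.+1 @^-1` A) = (\int[Pr]_(w in F) P (J n w) A)%E].

(* All realizations of the chain started at x have the same law, and one exists
   on a standard Borel X (Ionescu-Tulcea), so quantifying over them amounts to
   a statement about P_x. *)
Definition harris_recurrent (R : realType) (dX : measure_display)
    (X : measurableType dX) (P : X -> set X -> \bar R) : Prop :=
  exists phi : {measure set X -> \bar R},
    [/\ sigma_finite setT phi, (0 < phi setT)%E &
        forall A, measurable A -> (0 < phi A)%E ->
        forall (x : X) (dO : measure_display) (Omega : measurableType dO)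
          (Pr : probability Omega R) (J : nat -> Omega -> X),
          markov_chain_from P x Pr J ->
          Pr [set w | forall n, exists2 i, (n <= i)%N & A (J i w)] = 1%E].

Definition invariant_probability (R : realType) (dX : measure_display)
    (X : measurableType dX) (P : X -> set X -> \bar R)
    (mu : probability X R) : Prop :=
  forall A, measurable A -> mu A = (\int[mu]_x P x A)%E.

Definition positive_harris (R : realType) (dX : measure_display)
    (X : measurableType dX) (P : X -> set X -> \bar R)
    (mu : probability X R) : Prop :=
  harris_recurrent P /\ invariant_probability P mu.

Definition kerP (R : realType) (d : nat) (dX : measure_display)
    (X : measurableType dX) (q : 'cV[nat]_d -> R.-ker X ~> X)
    (x : X) (A : set X) : \bar R :=
  (\esum_(k in [set: 'cV[nat]_d]) q k x A)%E.

Definition kerQ (R : realType) (d : nat) (dX : measure_display)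
    (X : measurableType dX) (q : 'cV[nat]_d -> R.-ker X ~> X)
    (x : X) (B : set (X * 'cV[nat]_d)) : \bar R :=
  (\esum_(k in [set: 'cV[nat]_d]) q k x [set y | B (y, k)])%E.

Definition renewal_kernel (R : realType) (d : nat) (dX : measure_display)
    (X : measurableType dX) (q : 'cV[nat]_d -> R.-ker X ~> X) : Prop :=
  forall x, kerP q x setT = 1%E.

Definition strict_kernel (R : realType) (d : nat) (dX : measure_display)
    (X : measurableType dX) (q : 'cV[nat]_d -> R.-ker X ~> X) : Prop :=
  forall x A, measurable A -> q 0 x A = 0%E.

Definition mean_step (R : realType) (d : nat) (dX : measure_display)
    (X : measurableType dX) (q : 'cV[nat]_d -> R.-ker X ~> X)
    (mu : probability X R) (i : 'I_d) : \bar R :=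
  (\int[mu]_x \esum_(k in [set: 'cV[nat]_d]) ((k i ord0)%:R%:E * q k x setT))%E.

Definition minorized (R : realType) (d : nat) (dX : measure_display)
    (X : measurableType dX) (q : 'cV[nat]_d -> R.-ker X ~> X) (C : set X)
    (eps : R) (theta : probability (X * 'cV[nat]_d)%type R) : Prop :=
  forall x B, C x -> measurable B -> (eps%:E * theta B <= kerQ q x B)%E.

(* Law of (J_{n+1}, X_{n+1}) given (J_n, chi_n) = (x, b).  For eps = 1 the
   middle case is a junk value, reached only with probability 0. *)
Definition split_step (R : realType) (d : nat) (dX : measure_display)
    (X : measurableType dX) (q : 'cV[nat]_d -> R.-ker X ~> X) (C : set X)
    (eps : R) (theta : probability (X * 'cV[nat]_d)%type R)
    (x : X) (b : bool) (B : set (X * 'cV[nat]_d)) : \bar R :=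
  if b then theta B
  else if x \in C then ((1 - eps)^-1%:E * (kerQ q x B - eps%:E * theta B))%E
  else kerQ q x B.

(* The process is given by J_n, chi_n (true for 1) and the increments X_n,
   n >= 1; X 0 plays no role, and S_0 = 0. *)
Definition psum (d : nat) (Omega : Type) (X : nat -> Omega -> 'cV[nat]_d)
    (n : nat) (w : Omega) : 'cV[nat]_d := \sum_(1 <= i < n.+1) X i w.

(* Split chain under P_a: for each n, the conditional law of
   (J_{n+1}, X_{n+1}) given the past, then the conditional law of chi_{n+1}
   given the past and (J_{n+1}, X_{n+1}), both in integrated form. *)
Definition split_chain_from_atom (R : realType) (d : nat)
    (dX dO : measure_display) (X : measurableType dX)
    (Omega : measurableType dO) (q : 'cV[nat]_d -> R.-ker X ~> X)
    (mu : probability X R) (C : set X) (eps : R)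
    (theta : probability (X * 'cV[nat]_d)%type R) (Pr : probability Omega R)
    (J : nat -> Omega -> X) (chi : nat -> Omega -> bool)
    (Xi : nat -> Omega -> 'cV[nat]_d) : Prop :=
  let past := filtration (fun n w => (J n w, chi n w, psum Xi n w)) in
  [/\ [/\ forall n, measurable_fun setT (J n),
          forall n, measurable_fun setT (chi n) &
          forall n, measurable_fun setT (Xi n)],
      Pr (chi 0%N @^-1` [set true]) = 1%E,
      forall A, measurable A ->
        Pr (J 0%N @^-1` A) = (fine (mu (A `&` C)) / fine (mu C))%:E,
      forall n F B, past n F -> measurable B ->
        Pr (F `&` (fun w => (J n.+1 w, Xi n.+1 w)) @^-1` B) =
        (\int[Pr]_(w in F) split_step q C eps theta (J n w) (chi n w) B)%E &
      forall n F,
        <<s past n `|` preimage_set_system setT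
              (fun w => (J n.+1 w, Xi n.+1 w)) measurable >> F ->
        Pr (F `&` chi n.+1 @^-1` [set true]) =
        (eps%:E * Pr (F `&` J n.+1 @^-1` C))%E].

(* First time after n at which v holds; the junk value n when there is none,
   which for the visits of the split chain to its atom has probability 0. *)
Definition next_visit (v : pred nat) (n : nat) : nat :=
  match pselect (exists i, (n < i)%N && v i) with
  | left ex => ex_minn ex
  | right _ => n
  end.

Definition cycle_time (X Omega : Type) (C : set X) (J : nat -> Omega -> X)
    (chi : nat -> Omega -> bool) (j : nat) (w : Omega) : nat :=
  iter j (next_visit (fun n => (J n w \in C) && chi n w)) 0%N.

(* Y_j; meaningful for j >= 1. *)
Definition cycle_incr (d : nat) (X Omega : Type) (C : set X)
    (J : nat -> Omega -> X) (chi : nat -> Omega -> bool)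
    (Xi : nat -> Omega -> 'cV[nat]_d) (j : nat) (w : Omega) : 'cV[nat]_d :=
  subNd (psum Xi (cycle_time C J chi j w) w)
        (psum Xi (cycle_time C J chi j.-1 w) w).

(* The remaining definitions take the sequence Y = (Y_j)_{j >= 1} of cycle
   increments as a parameter; C_n is psum Y n. *)

Definition supp (R : realType) (d : nat) (dO : measure_display)
    (Omega : measurableType dO) (Pr : probability Omega R)
    (Y1 : Omega -> 'cV[nat]_d) : set 'cV[nat]_d :=
  [set y | (0 < Pr (Y1 @^-1` [set y]))%E].

Definition is_subgroup (V : zmodType) (H : set V) : Prop :=
  H 0 /\ forall x y, H x -> H y -> H (x - y).

Definition subgroup_gen (V : zmodType) (A : set V) : set V :=
  smallest (@is_subgroup V) A.

Definition diff_lattice (d : nat) (S : set 'cV[nat]_d) : set 'cV[int]_d :=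
  subgroup_gen [set v | exists y y', [/\ S y, S y' & v = toZ y - toZ y']].

Definition full_lattice (d : nat) (S : set 'cV[nat]_d) (y0 : 'cV[nat]_d) :
    set 'cV[int]_d :=
  [set v | exists l (z : int), diff_lattice S l /\ v = l + toZ y0 *~ z].

(* Linear independence over Z of the columns of B. *)
Definition zfree (d n : nat) (B : 'M[int]_(d, n)) : Prop :=
  forall c : 'cV[int]_n, B *m c = 0 -> c = 0.

Definition has_rank (d : nat) (L : set 'cV[int]_d) (n : nat) : Prop :=
  (exists B : 'M[int]_(d, n), (forall j, L (col j B)) /\ zfree B) /\
  (forall p (B : 'M[int]_(d, p)), (forall j, L (col j B)) -> zfree B -> (p <= n)%N).

Definition coset_class (d : nat) (L : set 'cV[int]_d) (v : 'cV[int]_d) :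
    set 'cV[int]_d := [set u | L (u - v)].

(* The index of L in Z^d, when it is finite. *)
Definition lattice_index (d : nat) (L : set 'cV[int]_d) : nat :=
  #|` fset_set (range (coset_class L)) |.

(* U_C on Z^d.  The series converges, since almost surely C_n has l1-norm
   at least n for every n (strictness). *)
Definition renewal_mass (R : realType) (d : nat) (dO : measure_display)
    (Omega : measurableType dO) (Pr : probability Omega R)
    (Y : nat -> Omega -> 'cV[nat]_d) (v : 'cV[int]_d) : R :=
  if [forall i, 0 <= v i ord0]
  then fine (\sum_(0 <= n <oo) Pr [set w | toZ (psum Y n w) = v])%E
  else 0.

Definition mass (R : realType) (d : nat)
    (r : {charge set 'cV[nat]_d -> \bar R}) (u : 'cV[nat]_d) : R :=
  fine (r [set u]).

(* |r|({u}) = |r({u})|. *)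
Definition exp_summable (R : realType) (d : nat)
    (r : {charge set 'cV[nat]_d -> \bar R}) : Prop :=
  exists2 eta : R, 0 < eta &
    (\esum_(u in [set: 'cV[nat]_d])
       (expR (eta * (norm1 u)%:R) * `|mass r u|)%:E < +oo)%E.

(* U_r(k); the sum over u has finite support, as U_C(k - u) = 0 unless u <= k. *)
Definition renewal_mass_conv (R : realType) (d : nat) (dO : measure_display)
    (Omega : measurableType dO) (Pr : probability Omega R)
    (Y : nat -> Omega -> 'cV[nat]_d) (r : {charge set 'cV[nat]_d -> \bar R})
    (k : 'cV[nat]_d) : R :=
  \sum_(u \in [set: 'cV[nat]_d]) renewal_mass Pr Y (toZ k - toZ u) * mass r u.

(* r(gamma); by sigma-additivity, the sum of mass r u over the u in gamma. *)
Definition class_mass (R : realType) (d : nat) (L : set 'cV[int]_d)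
    (r : {charge set 'cV[nat]_d -> \bar R}) (gamma : set 'cV[int]_d) : R :=
  fine (r [set u | coset_class L (toZ u) = gamma]).

Definition quad (R : realType) (d : nat) (A : 'M[R]_d) (w : 'cV[R]_d) : R :=
  (w^T *m A *m w) ord0 ord0.

Definition pos_def (R : realType) (d : nat) (A : 'M[R]_d) : Prop :=
  A^T = A /\ forall w : 'cV[R]_d, w != 0 -> 0 < quad A w.

Definition transverse_form (R : realType) (d : nat) (m : 'cV[R]_d)
    (G : 'M[R]_d) : 'M[R]_d :=
  invmx G - (quad (invmx G) m)^-1 *: (invmx G *m m *m m^T *m invmx G).

Definition transverse_density (R : realType) (d : nat) (m : 'cV[R]_d)
    (G : 'M[R]_d) (w : 'cV[R]_d) : R :=
  (2 * pi) `^ (- ((d%:R - 1) / 2)) * (\det G) `^ (- 2^-1) *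
  (quad (invmx G) m) `^ (- 2^-1) *
  expR (- (2^-1 * quad (transverse_form m G) w)).

Definition transverse_density_star (R : realType) (d : nat)
    (L : set 'cV[int]_d) (m : 'cV[R]_d) (G : 'M[R]_d) (w : 'cV[R]_d) : R :=
  (lattice_index L)%:R * transverse_density m G w.

Definition rescaled (R : realType) (d : nat) (m : 'cV[R]_d) (a : R)
    (k : 'cV[nat]_d) : 'cV[R]_d :=
  (Num.sqrt a)^-1 *: (toR R k - a *: m).

Definition window (R : realType) (d : nat) (m : 'cV[R]_d) (K : set 'cV[R]_d)
    (a : R) : set 'cV[nat]_d := [set k | K (rescaled m a k)].

(* Main.v *)
Require Import Defs.
From HB Require Import structures.
From mathcomp Require Import all_boot all_order all_algebra finmap.
From mathcomp Require Import all_classical all_reals all_analysis.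
From mathcomp Require Import measurable_realfun.
From mathcomp Require Import ring lra zify.

(** The proof has a probabilistic half, which reduces the statement to the
    iterates of one convolution operator, and an analytic half, a local limit
    theorem for these iterates that uses no Fourier transform.

    Each time the split chain visits the atom, its next step has the law
    [theta] whatever its past, so its future is an independent copy of the
    future at time 0 ([regeneration]). The visits recur almost surely: the
    occupation measure of an excursion is dominated by a multiple of the
    invariant law ([occupation], [revisit]). Hence the increments over the
    cycles are independent copies of [Y 1] ([cycle_increments]), and with
    [P f x = E (f (x - Y 1))] the probability that the sum of [n] cycles is [x]
    is the value at [x] of the [n]-th iterate of [P] on the point mass at 0
    ([hit_law]); [hit n x] denotes it.

    For [x] within [D sqrt a] of [a m], exponential tilting shows that only the
    times [n] within [A sqrt a] of [a] contribute to the renewal series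
    ([step_tail], [hit_sums]). The iterates of an averaging operator become
    smooth along the differences of two points of its support ([diff_iter]).
    Since [d] differences of the indicator of a cone produce the point mass, the
    iterates decay like [n^(-d/2)] and their gradients along the difference
    lattice like [n^(-(d+1)/2)] ([sup_decay], [gradient_decay]). A translation by
    [y0] amounts to one more step, which changes the sum over the window of times
    by its end terms only. So the window sum varies slowly along the full lattice
    ([window_lipschitz]), and summed over representatives of the cosets it varies
    slowly on Z^d; this is where the index of the lattice comes from.

    A slowly varying function may be replaced by its average against a Gaussian
    of smaller scale. The walk moves Gaussian kernels into Gaussian kernels up to
    errors of third order ([heat_step]), because its first two moments match;
    hence the smoothed law of the walk at time [n] is Gaussian ([smoothed_hit]).
    Along the times of the window these Gaussians form a Riemann sum in the
    direction of [m], which integrates this direction out and leaves the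
    transverse density ([gauss_split], [window_riemann]). This proves the local
    limit theorem for the renewal masses ([main_limit]).

    The convolution with [r] is then a dominated sum: the masses of [r] at distance
    small with respect to [sqrt a] see the same limit, and the others are
    exponentially small while the renewal masses are bounded
    ([limit_nearby], [convolution_limit]). *)

Set Implicit Arguments.
Unset Strict Implicit.
Unset Printing Implicit Defensive.
Import Order.TTheory GRing.Theory Num.Theory.
Import numFieldNormedType.Exports.
Local Open Scope classical_set_scope.
Local Open Scope ring_scope.

(** * Countable families and discrete laws *)

Section countable_families.
Local Open Scope ereal_scope.
Context (T : countType).

(** The enumeration of a countable type has gaps, which carry the empty set. *)
Definition opt_set (U : Type) (A : T -> set U) (n : nat) : set U :=
  if choice.pickle_inv n is Some t then A t else set0.

Lemma opt_setE (U : Type) (A : T -> set U) t : opt_set A (choice.pickle t) = A t.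
Proof. by rewrite /opt_set choice.pickleK_inv. Qed.

Lemma bigcup_opt (U : Type) (A : T -> set U) : \bigcup_t A t = \bigcup_n opt_set A n.
Proof.
apply/seteqP; split => [w [t _ h]|w [n _]].
  by exists (choice.pickle t) => //; rewrite opt_setE.
by rewrite /opt_set; case: choice.pickle_inv => // t h; exists t.
Qed.

Lemma trivIset_opt (U : Type) (f : U -> T) (A : T -> set U) :
  (forall t, A t `<=` f @^-1` [set t]) -> trivIset setT (opt_set A).
Proof.
move=> h; apply/trivIsetP => i j _ _ ij; apply/seteqP; split=> // w [].
rewrite /opt_set.
case: choice.pickle_inv (@choice.pickle_invK T i) => //= t ti At.
case: choice.pickle_inv (@choice.pickle_invK T j) => //= t' tj At'.
by move/eqP: ij; apply; rewrite -ti -tj -(h _ _ At) -(h _ _ At').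
Qed.

Lemma sigma_algebra_countable (U : Type) (M : set (set U)) (A : T -> set U) :
  sigma_algebra setT M -> (forall t, M (A t)) -> M (\bigcup_t A t).
Proof.
move=> [M0 _ MU] h; rewrite bigcup_opt; apply: MU => n; rewrite /opt_set.
by case: choice.pickle_inv.
Qed.

Lemma esum_pickle (R : realType) (a : T -> \bar R) : (forall t, 0 <= a t) ->
  \esum_(t in [set: T]) a t =
  \sum_(0 <= n <oo) (if choice.pickle_inv n is Some t then a t else 0).
Proof.
move=> a0; rewrite nneseries_esumT; last by move=> n; case: choice.pickle_inv.
rewrite [RHS](_ : _ = \esum_(n in range (@choice.pickle T))
    (if choice.pickle_inv n is Some t then a t else 0)); last first.
  rewrite [RHS]esum_mkcond; apply: eq_esum => n _.
  case: ifPn => // /negP h.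
  case: choice.pickle_inv (@choice.pickle_invK T n) => //= t tn.
  by exfalso; apply: h; rewrite inE; exists t.
rewrite (@reindex_esum R T nat setT (range (@choice.pickle T)) (@choice.pickle T)).
  by apply: eq_esum => t _; rewrite choice.pickleK_inv.
by split=> //; move=> s t _ _; exact: (pcan_inj choice.pickleK).
Qed.

End countable_families.

Section discrete_laws.
Local Open Scope ereal_scope.
Context (R : realType) (dO : measure_display) (Omega : measurableType dO)
  (Pa : probability Omega R) (T : countType).
Variable f : Omega -> T.
Hypothesis mf : forall t, measurable (f @^-1` [set t]).

Lemma measure_split E : measurable E ->
  Pa E = \sum_(0 <= n <oo)
     (if choice.pickle_inv n is Some t then Pa (E `&` f @^-1` [set t]) else 0).
Proof.
move=> mE; have eE : E = \bigcup_t (E `&` f @^-1` [set t]).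
  by apply/seteqP; split => [w Ew|w [t _ []]//]; exists (f w).
rewrite [in LHS]eE bigcup_opt measure_semi_bigcup.
- by apply: eq_eseriesr => n _; rewrite /opt_set; case: choice.pickle_inv.
- move=> n; rewrite /opt_set; case: choice.pickle_inv => // t; exact: measurableI.
- by apply: (@trivIset_opt T _ f) => t w [].
- rewrite -bigcup_opt; apply: (@sigma_algebra_countable T _ measurable).
    exact: sigma_algebra_measurable.
  by move=> t; exact: measurableI.
Qed.

Lemma measurable_discrete (B : set T) : measurable (f @^-1` B).
Proof.
have -> : f @^-1` B = \bigcup_t (if t \in B then f @^-1` [set t] else set0).
  apply/seteqP; split => [w Bw|w [t _]]; first by exists (f w) => //; rewrite mem_set.
  by case: ifPn => // /set_mem tB h; rewrite /preimage /= h.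
apply: (@sigma_algebra_countable T _ measurable).
  exact: sigma_algebra_measurable.
by move=> t; case: ifP.
Qed.

Lemma integral_discrete (g : T -> R) : (forall t, (0 <= g t)%R) ->
  \int[Pa]_w (g (f w))%:E = \sum_(0 <= n <oo)
     (if choice.pickle_inv n is Some t then (g t)%:E * Pa (f @^-1` [set t]) else 0).
Proof.
move=> g0.
have mg : measurable_fun setT (fun w => (g (f w))%:E).
  by move=> _ B _; rewrite setTI; exact: (measurable_discrete (fun t => B (g t)%:E)).
have e : [set: Omega] = \bigcup_n opt_set (fun t => f @^-1` [set t]) n.
  by rewrite -bigcup_opt; apply/seteqP; split => // w _; exists (f w).
rewrite [in LHS]e ge0_integral_bigcup.
- apply: eq_eseriesr => n _; rewrite /opt_set; case: choice.pickle_inv => [t|].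
    rewrite -[RHS]integral_cst//; apply: eq_integral => w; rewrite inE /= => ->//.
  by rewrite integral_set0.
- by move=> n; rewrite /opt_set; case: choice.pickle_inv.
- by rewrite -e.
- by move=> w _; rewrite lee_fin.
- by apply: (@trivIset_opt T _ f) => t; exact: subset_refl.
Qed.

End discrete_laws.

Section transfer.
Local Open Scope ereal_scope.
Context (R : realType) (dO dX : measure_display) (Omega : measurableType dO)
  (X : measurableType dX) (Pa : probability Omega R).

Lemma integral_law_on E (mE : measurable E) j (mj : measurable_fun setT j) (f : X -> \bar R) :
  measurable_fun setT f -> (forall x, 0 <= f x) ->
  \int[Pa]_(w in E) f (j w) = \int[pushforward (mrestr Pa mE) j]_x f x.
Proof.
move=> mf f0; rewrite (ge0_integral_pushforward mj)//= preimage_setT.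
have mfj : measurable_fun setT (f \o j) by exact: measurableT_comp.
rewrite [RHS](ge0_negligible_integral (N := ~` E))//.
- rewrite setTD setCK; apply: eq_measure_integral => A mA AE.
  by rewrite /= /mrestr setIidl.
- exact: measurableC.
- by rewrite /= /mrestr setICl measure0.
Qed.

(** Both integrals are integrals of [f] against the law of [j] on the event,
    and two laws that agree up to a factor have integrals that do. *)
Lemma integral_transfer E E' (j j' : Omega -> X) (c : R) (f : X -> \bar R) :
  measurable E -> measurable E' -> measurable_fun setT j -> measurable_fun setT j' ->
  (0 <= c)%R -> measurable_fun setT f -> (forall x, 0 <= f x) ->
  (forall A, measurable A -> Pa (E `&` j @^-1` A) = c%:E * Pa (E' `&` j' @^-1` A)) ->
  \int[Pa]_(w in E) f (j w) = c%:E * \int[Pa]_(w in E') f (j' w).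
Proof.
move=> mE mE' mj mj' c0 mf f0 h.
rewrite (integral_law_on mE mj mf f0) (integral_law_on mE' mj' mf f0).
rewrite -(ge0_integral_mscale _ measurableT (NngNum c0))//.
apply: eq_measure_integral => A mA _.
by rewrite /= /pushforward /mscale /= /mrestr setIC h// setIC.
Qed.

End transfer.

(** * Regeneration of the split chain *)

Section increments.
Local Open Scope ereal_scope.
Context (d : nat).
Notation Nd := 'cV[nat]_d.
Implicit Types j k t x : Nd.

Definition leNd t k := [forall i, t i ord0 <= k i ord0]%N.

Lemma subNdK t k : leNd t k -> (t + subNd k t = k)%R.
Proof.
move=> /forallP h; apply/colP => i; rewrite mxE /subNd mxE.
exact: subnKC (h i).
Qed.

Lemma addNdK j t : subNd (j + t)%R j = t.
Proof. by apply/colP => i; rewrite /subNd !mxE; exact: addKn. Qed.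

Lemma leNd_addr j t : leNd j (j + t)%R.
Proof. by apply/forallP => i; rewrite mxE; exact: leq_addr. Qed.

Lemma addNd_inj j : injective (fun t => (j + t)%R).
Proof. by move=> a b h; rewrite -(addNdK j a) h addNdK. Qed.

Lemma leNd_trans t j k : leNd j t -> leNd t k -> leNd j k.
Proof. by move=> /forallP h /forallP h'; apply/forallP => i; exact: leq_trans (h' i). Qed.

Lemma leNd_refl k : leNd k k. Proof. by apply/forallP. Qed.

Context (Omega : Type) (Xi : nat -> Omega -> Nd).

Lemma psumS n w : (psum Xi n.+1 w = psum Xi n w + Xi n.+1 w)%R.
Proof. by rewrite /psum big_nat_recr. Qed.

Lemma psum0 w : psum Xi 0 w = 0%R.
Proof. by rewrite /psum big_geq. Qed.

Lemma psum_mono n p w : (n <= p)%N -> leNd (psum Xi n w) (psum Xi p w).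
Proof.
move=> /subnK <-; elim: (p - n)%N => [|u IH]; first exact: leNd_refl.
by rewrite addSn psumS; apply: leNd_trans IH (leNd_addr _ _).
Qed.

End increments.

Section sigma_algebras.
Local Open Scope ereal_scope.
Context (U : Type) (M : set (set U)).
Hypothesis hM : sigma_algebra setT M.

Lemma sigC A : M A -> M (~` A).
Proof. by move=> h; rewrite -setTD; case: hM => _ + _; apply. Qed.

Lemma sigI A A' : M A -> M A' -> M (A `&` A').
Proof.
move=> h h'; have [M0 _ MU] := hM.
have -> : A `&` A' = ~` (\bigcup_i nth set0 [:: ~` A; ~` A'] i).
  apply/seteqP; split => [w [a a'] [[|[|i]] _]//=|w h1].
    by rewrite nth_nil.
  by split; apply: contrapT => na; apply: h1; [exists 0%N|exists 1%N].
by apply: sigC; apply: MU => -[|[|i]] /=; rewrite ?nth_nil//; exact: sigC.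
Qed.

Lemma sigT : M setT.
Proof. by rewrite -setC0; apply: sigC; case: hM. Qed.

End sigma_algebras.

Section split_chain.
Local Open Scope ereal_scope.
Context (R : realType) (d : nat) (dX : measure_display) (X : measurableType dX)
  (q : 'cV[nat]_d -> R.-ker X ~> X).
Hypothesis hq : renewal_kernel q.
Context (mu : probability X R).
Variable C : set X.
Hypothesis hC : measurable C.
Variable eps : R.
Hypotheses (heps0 : (0 < eps)%R) (heps1 : (eps <= 1)%R).
Context (theta : probability (X * 'cV[nat]_d)%type R).
Hypothesis hminor : minorized q C eps theta.
Context (dO : measure_display) (Omega : measurableType dO) (Pa : probability Omega R)
  (J : nat -> Omega -> X) (chi : nat -> Omega -> bool)
  (Xi : nat -> Omega -> 'cV[nat]_d).
Hypothesis hchain : split_chain_from_atom q mu C eps theta Pa J chi Xi.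
Notation Nd := 'cV[nat]_d.
Notation S := (psum Xi).
Notation past := (filtration (fun n w => (J n w, chi n w, S n w))).
Notation step := (split_step q C eps theta).

Lemma measurable_kerQ B : measurable B -> measurable_fun setT (fun x => kerQ q x B).
Proof.
move=> mB; pose B' (k : Nd) := [set y | B (y, k)].
have mB' k : measurable (B' k).
  by rewrite -[B' k]/((fun y => (y, k)) @^-1` B) -ysectionE; exact: measurable_ysection.
rewrite (_ : (fun x => kerQ q x B) = (fun x => \sum_(0 <= n <oo)
    (if choice.pickle_inv n is Some k then q k x (B' k) else 0))); last first.
  by apply/funext => x; rewrite /kerQ esum_pickle.
rewrite (_ : (fun x => _) = (fun x => \sum_(0 <= n <oo | n \in predT)
    (if choice.pickle_inv n is Some k then q k x (B' k) else 0))); last first.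
  by apply/funext => x; apply: eq_eseriesl.
apply: ge0_emeasurable_sum => [n x _ _|n _]; first by case: choice.pickle_inv.
by case: choice.pickle_inv => [k|]//; exact: measurable_kernel.
Qed.

Lemma kerQ_ge0 x B : 0 <= kerQ q x B.
Proof. by apply: esum_ge0. Qed.

Lemma measurable_step B : measurable B -> measurable_fun setT (fun x => step x false B).
Proof.
move=> mB; rewrite /split_step.
have mC : measurable_fun setT (fun x => x \in C).
  apply: (measurable_fun_bool true); rewrite setTI.
  by rewrite (_ : _ @^-1` _ = C)//; apply/seteqP; split => x /=; [exact: set_mem|exact: mem_set].
apply: (measurable_fun_ifT mC); last exact: measurable_kerQ.
apply: emeasurable_funM => //; apply: emeasurable_funB => //.
exact: measurable_kerQ.
Qed.

Lemma step_ge0 x B : measurable B -> 0 <= step x false B.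
Proof.
move=> mB; rewrite /split_step; case: ifPn => [/set_mem xC|_]; last exact: kerQ_ge0.
apply: mule_ge0; first by rewrite lee_fin invr_ge0 subr_ge0.
rewrite sube_ge0; first exact: hminor.
by rewrite fin_numM// fin_num_measure.
Qed.

Let mJ n : measurable_fun setT (J n). Proof. by case: hchain => -[]. Qed.
Let mchi n : measurable_fun setT (chi n). Proof. by case: hchain => -[]. Qed.
Let mXi n : measurable_fun setT (Xi n). Proof. by case: hchain => -[]. Qed.

Lemma past_sigma n : sigma_algebra setT (past n).
Proof. exact: smallest_sigma_algebra. Qed.

Let past_gen n i (B : set (X * bool * Nd)) : (i <= n)%N -> measurable B ->
  past n ((fun w => (J i w, chi i w, S i w)) @^-1` B).
Proof.
move=> ni mB; apply: sub_sigma_algebra; exists i => //.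
by exists B => //; rewrite setTI.
Qed.

Lemma past_chi n i b : (i <= n)%N -> past n [set w | chi i w = b].
Proof.
move=> ni; have := @past_gen n i ((setT `*` [set b]) `*` setT) ni.
rewrite (_ : _ @^-1` _ = [set w | chi i w = b]); last by apply/seteqP; split => w //= [[]].
by apply; apply: measurableX => //; exact: measurableX.
Qed.

Lemma past_S n i k : (i <= n)%N -> past n [set w | S i w = k].
Proof.
move=> ni; have := @past_gen n i (setT `*` [set k]) ni.
rewrite (_ : _ @^-1` _ = [set w | S i w = k]); last by apply/seteqP; split => w //= [].
by apply; apply: measurableX.
Qed.

Lemma past_le n p : (n <= p)%N -> past n `<=` past p.
Proof.
move=> np; apply: sub_sigma_algebra2 => F [i /= ni hF].
by exists i => //=; exact: leq_trans np.
Qed.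

Let mS n k : measurable [set w | S n w = k].
Proof.
elim: n k => [|n IH] k.
  rewrite (_ : [set _ | _] = [set w | 0%R = k]).
    by have [->|h] := eqVneq 0%R k; [rewrite (_ : mkset _ = setT)//; apply/seteqP; split
      | rewrite (_ : mkset _ = set0)//; apply/seteqP; split => // w /= /eqP; rewrite (negbTE h)].
  by apply/seteqP; split => w /=; rewrite psum0.
rewrite (_ : [set _ | _] = \bigcup_(t : Nd) ([set w | S n w = t] `&` Xi n.+1 @^-1` [set x | t + x = k]%R)).
  apply: (@sigma_algebra_countable Nd _ measurable); first exact: sigma_algebra_measurable.
  by move=> t; apply: measurableI => //; rewrite -[X in measurable X]setTI; exact: mXi.
apply/seteqP; split => [w /= <-|w [t _ [/= <- <-]]]; last by rewrite psumS.
by exists (S n w) => //; split => //=; rewrite psumS.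
Qed.

Lemma past_measurable n F : past n F -> measurable F.
Proof.
apply: (smallest_sub (C := sigma_algebra setT) (sigma_algebra_measurable _)).
move=> A [i _ [B mB <-]]; rewrite setTI.
rewrite -[X in measurable X]setTI.
suff : measurable_fun setT (fun w => (J i w, chi i w, S i w)) by apply.
apply/measurable_fun_pair => /=.
  by apply/measurable_fun_pair.
move=> _ D _; rewrite setTI.
exact: (@measurable_discrete _ _ Nd (S i) (mS i)).
Qed.

(** The information available when the coin of time [n.+1] is flipped: the
    past of [n], the new state and the new increment. *)
Definition past_step n := <<s past n `|` preimage_set_system setT
              (fun w => (J n.+1 w, Xi n.+1 w)) measurable >>.

Lemma past_step_sigma n : sigma_algebra setT (past_step n).
Proof. exact: smallest_sigma_algebra. Qed.

Lemma past_step_past n : past n `<=` past_step n.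
Proof. by move=> F h; apply: sub_sigma_algebra; left. Qed.

Lemma past_step_J n A : measurable A -> past_step n (J n.+1 @^-1` A).
Proof.
move=> mA; apply: sub_sigma_algebra; right.
exists (A `*` setT); first exact: measurableX.
by rewrite setTI; apply/seteqP; split => w // [].
Qed.

Lemma past_step_S n k : past_step n [set w | S n.+1 w = k].
Proof.
rewrite (_ : [set _ | _] = \bigcup_(t : Nd) ([set w | S n w = t] `&` Xi n.+1 @^-1` [set x | t + x = k]%R)).
  apply: (@sigma_algebra_countable Nd _ (past_step n)); first exact: past_step_sigma.
  move=> t; apply: (sigI (past_step_sigma n)).
    by apply: past_step_past; exact: past_S.
  apply: sub_sigma_algebra; right; exists (setT `*` [set x | t + x = k]%R).
    exact: measurableX.
  by rewrite setTI; apply/seteqP; split => w // [].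
apply/seteqP; split => [w /= <-|w [t _ [/= <- <-]]]; last by rewrite psumS.
by exists (S n w) => //; split => //=; rewrite psumS.
Qed.

Lemma past_step_measurable n F : past_step n F -> measurable F.
Proof.
apply: (smallest_sub (C := sigma_algebra setT) (sigma_algebra_measurable _)).
move=> A [|[B mB <-]]; first exact: past_measurable.
suff : measurable_fun setT (fun w => (J n.+1 w, Xi n.+1 w)) by apply.
exact/measurable_fun_pair.
Qed.

Lemma coin_heads n F : past_step n F ->
  Pa (F `&` [set w | chi n.+1 w = true]) = eps%:E * Pa (F `&` J n.+1 @^-1` C).
Proof. by case: hchain => _ _ _ _ h; exact: h. Qed.

Lemma coin_tails n F : past_step n F ->
  Pa (F `&` [set w | chi n.+1 w = false]) = Pa F - eps%:E * Pa (F `&` J n.+1 @^-1` C).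
Proof.
move=> hF; rewrite -coin_heads// (_ : F `&` _ = F `\` [set w | chi n.+1 w = true]).
  rewrite measureD//; last by rewrite -ge0_fin_numE// fin_num_measure//; exact: past_step_measurable hF.
    exact: past_step_measurable hF.
  by apply: (@past_measurable n.+1); exact: past_chi.
apply/seteqP; split => w [h1 h2]; split => //=; first by rewrite h2.
by move: h2 => /=; case: chi.
Qed.

Lemma step_heads n F B : past n F -> measurable B -> F `<=` [set w | chi n w = true] ->
  Pa (F `&` (fun w => (J n.+1 w, Xi n.+1 w)) @^-1` B) = theta B * Pa F.
Proof.
move=> hF mB h; have mF := past_measurable hF.
case: hchain => _ _ _ -> // _; rewrite -integral_cst//.
by apply: eq_integral => w; rewrite inE => /h /= ->.
Qed.

Lemma step_tails n F B : past n F -> measurable B -> F `<=` [set w | chi n w = false] ->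
  Pa (F `&` (fun w => (J n.+1 w, Xi n.+1 w)) @^-1` B) = \int[Pa]_(w in F) step (J n w) false B.
Proof.
move=> hF mB h; case: hchain => _ _ _ -> // _.
by apply: eq_integral => w; rewrite inE => /h /= ->.
Qed.

Definition quiet s n : set Omega := [set w | forall i, (s < i < n)%N -> chi i w = false].

Lemma quiet1 s : quiet s s.+1 = setT.
Proof.
apply/seteqP; split => // w _ i /andP[h1 h2]; move: h2; rewrite ltnS leqNgt h1//.
Qed.

Lemma quietS s n : (s < n)%N -> quiet s n.+1 = quiet s n `&` [set w | chi n w = false].
Proof.
move=> sn; apply/seteqP; split => [w h|w [h1 h2] i /andP[si]].
  split; last by apply: h; rewrite sn ltnSn.
  by move=> i /andP[si ni]; apply: h; rewrite si ltnS ltnW.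
rewrite ltnS leq_eqVlt => /orP[/eqP->//|ni]; apply: h1; by rewrite si.
Qed.

Lemma quiet_past s n : (s < n)%N -> past n.-1 (quiet s n).
Proof.
move=> /subnK <-; rewrite addnS; elim: (n - s.+1)%N => [|u IH] /=.
  by rewrite add0n quiet1; exact: sigT (past_sigma _).
rewrite -[(u.+1 + s).+1]/((u + s).+2) quietS; last by rewrite ltnS leq_addl.
apply: (sigI (past_sigma _)); last exact: past_chi.
by apply: past_le IH; rewrite /= leqnSn.
Qed.

(** A visit at time [s], at a known place [j] and decided by the past of [s]:
    the chain restarts from such an event. *)
Record start (F : set Omega) (s : nat) (j : Nd) : Prop := Start {
  start_past : past s F;
  start_visit : F `<=` [set w | chi s w = true];
  start_place : F `<=` [set w | S s w = j] }.

(** After a start at time [s] from [j], the walk reaches [j + k] at time [n]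
    and has not visited the atom in between. *)
Definition excursion (F : set Omega) s n (j k : Nd) : set Omega :=
  F `&` quiet s n `&` [set w | S n w = j + k]%R.

Let excursion_step F s n j k : start F s j -> (s < n)%N ->
  past_step n.-1 (excursion F s n j k).
Proof.
move=> [hF _ _]; case: n => // n sn /=.
apply: (sigI (past_step_sigma _)); last exact: past_step_S.
apply: (sigI (past_step_sigma _)).
  by apply: past_step_past; exact: past_le hF.
by apply: past_step_past; exact: (@quiet_past s n.+1).
Qed.

Let F0 : set Omega := [set w | chi 0%N w = true].

Lemma start0 : start F0 0 0%R.
Proof. by split=> //; [exact: past_chi|move=> w _ /=; rewrite psum0]. Qed.

Lemma PaF0 : Pa F0 = 1. Proof. by case: hchain. Qed.

(** The last step before [n.+1] is taken from the place [j + t] reached at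
    time [n]; only [t] below [k] contributes, because the walk is monotone. *)
Lemma excursion_split F s n j k A t : start F s j -> (s < n)%N ->
  excursion F s n.+1 j k `&` J n.+1 @^-1` A `&` [set w | subNd (S n w) j = t] =
  if leNd t k then (excursion F s n j t `&` [set w | chi n w = false])
     `&` (fun w => (J n.+1 w, Xi n.+1 w)) @^-1` (A `*` [set subNd k t])
  else set0.
Proof.
move=> [_ _ hj] sn; rewrite /excursion quietS//.
have hS w : F w -> (j + subNd (S n w) j = S n w)%R.
  by move=> /hj <-; apply: subNdK; apply: psum_mono; exact: ltnW.
case: ifPn => tk; apply/seteqP; split=> // w.
- move=> [[[[Fw [qw cw]]] /= hk hA] ht]; have e := hS w Fw.
  rewrite -ht in tk *; rewrite /= e; split=> //; split=> //.
  apply: (@addNd_inj d (subNd (S n w) j)); apply: (@addNd_inj d j) => /=.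
  move: hk; rewrite psumS -{1}e -addrA => ->; congr (_ + _)%R.
  by rewrite subNdK.
- move=> [[[[Fw qw] /= hSw] cw] [/= hA hX]]; split; first split=> //.
    by split=> //=; rewrite psumS hSw hX -addrA subNdK.
  by rewrite /= hSw addNdK.
move=> [[[[Fw [qw cw]]] /= hk hA] ht]; have e := hS w Fw.
move/negP: tk; apply; rewrite -ht.
have : (j + (subNd (S n w) j + Xi n.+1 w) = j + k)%R by rewrite addrA e -psumS.
by move=> /addNd_inj <-; exact: leNd_addr.
Qed.

(** The first step from the atom has law [theta] whatever the past. After it,
    the law of the state on the excursion is proportional to its copy at time
    0 by induction; a failed coin flip multiplies this law by [1 - eps] on
    [C], and one more step integrates a fixed kernel against it. So the future
    of a visit is a copy of the future at time 0, up to the factor [Pa F]. *)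
Lemma regeneration F s j : start F s j -> forall u k A, measurable A ->
  Pa (excursion F s (s + u.+1) j k `&` J (s + u.+1) @^-1` A) =
  Pa F * Pa (excursion F0 0 u.+1 0 k `&` J u.+1 @^-1` A).
Proof.
move=> hF; pose c := fine (Pa F).
have mF := past_measurable (start_past hF).
have ce : Pa F = c%:E by rewrite fineK// fin_num_measure.
have c0 : (0 <= c)%R by rewrite fine_ge0.
elim=> [|u IH] k A mA.
  have base F' s' j' : start F' s' j' ->
      Pa (excursion F' s' s'.+1 j' k `&` J s'.+1 @^-1` A) = theta (A `*` [set k]) * Pa F'.
    move=> [h1 h2 h3]; rewrite -(step_heads h1)//; last exact: measurableX.
    congr (Pa _); rewrite /excursion quiet1 setIT; apply/seteqP; split => w.
      move=> [[Fw /= hk] hA]; split=> //=; split=> //=.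
      by move: hk; rewrite psumS (h3 _ Fw) => /addNd_inj.
    by move=> [Fw [/= hA hX]]; split=> //; split => //=; rewrite psumS (h3 _ Fw) hX.
  by rewrite addn1 (base _ _ _ hF) (base _ _ _ start0) PaF0 mule1 muleC.
rewrite addnS; set n := (s + u.+1)%N.
have sn : (s < n)%N by rewrite /n addnS ltnS leq_addr.
have mE F' s' n' j' k' : start F' s' j' -> (s' < n')%N ->
    measurable (excursion F' s' n' j' k').
  by move=> hF' sn'; exact: past_step_measurable (excursion_step k' hF' sn').
have mJA n' A' : measurable A' -> measurable (J n' @^-1` A').
  by move=> mA'; rewrite -[X in measurable X]setTI; exact: mJ.
have mf n' j' (t : Nd) : measurable ((fun w => subNd (S n' w) j') @^-1` [set t]).
  exact: (measurable_discrete (mS n') (fun v => subNd v j' = t)).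
rewrite (measure_split Pa (mf n j)); last first.
  by apply: measurableI; [apply: mE => //; exact: ltnW|apply: mJA].
rewrite (@measure_split _ _ _ Pa _ _ (mf u.+1 0%R) (excursion F0 0 u.+2 0%R k `&` _)); last first.
  by apply: measurableI; [apply: mE => //; exact: start0|apply: mJA].
rewrite ce -nneseriesZl; last by move=> i _; case: choice.pickle_inv.
apply: eq_eseriesr => i _; case: choice.pickle_inv => [t|]; last by rewrite mule0.
rewrite (excursion_split k A t hF sn) (@excursion_split F0 0 u.+1 0%R k A t start0)//.
case: ifP => tk; last by rewrite !measure0 mule0.
have mB : measurable (A `*` [set subNd k t]) by exact: measurableX.
have pE F' s' n' j' : start F' s' j' -> (s' < n')%N ->
    past n' (excursion F' s' n' j' t `&` [set w | chi n' w = false]).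
  move=> [h1 _ _] sn'; have sg := past_sigma n'.
  apply: (sigI sg); last exact: past_chi.
  apply: (sigI sg); last exact: past_S.
  apply: (sigI sg); first exact: past_le (ltnW sn') _ h1.
  exact: past_le (leq_pred _) _ (quiet_past sn').
rewrite (step_tails (pE _ _ _ _ hF sn))//.
rewrite (step_tails (pE _ _ _ _ start0 (ltn0Sn u)))//.
apply: (@integral_transfer R dO dX Omega X Pa _ _ (J n) (J u.+1) c (fun x => step x false (A `*` [set subNd k t]))) => //.
- exact: past_measurable (pE _ _ _ _ hF sn).
- exact: past_measurable (pE _ _ _ _ start0 (ltn0Sn u)).
- exact: measurable_step.
- by move=> x; exact: step_ge0.
move=> A' mA'.
have tails F' s' n' j' : start F' s' j' -> (s' < n')%N ->
    Pa (excursion F' s' n' j' t `&` [set w | chi n' w = false] `&` J n' @^-1` A') =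
    Pa (excursion F' s' n' j' t `&` J n' @^-1` A')
    - eps%:E * Pa (excursion F' s' n' j' t `&` J n' @^-1` (A' `&` C)).
  case: n' => // n' hF' sn'.
  have h := excursion_step t hF' sn'; rewrite /= in h.
  rewrite setIAC coin_tails; last first.
    by apply: (sigI (past_step_sigma n')); [exact: h|exact: past_step_J].
  by rewrite -setIA -preimage_setI.
rewrite (tails _ _ _ _ hF sn) (tails _ _ _ _ start0 (ltn0Sn u))//.
rewrite IH// IH; last exact: measurableI.
rewrite ce.
have fin E : measurable E -> Pa E \is a fin_num by move=> ?; exact: fin_num_measure.
rewrite -(fineK (fin _ (measurableI _ _ (mE _ _ u.+1 _ t start0 (ltn0Sn u)) (mJA u.+1 _ mA'))))//.
rewrite -(fineK (fin _ (measurableI _ _ (mE _ _ u.+1 _ t start0 (ltn0Sn u)) (mJA u.+1 _ (measurableI _ _ mA' hC)))))//.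
by rewrite -!EFinM -!EFinB; congr (_%:E); ring.
Qed.

Hypothesis hinv : invariant_probability (kerP q) mu.
Hypothesis hmuC : 0 < mu C.

Let mF0 : measurable F0. Proof. exact: past_measurable (past_chi true (leqnn 0)). Qed.
Let pF0 n : past n F0. Proof. exact: past_chi. Qed.
Let mJA n A : measurable A -> measurable (J n @^-1` A).
Proof. by move=> mA; rewrite -[X in measurable X]setTI; exact: mJ. Qed.
Let mquiet s n : (s < n)%N -> measurable (quiet s n).
Proof. by move=> sn; exact: past_measurable (quiet_past sn). Qed.

Let unvisited n A := Pa (F0 `&` quiet 0 n.+1 `&` J n.+1 @^-1` A).

(** The kernel [P] with the part [eps * theta] removed on [C]: how the chain
    moves as long as the coin flips fail. *)
Let residual A x :=
  kerQ q x (A `*` setT) - (if x \in C then eps%:E * theta (A `*` setT) else 0).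

Let mAT (A : set X) : measurable A -> measurable (A `*` [set: Nd]).
Proof. by move=> mA; exact: measurableX. Qed.

Let theta_fin A : measurable A -> eps%:E * theta (A `*` setT) \is a fin_num.
Proof. by move=> mA; rewrite fin_numM// fin_num_measure//; exact: mAT. Qed.

Let mC : measurable_fun setT (fun x => x \in C).
Proof.
apply: (measurable_fun_bool true); rewrite setTI.
by rewrite (_ : _ @^-1` _ = C)//; apply/seteqP; split => x /=; [exact: set_mem|exact: mem_set].
Qed.

Let residual_ge0 A x : measurable A -> 0 <= residual A x.
Proof.
move=> mA; rewrite /residual; case: ifPn => [/set_mem xC|_]; last by rewrite sube0 kerQ_ge0.
by rewrite sube_ge0 ?theta_fin//; apply: hminor => //; exact: mAT.
Qed.

Let measurable_residual A : measurable A -> measurable_fun setT (residual A).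
Proof.
move=> mA; apply: emeasurable_funB; first exact: measurable_kerQ (mAT mA).
exact: (measurable_fun_ifT mC).
Qed.

(** Invariance of [mu], with the mass that regenerates on [C] written apart. *)
Let invariantE A : measurable A ->
  mu A = \int[mu]_x residual A x + eps%:E * theta (A `*` setT) * mu C.
Proof.
move=> mA; rewrite (hinv mA).
have e : eps%:E * theta (A `*` setT) * mu C =
    \int[mu]_x (if x \in C then eps%:E * theta (A `*` setT) else 0).
  rewrite -integral_cst// [LHS]integral_mkcond; apply: eq_integral => x _.
  by rewrite patchE.
have t0 : 0 <= eps%:E * theta (A `*` setT) by rewrite mule_ge0// lee_fin ltW.
rewrite e -ge0_integralD//.
- apply: eq_integral => x _; rewrite /residual subeK; last by case: ifP => // _; exact: theta_fin.
  rewrite /kerP /kerQ; apply: eq_esum => k _; congr (q k x _).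
  by apply/seteqP; split => y //= [].
- by move=> x _; exact: residual_ge0.
- exact: measurable_residual.
- by move=> x _; case: ifP.
- exact: (measurable_fun_ifT mC).
Qed.

Let quiet_tails n A : measurable A ->
  Pa (F0 `&` quiet 0 n.+2 `&` J n.+1 @^-1` A) =
  unvisited n A - eps%:E * unvisited n (A `&` C).
Proof.
move=> mA; rewrite /unvisited quietS// setIA setIAC coin_tails; last first.
  apply: (sigI (past_step_sigma n)); last exact: past_step_J.
  apply: past_step_past; apply: (sigI (past_sigma n)); first exact: pF0.
  exact: quiet_past (ltn0Sn n).
by rewrite preimage_setI setIA.
Qed.

(** On [C] the failed flip multiplies the law by [1 - eps], which cancels the
    normalization in [step]. When [eps] is 1 that normalization is the default
    value 0, whence an inequality. *)
Let unvisited_step n A : measurable A -> unvisited n.+1 A <=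
  \int[Pa]_(w in F0 `&` quiet 0 n.+1) residual A (J n.+1 w).
Proof.
move=> mA; set B := A `*` [set: Nd]; have mB : measurable B by exact: mAT.
set E2 := F0 `&` quiet 0 n.+1; set E1 := F0 `&` quiet 0 n.+2.
have pE1 : past n.+1 E1.
  by apply: (sigI (past_sigma _)); [exact: pF0|exact: quiet_past (ltn0Sn n.+1)].
have mE1 : measurable E1 := past_measurable pE1.
have mE2 : measurable E2 by apply: measurableI => //; exact: mquiet.
pose D b := J n.+1 @^-1` (if b then C else ~` C).
have mD b : measurable (D b) by apply: mJA; case: b => //; exact: measurableC.
have splitE E f : measurable E -> measurable_fun setT f -> (forall x, 0 <= f x) ->
    \int[Pa]_(w in E) f (J n.+1 w) = \int[Pa]_(w in E `&` D true) f (J n.+1 w)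
      + \int[Pa]_(w in E `&` D false) f (J n.+1 w).
  move=> mE mf f0; rewrite -ge0_integral_setU//.
  - by congr integral; rewrite -setIUr /D -preimage_setU setUv preimage_setT setIT.
  - exact: measurableI.
  - exact: measurableI.
  - by apply: measurable_funTS; exact: (measurableT_comp mf (mJ n.+1)).
  - by apply/disj_setPS => w [[_ h1] [_ h2]].
rewrite (_ : unvisited n.+1 A = \int[Pa]_(w in E1) step (J n.+1 w) false B); last first.
  rewrite -step_tails//; last by move=> w [_ h]; apply: h; rewrite /= ltnSn.
  by congr (Pa _); apply/seteqP; split => w [h1 h2]; split => //; case: h2.
rewrite (splitE E1 (fun x => step x false B))//; last 2 first.
- exact: measurable_step.
- by move=> x; exact: step_ge0.
rewrite (splitE E2 (residual A))//; last 2 first.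
- exact: measurable_residual.
- by move=> x; exact: residual_ge0.
have tr b A' : measurable A' -> Pa (E1 `&` D b `&` J n.+1 @^-1` A') =
    (if b then 1 - eps else 1)%:E * Pa (E2 `&` D b `&` J n.+1 @^-1` A').
  move=> mA'; rewrite /D -[E1 `&` _ `&` _]setIA -[E2 `&` _ `&` _]setIA -preimage_setI /E1 /E2.
  have mA2 : measurable ((if b then C else ~` C) `&` A').
    by apply: measurableI => //; case: b => //; exact: measurableC.
  rewrite quiet_tails// /unvisited; case: b mA2 => mA2.
    rewrite (_ : C `&` A' `&` C = C `&` A'); last by rewrite setIAC setIid.
    have fz : Pa (F0 `&` quiet 0 n.+1 `&` J n.+1 @^-1` (C `&` A')) \is a fin_num.
      by rewrite fin_num_measure//; apply: (measurableI _ _ mE2); exact: mJA.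
    move: (Pa _) fz => [r| |]// _; rewrite -!EFinM -EFinB; congr (_%:E); ring.
  rewrite (_ : ~` C `&` A' `&` C = set0); last by rewrite setIAC setICl set0I.
  by rewrite preimage_set0 setI0 measure0 mule0 sube0 mul1e.
have e1 : (0 <= 1 - eps)%R by rewrite subr_ge0.
apply: leeD.
  rewrite (@integral_transfer R dO dX Omega X Pa _ (E2 `&` D true) (J n.+1) (J n.+1) (1 - eps)
     (fun x => step x false B))//.
  - rewrite -ge0_integralZl//.
    + apply: ge0_le_integral => //.
      * exact: measurableI.
      * by move=> w _; rewrite mule_ge0 ?step_ge0// lee_fin.
      * apply: emeasurable_funM => //; apply: measurable_funTS.
        exact: (measurableT_comp (measurable_step mB) (mJ n.+1)).
      * apply: measurable_funTS; exact: (measurableT_comp (measurable_residual mA) (mJ n.+1)).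
      * move=> w [_ wC]; rewrite /residual /split_step mem_set// -/B.
        have t0 := residual_ge0 (J n.+1 w) mA; rewrite /residual mem_set// -/B in t0.
        have [e0|e0] := eqVneq (1 - eps)%R 0%R; first by rewrite e0 mul0e.
        by rewrite muleA -EFinM mulfV// mul1e.
    + exact: measurableI.
    + apply: measurable_funTS; exact: (measurableT_comp (measurable_step mB) (mJ n.+1)).
    + by move=> w _; exact: step_ge0.
  - exact: measurableI.
  - exact: measurableI.
  - exact: measurable_step.
  - by move=> x; exact: step_ge0.
  - by move=> A' mA'; rewrite (tr true).
rewrite (@integral_transfer R dO dX Omega X Pa _ (E2 `&` D false) (J n.+1) (J n.+1) 1
     (fun x => step x false B))//.
- rewrite mul1e le_eqVlt; apply/orP; left; apply/eqP; apply: eq_integral => w.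
  rewrite inE => -[_ wC]; rewrite /residual /split_step memNset// sube0//.
- exact: measurableI.
- exact: measurableI.
- exact: measurable_step.
- by move=> x; exact: step_ge0.
- by move=> A' mA'; rewrite (tr false).
Qed.

Let c : R := (eps * fine (mu C))%R.

Let c_gt0 : (0 < c)%R.
Proof. by rewrite mulr_gt0// fine_gt0// hmuC ltey_eq fin_num_measure. Qed.

(** Moving the occupation measure of an excursion by the residual kernel adds
    one step and loses the first term, which is exactly what regeneration
    contributes to the invariant law in [invariantE]; so a multiple of it
    stays below the invariant law, by induction on [N]. *)
Let occupation N A : measurable A -> c%:E * \sum_(n < N) unvisited n A <= mu A.
Proof.
elim: N A => [|N IH] A mA; first by rewrite big_ord0 mule0.
have /boolp.choice [law hlaw] : forall n, exists m' : {measure set X -> \bar R},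
    (forall A, m' A = unvisited n A) /\ forall f, measurable_fun setT f ->
    (forall x, 0 <= f x) -> \int[m']_x f x = \int[Pa]_(w in F0 `&` quiet 0 n.+1) f (J n.+1 w).
  move=> n; have mE : measurable (F0 `&` quiet 0 n.+1).
    by apply: measurableI => //; exact: mquiet.
  exists (@measure_function_pushforward__canonical__measure_function_Measure
    _ _ _ _ _ (mrestr Pa mE) (J n.+1) (mJ n.+1)); split.
    by move=> A'; rewrite /= /pushforward /mrestr setIC.
  by move=> f mf f0; rewrite (integral_law_on Pa mE (mJ n.+1) mf f0).
have hle S' : measurable S' -> mscale (NngNum (ltW c_gt0)) (msum law N) S' <= mu S'.
  move=> mS'; rewrite /mscale /= /msum; apply: le_trans (IH S' mS').
  by rewrite le_eqVlt; apply/orP; left; apply/eqP; congr (_ * _); apply: eq_bigr => n _; rewrite (hlaw n).1.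
have := ge0_le_measure_integral hle measurableT (fun x => residual_ge0 x mA) (measurable_residual mA).
rewrite ge0_integral_mscale//; last 2 first.
- exact: measurable_residual.
- by move=> x _; exact: residual_ge0.
rewrite ge0_integral_measure_sum//; last 2 first.
- by move=> x _; exact: residual_ge0.
- exact: measurable_residual.
move=> /= h1; rewrite (invariantE mA) big_ord_recl /= ge0_muleDr//; last first.
  by apply: sume_ge0.
rewrite addeC; apply: leeD.
  apply: le_trans h1; rewrite lee_wpmul2l ?lee_fin ?(ltW c_gt0)//.
  apply: lee_sum => n _; rewrite (hlaw n).2//.
  - exact: unvisited_step.
  - exact: measurable_residual.
  - by move=> x; exact: residual_ge0.
rewrite /unvisited quiet1 setIT.
rewrite (_ : F0 `&` J 1%N @^-1` A = F0 `&` (fun w => (J 1%N w, Xi 1%N w)) @^-1` (A `*` setT)); last first.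
  by apply/seteqP; split => w [h h']; split => //; case: h'.
rewrite step_heads//; last exact: mAT.
rewrite PaF0 mule1 /c EFinM fineK ?fin_num_measure// muleAC//.
Qed.

(** The probabilities of having seen no visit by time [n.+1] decrease, and by
    [occupation] their sum is finite. *)
Let quiet_bound n : (c * n.+1%:R)%:E * Pa (F0 `&` quiet 0 n.+1) <= 1.
Proof.
rewrite -(@probability_setT _ _ _ mu); apply: le_trans (occupation n.+1 measurableT).
rewrite EFinM -muleA lee_wpmul2l ?lee_fin ?(ltW c_gt0)//.
have -> : n.+1%:R%:E * Pa (F0 `&` quiet 0 n.+1) = \sum_(i < n.+1) Pa (F0 `&` quiet 0 n.+1).
  have : Pa (F0 `&` quiet 0 n.+1) \is a fin_num.
    by rewrite fin_num_measure//; apply: measurableI => //; exact: mquiet.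
  by move: (Pa _) => [r| |]// _; rewrite sumEFin sumr_const card_ord -EFinM mulr_natl.
apply: lee_sum => i _; rewrite /unvisited preimage_setT setIT; apply: le_measure.
- by rewrite inE; apply: measurableI => //; exact: mquiet.
- by rewrite inE; apply: measurableI => //; exact: mquiet.
move=> w [h1 h2]; split=> // p /andP[p0 pi]; apply: h2; rewrite p0 /=.
by apply: leq_trans pi _; rewrite ltnS -ltnS.
Qed.

Lemma regeneration_quiet F s j n : start F s j ->
  Pa (F `&` quiet s (s + n.+1)) = Pa F * Pa (F0 `&` quiet 0 n.+1).
Proof.
move=> hF; have sn : (s < s + n.+1)%N by rewrite addnS ltnS leq_addr.
have mF := past_measurable (start_past hF).
have mf n' j' (t : Nd) : measurable ((fun w => subNd (S n' w) j') @^-1` [set t]).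
  exact: (measurable_discrete (mS n') (fun v => subNd v j' = t)).
rewrite (measure_split Pa (mf (s + n.+1)%N j)); last by apply: measurableI => //; exact: mquiet.
rewrite (@measure_split _ _ _ Pa _ _ (mf n.+1 0%R) (F0 `&` _)); last first.
  by apply: measurableI => //; exact: mquiet.
pose cF := fine (Pa F); have ce : Pa F = cF%:E by rewrite fineK// fin_num_measure.
rewrite ce -nneseriesZl; last by move=> i _; case: choice.pickle_inv.
apply: eq_eseriesr => i _; case: choice.pickle_inv => [t|]; last by rewrite mule0.
have e F' s' n' j' : start F' s' j' -> (s' < n')%N ->
    F' `&` quiet s' n' `&` (fun w => subNd (S n' w) j') @^-1` [set t] =
    excursion F' s' n' j' t `&` J n' @^-1` setT.
  move=> [_ _ hj] sn'; rewrite preimage_setT setIT; apply/seteqP; split => w [[h1 h2] /= h3].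
    split=> //=; rewrite -h3 subNdK// -(hj _ h1); exact/psum_mono/ltnW.
  by split => //=; rewrite h3 addNdK.
by rewrite (e _ _ _ _ hF sn) (e _ _ _ _ start0 (ltn0Sn n)) (regeneration hF)// ce.
Qed.

Let mnever s : measurable [set w | forall i, (s < i)%N -> chi i w = false].
Proof.
rewrite (_ : [set _ | _] = \bigcap_n quiet s (s + n.+1)); last first.
  apply/seteqP; split => [w h n _ i /andP[si _]|w h i si]; first exact: h.
  by apply: (h i) => //; rewrite si addnS ltnS leq_addl.
by apply: bigcapT_measurable => n; apply: mquiet; rewrite addnS ltnS leq_addr.
Qed.

(** Recurrence of the atom, from [quiet_bound] carried to the time [s] by
    regeneration. *)
Lemma revisit F s j : start F s j ->
  Pa (F `&` [set w | forall i, (s < i)%N -> chi i w = false]) = 0.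
Proof.
move=> hF; have mF := past_measurable (start_past hF).
set N := [set w | _].
have mFN : measurable (F `&` N) by apply: measurableI => //; exact: mnever.
have h n : (c * n.+1%:R)%:E * Pa (F `&` N) <= 1.
  apply: (@le_trans _ _ ((c * n.+1%:R)%:E * Pa (F0 `&` quiet 0 n.+1))); last exact: quiet_bound.
  apply: lee_wpmul2l; first by rewrite lee_fin mulr_ge0// ltW.
  apply: (@le_trans _ _ (Pa (F `&` quiet s (s + n.+1)))).
    apply: le_measure; rewrite ?inE//; first apply: measurableI => //.
      by apply: mquiet; rewrite addnS ltnS leq_addr.
    by move=> w [h1 h2]; split => // i /andP[si _]; exact: h2.
  rewrite (regeneration_quiet n hF) -[leRHS]mul1e lee_wpmul2r//.
  exact: probability_le1.
have fz : Pa (F `&` N) \is a fin_num by exact: fin_num_measure.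
have : 0 <= Pa (F `&` N) by exact: measure_ge0.
move: h; rewrite -(fineK fz); move: (fine (Pa (F `&` N))) => x h.
rewrite lee_fin => x0; congr (_%:E).
apply/eqP; rewrite eq_le x0 andbT leNgt; apply/negP => xp.
have cx : (0 < c * x)%R by exact: mulr_gt0.
have := h (Num.truncn (c * x)^-1); rewrite -EFinM lee_fin mulrAC => h1.
have := truncnS_gt (c * x)^-1.
by rewrite -(ltr_pM2l cx) mulfV ?gt_eqF// ltNge h1.
Qed.

Notation visits w := (fun n => (J n w \in C) && chi n w).
Notation T := (cycle_time C J chi).
Notation Y := (cycle_incr C J chi Xi).

Lemma next_visit_ge v n : (n <= next_visit v n)%N.
Proof.
rewrite /next_visit; case: pselect => // ex.
by case: ex_minnP => i /andP[/ltnW].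
Qed.

Lemma next_visitP v n s : (n < s)%N -> next_visit v n = s <->
  v s /\ forall i, (n < i < s)%N -> ~~ v i.
Proof.
move=> ns; rewrite /next_visit; case: pselect => [ex|nex].
  case: ex_minnP => i /andP[ni vi] hmin; split => [<-|[vs hs]].
    split=> // p /andP[np pi]; apply/negP => vp.
    by have := hmin p; rewrite np vp leqNgt pi => /(_ isT).
  apply/eqP; rewrite eqn_leq (hmin s) ?ns//= leqNgt; apply/negP => is_.
  by have := hs i; rewrite ni is_ vi => /(_ isT).
split=> [h|[vs _]]; first by move: ns; rewrite h ltnn.
by exfalso; apply: nex; exists s; rewrite ns.
Qed.

Lemma next_visit_same v n : next_visit v n = n <-> forall i, (n < i)%N -> ~~ v i.
Proof.
rewrite /next_visit; case: pselect => [ex|nex]; split => //.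
- by case: ex_minnP => i /andP[ni _] _ h; move: ni; rewrite h ltnn.
- by move=> h; exfalso; case: (ex) => i /andP[ni vi]; have := h i ni; rewrite vi.
by move=> _ i ni; apply/negP => vi; apply: nex; exists i; rewrite ni.
Qed.

Local Arguments cycle_time : simpl never.

Lemma cycle_timeS n w : T n.+1 w = next_visit (visits w) (T n w).
Proof. by rewrite /cycle_time iterS. Qed.

(** Telescoping. It holds on every path, also where a visit is missing: the
    default value of [next_visit] repeats the last visit, which adds a zero
    cycle. *)
Lemma psum_cycles n w : psum Y n w = S (T n w) w.
Proof.
elim: n => [|n IH]; first by rewrite !psum0.
rewrite psumS IH -[Y n.+1 w]/(subNd (S (T n.+1 w) w) (S (T n w) w)) subNdK//; apply: psum_mono.
by rewrite cycle_timeS next_visit_ge.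
Qed.

Let mvisit i : measurable [set w | visits w i].
Proof.
rewrite (_ : [set _ | _] = J i @^-1` C `&` [set w | chi i w = true]).
  by apply: measurableI; [exact: mJA|exact: past_measurable (past_chi true (leqnn i))].
by apply/seteqP; split => w /=; [move=> /andP[/set_mem]|move=> [/mem_set -> ->]].
Qed.

Let mgap (P : pred nat) : measurable [set w | forall i, P i -> ~~ visits w i].
Proof.
rewrite (_ : [set _ | _] = \bigcap_i (if P i then ~` [set w | visits w i] else setT)).
  by apply: bigcapT_measurable => i; case: ifP => // _; exact/measurableC/mvisit.
apply/seteqP; split => [w h i _|w h i Pi]; first by case: ifP => // Pi; exact/negP/h.
by have := h i I; rewrite Pi => /negP.
Qed.

Let mnext p s : measurable [set w | next_visit (visits w) p = s].
Proof.
have [ps|sp|sp] := ltngtP p s.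
- rewrite (_ : [set _ | _] = [set w | visits w s] `&` [set w | forall i, (p < i < s)%N -> ~~ visits w i]).
    by apply: measurableI; [exact: mvisit|exact: (mgap (fun i => p < i < s)%N)].
  by apply/seteqP; split => w /=; [move/(next_visitP _ ps)|move=> h; apply/(next_visitP _ ps)].
- rewrite (_ : [set _ | _] = set0)//; apply/seteqP; split=> // w /= h.
  by have := next_visit_ge (visits w) p; rewrite h leqNgt sp.
rewrite -sp (_ : [set _ | _] = [set w | forall i, (p < i)%N -> ~~ visits w i]).
  exact: (mgap (fun i => p < i)%N).
by apply/seteqP; split => w /=; [move/next_visit_same|move=> h; apply/next_visit_same].
Qed.

Lemma measurable_cycle_time n s : measurable (T n @^-1` [set s]).
Proof.
elim: n s => [|n IH] s.
  have [->|s0] := eqVneq s 0%N; first by rewrite (_ : _ @^-1` _ = setT)//; apply/seteqP; split.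
  by rewrite (_ : _ @^-1` _ = set0)//; apply/seteqP; split=> // w /= e; rewrite -e eqxx in s0.
rewrite (_ : _ @^-1` _ = \bigcup_p (T n @^-1` [set p] `&` [set w | next_visit (visits w) p = s])).
  by apply: bigcupT_measurable => p; apply: measurableI => //; exact: mnext.
apply/seteqP; split => [w /= h|w [p _ [/= hp h]]]; last by rewrite cycle_timeS hp.
by exists (T n w) => //; split => //=; rewrite -cycle_timeS.
Qed.

Lemma measurable_cycle_place n v : measurable [set w | S (T n w) w = v].
Proof.
rewrite (_ : [set _ | _] = \bigcup_s (T n @^-1` [set s] `&` [set w | S s w = v])).
  by apply: bigcupT_measurable => s; apply: measurableI => //; exact: measurable_cycle_time.
by apply/seteqP; split => [w /= h|w [s _ [/= -> h]]]//; exists (T n w).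
Qed.

Lemma measurable_cycle_incr n y : measurable (Y n @^-1` [set y]).
Proof.
rewrite (_ : _ @^-1` _ = \bigcup_(v : Nd) \bigcup_(u : Nd)
  (if subNd v u == y then [set w | S (T n w) w = v] `&` [set w | S (T n.-1 w) w = u] else set0)).
  apply: (@sigma_algebra_countable Nd _ measurable); first exact: sigma_algebra_measurable.
  move=> v; apply: (@sigma_algebra_countable Nd _ measurable); first exact: sigma_algebra_measurable.
  by move=> u; case: ifP => // _; apply: measurableI; exact: measurable_cycle_place.
apply/seteqP; split => [w /= h|w [v _ [u _]]].
  by exists (S (T n w) w) => //; exists (S (T n.-1 w) w) => //; rewrite -/(Y n w) h eqxx.
by case: ifP => // /eqP <- [/= <- <-].
Qed.

(** Almost every path starts with a visit, has its successful flips in [C]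
    only, and returns after each visit; on such paths a successful flip is a
    visit to the atom and no default value of [next_visit] is met. *)
Definition regular w := [/\ chi 0%N w = true, forall i, chi i w = true -> C (J i w) &
  forall s, chi s w = true -> exists2 i, (s < i)%N & chi i w = true].

Let null_ae A : measurable A -> Pa A = 0 -> {ae Pa, forall w, ~ A w}.
Proof.
move=> mA h; apply: (negligibleS (A := A)); last exact/negligibleP.
by move=> w /= /contrapT.
Qed.

Let mchi1 i : measurable [set w | chi i w = true].
Proof. exact: past_measurable (past_chi true (leqnn i)). Qed.

Lemma ae_regular : {ae Pa, forall w, regular w}.
Proof.
have h0 : {ae Pa, forall w, ~ (~` F0) w}.
  apply: null_ae; first exact: measurableC.
  by rewrite probability_setC// PaF0 subee.
have h1 : {ae Pa, forall w, forall i, ~ ([set w | chi i w = true] `&` J i @^-1` (~` C)) w}.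
  apply: ae_foralln => i; apply: null_ae.
    by apply: measurableI => //; apply: mJA; exact: measurableC.
  case: i => [|i].
    apply/eqP; rewrite eq_le measure_ge0 andbT.
    apply: (@le_trans _ _ (Pa (J 0%N @^-1` (~` C)))).
      by apply: le_measure; rewrite ?inE; [apply: measurableI => //| |by move=> w []];
        apply: mJA; exact: measurableC.
    case: hchain => _ _ -> //; last exact: measurableC.
    by rewrite setICl measure0 /= mul0r.
  rewrite setIC coin_heads; last by apply: past_step_J; exact: measurableC.
  by rewrite -preimage_setI setICl preimage_set0 measure0 mule0.
have h2 : {ae Pa, forall w, forall (s i : nat),
    ~ (if choice.unpickle i is Some j then [set w | chi s w = true] `&` [set w | S s w = j]
      `&` [set w | forall i, (s < i)%N -> chi i w = false] else set0) w}.
  apply: ae_foralln => s; apply: ae_foralln => i; apply: null_ae.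
    case: choice.unpickle => // j.
    by apply: measurableI; [apply: measurableI => //; exact: mchi1|exact: mnever].
  case: choice.unpickle => // j; apply: (@revisit _ s j); split => //.
  by apply: (sigI (past_sigma s)); [exact: past_chi|exact: past_S].
move: h0 h1 h2; apply: filterS3 => w h0 h1 h2; split; first exact: contrapT.
  by move=> i hi; apply: contrapT => nC; apply: (h1 i); split.
move=> s hs; apply: contrapT => nex; apply: (h2 s (choice.pickle (S s w))).
rewrite choice.pickleK; split=> // i si; apply/negP => ci; apply: nex.
by exists i.
Qed.

Lemma ae_eq_prob A B : measurable A -> measurable B ->
  {ae Pa, forall w, A w <-> B w} -> Pa A = Pa B.
Proof.
move=> mA mB [N [mN N0 hN]].
have le A' B' : measurable A' -> measurable B' -> (forall w, ~ N w -> A' w -> B' w) -> Pa A' <= Pa B'.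
  move=> mA' mB' h; rewrite -(measureU0 mB' mN N0); apply: le_measure; rewrite ?inE//.
    exact: measurableU.
  by move=> w A'w; have [Nw|nN] := pselect (N w); [right|left; exact: h].
have hh w : ~ N w -> A w <-> B w by move=> nN; apply: contrapT => h; apply/nN/hN.
by apply/eqP; rewrite eq_le !le// => w /hh [].
Qed.

(** The event that the [n]-th visit takes place at time [s], in a form that
    depends only on the past of [s]; [cycle_time] itself looks ahead where it
    takes its default value. *)
Fixpoint nth_visit n s : set Omega :=
  if n is n'.+1 then \bigcup_p (if (p < s)%N then nth_visit n' p `&` quiet p s
      `&` [set w | chi s w = true] else set0)
  else if s == 0%N then F0 else set0.

Lemma nth_visit_past n s : past s (nth_visit n s).
Proof.
elim: n s => [|n IH] s /=.
  by case: ifP => _; [exact: pF0|case: (past_sigma s)].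
apply: (@sigma_algebra_countable nat _ (past s)); first exact: past_sigma.
move=> p; case: ifP => ps; last by case: (past_sigma s).
apply: (sigI (past_sigma s)); last exact: past_chi.
apply: (sigI (past_sigma s)); first exact: past_le (ltnW ps) _ (IH p).
exact: past_le (leq_pred _) _ (quiet_past ps).
Qed.

Lemma nth_visit_visit n s : nth_visit n s `<=` [set w | chi s w = true].
Proof.
case: n => [|n] w /=; first by case: eqP => // ->.
by move=> [p _]; case: ifP => // _ [].
Qed.

Lemma regular_next w s n : regular w -> chi s w = true -> (s < n)%N ->
  next_visit (visits w) s = n <-> quiet s n w /\ chi n w = true.
Proof.
move=> [_ hC' _] cs sn.
have e i : visits w i = chi i w.
  by case: (boolP (chi i w)) => h; rewrite ?andbF// mem_set//; exact: hC'.
split=> [/(next_visitP _ sn)|[h1 h2]].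
  rewrite e => -[h1 h2]; split=> // i hi; have := h2 i hi.
  by rewrite e => /negbTE.
by apply/(next_visitP _ sn); rewrite e; split=> // i /h1; rewrite e => ->.
Qed.

Lemma regular_next_gt w s : regular w -> chi s w = true ->
  (s < next_visit (visits w) s)%N.
Proof.
move=> [_ hC' hr] cs; have [i si ci] := hr s cs.
rewrite ltn_neqAle next_visit_ge andbT; apply/eqP => /esym/next_visit_same/(_ i si).
by rewrite ci mem_set//; exact: hC'.
Qed.

Lemma nth_visitE w : regular w -> forall n s, nth_visit n s w <-> T n w = s.
Proof.
move=> rw; elim => [|n IH] s /=.
  by case: rw => h0 _ _; case: eqP => [->|s0]; split => //; move/esym.
have cT : chi (T n w) w = true by apply: nth_visit_visit; apply/(IH (T n w)).
rewrite cycle_timeS; split => [[p _]|h].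
  case: ifP => // ps [[/IH hp qp] cp]; rewrite hp in cT *.
  exact/(regular_next rw cT ps).
exists (T n w) => //.
have sT := regular_next_gt rw cT; rewrite h in sT; rewrite sT.
by have [h1 h2] := (regular_next rw cT sT).1 h; split => //; split => //; exact/IH.
Qed.

(** The law of the walk at the first return to the atom. *)
Let ret k : \bar R :=
  \sum_(0 <= u <oo) (eps%:E * Pa (excursion F0 0 u.+1 0 k `&` J u.+1 @^-1` C)).

(** Sum over the length of the cycle: it ends at the first successful flip,
    and each term regenerates. *)
Let return_law F s j k n : start F s j -> {ae Pa, forall w, F w -> T n w = s} ->
  Pa (F `&` [set w | S (T n.+1 w) w = j + k]%R) = Pa F * ret k.
Proof.
move=> hF hT; have mF := past_measurable (start_past hF).
pose gap w := (T n.+1 w - s).-1.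
have mg (u : nat) : measurable (gap @^-1` [set u]).
  exact: (measurable_discrete (measurable_cycle_time n.+1) (fun t => (t - s).-1 = u)).
rewrite (measure_split Pa mg); last by apply: measurableI => //; exact: measurable_cycle_place.
pose cF := fine (Pa F); have ce : Pa F = cF%:E by rewrite fineK// fin_num_measure.
rewrite /ret ce -nneseriesZl; last first.
  by move=> u _; rewrite mule_ge0// lee_fin ltW.
apply: eq_eseriesr => u _; rewrite (_ : choice.pickle_inv u = Some u); last first.
  exact: (@choice.pickleK_inv nat u).
have sn : (s < s + u.+1)%N by rewrite addnS ltnS leq_addr.
have := coin_heads (excursion_step k hF sn).
rewrite addnS /= -addnS regeneration// => h.
rewrite muleCA -ce -h; apply: ae_eq_prob.
- by apply: measurableI => //; apply: measurableI => //; exact: measurable_cycle_place.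
- by apply: measurableI => //; exact: past_step_measurable (excursion_step k hF sn).
move: ae_regular hT; apply: filterS2 => w rw hT; split.
- move=> [[Fw /= hS] hg]; have Tn := hT Fw.
  have cs : chi s w = true := start_visit hF Fw.
  have gt := regular_next_gt rw cs; rewrite -Tn -cycle_timeS Tn in gt.
  have e : T n.+1 w = (s + u.+1)%N by move: hg gt; rewrite /gap /=; lia.
  move: hS; rewrite e => hS.
  have : next_visit (visits w) s = (s + u.+1)%N by rewrite -{1}Tn -cycle_timeS.
  by move=> /(regular_next rw cs sn) [h1 h2].
move=> [[[Fw qw] /= hS] cw]; have Tn := hT Fw.
have cs : chi s w = true := start_visit hF Fw.
have e : T n.+1 w = (s + u.+1)%N.
  by rewrite cycle_timeS Tn; apply/(regular_next rw cs sn).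
by split; [split => //=; rewrite e|rewrite /gap /= e addKn].
Qed.

(** Independence of a cycle increment from the sum of the previous ones, and
    stationarity: the time of the [n]-th visit is split off, and [return_law]
    applies to each value of it. *)
Lemma cycle_increments n j k :
  Pa ([set w | psum Y n w = j] `&` [set w | psum Y n.+1 w = j + k]%R) =
  Pa [set w | psum Y n w = j] * Pa (Y 1%N @^-1` [set k]).
Proof.
have e1 : Pa (Y 1%N @^-1` [set k]) = ret k.
  transitivity (Pa (F0 `&` [set w | S (T 1%N w) w = 0 + k]%R)).
    apply: ae_eq_prob; first exact: measurable_cycle_incr.
      by apply: measurableI => //; exact: measurable_cycle_place.
    move: ae_regular; apply: filterS => w [h0 _ _].
    rewrite /preimage /setI /=.
    have -> : Y 1%N w = S (T 1%N w) w by rewrite -psum_cycles /psum big_nat1.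
    by rewrite add0r; split => [|[]].
  rewrite (return_law k start0) ?PaF0 ?mul1e//.
  by apply: aeW.
rewrite e1.
have mP i v : measurable [set w | psum Y i w = v].
  rewrite (_ : [set _ | _] = [set w | S (T i w) w = v]); first exact: measurable_cycle_place.
  by apply/seteqP; split => w /=; rewrite psum_cycles.
rewrite (@measure_split _ _ _ Pa _ _ (measurable_cycle_time n) (_ `&` _)); last exact: measurableI.
rewrite (@measure_split _ _ _ Pa _ _ (measurable_cycle_time n) [set w | psum Y n w = j])//.
have ret_fin : ret k \is a fin_num by rewrite -e1 fin_num_measure//; exact: measurable_cycle_incr.
rewrite muleC -(fineK ret_fin) -nneseriesZl; last by move=> i _; case: choice.pickle_inv.
apply: eq_eseriesr => i _; rewrite (_ : choice.pickle_inv i = Some i); last first.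
  exact: (@choice.pickleK_inv nat i).
rewrite fineK//; pose E := nth_visit n i `&` [set w | S i w = j].
have hE : start E i j.
  split=> [||w []//]; last by move=> w [/nth_visit_visit].
  by apply: (sigI (past_sigma i)); [exact: nth_visit_past|exact: past_S].
have mE := past_measurable (start_past hE).
have hT : {ae Pa, forall w, E w -> T n w = i}.
  by move: ae_regular; apply: filterS => w rw [/(nth_visitE rw)].
transitivity (Pa (E `&` [set w | S (T n.+1 w) w = j + k]%R)).
  apply: ae_eq_prob.
  - by apply: measurableI; [exact: measurableI|exact: measurable_cycle_time].
  - by apply: measurableI => //; exact: measurable_cycle_place.
  move: ae_regular; apply: filterS => w rw; rewrite /= !psum_cycles.
  split=> [[[h1 h2] h3]|[[/(nth_visitE rw) h1 h2] h3]].
    by split=> //; split; [exact/(nth_visitE rw)|rewrite -h3].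
  by rewrite h1; split.
rewrite (return_law k hE hT) muleC; congr (_ * _).
apply: ae_eq_prob => //; first by apply: measurableI => //; exact: measurable_cycle_time.
move: ae_regular; apply: filterS => w rw; rewrite /= psum_cycles.
split=> [[/(nth_visitE rw) h1 h2]|[h1 h2]]; first by rewrite h1.
by split; [exact/(nth_visitE rw)|rewrite -h2].
Qed.

End split_chain.

(** * Averaging operators and smoothing along two points *)

Section averaging_operators.
Context (R : realType) (d : nat).
Notation Zd := 'cV[int]_d.
Implicit Types (f g : Zd -> R) (Q : (Zd -> R) -> (Zd -> R)).

Definition bounded_by (M : R) f := forall x, `|f x| <= M.

Definition shift (v : Zd) f : Zd -> R := fun x => f (x - v).

(** The convolution operators by a probability on Z^d, described by what is
    used of them; only bounded functions are averaged. *)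
Record averaging Q : Prop := Averaging {
  avg_lin : forall c f g M N, bounded_by M f -> bounded_by N g ->
    Q (fun x => c * f x + g x) = (fun x => c * Q f x + Q g x);
  avg_pos : forall f M, bounded_by M f -> (forall x, 0 <= f x) ->
    forall x, 0 <= Q f x;
  avg_one : Q (fun=> 1) = (fun=> 1);
  avg_shift : forall v f, Q (shift v f) = shift v (Q f) }.

Lemma bounded_byS v f M : bounded_by M f -> bounded_by M (shift v f).
Proof. by move=> h x; exact: h. Qed.

Lemma bounded_by_ge0 f M : bounded_by M f -> 0 <= M.
Proof. by move=> /(_ 0); exact: le_trans. Qed.

Lemma bounded_by_lin c f g M N : bounded_by M f -> bounded_by N g ->
  bounded_by (`|c| * M + N) (fun x => c * f x + g x).
Proof.
move=> hf hg x; rewrite (le_trans (ler_normD _ _))// lerD//.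
by rewrite normrM ler_wpM2l.
Qed.

Lemma bounded_cst (c : R) : bounded_by `|c| (fun=> c).
Proof. by move=> x. Qed.

Section one.
Variable Q : (Zd -> R) -> (Zd -> R).
Hypothesis hQ : averaging Q.

Lemma avg_cst c : Q (fun=> c) = fun=> c.
Proof.
have h0 : Q (fun=> 0) = fun=> 0.
  have := avg_lin hQ 1 (@bounded_cst 0) (@bounded_cst 0).
  rewrite mul1r addr0 => h; apply/funext => x.
  by have := congr1 (@^~ x) h; lra.
have := avg_lin hQ c (@bounded_cst 1) (@bounded_cst 0).
rewrite mulr1 addr0 => ->; rewrite (avg_one hQ) h0.
by apply/funext => x; rewrite mulr1 addr0.
Qed.

Lemma avgD f g M N : bounded_by M f -> bounded_by N g ->
  Q (fun x => f x + g x) = fun x => Q f x + Q g x.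
Proof.
move=> hf hg; have := avg_lin hQ 1 hf hg.
rewrite (_ : (fun x => 1 * f x + g x) = fun x => f x + g x); last first.
  by apply/funext => x; rewrite mul1r.
by move=> ->; apply/funext => x; rewrite mul1r.
Qed.

Lemma avgZ c f M : bounded_by M f -> Q (fun x => c * f x) = fun x => c * Q f x.
Proof.
move=> hf; have := avg_lin hQ c hf (@bounded_cst 0).
rewrite (_ : (fun x => c * f x + 0) = fun x => c * f x); last first.
  by apply/funext => x; rewrite addr0.
by move=> ->; apply/funext => x; rewrite avg_cst addr0.
Qed.

Lemma avgB f g M N : bounded_by M f -> bounded_by N g ->
  Q (fun x => f x - g x) = fun x => Q f x - Q g x.
Proof.
move=> hf hg; have := avg_lin hQ (-1) hg hf.
rewrite (_ : (fun x => -1 * g x + f x) = fun x => f x - g x); last first.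
  by apply/funext => x; rewrite mulN1r addrC.
by move=> ->; apply/funext => x; rewrite mulN1r addrC.
Qed.

Lemma avg_mono f g M N : bounded_by M f -> bounded_by N g ->
  (forall x, f x <= g x) -> forall x, Q f x <= Q g x.
Proof.
move=> hf hg h x.
have h0 : forall x, 0 <= -1 * f x + g x by move=> z; have := h z; lra.
have := avg_pos hQ (bounded_by_lin (-1) hf hg) h0 x.
by rewrite (avg_lin hQ _ hf hg); lra.
Qed.

Lemma avg_bounded f M : bounded_by M f -> bounded_by M (Q f).
Proof.
move=> hf x; rewrite ler_norml.
have le1 : forall z, (fun=> - M) z <= f z.
  by move=> z; have := hf z; rewrite ler_norml => /andP[].
have le2 : forall z, f z <= (fun=> M) z.
  by move=> z; have := hf z; rewrite ler_norml => /andP[].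
have := avg_mono (@bounded_cst (- M)) hf le1 x.
have := avg_mono hf (@bounded_cst M) le2 x.
by rewrite !avg_cst => -> ->.
Qed.

Lemma averaging_iter n : averaging (iter n Q).
Proof.
elim: n => [|n IH]; first by split.
split.
- move=> c f g M N hf hg; rewrite /= (avg_lin IH _ hf hg).
  have bi : forall h K, bounded_by K h -> bounded_by K (iter n Q h).
    move=> h K hh; elim: (n) => [//|k]; exact: avg_bounded.
  by rewrite (avg_lin hQ _ (bi _ _ hf) (bi _ _ hg)).
- move=> f M hf f0; elim: n.+1 => [//|k IHk] /= x.
  apply: (avg_pos hQ _ IHk).
  by elim: (k) => [|j]; [exact: hf|exact: avg_bounded].
- by rewrite /= (avg_one IH) (avg_one hQ).
- by move=> v f; rewrite /= (avg_shift IH) (avg_shift hQ).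
Qed.

End one.

Lemma iter_bounded Q n f M : averaging Q -> bounded_by M f ->
  bounded_by M (iter n Q f).
Proof. by move=> hQ; apply: avg_bounded; exact: averaging_iter. Qed.

(** The convolving probability gives mass at least [k] to [y]. *)
Definition dominates Q (k : R) (y : Zd) := forall f M, bounded_by M f ->
  (forall x, 0 <= f x) -> forall x, k * f (x - y) <= Q f x.

Section two_points.
Variables y y' : Zd.

Definition two_point f : Zd -> R := fun x => (f (x - y) + f (x - y')) / 2.
Definition diff f : Zd -> R := fun x => f (x - y) - f (x - y').

Lemma averaging_two_point : averaging two_point.
Proof.
split=> //.
- by move=> c f g M N hf hg; apply/funext => x; rewrite /two_point; field.
- by move=> f M hf f0 x; rewrite /two_point divr_ge0// addr_ge0.
- by apply/funext => x; rewrite /two_point; field.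
- move=> v f; apply/funext => x; rewrite /two_point /shift.
  by rewrite -!addrA ![- v + _]addrC.
Qed.

Lemma diff_lin c f g :
  diff (fun x => c * f x + g x) = fun x => c * diff f x + diff g x.
Proof. by apply/funext => x; rewrite /diff; ring. Qed.

(** A linear substitute for the Cauchy-Schwarz inequality: bounds on second
    moments become bounds on first moments, and [s] is optimized at the end. *)
Lemma sqr_amgm (s c : R) : 0 < s -> `|c| <= (s + c ^+ 2 / s) / 2.
Proof.
move=> s0; rewrite -[c ^+ 2]real_normK ?num_real// ler_pdivlMr//.
rewrite -(ler_pM2r s0) mulrDl divfK ?gt_eqF//.
by have := sqr_ge0 (s - `|c|); nra.
Qed.

(** Let [e] be the endpoint of [J] steps of a fair +1/-1 walk. Choosing [y]
    for +1 and [y'] for -1 in [two_point], the left side is the absolute value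
    of the expectation of [(c + e)] times a value of [f]: the term in [diff]
    is the correlation of [e] with the value, summed over the steps. By
    [sqr_amgm] it is at most half of [s + E (c + e)^2 / s], and the second
    moment is [c^2 + J]. *)
Lemma signed_walk s J : 0 < s -> forall c f M, bounded_by M f -> forall x,
  `|c * iter J two_point f x + J%:R / 2 * diff (iter J.-1 two_point f) x|
    <= (s + (c ^+ 2 + J%:R) / s) / 2 * M.
Proof.
move=> s0; elim: J => [|J IH] c f M hf x.
  rewrite /= mul0r mul0r !addr0 normrM ler_pM// sqr_amgm//.
have hi k := averaging_iter averaging_two_point k.
have e0 k g N : bounded_by N g ->
    iter k.+1 two_point g = fun x => (iter k two_point (shift y g) x
      + iter k two_point (shift y' g) x) / 2.
  move=> hg; rewrite iterSr.
  have -> : two_point g = fun x => 2^-1 * (shift y g x + shift y' g x).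
    by apply/funext => z; rewrite /two_point /shift mulrC.
  rewrite (avgZ (hi k) 2^-1 (M := `|1| * N + N)); last first.
    have := bounded_by_lin 1 (bounded_byS y hg) (bounded_byS y' hg).
    by under eq_fun do rewrite mul1r.
  rewrite (avgD (hi k) (bounded_byS y hg) (bounded_byS y' hg)).
  by apply/funext => z; rewrite mulrC.
have e1 k g : diff (iter k two_point g) = fun x =>
    iter k two_point (shift y g) x - iter k two_point (shift y' g) x.
  by apply/funext => z; rewrite !(avg_shift (hi k)).
have -> : c * iter J.+1 two_point f x + J.+1%:R / 2 * diff (iter J.+1.-1 two_point f) x
  = (((c + 1) * iter J two_point (shift y f) x
       + J%:R / 2 * diff (iter J.-1 two_point (shift y f)) x)
    + ((c - 1) * iter J two_point (shift y' f) x
       + J%:R / 2 * diff (iter J.-1 two_point (shift y' f)) x)) / 2.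
  rewrite (e0 _ _ _ hf) /= e1.
  case: J {IH} => [|J] /=; first by rewrite mulr0n; field.
  have -> : diff (iter J two_point (shift y f)) x
    = 2 * (iter J.+1 two_point (shift y f) x - iter J.+1 two_point (shift y' f) x)
      - diff (iter J two_point (shift y' f)) x.
    rewrite !e1 (e0 _ _ _ (bounded_byS y hf)) (e0 _ _ _ (bounded_byS y' hf)).
    have -> : shift y (shift y' f) = shift y' (shift y f).
      by apply/funext => z; rewrite /shift -!addrA [- y + _]addrC.
    by field.
  by rewrite -[J.+2%:R]natr1 /=; field.
rewrite normrM [X in _ * X <= _]ger0_norm ?invr_ge0//.
rewrite ler_pdivrMr// (le_trans (ler_normD _ _))//.
apply: le_trans (lerD (IH _ _ _ (bounded_byS y hf) _) (IH _ _ _ (bounded_byS y' hf) _)) _.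
rewrite -mulrDl [leRHS]mulrAC ler_wpM2r ?(bounded_by_ge0 hf)//.
rewrite -[in leRHS]natr1 le_eqVlt; apply/orP; left; apply/eqP; field.
by rewrite gt_eqF.
Qed.

(** The case [c = 0] of [signed_walk]: a difference of binomial averages is of
    the order of the inverse square root of the number of steps. *)
Lemma diff_two_point s j f M x : 0 < s -> bounded_by M f ->
  `|diff (iter j two_point f) x| <= (s / j.+1%:R + s^-1) * M.
Proof.
move=> s0 hf; have := signed_walk j.+1 s0 0 hf x.
rewrite mul0r add0r expr0n /= add0r.
have j0 : (0 : R) < j.+1%:R by rewrite ltr0n.
rewrite normrM ger0_norm ?divr_ge0// => h.
have : j.+1%:R / 2 * `|diff (iter j two_point f) x|
   <= j.+1%:R / 2 * ((s / j.+1%:R + s^-1) * M).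
  apply: le_trans h _; rewrite le_eqVlt; apply/orP; left; apply/eqP; field.
  by rewrite !gt_eqF.
by rewrite ler_pM2l// divr_gt0.
Qed.

Variable Q : (Zd -> R) -> (Zd -> R).
Variable k : R.
Hypotheses (hQ : averaging Q) (k0 : 0 < k) (k1 : k <= 1).
Hypotheses (dy : dominates Q k y) (dy' : dominates Q k y').

Lemma remainder_bounded f M : bounded_by M f ->
  bounded_by ((1 - k) * M) (fun x => - k * two_point f x + Q f x).
Proof.
move=> hf x.
have bM c : bounded_by (`|c| * M + `|M|) (fun x => c * f x + M).
  by apply: bounded_by_lin.
have hle := fun z => hf z; have M0 := bounded_by_ge0 hf.
have p1 : forall z, 0 <= -1 * f z + M.
  by move=> z; have := hf z; rewrite ler_norml; lra.
have p2 : forall z, 0 <= 1 * f z + M.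
  by move=> z; have := hf z; rewrite ler_norml; lra.
have := dy (bM _) p1 x; have := dy' (bM _) p1 x.
have := dy (bM _) p2 x; have := dy' (bM _) p2 x.
rewrite !(avg_lin hQ _ hf (@bounded_cst M)) !(avg_cst hQ) /two_point.
by rewrite ler_norml; nra.
Qed.

Lemma two_point_comm n f M : bounded_by M f ->
  iter n Q (two_point f) = two_point (iter n Q f).
Proof.
move=> hf.
have hn := averaging_iter hQ n.
have -> : two_point f = fun x => 2^-1 * (shift y f x + shift y' f x).
  by apply/funext => z; rewrite /two_point /shift mulrC.
rewrite (avgZ hn 2^-1 (M := `|1| * M + M)); last first.
  have := bounded_by_lin 1 (bounded_byS y hf) (bounded_byS y' hf).
  by under eq_fun do rewrite mul1r.
rewrite (avgD hn (bounded_byS y hf) (bounded_byS y' hf)) !(avg_shift hn).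
by apply/funext => z; rewrite mulrC.
Qed.

(** [Q] is a mixture of [two_point] with weight [k] and of an averaging part,
    so among [n] steps about [k n] are two-point steps. In the induction on
    [n] the number [j] of two-point steps made so far is generalized, and the
    bound survives the mixture because [k / (z + 1) + (1 - k) / z] is at most
    [1 / (z + k / 2)]. *)
Lemma diff_iter_amgm s n : 0 < s -> forall j f M x, bounded_by M f ->
  `|diff (iter j two_point (iter n Q f)) x|
     <= (s / (j.+1%:R + k / 2 * n%:R) + s^-1) * M.
Proof.
move=> s0; elim: n => [|n IH] j f M x hf.
  by rewrite mulr0 addr0; exact: diff_two_point.
have M0 := bounded_by_ge0 hf.
rewrite iterSr.
have -> : Q f = fun x => k * two_point f x + (- k * two_point f x + Q f x).
  by apply/funext => z; ring.
have b2 := avg_bounded averaging_two_point hf.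
rewrite (avg_lin (averaging_iter hQ n) _ b2 (remainder_bounded hf)).
rewrite (avg_lin (averaging_iter averaging_two_point j) _
  (iter_bounded n hQ b2) (iter_bounded n hQ (remainder_bounded hf))).
rewrite diff_lin (two_point_comm _ hf) -iterSr.
apply: le_trans (ler_normD _ _) _; rewrite normrM gtr0_norm//.
apply: le_trans (lerD (ler_wpM2l (ltW k0) (IH _ _ _ _ hf))
   (IH _ _ _ _ (remainder_bounded hf))) _.
rewrite mulrA [X in _ + X]mulrA -mulrDl ler_wpM2r//.
set z : R := j.+1%:R + k / 2 * n%:R.
have z1 : 1 <= z.
  by rewrite /z -natr1 -addrA addrCA ler_wpDr// addr_ge0// mulr_ge0// divr_ge0// ltW.
have -> : j.+2%:R + k / 2 * n%:R = z + 1 by rewrite /z -[j.+2%:R]natr1; ring.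
have -> : j.+1%:R + k / 2 * n.+1%:R = z + k / 2 by rewrite /z -[n.+1%:R]natr1; ring.
suff h : k / (z + 1) + (1 - k) / z <= (z + k / 2)^-1.
  have := ler_wpM2l (ltW s0) h; rewrite mulrDr => h'.
  apply: (@le_trans _ _ (s * (k / (z + 1)) + s * ((1 - k) / z) + s^-1)).
    by rewrite le_eqVlt; apply/orP; left; apply/eqP; ring.
  by rewrite lerD2r.
have z0 : 0 < z by lra.
have zk : 0 < z + k / 2 by rewrite addr_gt0// divr_gt0.
have zz : 0 < z + 1 by lra.
rewrite -subr_ge0.
have -> : (z + k / 2)^-1 - (k / (z + 1) + (1 - k) / z) =
   k * (z - 1 + k) / 2 / (z * (z + 1) * (z + k / 2)).
  have z2 : 0 < z * 2 + k by apply: addr_gt0 => //; apply: mulr_gt0.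
  by field; rewrite (gt_eqF z0) (gt_eqF zz) (gt_eqF z2).
have kk : 0 <= k * (z - 1 + k).
  by apply: mulr_ge0; [exact: ltW|rewrite addr_ge0 ?subr_ge0// ltW].
apply: divr_ge0; first exact: divr_ge0.
by apply: mulr_ge0; [apply: mulr_ge0|]; exact: ltW.
Qed.

(** [diff_iter_amgm] with the optimal value of [s]. *)
Lemma diff_iter n f M x : bounded_by M f ->
  `|diff (iter n Q f) x| <= 2 / Num.sqrt (k / 2) * (M / Num.sqrt n.+1%:R).
Proof.
move=> hf; set z : R := k / 2 * n.+1%:R.
have z0 : 0 < z by rewrite mulr_gt0 ?ltr0n// divr_gt0.
have := @diff_iter_amgm (Num.sqrt z) n _ 0%N f M x hf.
rewrite sqrtr_gt0 => /(_ z0) /= h; apply: le_trans h _.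
have -> : 2 / Num.sqrt (k / 2) * (M / Num.sqrt n.+1%:R) = 2 / Num.sqrt z * M.
  have -> : Num.sqrt z = Num.sqrt (k / 2) * Num.sqrt n.+1%:R.
    by rewrite -sqrtrM// divr_ge0// ltW.
  set u := Num.sqrt (k / 2); set v := Num.sqrt n.+1%:R.
  have u0 : 0 < u by rewrite sqrtr_gt0 divr_gt0.
  have v0 : 0 < v by rewrite sqrtr_gt0.
  by field; rewrite (gt_eqF u0) (gt_eqF v0).
rewrite ler_wpM2r ?(bounded_by_ge0 hf)//.
have -> : 2 / Num.sqrt z = (Num.sqrt z)^-1 + (Num.sqrt z)^-1.
  by rewrite mulrDl mul1r.
rewrite lerD2r -[in leRHS](@mulfK _ (Num.sqrt z) _ (Num.sqrt z)^-1); last first.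
  by rewrite gt_eqF// sqrtr_gt0.
rewrite mulVf ?gt_eqF ?sqrtr_gt0// mul1r.
have e : (Num.sqrt z)^-1 = Num.sqrt z / z.
  rewrite -{3}(sqr_sqrtr (ltW z0)); field.
  by rewrite gt_eqF// sqrtr_gt0.
rewrite e ler_wpM2l ?sqrtr_ge0// lef_pV2 ?posrE//.
- rewrite /z -[n.+1%:R]natr1 mulrDr mulr1 addrC lerD2r.
  by rewrite ler_pdivrMr// mul1r (le_trans k1)// ler1n.
- by rewrite ltr_pwDl// mulr_ge0// divr_ge0// ltW.
Qed.

End two_points.
End averaging_operators.

(** * Point masses and gradients of iterated averages *)

Section local_bounds.
Context (R : realType) (d : nat).
Notation Zd := 'cV[int]_d.
Notation operator := ((Zd -> R) -> (Zd -> R)).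
Variables (F : set operator) (S : set 'cV[nat]_d).
Hypothesis avgF : forall Q, F Q -> averaging Q.
Hypothesis domF : forall y, S y -> exists k : R, [/\ 0 < k, k <= 1 &
  forall Q, F Q -> dominates Q k (toZ y)].

Definition rsqrt (n : nat) : R := (Num.sqrt n.+1%:R)^-1.

Lemma rsqrt_gt0 n : 0 < rsqrt n.
Proof. by rewrite invr_gt0 sqrtr_gt0 ltr0n. Qed.

Lemma rsqrt_le n N k : (N < n.+1 * k.+1)%N ->
  rsqrt n <= Num.sqrt k.+1%:R * rsqrt N.
Proof.
move=> h; rewrite /rsqrt -[leLHS]mul1r ler_pdivrMr ?sqrtr_gt0 ?ltr0n//.
rewrite mulrAC ler_pdivlMr ?sqrtr_gt0 ?ltr0n// mul1r -sqrtrM ?ler0n//.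
by rewrite -natrM ler_sqrt ?ler0n// ler_nat mulnC.
Qed.

(** The bound holds for differences of support points by [diff_iter], and the
    vectors for which it holds with some constant form a subgroup. *)
Lemma diff_lattice_bound v : diff_lattice S v -> exists2 K : R, 0 <= K &
  forall Q, F Q -> forall n f M x, bounded_by M f ->
  `|iter n Q f x - iter n Q f (x - v)| <= K * M * rsqrt n.
Proof.
set A := (X in _ -> X).
pose B := [set v | exists2 K : R, 0 <= K &
  forall Q, F Q -> forall n f M x, bounded_by M f ->
  `|iter n Q f x - iter n Q f (x - v)| <= K * M * rsqrt n].
rewrite /diff_lattice /subgroup_gen => /(_ B); apply; split.
  split.
    exists 0 => // Q FQ n f M x hf; rewrite subr0 subrr normr0 mulr_ge0//.
      by rewrite mul0r.
    exact/ltW/rsqrt_gt0.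
  move=> {v A} v w [K K0 hK] [K' K'0 hK']; exists (K + K'); first exact: addr_ge0.
  move=> Q FQ n f M x hf.
  have h1 := hK Q FQ n f M x hf; have h2 := hK' Q FQ n f M (x - (v - w)) hf.
  have e : x - (v - w) - w = x - v by rewrite opprB addrA addrAC addrK.
  rewrite e distrC in h2; rewrite !mulrDl.
  apply: le_trans (lerD h1 h2).
  by rewrite (le_trans _ (ler_normD _ _))// addrA subrK.
move=> _ [y [y' [Sy Sy' ->]]].
have [k [k0 k1 hk]] := domF Sy; have [l [l0 l1 hl]] := domF Sy'.
pose c := Num.min k l.
have c0 : 0 < c by rewrite lt_min k0.
have c1 : c <= 1 by rewrite ge_min k1.
exists (2 / Num.sqrt (c / 2)); first by rewrite divr_ge0// sqrtr_ge0.
move=> Q FQ n f M x hf.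
have dm z (b : R) : dominates Q b z -> c <= b -> dominates Q c z.
  move=> hb cb g N hg g0 u; apply: le_trans (hb _ _ hg g0 u).
  by rewrite ler_wpM2r.
have dy := dm _ _ (hk Q FQ); have dy' := dm _ _ (hl Q FQ).
have := diff_iter (avgF FQ) c0 c1 (dy _) (dy' _) n (x + toZ y') hf.
rewrite !ge_min !lexx orbT /= => /(_ erefl erefl).
have e : x + toZ y' - toZ y = x - (toZ y - toZ y') by rewrite opprB addrA.
by rewrite /diff e addrK distrC /rsqrt !mulrA.
Qed.

Variable B : 'M[int]_d.
Hypothesis colB : forall j, diff_lattice S (col j B).
Hypothesis freeB : zfree B.

Definition delta0 : Zd -> R := fun x => (x == 0)%:R.

Lemma delta0_bounded : bounded_by 1 delta0.
Proof. by move=> x; rewrite /delta0 ger0_norm ?ler0n// lern1; case: eqP. Qed.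

(** The faces of the cone spanned by the columns of [B]: differencing the
    indicator of a face along one more column gives the next face, so [d]
    differences of the bounded function [cone 0] produce the point mass. *)
Definition cone (i : nat) : Zd -> R := fun x =>
  `[< exists2 n : Zd, x = B *m n &
      forall j, 0 <= n j 0 /\ ((j < i)%N -> n j 0 = 0) >]%:R.

Lemma cone_bounded i : bounded_by 1 (cone i).
Proof. by move=> x; rewrite /cone ger0_norm ?ler0n// lern1; case: asboolP. Qed.

Lemma freeB_inj (n n' : Zd) : B *m n = B *m n' -> n = n'.
Proof.
move=> h; apply/eqP; rewrite -subr_eq0; apply/eqP/freeB.
by rewrite mulmxBr h subrr.
Qed.

Lemma cone_diff (i : 'I_d) x : cone i.+1 x = cone i x - cone i (x - col i B).
Proof.
have eB : col i B = B *m (delta_mx i 0 : Zd) by rewrite -colE.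
rewrite /cone; case: asboolP => [[n -> hn]|h1].
  rewrite asboolT; last first.
    by exists n => // j; split; [exact: (hn j).1|move=> ji; apply: (hn j).2; exact: ltnW].
  rewrite asboolF ?subr0// => -[n' e hn'].
  have {}e : n = n' + delta_mx i 0.
    by apply: freeB_inj; rewrite mulmxDr -e eB subrK.
  have := (hn i).2 (ltnSn _); rewrite e !mxE !eqxx /= => h.
  by have := (hn' i).1; lia.
case: asboolP => [[n en hn]|h2].
  rewrite asboolT ?subrr//; exists (n - delta_mx i 0).
    by rewrite mulmxBr eB en.
  move=> j; rewrite !mxE eqxx andbT.
  have [->|ji] := eqVneq j i; last first.
    by rewrite subr0; exact: hn.
  have [n0|n0] := eqVneq (n i 0) 0.
    exfalso; apply: h1; exists n => // k; split; first exact: (hn k).1.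
    rewrite ltnS leq_eqVlt => /predU1P[/ord_inj ->//|]; exact: (hn k).2.
  by have := (hn i).1; split; [rewrite /= mulr1n; lia|rewrite ltnn].
rewrite asboolF ?subrr// => -[n e hn]; apply: h2; exists (n + delta_mx i 0).
  by rewrite mulmxDr -e eB subrK.
move=> j; rewrite !mxE eqxx andbT; have := hn j.
have [->|ji] := eqVneq j i; last by rewrite addr0.
by move=> [h _]; split; [rewrite /= mulr1n; lia|rewrite ltnn].
Qed.

Lemma cone_delta0 : cone d = delta0.
Proof.
apply/funext => x; rewrite /cone /delta0; congr (nat_of_bool _)%:R.
apply/asboolP/eqP => [[n -> hn]|->].
  rewrite (_ : n = 0) ?mulmx0//; apply/colP => j; rewrite mxE.
  exact: (hn j).2.
by exists 0; [rewrite mulmx0|move=> j; rewrite mxE].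
Qed.

(** Each of the [i] differences that produce [cone i] is smoothed by its own
    [n] steps, and costs a factor [rsqrt n] by [diff_lattice_bound]. *)
Lemma cone_decay : exists2 K : R, 0 <= K & forall Q, F Q ->
  forall n i, (i <= d)%N -> bounded_by ((K * rsqrt n) ^+ i) (iter (n * i) Q (cone i)).
Proof.
have /choice[K hK] : forall j : 'I_d, exists K : R, 0 <= K /\
    forall Q, F Q -> forall n f M x, bounded_by M f ->
  `|iter n Q f x - iter n Q f (x - col j B)| <= K * M * rsqrt n.
  by move=> j; have [K] := diff_lattice_bound (colB j); exists K.
have K0 : 0 <= \sum_j K j by apply: sumr_ge0 => j _; exact: (hK j).1.
exists (\sum_j K j) => // Q FQ n; elim=> [|i IH] id.
  by rewrite muln0; exact: cone_bounded.
have hi := averaging_iter (avgF FQ).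
have {IH} := IH (ltnW id); set M := (_ ^+ i) => hM.
have -> : cone i.+1 = fun x => cone i x - shift (col (Ordinal id) B) (cone i) x.
  by apply/funext => x; rewrite (cone_diff (Ordinal id)).
rewrite (avgB (hi _) (@cone_bounded i) (bounded_byS _ (@cone_bounded i))).
move=> x; rewrite (avg_shift (hi _)) mulnS iterD.
apply: le_trans ((hK (Ordinal id)).2 Q FQ n _ _ x hM) _.
rewrite exprSr -/M [leRHS]mulrC -!mulrA [rsqrt n * M]mulrC ler_wpM2r//.
  by rewrite mulr_ge0 ?(bounded_by_ge0 hM)// ltW// rsqrt_gt0.
by rewrite (bigD1 (Ordinal id))//= lerDl sumr_ge0// => j _; exact: (hK j).1.
Qed.

(** The decay [n^(-d/2)] of the point probabilities of the walk, uniformly in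
    the family [F]. *)
Lemma sup_decay : exists2 K : R, 0 <= K & forall Q, F Q ->
  forall n, bounded_by (K * rsqrt n ^+ d) (iter n Q delta0).
Proof.
have [K K0 hK] := cone_decay.
exists ((K * Num.sqrt d.+1%:R) ^+ d).
  by rewrite exprn_ge0// mulr_ge0// sqrtr_ge0.
move=> Q FQ N; pose n := (N %/ d.+1)%N.
have Nn : (n * d <= N)%N.
  by apply: leq_trans (leq_trunc_div N d.+1); rewrite leq_mul2l leqnSn orbT.
rewrite -(subnK Nn) iterD -cone_delta0.
apply: (iter_bounded _ (avgF FQ)) => x.
apply: le_trans (hK Q FQ n d (leqnn _) x) _.
rewrite subnK// -exprMn lerXn2r ?nnegrE ?mulr_ge0 ?sqrtr_ge0 ?(ltW (rsqrt_gt0 _))//.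
by rewrite -mulrA ler_wpM2l// rsqrt_le// ltn_ceil.
Qed.

(** The steps are cut into [d.+1] blocks: [d] of them act on the cone as in
    [sup_decay], and the last one smooths the difference along [v]. *)
Lemma gradient_decay v : diff_lattice S v -> exists2 K : R, 0 <= K &
  forall Q, F Q -> forall n x,
  `|iter n Q delta0 x - iter n Q delta0 (x - v)| <= K * rsqrt n ^+ d.+1.
Proof.
move=> /diff_lattice_bound[Kv Kv0 hKv]; have [K K0 hK] := cone_decay.
exists (Kv * Num.sqrt d.+1%:R * (K * Num.sqrt d.+1%:R) ^+ d).
  by rewrite mulr_ge0 ?exprn_ge0 ?mulr_ge0 ?sqrtr_ge0.
move=> Q FQ N x; pose n := (N %/ d.+1)%N.
have Nn : (n * d <= N - n)%N.
  rewrite -(leq_add2r n) subnK ?leq_div//.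
  by apply: leq_trans (leq_trunc_div N d.+1); rewrite mulnS addnC.
have Nn' : (n * d <= N)%N by apply: leq_trans Nn _; exact: leq_subr.
rewrite -{1 2}(subnK Nn') iterD -cone_delta0.
apply: le_trans (hKv Q FQ _ _ _ x (hK Q FQ n d (leqnn _))) _.
have nr : rsqrt n <= Num.sqrt d.+1%:R * rsqrt N by rewrite rsqrt_le// ltn_ceil.
have r0 := fun k => ltW (rsqrt_gt0 k).
apply: (@le_trans _ _ (Kv * (K * (Num.sqrt d.+1%:R * rsqrt N)) ^+ d *
   (Num.sqrt d.+1%:R * rsqrt N))).
  apply: ler_pM => //; first by rewrite mulr_ge0 ?exprn_ge0 ?mulr_ge0.
    rewrite ler_wpM2l// lerXn2r ?nnegrE ?mulr_ge0 ?sqrtr_ge0//.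
    by rewrite ler_wpM2l.
  apply: le_trans nr; rewrite /rsqrt lef_pV2 ?posrE ?sqrtr_gt0 ?ltr0n//.
  rewrite ler_sqrt ?ler0n// ler_nat ltnS leq_subRL//.
  by apply: leq_trans (leq_trunc_div N d.+1); rewrite mulnS addnC.
by rewrite le_eqVlt !exprMn exprSr; apply/orP; left; apply/eqP; ring.
Qed.

End local_bounds.

(** * Expectations of functions of one step *)

Section expectation_of_step.
Context (R : realType) (d : nat) (dO : measure_display)
  (Omega : measurableType dO) (Pa : probability Omega R).
Variables (Y : Omega -> 'cV[nat]_d) (t : R).
Hypothesis mY : measurable_fun setT Y.
Hypothesis t0 : 0 < t.
Hypothesis hexp : ('E_Pa[fun w => expR (t * (norm1 (Y w))%:R)] < +oo)%E.
Notation Nd := 'cV[nat]_d.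
Implicit Types (f g : Nd -> R).

Definition Ex g : R := (\int[Pa]_w g (Y w))%R.

Definition tame g := exists C : R, forall y, `|g y| <= C * expR (t * (norm1 y)%:R).

Lemma tame_cst c : tame (fun=> c).
Proof.
exists `|c| => y; rewrite ler_peMr// -expR0 ler_expR mulr_ge0 ?ler0n//.
exact: ltW.
Qed.

Lemma tame_le f g : tame g -> (forall y, `|f y| <= `|g y|) -> tame f.
Proof. by move=> [C hC] h; exists C => y; exact: le_trans (h y) (hC y). Qed.

Lemma tame_bounded f M : (forall y, `|f y| <= M) -> tame f.
Proof.
move=> h; apply: (tame_le (tame_cst M)) => y.
by rewrite (le_trans (h y))// ler_norm.
Qed.

Lemma tameD f g : tame f -> tame g -> tame (fun y => f y + g y).
Proof.
move=> [C hC] [D hD]; exists (C + D) => y.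
by rewrite (le_trans (ler_normD _ _))// mulrDl lerD.
Qed.

Lemma tameZ c f : tame f -> tame (fun y => c * f y).
Proof.
move=> [C hC]; exists (`|c| * C) => y.
by rewrite normrM -mulrA ler_wpM2l.
Qed.

Lemma tame_norm f : tame f -> tame (fun y => `|f y|).
Proof. by move=> h; apply: tame_le h _ => y; rewrite normr_id. Qed.

Lemma measurable_stepR f : measurable_fun setT (fun w => f (Y w)).
Proof.
have mf : measurable_fun setT f by [].
exact: (measurableT_comp mf mY).
Qed.

Lemma integrable_step f : tame f -> Pa.-integrable setT (EFin \o (fun w => f (Y w))).
Proof.
move=> [C hC].
apply: (@le_integrable _ _ _ Pa setT measurableT _
   (fun w => (C%:E * (expR (t * (norm1 (Y w))%:R))%:E)%E)).
- exact/measurable_EFinP/measurable_stepR.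
- move=> w _; rewrite /= lee_fin (le_trans (hC _))//.
  exact: ler_norm.
- apply: integrableZl => //; apply/integrableP; split.
    apply/measurable_EFinP.
    exact: (measurable_stepR (fun y => expR (t * (norm1 y)%:R))).
  rewrite (le_lt_trans _ hexp)// unlock; apply: ge0_le_integral => //.
  + apply: measurableT_comp => //; apply/measurable_EFinP.
    exact: (measurable_stepR (fun y => expR (t * (norm1 y)%:R))).
  + apply/measurable_EFinP.
    exact: (measurable_stepR (fun y => expR (t * (norm1 y)%:R))).
  + by move=> w _; rewrite /= lee_fin ger0_norm// expR_ge0.
Qed.

Lemma ExD f g : tame f -> tame g -> Ex (fun y => f y + g y) = Ex f + Ex g.
Proof.
move=> hf hg; rewrite /Ex (RintegralD measurableT)//.
- exact: (integrable_step hf).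
- exact: (integrable_step hg).
Qed.

Lemma ExZ c f : tame f -> Ex (fun y => c * f y) = c * Ex f.
Proof. by move=> hf; rewrite /Ex RintegralZl//; exact: (integrable_step hf). Qed.

Lemma ExB f g : tame f -> tame g -> Ex (fun y => f y - g y) = Ex f - Ex g.
Proof.
move=> hf hg; rewrite /Ex (RintegralB measurableT)//.
- exact: (integrable_step hf).
- exact: (integrable_step hg).
Qed.

Lemma Ex_cst c : Ex (fun=> c) = c.
Proof. by rewrite /Ex Rintegral_cst//= (@probability_setT _ _ _ Pa) mulr1. Qed.

Lemma eq_Ex f g : f =1 g -> Ex f = Ex g.
Proof. by move=> h; apply: eq_Rintegral => w _; exact: h. Qed.

Lemma Ex_sum (I : Type) (s : seq I) (F : I -> Nd -> R) :
  (forall i, tame (F i)) ->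
  Ex (fun y => \sum_(i <- s) F i y) = \sum_(i <- s) Ex (F i).
Proof.
move=> hF; elim: s => [|i s IH].
  by rewrite big_nil -[RHS](Ex_cst 0); apply: eq_Ex => y; rewrite big_nil.
rewrite big_cons -IH -ExD//; first by apply: eq_Ex => y; rewrite big_cons.
elim: s {IH} => [|j s IH].
  by apply: (tame_le (tame_cst 0)) => y; rewrite big_nil.
by apply: (tame_le (tameD (hF j) IH)) => y; rewrite big_cons.
Qed.

Lemma Ex_le f g : tame f -> tame g -> (forall y, f y <= g y) -> Ex f <= Ex g.
Proof.
move=> hf hg fg; apply: le_Rintegral => //.
- exact: (integrable_step hf).
- exact: (integrable_step hg).
Qed.

Lemma Ex_ge0 f : (forall y, 0 <= f y) -> 0 <= Ex f.
Proof. by move=> h; apply: Rintegral_ge0. Qed.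

Lemma Ex_norm f : tame f -> `|Ex f| <= Ex (fun y => `|f y|).
Proof. by move=> hf; apply: le_normr_Rintegral => //; exact: (integrable_step hf). Qed.

Lemma Ex_norm_le f g : tame g -> (forall y, `|f y| <= g y) -> `|Ex f| <= Ex g.
Proof.
move=> hg fg.
have hf : tame f.
  by apply: tame_le hg _ => y; rewrite (le_trans (fg y))// ler_norm.
by apply: le_trans (Ex_norm hf) _; apply: Ex_le => //; exact: tame_norm.
Qed.

Lemma EFin_Ex f : tame f -> (Ex f)%:E = ('E_Pa[fun w => f (Y w)])%E.
Proof.
move=> hf; rewrite unlock /Ex /Rintegral fineK//.
by apply: integrable_fin_num => //; exact: integrable_step.
Qed.

Definition step_mass (y : Nd) : R := fine (Pa (Y @^-1` [set y])).

Lemma Ex_indic y : Ex (fun z => (z == y)%:R) = step_mass y.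
Proof.
rewrite /Ex /Rintegral /step_mass; congr fine.
have mA : measurable (Y @^-1` [set y]) by rewrite -[X in measurable X]setTI; exact: mY.
transitivity (\int[Pa]_w (\1_(Y @^-1` [set y]) w)%:E)%E; last first.
  by rewrite integral_indic// setIT.
apply: eq_integral => w _; rewrite indicE; congr ((nat_of_bool _)%:R%:E).
by apply/idP/idP; rewrite inE => /eqP.
Qed.

Lemma Ex_supp f g : (forall y, supp Pa Y y -> f y = g y) -> Ex f = Ex g.
Proof.
move=> h; rewrite /Ex /Rintegral; congr fine.
apply: ae_eq_integral => //.
- by exact/measurable_EFinP/measurable_stepR.
- by exact/measurable_EFinP/measurable_stepR.
have mA y : measurable (Y @^-1` [set y]) by rewrite -[X in measurable X]setTI; exact: mY.
exists (\bigcup_n [set w | exists2 y : Nd, choice.pickle y = n /\ Y w = y & ~ supp Pa Y y]).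
have mB n : measurable [set w | exists2 y : Nd, choice.pickle y = n /\ Y w = y & ~ supp Pa Y y].
  pose D := [set y : Nd | choice.pickle y = n /\ ~ supp Pa Y y].
  rewrite (_ : mkset _ = Y @^-1` D).
    by rewrite -[X in measurable X]setTI; exact: mY.
  apply/seteqP; split => w /=; first by move=> [y [yn yw] ys]; rewrite yw.
  by move=> [a b]; exists (Y w).
split.
- exact: bigcupT_measurable.
- have h1 := measure_sigma_subadditive Pa mB (bigcupT_measurable _ mB) (@subset_refl _ _).
  apply/eqP; rewrite -measure_le0 (le_trans h1)//.
  rewrite eseries0// => n _ _.
  apply: (@subset_measure0 _ _ _ Pa _ (Y @^-1` [set y : Nd | choice.pickle y = n /\ ~ supp Pa Y y])) => //.
  + by rewrite -[X in measurable X]setTI; exact: mY.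
  + by move=> w [y [yn yw] ys] /=; rewrite yw.
  have [[y [yn ys]]|hn] := pselect (exists y : Nd, choice.pickle y = n /\ ~ supp Pa Y y).
    apply: (@subset_measure0 _ _ _ Pa _ (Y @^-1` [set y])) => //.
    + by rewrite -[X in measurable X]setTI; exact: mY.
    + by move=> w /= [en _]; apply: (pcan_inj choice.pickleK); rewrite en yn.
    apply/eqP; move/negP : ys; rewrite /supp /= -leNgt => h3.
    by apply/eqP; apply/le_anti; rewrite h3 measure_ge0.
  rewrite (_ : _ @^-1` _ = set0) ?measure0//.
  by apply/seteqP; split => w //= h2; apply: hn; exists (Y w).
move=> w /= hw; exists (choice.pickle (Y w)) => //; exists (Y w) => // ys.
by apply: hw => _ /=; rewrite (h _ ys).
Qed.

End expectation_of_step.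

(** * Exponential tilting *)

Section exponential_tilting.
Context (R : realType) (d : nat) (dO : measure_display)
  (Omega : measurableType dO) (Pa : probability Omega R).
Variables (Y : Omega -> 'cV[nat]_d) (t : R).
Hypothesis mY : measurable_fun setT Y.
Hypothesis t0 : 0 < t.
Hypothesis hexp : ('E_Pa[fun w => expR (t * (norm1 (Y w))%:R)] < +oo)%E.
Notation Nd := 'cV[nat]_d.
Notation Zd := 'cV[int]_d.
Notation Ex := (Ex Pa Y).
Notation tame := (@tame R d t).

Definition nrm (x : Zd) : R := \sum_i (x i 0)%:~R.

Lemma nrmD x y : nrm (x + y) = nrm x + nrm y.
Proof. by rewrite /nrm -big_split; apply: eq_bigr => i _; rewrite mxE intrD. Qed.

Lemma nrmN x : nrm (- x) = - nrm x.
Proof. by rewrite /nrm -sumrN; apply: eq_bigr => i _; rewrite mxE intrN. Qed.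

Lemma nrm_toZ (y : Nd) : nrm (toZ y) = (norm1 y)%:R.
Proof.
by rewrite /nrm /norm1 natr_sum; apply: eq_bigr => i _; rewrite mxE.
Qed.

Definition weight (th : R) (y : Nd) : R := expR (th * (norm1 y)%:R).

Definition Mgf th := Ex (weight th).

Definition step_op (f : Zd -> R) : Zd -> R := fun x => Ex (fun y => f (x - toZ y)).

(** The step operator of the exponentially tilted walk. *)
Definition tilted_op th (f : Zd -> R) : Zd -> R :=
  fun x => (Mgf th)^-1 * Ex (fun y => weight th y * f (x - toZ y)).

Lemma weight_gt0 th y : 0 < weight th y. Proof. exact: expR_gt0. Qed.

Lemma weight_le th y : th <= t -> weight th y <= weight t y.
Proof. by move=> h; rewrite ler_expR ler_wpM2r. Qed.

Lemma tame_weight th : th <= t -> tame (weight th).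
Proof.
by move=> h; exists 1 => y; rewrite mul1r gtr0_norm ?weight_gt0// weight_le.
Qed.

Lemma tame_weightM th (g : Nd -> R) M : th <= t -> (forall y, `|g y| <= M) ->
  tame (fun y => weight th y * g y).
Proof.
move=> h hg; apply: (tame_le (tameZ M (tame_weight h))) => y.
rewrite !normrM mulrC; apply: ler_wpM2r => //.
exact: le_trans (hg y) (ler_norm _).
Qed.

Lemma tame_norm1 : tame (fun y => (norm1 y)%:R).
Proof.
exists t^-1 => y; rewrite ger0_norm ?ler0n// -ler_pdivrMl ?invr_gt0// invrK.
by apply: le_trans (expR_ge1Dx _); rewrite lerDr.
Qed.

Lemma Mgf_gt0 th : th <= t -> 0 < Mgf th.
Proof.
move=> h; have [->|tn0] := eqVneq th 0.
  have -> : Mgf 0 = Ex (fun=> 1); last by rewrite Ex_cst.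
  by apply: eq_Ex => y; rewrite /weight mul0r expR0.
have k0 : 0 < expR (Ex (fun y => th * (norm1 y)%:R)) by exact: expR_gt0.
(* Jensen, from the tangent of the exponential at the mean *)
set e := Ex _ in k0; apply: lt_le_trans k0 _.
have tn : tame (fun y => th * (norm1 y)%:R) := tameZ th tame_norm1.
have -> : expR e = Ex (fun y => expR e * (1 - e) + expR e * (th * (norm1 y)%:R)).
  rewrite (ExD mY hexp (tame_cst _ t0 _) (tameZ _ tn)) Ex_cst (ExZ mY hexp _ tn).
  by rewrite -/e; ring.
apply: (Ex_le mY hexp).
- exact: (tameD (tame_cst _ t0 _) (tameZ _ tn)).
- exact: tame_weight.
move=> y; rewrite /weight; set u := th * _.
have -> : expR e * (1 - e) + expR e * u = expR e * (1 + (u - e)) by ring.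
have {2}-> : u = e + (u - e) by ring.
by rewrite expRD ler_wpM2l ?expR_ge0// expR_ge1Dx.
Qed.

Lemma tilted_opE0 : tilted_op 0 = step_op.
Proof.
apply/funext => f; apply/funext => x; rewrite /tilted_op /step_op /Mgf.
have -> : Ex (weight 0) = 1.
  rewrite -[RHS](Ex_cst Pa Y 1); apply: eq_Ex => y.
  by rewrite /weight mul0r expR0.
rewrite invr1 mul1r; apply: eq_Ex => y.
by rewrite /weight mul0r expR0 mul1r.
Qed.

Lemma averaging_tilted th : th <= t -> averaging (tilted_op th).
Proof.
move=> h; have M0 := Mgf_gt0 h.
have tm f M (x : Zd) : bounded_by M f -> tame (fun y => weight th y * f (x - toZ y)).
  by move=> hf; apply: (tame_weightM h (M := M)) => y.
split.
- move=> c f g M N hf hg; apply/funext => x; rewrite /tilted_op.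
  transitivity ((Mgf th)^-1 * (c * Ex (fun y => weight th y * f (x - toZ y))
     + Ex (fun y => weight th y * g (x - toZ y)))); last by ring.
  rewrite -(ExZ mY hexp c (tm f M x hf)).
  rewrite -(ExD mY hexp (tameZ c (tm f M x hf)) (tm g N x hg)).
  by congr (_ * _); apply: eq_Ex => y; ring.
- move=> f M hf f0 x; rewrite mulr_ge0 ?invr_ge0 ?(ltW M0)//.
  by apply: Ex_ge0 => y; rewrite mulr_ge0// ltW// weight_gt0.
- apply/funext => x; rewrite /tilted_op.
  have -> : Ex (fun y => weight th y * 1) = Mgf th.
    by apply: eq_Ex => y; rewrite mulr1.
  by rewrite mulVf ?gt_eqF.
- move=> v f; apply/funext => x; rewrite /tilted_op /shift.
  by congr (_ * _); apply: eq_Ex => y; rewrite addrAC.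
Qed.

Lemma averaging_step : averaging step_op.
Proof. by rewrite -tilted_opE0; apply: averaging_tilted; exact: ltW. Qed.

Definition tilted_family : set ((Zd -> R) -> Zd -> R) :=
  [set Q | exists2 th, `|th| <= t & Q = tilted_op th].

Lemma tilted_family_averaging Q : tilted_family Q -> averaging Q.
Proof.
by move=> [th h ->]; apply: averaging_tilted; rewrite (le_trans (ler_norm _)).
Qed.

(** A point of the support keeps a mass bounded below under all tiltings by a
    parameter in [-t, t], so the local bounds are uniform in the tilting. *)
Lemma tilted_family_dominates y : supp Pa Y y -> exists k : R, [/\ 0 < k, k <= 1 &
  forall Q, tilted_family Q -> dominates Q k (toZ y)].
Proof.
move=> Sy; have p0 : 0 < step_mass Pa Y y.
  rewrite /step_mass fine_gt0// Sy /=.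
  rewrite (le_lt_trans (probability_le1 _ _)) ?ltry//.
  by rewrite -[X in measurable X]setTI; exact: mY.
have Mt0 : 0 < Mgf t by apply: Mgf_gt0.
have w1 : weight (- t) y <= 1 by rewrite -expR0 ler_expR mulNr oppr_le0 mulr_ge0// ltW.
have M1 : 1 <= Mgf t.
  rewrite -[leLHS](Ex_cst Pa Y 1); apply: (Ex_le mY hexp).
  - exact: tame_cst.
  - exact: tame_weight.
  by move=> z; rewrite -expR0 ler_expR mulr_ge0// ltW.
have p1 : step_mass Pa Y y <= 1.
  rewrite -(Ex_indic Pa mY) -[leRHS](Ex_cst Pa Y 1).
  have b z : `|(z == y)%:R| <= 1 :> R by rewrite ger0_norm ?ler0n// lern1; case: eqP.
  apply: (Ex_le mY hexp); first exact: (tame_bounded t0 b).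
    exact: tame_cst.
  by move=> z; rewrite (le_trans (ler_norm _)).
exists (weight (- t) y * step_mass Pa Y y / Mgf t); split.
- by rewrite divr_gt0// mulr_gt0// weight_gt0.
- by rewrite ler_pdivrMr// mul1r (le_trans _ M1)// mulr_ile1// ltW// weight_gt0.
move=> Q [th hth ->] f M hf f0 x.
move: (hth); rewrite ler_norml => /andP[th1 th2].
have Mh0 := Mgf_gt0 th2.
have MM : Mgf th <= Mgf t.
  by apply: (Ex_le mY hexp); [exact: tame_weight|exact: tame_weight|move=> z; exact: weight_le].
rewrite /tilted_op.
apply: (@le_trans _ _ ((Mgf th)^-1 * (weight (- t) y * f (x - toZ y) * step_mass Pa Y y))).
  have -> : weight (- t) y * step_mass Pa Y y / Mgf t * f (x - toZ y) =
    (Mgf t)^-1 * (weight (- t) y * f (x - toZ y) * step_mass Pa Y y) by ring.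
  rewrite ler_wpM2r ?lef_pV2 ?posrE//.
  by rewrite !mulr_ge0 ?(ltW p0) ?(ltW (weight_gt0 _ _)).
rewrite ler_wpM2l ?invr_ge0 ?(ltW Mh0)// -(Ex_indic Pa mY).
have b z : `|(z == y)%:R| <= 1 :> R by rewrite ger0_norm ?ler0n// lern1; case: eqP.
rewrite -(ExZ mY hexp _ (tame_bounded t0 b)).
apply: (Ex_le mY hexp).
- by apply: tameZ; exact: (tame_bounded t0 b).
- exact: (tame_weightM th2 (M := M)).
move=> z; have [->|zy] := eqVneq z y.
  rewrite mulr1 ler_wpM2r// ler_expR ler_wpM2r//.
by rewrite mulr0 mulr_ge0// ltW// weight_gt0.
Qed.

(** The change of measure: along a path of [n] steps from 0 to [x] the tilting
    factors multiply to a function of [n] and [x] only. *)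
Lemma tilt_iter th n x : th <= t ->
  iter n step_op (@delta0 R d) x =
    Mgf th ^+ n * expR (- (th * nrm x)) * iter n (tilted_op th) (@delta0 R d) x.
Proof.
move=> h; elim: n x => [|n IH] x /=.
  rewrite mul1r /delta0; have [->|_] := eqVneq x 0; last by rewrite mulr0.
  by rewrite /nrm big1 ?mulr0 ?oppr0 ?expR0 ?mul1r// => i _; rewrite mxE.
have bn := iter_bounded n (averaging_tilted h) (@delta0_bounded R d).
rewrite {1}/step_op exprS; set g := iter n (tilted_op th) _ in bn *.
have -> : tilted_op th g x = (Mgf th)^-1 * Ex (fun y => weight th y * g (x - toZ y)) by [].
transitivity (Ex (fun y => Mgf th ^+ n * expR (- (th * nrm x)) *
   (weight th y * g (x - toZ y)))).
  apply: eq_Ex => y; rewrite IH -/g nrmD nrmN nrm_toZ /weight.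
  rewrite mulrBr opprB addrC expRD; ring.
rewrite (ExZ mY hexp); last by apply: (tame_weightM h (M := 1)) => y; exact: bn.
set E := Ex _; have M0 := Mgf_gt0 h; field.
by rewrite gt_eqF.
Qed.

Lemma expR_sub1 (x : R) : 0 <= expR x - 1 - x <= x ^+ 2 * expR `|x|.
Proof.
apply/andP; split; first by have := expR_ge1Dx x; lra.
have h : expR x - 1 <= x * expR x.
  have := expR_ge1Dx (- x); rewrite expRN => h1.
  have e0 := expR_gt0 x.
  have := ler_wpM2r (ltW e0) h1; rewrite mulVf ?gt_eqF// => h2; lra.
have [x0|x0] := leP 0 x.
  rewrite ger0_norm//; have := ler_wpM2l x0 h; rewrite expr2 -mulrA; lra.
have e1 : 1 <= expR `|x| by rewrite -expR0 ler_expR.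
have h1 : expR x - 1 >= x by have := expR_ge1Dx x; lra.
have := ler_wnM2l (ltW x0) h1 => h2.
have : x ^+ 2 <= x ^+ 2 * expR `|x| by rewrite ler_peMr// sqr_ge0.
rewrite expr2; lra.
Qed.

Definition mu1 := Ex (fun y => (norm1 y)%:R).

Lemma sqr_le_weight (y : Nd) (s : R) : 0 < s ->
  (norm1 y)%:R ^+ 2 <= 2 / s ^+ 2 * expR (s * (norm1 y)%:R).
Proof.
move=> s0; have := @expR_ge1Dxn R (s * (norm1 y)%:R) 1%N.
rewrite (mulr_ge0 (ltW s0) (ler0n _ _)) => /(_ isT) h.
rewrite mulrAC ler_pdivlMr ?exprn_gt0//.
move: h; rewrite exprMn /= (_ : (2`!)%N = 2%N)// => h.
have : s ^+ 2 * (norm1 y)%:R ^+ 2 / 2 <= expR (s * (norm1 y)%:R) by lra.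
by rewrite ler_pdivrMr// mulrC [leRHS]mulrC.
Qed.

Lemma Mgf_le : exists2 C : R, 0 < C & forall th, `|th| <= t / 2 ->
  Mgf th <= expR (th * mu1 + C * th ^+ 2).
Proof.
pose C := 2 / (t / 2) ^+ 2 * Mgf t.
have C0 : 0 < C by rewrite mulr_gt0 ?Mgf_gt0// divr_gt0// exprn_gt0// divr_gt0.
exists C => // th hth.
apply: le_trans (expR_ge1Dx _).
have tn := tame_norm1; have tw := tame_weight (lexx t).
have -> : 1 + (th * mu1 + C * th ^+ 2) =
  Ex (fun y => (1 + th * (norm1 y)%:R) + th ^+ 2 * (2 / (t / 2) ^+ 2) * weight t y).
  rewrite (ExD mY hexp (tameD (tame_cst _ t0 _) (tameZ _ tn)) (tameZ _ tw)).
  rewrite (ExD mY hexp (tame_cst _ t0 _) (tameZ _ tn)).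
  rewrite (ExZ mY hexp _ tn) (ExZ mY hexp _ tw) Ex_cst.
  by rewrite /C /Mgf /mu1; ring.
have th2 : th <= t.
  rewrite (le_trans (ler_norm _))// (le_trans hth)//.
  by rewrite ler_pdivrMr// ler_peMr ?ler1n// ltW.
apply: (Ex_le mY hexp).
- exact: tame_weight.
- exact: (tameD (tameD (tame_cst _ t0 _) (tameZ _ tn)) (tameZ _ tw)).
move=> y; set z : R := (norm1 y)%:R.
have z0 : 0 <= z by rewrite /z ler0n.
have /andP[_ h1] := expR_sub1 (th * z).
have h2 := sqr_le_weight y (divr_gt0 t0 (ltr0n R 2)); rewrite -/z in h2.
have h3 : expR `|th * z| <= expR (t / 2 * z).
  by rewrite ler_expR normrM (ger0_norm z0) ler_wpM2r.
have h4 : weight t y = expR (t / 2 * z) * expR (t / 2 * z).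
  by rewrite -expRD /weight -mulrDl -splitr.
rewrite /weight -/z in h4 *.
have : (th * z) ^+ 2 * expR `|th * z| <=
   th ^+ 2 * (2 / (t / 2) ^+ 2) * expR (t * z).
  rewrite h4; set e1 := expR _ in h3 *; set e2 := expR (t / 2 * z) in h2 h3 *.
  have -> : (th * z) ^+ 2 * e1 = th ^+ 2 * (z ^+ 2 * e1) by ring.
  have -> : th ^+ 2 * (2 / (t / 2) ^+ 2) * (e2 * e2) =
    th ^+ 2 * ((2 / (t / 2) ^+ 2 * e2) * e2) by ring.
  by rewrite ler_wpM2l ?sqr_ge0// ler_pM ?sqr_ge0 ?expR_ge0.
by move: h1; lra.
Qed.

Hypothesis mu_gt0 : 0 < mu1.
Variable B : 'M[int]_d.
Hypothesis colB : forall j, diff_lattice (supp Pa Y) (col j B).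
Hypothesis freeB : zfree B.

(** Tilting by [th = + / - lam / sqrt a], with the sign of [a - n]. By
    [tilt_iter] and [Mgf_le] this costs [exp (th (n mu1 - nrm x) + O (n
    th^2))], whose exponent is about [- lam mu1 |n - a| / sqrt a] for [x]
    close to the hyperplane of height [a mu1]; the tilted walk itself
    satisfies [sup_decay]. *)
Lemma step_tail : exists c : R, exists2 K : R, 0 < c /\ 0 < K &
  forall D, 0 <= D -> exists2 C, 0 < C &
  forall a x, 1 <= a -> `|nrm x - a * mu1| <= D * Num.sqrt a ->
  forall n, iter n step_op (@delta0 R d) x <=
     C * Num.min 1 (K * rsqrt R n ^+ d) * expR (- (c * `|n%:R - a| / Num.sqrt a)).
Proof.
have [C0 C00 hC] := Mgf_le.
have [K K0 hK] := sup_decay tilted_family_averaging tilted_family_dominates colB freeB.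
(* [lam] is so small that the quadratic term of [Mgf_le] takes at most half of the gain. *)
pose lam := Num.min (t / 2) (mu1 / (2 * C0)).
have l0 : 0 < lam by rewrite lt_min !divr_gt0// mulr_gt0.
have lt2 : lam <= t / 2 by rewrite ge_min lexx.
have lmu : lam * C0 <= mu1 / 2.
  have : lam <= mu1 / (2 * C0) by rewrite ge_min lexx orbT.
  rewrite ler_pdivlMr ?mulr_gt0// => h; lra.
exists (lam * mu1 / 2), (K + 1).
  by split; [rewrite divr_gt0// mulr_gt0|rewrite ltr_wpDl].
move=> D D0; exists (expR (lam * D + C0 * lam ^+ 2)); first exact: expR_gt0.
move=> a x a1 hx n.
have a0 : 0 < a by lra.
set s := Num.sqrt a; have s0 : 0 < s by rewrite sqrtr_gt0.
have ss : s * s = a by rewrite -expr2 sqr_sqrtr// ltW.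
have s1 : 1 <= s by nra.
pose th : R := if n%:R < a then lam / s else - (lam / s).
have nth : `|th| = lam / s.
  by rewrite /th; case: ifP => _; rewrite ?normrN gtr0_norm// divr_gt0.
have hth : `|th| <= t / 2.
  by rewrite nth ler_pdivrMr// (le_trans lt2)// ler_peMr// divr_ge0// ltW.
have th2 : th <= t.
  rewrite (le_trans (ler_norm _))// (le_trans hth)//.
  by rewrite ler_pdivrMr// ler_peMr ?ler1n// ltW.
have ha : averaging (tilted_op th) := averaging_tilted th2.
have Fth : tilted_family (tilted_op th).
  by exists th => //; rewrite (le_trans hth)// ler_pdivrMr// ler_peMr ?ler1n// ltW.
rewrite (tilt_iter n x th2).
have b1 : iter n (tilted_op th) (@delta0 R d) x <= Num.min 1 ((K + 1) * rsqrt R n ^+ d).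
  rewrite le_min; apply/andP; split.
    by rewrite (le_trans (ler_norm _))//; exact: (iter_bounded n ha (@delta0_bounded R d)).
  rewrite (le_trans (ler_norm _))// (le_trans (hK _ Fth n x))//.
  by rewrite ler_wpM2r ?exprn_ge0 ?(ltW (rsqrt_gt0 _ _))// lerDl.
have b0 : 0 <= iter n (tilted_op th) (@delta0 R d) x.
  apply: (avg_pos (averaging_iter ha n) (@delta0_bounded R d)) => z.
  by rewrite /delta0 ler0n.
rewrite [leRHS]mulrAC; apply: ler_pM => //.
  by rewrite mulr_ge0 ?expR_ge0// exprn_ge0// ltW// Mgf_gt0.
apply: (@le_trans _ _ (expR (th * mu1 + C0 * th ^+ 2) ^+ n * expR (- (th * nrm x)))).
  rewrite ler_wpM2r ?expR_ge0// lerXn2r ?nnegrE ?expR_ge0 ?(ltW (Mgf_gt0 _))//.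
  exact: hC.
rewrite -expRM_natl -!expRD ler_expR.
have tsq : th ^+ 2 = lam ^+ 2 / a.
  by rewrite -[th ^+ 2]real_normK ?num_real// nth exprMn exprVn -ss expr2.
have h1 : th * (n%:R * mu1 - nrm x) <= - (lam * mu1 * `|n%:R - a| / s) + lam * D.
  have e : n%:R * mu1 - nrm x = (n%:R - a) * mu1 - (nrm x - a * mu1) by ring.
  rewrite e mulrBr lerD//.
    rewrite /th; case: ltP => na.
      rewrite ltr0_norm ?subr_lt0// le_eqVlt; apply/orP; left; apply/eqP; field.
      by rewrite gt_eqF.
    rewrite ger0_norm ?subr_ge0// le_eqVlt; apply/orP; left; apply/eqP; field.
    by rewrite gt_eqF.
  rewrite (le_trans (ler_norm _))// normrN normrM nth.
  by rewrite mulrAC ler_pdivrMr// -mulrA ler_wpM2l// ltW.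
have h2 : n%:R / a <= 1 + `|n%:R - a| / s.
  have h3 : n%:R <= a + `|n%:R - a| by have := ler_norm (n%:R - a); lra.
  have h4 : n%:R / a <= 1 + `|n%:R - a| / a.
    by rewrite ler_pdivrMr// mulrDl mul1r divfK// gt_eqF.
  rewrite (le_trans h4)// lerD2l ler_wpM2l// lef_pV2 ?posrE// -ss.
  by rewrite ler_peMr// ltW.
have e1 : n%:R * (th * mu1 + C0 * th ^+ 2) - th * nrm x =
  th * (n%:R * mu1 - nrm x) + C0 * lam ^+ 2 * (n%:R / a).
  by rewrite tsq; ring.
rewrite e1.
have h5 : C0 * lam ^+ 2 * (n%:R / a) <= C0 * lam ^+ 2 * (1 + `|n%:R - a| / s).
  by rewrite ler_wpM2l// mulr_ge0 ?sqr_ge0// ltW.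
have h6 : C0 * lam ^+ 2 * (`|n%:R - a| / s) <= lam * mu1 / 2 * (`|n%:R - a| / s).
  apply: ler_wpM2r; first by rewrite divr_ge0// ltW.
  have : lam * (lam * C0) <= lam * (mu1 / 2) by apply: ler_wpM2l => //; exact: ltW.
  rewrite expr2; lra.
apply: le_trans (lerD h1 h5) _.
move: h6; rewrite -!mulrA; set q := `|_| / s => h6.
lra.
Qed.

End exponential_tilting.

(** * Lattices of full rank *)

Section full_rank_lattices.
Context (R : realType) (d : nat).
Notation Zd := 'cV[int]_d.

Lemma zfree_det (B : 'M[int]_d) : zfree B -> \det B != 0.
Proof.
move=> fB; apply/eqP => dB.
have [L uL [U uU [e _ BE]]] := int_Smith_normal_form B.
pose D : 'M[int]_d := \matrix_(i, j) (e`_i *+ (i == j :> nat)).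
have {}BE : B = L *m D *m U by [].
have /eqP : \det D = 0.
  move: dB; rewrite BE !det_mulmx => /eqP.
  rewrite !mulf_eq0 -!orbA => /or3P[/eqP h|/eqP //|/eqP h].
    by move: uL; rewrite unitmxE h unitr0.
  by move: uU; rewrite unitmxE h unitr0.
have -> : D = diag_mx (\row_i e`_i).
  by apply/matrixP => i j; rewrite !mxE; case: eqP => [/ord_inj->|/eqP h];
    rewrite ?eqxx// (_ : (i == j) = false)//; exact/negbTE.
rewrite det_diag prodf_seq_eq0 => /hasP[i _]; rewrite mxE /= => /eqP ei.
have := fB (invmx U *m delta_mx i 0).
rewrite BE mulmxA mulmxK// -mulmxA.
have -> : D *m (delta_mx i 0 : 'cV_d) = 0.
  apply/colP => j; rewrite -colE !mxE.
  by case: eqP => [->|]; rewrite ?ei ?mul0rn ?mulr0n.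
rewrite mulmx0 => /(_ erefl) h.
have : delta_mx i 0 = 0 :> 'cV[int]_d.
  by rewrite -(mulKVmx uU (delta_mx i 0)) h mulmx0.
by move=> /colP/(_ i); rewrite !mxE !eqxx.
Qed.

Definition l1 (x : Zd) : R := \sum_i `|x i 0|%:~R.

Lemma l1_ge0 x : 0 <= l1 x.
Proof. by apply: sumr_ge0 => i _; rewrite ler0z. Qed.

Lemma l1D (x y : Zd) : l1 (x + y) <= l1 x + l1 y.
Proof.
rewrite /l1 -big_split; apply: ler_sum => i _ /=.
by rewrite mxE -intrD ler_int ler_normD.
Qed.

Lemma l1N (x : Zd) : l1 (- x) = l1 x.
Proof. by apply: eq_bigr => i _; rewrite mxE normrN. Qed.

Lemma coord_le_l1 (x : Zd) i : `|x i 0|%:~R <= l1 x.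
Proof. by rewrite /l1 (bigD1 i)//= lerDl sumr_ge0// => j _; rewrite ler0z. Qed.

Section one_lattice.
Variables (M : set Zd) (B : 'M[int]_d).
Hypotheses (sM : is_subgroup M) (cB : forall j, M (col j B)) (dB : \det B != 0).

Let Mopp x : M x -> M (- x).
Proof. by move=> h; rewrite -[- x]add0r; apply: sM.2 => //; exact: sM.1. Qed.

Let Madd x y : M x -> M y -> M (x + y).
Proof. by move=> hx hy; rewrite -[y]opprK; apply: sM.2 => //; exact: Mopp. Qed.

Let Mmulz x (z : int) : M x -> M (z *: x).
Proof.
have h0 n : M x -> M (n%:Z *: x).
  move=> hx; elim: n => [|n IH]; first by rewrite scale0r; exact: sM.1.
  by rewrite intS scalerDl scale1r; exact: Madd.
case: z => n hx; first exact: h0.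
by rewrite NegzE scaleNr; apply: Mopp; exact: h0.
Qed.

Lemma mulmx_cols (n : Zd) : B *m n = \sum_j n j 0 *: col j B.
Proof.
apply/colP => i; rewrite mxE summxE; apply: eq_bigr => j _.
by rewrite !mxE mulrC.
Qed.

Let Mcols n : M (B *m n).
Proof.
by rewrite mulmx_cols; elim/big_ind: _ => // [|j _]; [exact: sM.1|exact: Mmulz].
Qed.

Notation box := 'cV['I_(`|\det B|%N).+1]_d.

Definition residue (r : box) : Zd := map_mx (fun k => Posz (nat_of_ord k)) r.

(** The adjugate matrix shows that [det B * Z^d] is contained in [B * Z^d], so
    coordinatewise division by the determinant is a division by [B]. *)
Lemma lattice_division : exists2 C : R, 0 <= C & forall v : Zd,
  exists n : Zd, exists2 r : box, v = B *m n + residue r & l1 n <= C * (1 + l1 v).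
Proof.
move: (dB); set N := \det B => dN.
pose A := \sum_i \sum_j (`|(\adj B) i j|%:~R : R).
have A0 : 0 <= A by apply: sumr_ge0 => i _; apply: sumr_ge0 => j _; rewrite ler0z.
exists (A * (1 + d%:R)); first by rewrite mulr_ge0// ler_wpDr.
move=> v; pose q : Zd := map_mx (fun k => (k %/ N)%Z) v.
exists (\adj B *m q), (map_mx (fun k => inord `|(k %% N)%Z|) v).
  rewrite mulmxA mul_mx_adj -/N; apply/colP => i.
  rewrite mul_scalar_mx !mxE inordK; last first.
    by rewrite ltnS -lez_nat !abszE (ger0_norm (modz_ge0 _ dN)) ltW// ltz_mod.
  by rewrite abszE (ger0_norm (modz_ge0 _ dN)) mulrC -divz_eq.
have hq j : `|q j 0| <= 1 + `|v j 0|.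
  rewrite mxE; set k := v j 0.
  have := divz_eq k N; have := modz_ge0 k dN; have := ltz_mod k dN.
  set qq := (_ %/ _)%Z; set rr := (_ %% _)%Z => h1 h2 h3.
  have h4 : `|qq| * `|N| <= `|k| + `|N|.
    rewrite -normrM (_ : qq * N = k - rr); last by lia.
    by lia.
  have N1 : 1 <= `|N| by lia.
  nia.
have hq2 : l1 q <= d%:R + l1 v.
  rewrite (_ : d%:R = \sum_(i < d) 1 :> R); last by rewrite sumr_const card_ord.
  rewrite /l1 -big_split; apply: ler_sum => j _ /=.
  by rewrite (_ : 1 = 1%:~R)// -intrD ler_int.
have h1 : l1 (\adj B *m q) <= A * l1 q.
  rewrite /A mulr_suml; apply: ler_sum => i _; rewrite mxE mulr_suml.
  apply: (@le_trans _ _ (\sum_j `|(\adj B) i j * q j 0|%:~R)).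
    by rewrite -rmorph_sum ler_int ler_norm_sum.
  by apply: ler_sum => j _; rewrite normrM intrM ler_wpM2l ?ler0z ?coord_le_l1.
apply: le_trans h1 _; rewrite -mulrA ler_wpM2l// (le_trans hq2)//.
have := l1_ge0 v; have : (0 : R) <= d%:R by []. nra.
Qed.

(** Bounds for the single vectors of a lattice [M], with constants [K v] of
    unknown size, give a bound that is linear in the length of the vector: by
    [lattice_division] a vector is a combination of the columns of [B] plus
    one of finitely many residues. *)
Lemma lipschitz_on_lattice (K : Zd -> R) : (forall v, 0 <= K v) ->
  exists2 C : R, 0 <= C & forall (V : Zd -> R) eta, 0 <= eta ->
  (forall v, M v -> forall x, `|V x - V (x - v)| <= K v * eta) ->
  forall v, M v -> forall x, `|V x - V (x - v)| <= C * (1 + l1 v) * eta.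
Proof.
move=> K0; have [C C0 hC] := lattice_division.
pose KB := \sum_j K (col j B); pose KR := \sum_(r : box) K (residue r).
have KB0 : 0 <= KB by apply: sumr_ge0.
have KR0 : 0 <= KR by apply: sumr_ge0.
exists (KB * C + KR); first by rewrite addr_ge0 ?mulr_ge0.
move=> V eta e0 hV v Mv x.
have [n [r e ln]] := hC v.
pose P (w : Zd) (b : R) := forall x, `|V x - V (x - w)| <= b.
have P0 : P 0 0 by move=> z; rewrite subr0 subrr normr0.
have PD w w' b b' : P w b -> P w' b' -> P (w + w') (b + b').
  move=> h h' z; have := lerD (h z) (h' (z - w)); apply: le_trans.
  by rewrite -addrA -opprD (le_trans _ (ler_normD _ _))// addrA subrK.
have PN w b : P w b -> P (- w) b.
  by move=> h z; have := h (z + w); rewrite addrK distrC opprK.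
have PZ w b (z : int) : P w b -> P (z *: w) (`|z|%:~R * b).
  have h0 k : P w b -> P (k%:Z *: w) (k%:R * b).
    move=> h; elim: k => [|k IH]; first by rewrite scale0r mul0r.
    by rewrite intS scalerDl scale1r -natr1 addrC mulrDl mul1r; exact: PD.
  case: z => k h; first exact: h0.
  by rewrite NegzE scaleNr normrN; apply: PN; exact: h0.
have Pcols : P (B *m n) (\sum_j `|n j 0|%:~R * (K (col j B) * eta)).
  rewrite mulmx_cols; elim/big_ind2 : _ => [//|x1 x2 y1 y2|j _]; first exact: PD.
  by apply: PZ; exact: hV.
have Mr : M (residue r).
  have -> : residue r = v - B *m n by rewrite e addrAC subrr add0r.
  by apply: sM.2.
have := PD _ _ _ _ Pcols (hV _ Mr) x; rewrite -e => h.
apply: le_trans h _.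
have h1 : \sum_j `|n j 0|%:~R * (K (col j B) * eta) <= KB * l1 n * eta.
  rewrite -mulrA mulr_suml; apply: ler_sum => j _.
  rewrite mulrCA ler_wpM2l// mulrC [leRHS]mulrC.
  by rewrite mulrC [leRHS]mulrC ler_wpM2r// coord_le_l1.
have h2 : K (residue r) <= KR.
  by rewrite /KR (bigD1 r)//= lerDl sumr_ge0.
apply: le_trans (lerD h1 (ler_wpM2r e0 h2)) _.
rewrite -mulrDl ler_wpM2r// mulrDl lerD//.
  by rewrite -mulrA ler_wpM2l.
by rewrite ler_peMr// lerDl l1_ge0.
Qed.

Lemma coset_classE x y : coset_class M x = coset_class M y <-> M (x - y).
Proof.
split=> [h|h].
  have : coset_class M x x by rewrite /coset_class /= subrr; exact: sM.1.
  by rewrite h.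
apply/seteqP; split => z; rewrite /coset_class /= => hz.
  by have := Madd hz h; rewrite addrA subrK.
by have := Madd hz (Mopp h); rewrite opprB addrA subrK.
Qed.

Lemma finite_cosets : finite_set (range (coset_class M)).
Proof.
have [C _ hC] := lattice_division.
apply: (@sub_finite_set _ _ [set coset_class M (residue r) | r in [set: box]]).
  move=> _ [v _ <-]; have [n [r e _]] := hC v.
  exists r => //; apply/coset_classE.
  by rewrite e opprD addrCA subrr addr0; apply: Mopp.
exact: finite_image.
Qed.

Lemma coset_transversal : exists2 cs : seq Zd, size cs = lattice_index M &
  forall x, exists2 i, (i < size cs)%N /\ M (x - cs`_i) &
    forall j, (j < size cs)%N -> M (x - cs`_j) -> j = i.
Proof.
set F := fset_set (range (coset_class M)).
pose rep (g : set Zd) : Zd := xget 0 [set u | coset_class M u = g].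
have hrep v : coset_class M (rep (coset_class M v)) = coset_class M v.
  by apply: (@xgetPex _ 0 [set u | coset_class M u = coset_class M v]); exists v.
have memF g : (g \in F) = (g \in range (coset_class M)).
  by rewrite /F in_fset_set//; exact: finite_cosets.
exists [seq rep g | g <- F]; first by rewrite size_map.
move=> x; set g := coset_class M x.
have gF : g \in enum_fset F by rewrite -[_ \in _]/(g \in F) memF inE; exists x.
have hi : (index g F < size F)%N by rewrite index_mem.
exists (index g F).
  rewrite size_map (nth_map set0)// nth_index//; split => //.
  by apply/coset_classE; rewrite hrep.
move=> j; rewrite size_map => hj; rewrite (nth_map set0)//.
set g' := nth set0 F j => /coset_classE h.
have : g' \in F by rewrite -[_ \in _]/(g' \in enum_fset F) mem_nth.
rewrite memF inE => -[v _ ev].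
have eg : g = g' by rewrite /g h -ev hrep.
by rewrite eg /g' index_uniq// fset_uniq.
Qed.

End one_lattice.
End full_rank_lattices.

(** * Taylor estimates for Gaussians *)

Section exponential_estimates.
Context (R : realType).
Implicit Types x y r w u v : R.

Lemma pow_le_exp x k : 0 <= x -> x ^+ k.+1 <= k.+1`!%:R * expR x.
Proof.
move=> x0; have := expR_ge1Dxn k x0.
have f0 : (0 : R) < k.+1`!%:R by rewrite ltr0n fact_gt0.
move=> h; rewrite mulrC -ler_pdivrMr//; lra.
Qed.

Lemma expR_sub2 y : `|expR y - 1 - y - y ^+ 2 / 2| <= `|y| ^+ 3 * expR `|y|.
Proof.
pose h y : R := expR y - 1 - y - y ^+ 2 / 2.
pose dh y : R := expR y - 1 - y.
have hd (z : R) : is_derive z (1:R) h (dh z).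
  rewrite /h /dh; apply: is_derive_eq.
  by rewrite /GRing.scale /=; field.
have hc a b : {within `[a, b], continuous h}.
  apply: derivable_within_continuous => z _.
  by have [] := hd z.
have h0 : h 0 = 0 by rewrite /h expR0; ring.
rewrite -/(h y).
have bnd c : `|c| <= `|y| -> `|dh c| <= y ^+ 2 * expR `|y|.
  move=> cy; have /andP[d0 d1] := expR_sub1 c.
  rewrite ger0_norm// (le_trans d1)// ler_pM ?sqr_ge0 ?expR_ge0 ?ler_expR//.
  by rewrite -[c ^+ 2]real_normK ?num_real// -[y ^+ 2]real_normK ?num_real// lerXn2r ?nnegrE.
have y3 : `|y| ^+ 3 = y ^+ 2 * `|y| by rewrite exprSr real_normK ?num_real.
have [y0|y0|->] := ltgtP y 0.
- have [c + hE] := MVT y0 (fun z _ => hd z) (hc y 0).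
  rewrite in_itv /= => /andP[c1 c2]; move: hE; rewrite h0 !sub0r => hE.
  have -> : `|h y| = `|dh c| * `|y|.
    by rewrite -normrN hE normrM normrN.
  rewrite y3 mulrAC ler_wpM2r// bnd// !ltr0_norm// lerN2; exact: ltW.
- have [c + hE] := MVT y0 (fun z _ => hd z) (hc 0 y).
  rewrite in_itv /= => /andP[c1 c2]; move: hE; rewrite h0 !subr0 => hE.
  rewrite hE normrM.
  rewrite y3 mulrAC ler_wpM2r// bnd// !gtr0_norm//; exact: ltW.
- by rewrite h0 normr0 mulr_ge0 ?expR_ge0// exprn_ge0.
Qed.

(** One step of the walk, in the variables [r = sqrt (quad z / t)], [w = sqrt
    (quad Z / t)], [u = <z, Z> / t], [v = w ^ 2]. The error is of third order
    in the size [w] of the step and uniform in [r], because the Gaussian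
    factor absorbs the powers of [r]. *)
Lemma gauss_space_taylor : exists2 C : R, 0 <= C & forall r w u v,
  0 <= r -> 0 <= w -> `|u| <= r * w -> 0 <= v -> v <= w ^+ 2 ->
  u - v / 2 <= r ^+ 2 / 2 ->
  `|expR (- (r ^+ 2 / 2)) * (expR (u - v / 2) - (1 + u + (u ^+ 2 - v) / 2))|
    <= C * w ^+ 3.
Proof.
pose C0 : R := 12 * expR 4.
have C00 : 0 <= C0 by rewrite mulr_ge0// expR_ge0.
have poly r : 0 <= r -> 2 * (1 + r) ^+ 3 * expR (1 + r) * expR (- (r ^+ 2 / 2)) <= C0.
  move=> r0; have r1 : 0 <= 1 + r by lra.
  have := pow_le_exp 2 r1; rewrite (_ : 3`! = 6)%N// => h.
  apply: (@le_trans _ _ (2 * (6 * expR (1 + r)) * expR (1 + r) * expR (- (r ^+ 2 / 2)))).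
    by rewrite !ler_wpM2r ?expR_ge0// ler_wpM2l.
  have -> : 2 * (6 * expR (1 + r)) * expR (1 + r) * expR (- (r ^+ 2 / 2)) =
    12 * expR ((1 + r) + (1 + r) - r ^+ 2 / 2) by rewrite !expRD; ring.
  rewrite /C0 ler_wpM2l// ler_expR.
  have := sqr_ge0 (r - 2); lra.
exists (1 + C0); first lra.
move=> r w u v r0 w0 hu v0 hv hQ.
set E := expR (- _).
have E0 : 0 < E by exact: expR_gt0.
have [w1|w1] := leP w 1; last first.
  have h1 : `|E * expR (u - v / 2)| <= 1.
    rewrite /E -expRD ger0_norm ?expR_ge0// -[leRHS](@expR0 R) ler_expR; lra.
  have w3 : 1 <= w ^+ 3 by rewrite exprn_ege1// ltW.
  have ww : w <= w ^+ 3 by rewrite ler_eXnr// ltW.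
  have ww2 : w ^+ 2 <= w ^+ 3 by rewrite ler_weXn2l// ltW.
  have w30 : 0 <= w ^+ 3 by lra.
  have hu2 : u ^+ 2 <= r ^+ 2 * w ^+ 2.
    by rewrite -exprMn -[u ^+ 2]real_normK ?num_real// lerXn2r ?nnegrE ?mulr_ge0.
  have h2 : `|1 + u + (u ^+ 2 - v) / 2| <= 2 * (1 + r) ^+ 3 * expR (1 + r) * w ^+ 3.
    have a1 : `|1 + u + (u ^+ 2 - v) / 2| <= 1 + r * w + (r ^+ 2 * w ^+ 2 + w ^+ 2) / 2.
      move: hu hu2 v0 hv (sqr_ge0 u); rewrite ler_norml => /andP[].
      move: (r * w) (r ^+ 2 * w ^+ 2) (w ^+ 2) (u ^+ 2) => p1 p2 p3 p4.
      by rewrite ler_norml => *; apply/andP; split; lra.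
    have a2 : 1 + r * w + (r ^+ 2 * w ^+ 2 + w ^+ 2) / 2 <= (1 + r + (r ^+ 2 + 1) / 2) * w ^+ 3.
      have := ler_wpM2l r0 ww; have := ler_wpM2l (sqr_ge0 r) ww2; lra.
    have e1 : 1 <= expR (1 + r) by rewrite -[leLHS](@expR0 R) ler_expR; lra.
    have a3 : 1 + r + (r ^+ 2 + 1) / 2 <= 2 * (1 + r) ^+ 3.
      rewrite -[(1 + r) ^+ 3]/((1 + r) * ((1 + r) * (1 + r))) expr2.
      have := mulr_ge0 r0 r0; have := mulr_ge0 r0 (mulr_ge0 r0 r0); lra.
    have a4 : 0 <= (1 + r) ^+ 3 by rewrite exprn_ge0//; lra.
    apply: le_trans a1 _; apply: le_trans a2 _; rewrite ler_wpM2r//.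
    apply: le_trans a3 _; rewrite ler_peMr//; lra.
  rewrite mulrBr; apply: le_trans (ler_normB _ _) _.
  have h3 : `|E * (1 + u + (u ^+ 2 - v) / 2)| <= C0 * w ^+ 3.
    rewrite normrM gtr0_norm//; apply: (@le_trans _ _ (E * (2 * (1 + r) ^+ 3 * expR (1 + r) * w ^+ 3))).
      by rewrite ler_wpM2l// ltW.
    have := poly r r0; rewrite -/E => /(ler_wpM2r w30); lra.
  rewrite [leRHS]mulrDl mul1r lerD// (le_trans h1)//.
pose y := u - v / 2.
have w2 : w ^+ 2 <= w by rewrite ler_iXnr.
have hy : `|y| <= w * (1 + r).
  rewrite /y (le_trans (ler_normB _ _))// [X in _ + X]ger0_norm; last lra.
  move: hu; lra.
have y1 : `|y| <= 1 + r by rewrite (le_trans hy)// ler_piMl//; lra.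
have -> : expR (u - v / 2) - (1 + u + (u ^+ 2 - v) / 2) =
  (expR y - 1 - y - y ^+ 2 / 2) + (v ^+ 2 / 8 - u * v / 2).
  by rewrite /y; field.
rewrite normrM gtr0_norm//.
have r1 : 0 <= 1 + r by lra.
have w30 : 0 <= w ^+ 3 by rewrite exprn_ge0.
have b1 : `|expR y - 1 - y - y ^+ 2 / 2| <= (1 + r) ^+ 3 * expR (1 + r) * w ^+ 3.
  apply: le_trans (expR_sub2 y) _.
  have -> : (1 + r) ^+ 3 * expR (1 + r) * w ^+ 3 = (w * (1 + r)) ^+ 3 * expR (1 + r).
    by rewrite exprMn; ring.
  rewrite ler_pM ?expR_ge0 ?exprn_ge0 ?ler_expR//.
  by rewrite lerXn2r ?nnegrE// mulr_ge0.
have e1 : 1 <= expR (1 + r) by rewrite -[leLHS](@expR0 R) ler_expR; lra.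
have b2 : `|v ^+ 2 / 8 - u * v / 2| <= (1 + r) ^+ 3 * expR (1 + r) * w ^+ 3.
  have c1 : `|u * v| <= r * w ^+ 3.
    rewrite normrM [X in _ * X]ger0_norm//.
    apply: le_trans (ler_pM _ _ hu hv) _ => //.
    by rewrite -mulrA -exprS.
  have c2 : v ^+ 2 <= w ^+ 3.
    apply: (@le_trans _ _ ((w ^+ 2) ^+ 2)); first by rewrite lerXn2r ?nnegrE ?sqr_ge0.
    rewrite -exprM; by apply: ler_wiXn2l.
  have c3 : `|v ^+ 2 / 8 - u * v / 2| <= (1 + r) * w ^+ 3.
    rewrite (le_trans (ler_normB _ _))// ger0_norm; last by rewrite divr_ge0// sqr_ge0.
    have -> : `|u * v / 2| = `|u * v| / 2 by rewrite normrM (@ger0_norm _ 2^-1).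
    have := normr_ge0 (u * v); have := mulr_ge0 r0 w30; lra.
  apply: le_trans c3 _; rewrite ler_wpM2r//.
  apply: (@le_trans _ _ ((1 + r) ^+ 3)); first by rewrite ler_eXnr//; lra.
  by rewrite ler_peMr// exprn_ge0.
apply: le_trans (ler_wpM2l (ltW E0) (le_trans (ler_normD _ _) (lerD b1 b2))) _.
have := poly r r0; rewrite -/E => /(ler_wpM2r w30) hp.
rewrite [leRHS]mulrDl mul1r; lra.
Qed.

Lemma ln1D_bounds x : 0 <= x -> x - x ^+ 2 <= ln (1 + x) <= x.
Proof.
move=> x0; apply/andP; split; last by apply: le_ln1Dx; lra.
have x1 : 0 < 1 + x by lra.
have := @le_ln1Dx R ((1 + x)^-1 - 1).
have -> : 1 + ((1 + x)^-1 - 1) = (1 + x)^-1 by ring.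
rewrite lnV ?posrE//.
have -> : (1 + x)^-1 - 1 = - (x / (1 + x)) by field; lra.
have h1 : x / (1 + x) < 1 by rewrite ltr_pdivrMr// mul1r; lra.
have h2 : x - x ^+ 2 <= x / (1 + x).
  rewrite ler_pdivlMr//; have := mulr_ge0 x0 (mulr_ge0 x0 x0); rewrite expr2; nra.
by move=> h; have := h ltac:(lra); lra.
Qed.

(** The effect on a Gaussian kernel in dimension [D] of increasing its
    variance by the factor [1 + e]. *)
Lemma gauss_time_taylor (D : R) : 0 <= D -> exists2 C : R, 0 <= C & forall rho e,
  0 <= rho -> 0 <= e <= 1 ->
  `|expR (- (D / 2 * ln (1 + e)) - rho / (2 * (1 + e)))
    - expR (- (rho / 2)) * (1 + e * (rho - D) / 2)| <= C * e ^+ 2.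
Proof.
move=> D0; exists (32 * expR ((1 + D) / 4 + D / 2)).
  by rewrite mulr_ge0// expR_ge0.
move=> rho e r0 /andP[e0 e1].
have /andP[l1 l2] := ln1D_bounds e0.
have e2 : e ^+ 2 <= e by rewrite ler_iXnr.
pose q := e / (1 + e); have p0 : 0 < 1 + e by lra.
have q1 : q <= e by rewrite /q ler_pdivrMr// mulrDr mulr1 lerDl mulr_ge0.
have q2 : e - e ^+ 2 <= q.
  rewrite ler_pdivlMr//; have := mulr_ge0 e0 (mulr_ge0 e0 e0); rewrite expr2; nra.
have q3 : q <= 1 / 2 by rewrite /q ler_pdivrMr//; lra.
have q0 : 0 <= q by rewrite divr_ge0// ltW.
pose y := rho * q / 2 - D / 2 * ln (1 + e).
have -> : - (D / 2 * ln (1 + e)) - rho / (2 * (1 + e)) = - (rho / 2) + y.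
  rewrite /y /q; set L := ln _; field; lra.
rewrite expRD -mulrBr normrM (ger0_norm (expR_ge0 _)).
have rq := ler_wpM2l r0 q1; have rq2 := ler_wpM2l r0 q2; have rq3 := ler_wpM2l r0 q3.
have Dl := ler_wpM2l D0 l1; have Dl2 := ler_wpM2l D0 l2.
have ln0 : 0 <= ln (1 + e) by rewrite ln_ge0//; lra.
have De := ler_wpM2l D0 e1; have D2 := ler_wpM2l D0 e2; have re2 := ler_wpM2l r0 e2.
have Dln := mulr_ge0 D0 ln0; have rqq := mulr_ge0 r0 q0.
have y1 : `|y - e * (rho - D) / 2| <= e ^+ 2 * (D + rho) / 2.
  rewrite /y ler_norml; apply/andP; split; lra.
have y2 : `|y| <= e * (D + rho) / 2.
  have := mulr_ge0 e0 r0; have := mulr_ge0 e0 D0.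
  rewrite /y ler_norml => *; apply/andP; split; lra.
have y3 : `|y| <= D / 2 + rho / 4.
  rewrite /y ler_norml; apply/andP; split; lra.
have /andP[s0 s1] := expR_sub1 y.
pose s := 1 + D + rho.
have s00 : 0 <= s by rewrite /s; lra.
have A1 : `|expR y - (1 + e * (rho - D) / 2)| <= e ^+ 2 * (s ^+ 2 * expR (D / 2 + rho / 4)).
  have -> : expR y - (1 + e * (rho - D) / 2) = (expR y - 1 - y) + (y - e * (rho - D) / 2).
    by ring.
  apply: le_trans (ler_normD _ _) _; rewrite (ger0_norm s0).
  have ex1 : 1 <= expR (D / 2 + rho / 4) by rewrite -[leLHS](@expR0 R) ler_expR; lra.
  have t1 : y ^+ 2 * expR `|y| <= e ^+ 2 * (((D + rho) / 2) ^+ 2 * expR (D / 2 + rho / 4)).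
    rewrite mulrA -exprMn ler_pM ?sqr_ge0 ?expR_ge0 ?ler_expR//.
    by rewrite -[y ^+ 2]real_normK ?num_real// lerXn2r ?nnegrE ?mulr_ge0 ?divr_ge0 ?addr_ge0// mulrA.
  have t2 : e ^+ 2 * (D + rho) / 2 <= e ^+ 2 * (((D + rho) / 2) * expR (D / 2 + rho / 4)).
    rewrite -mulrA ler_wpM2l ?sqr_ge0// ler_peMr//; lra.
  apply: le_trans (lerD (le_trans s1 t1) (le_trans y1 t2)) _.
  rewrite -mulrDr ler_wpM2l ?sqr_ge0// -mulrDl ler_wpM2r ?expR_ge0//.
  rewrite /s !expr2; have := mulr_ge0 (addr_ge0 D0 r0) (addr_ge0 D0 r0); lra.
have s2 : s ^+ 2 <= 32 * expR (s / 4).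
  have := @pow_le_exp (s / 4) 1 ltac:(lra); rewrite (_ : 2`! = 2)%N// expr_div_n => h.
  have : s ^+ 2 / 4 ^+ 2 * 4 ^+ 2 <= 2 * expR (s / 4) * 4 ^+ 2.
    by rewrite ler_wpM2r.
  rewrite divfK//; lra.
apply: le_trans (ler_wpM2l (expR_ge0 _) A1) _.
have -> : expR (- (rho / 2)) * (e ^+ 2 * (s ^+ 2 * expR (D / 2 + rho / 4))) =
  s ^+ 2 * (expR (- (rho / 2)) * expR (D / 2 + rho / 4)) * e ^+ 2 by ring.
rewrite ler_wpM2r ?sqr_ge0// -expRD.
apply: le_trans (ler_wpM2r (expR_ge0 _) s2) _.
by rewrite -mulrA -expRD ler_wpM2l// ler_expR /s; lra.
Qed.

End exponential_estimates.

(** * Quadratic forms and the evolution of Gaussian kernels *)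

Section quadratic_forms.
Context (R : realType) (d : nat).
Implicit Types (A : 'M[R]_d) (z w : 'cV[R]_d).

Definition bil A z w : R := (z^T *m A *m w) 0 0.

Lemma quadE A w : quad A w = bil A w w. Proof. by []. Qed.

Lemma bil_sum A z w : bil A z w = \sum_i \sum_j z i 0 * A i j * w j 0.
Proof.
rewrite /bil mxE exchange_big /=; apply: eq_bigr => j _.
by rewrite mxE mulr_suml; apply: eq_bigr => i _; rewrite mxE.
Qed.

Lemma bilDr A z w w' : bil A z (w + w') = bil A z w + bil A z w'.
Proof. by rewrite /bil mulmxDr mxE. Qed.

Lemma bilZr A z c w : bil A z (c *: w) = c * bil A z w.
Proof. by rewrite /bil -scalemxAr mxE. Qed.

Lemma bilC A z w : A^T = A -> bil A z w = bil A w z.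
Proof.
move=> sA; rewrite /bil -[in LHS](trmxK (z^T *m A *m w)) mxE.
by rewrite !trmx_mul trmxK sA mulmxA.
Qed.

Lemma quadZ A c w : quad A (c *: w) = c ^+ 2 * quad A w.
Proof.
rewrite !quadE bilZr !bil_sum !mulr_sumr; apply: eq_bigr => i _.
by rewrite !mulr_sumr; apply: eq_bigr => j _; rewrite mxE; ring.
Qed.

Lemma quadD A z w : A^T = A -> quad A (z + w) = quad A z + 2 * bil A z w + quad A w.
Proof.
move=> sA; rewrite !quadE bilDr (bilC (z + w) z sA) (bilC (z + w) w sA) !bilDr.
by rewrite (bilC w z sA); ring.
Qed.

Lemma quadN A w : quad A (- w) = quad A w.
Proof. by rewrite -scaleN1r quadZ sqrrN expr1n mul1r. Qed.

Lemma quadB A z w : A^T = A -> quad A (z - w) = quad A z - 2 * bil A z w + quad A w.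
Proof. by move=> sA; rewrite quadD// quadN -scaleN1r bilZr; ring. Qed.

Section positive.
Variable A : 'M[R]_d.
Hypothesis pA : pos_def A.

Lemma quad_ge0 w : 0 <= quad A w.
Proof.
have [->|w0] := eqVneq w 0; first by rewrite /quad mulmx0 mxE.
by rewrite ltW// pA.2.
Qed.

Lemma bil_cauchy z w : bil A z w ^+ 2 <= quad A z * quad A w.
Proof.
have [->|w0] := eqVneq w 0.
  by rewrite /bil /quad !mulmx0 !mxE expr0n /= mulr0.
have q0 := pA.2 w w0.
have := quad_ge0 (z - (bil A z w / quad A w) *: w).
rewrite quadB ?pA.1// bilZr quadZ => h.
rewrite -ler_pdivrMr//.
have -> : bil A z w ^+ 2 / quad A w =
  quad A z - (quad A z - 2 * (bil A z w / quad A w * bil A z w) +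
     (bil A z w / quad A w) ^+ 2 * quad A w).
  by field; rewrite gt_eqF.
lra.
Qed.

Lemma pos_def_unit : A \in unitmx.
Proof.
rewrite unitmxE unitfE; apply/det0P => -[v v0 vA].
have : v^T != 0 by rewrite trmx_eq0.
by move/pA.2; rewrite /quad trmxK vA mul0mx mxE ltxx.
Qed.

Lemma pos_def_inv : pos_def (invmx A).
Proof.
split; first by rewrite trmx_inv pA.1.
move=> w w0; have -> : quad (invmx A) w = quad A (invmx A *m w).
  rewrite /quad trmx_mul trmx_inv pA.1 -!mulmxA; congr ((_ *m _) _ _).
  by rewrite !mulmxA mulVmx ?pos_def_unit// mul1mx.
apply: pA.2; apply: contra_neq w0 => h.
by rewrite -(mulKVmx pos_def_unit w) h mulmx0.
Qed.

End positive.

Lemma quad_bound A : exists2 c : R, 0 <= c &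
  forall w M, (forall i, `|w i 0| <= M) -> `|quad A w| <= c * M ^+ 2.
Proof.
exists (\sum_i \sum_j `|A i j|).
  by apply: sumr_ge0 => i _; apply: sumr_ge0.
move=> w M hw; rewrite quadE bil_sum mulr_suml (le_trans (ler_norm_sum _ _ _))//.
apply: ler_sum => i _; rewrite mulr_suml (le_trans (ler_norm_sum _ _ _))//.
apply: ler_sum => j _; rewrite !normrM mulrAC mulrC ler_wpM2l// expr2.
by rewrite ler_pM.
Qed.

End quadratic_forms.

Section heat_kernel.
Context (R : realType) (d : nat) (dO : measure_display)
  (Omega : measurableType dO) (Pa : probability Omega R).
Variables (Y : Omega -> 'cV[nat]_d) (t : R).
Hypothesis mY : measurable_fun setT Y.
Hypothesis t0 : 0 < t.
Hypothesis hexp : ('E_Pa[fun w => expR (t * (norm1 (Y w))%:R)] < +oo)%E.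
Variables (m : 'cV[R]_d) (G : 'M[R]_d).
Hypothesis hm : forall i, ('E_Pa[fun w => (Y w i ord0)%:R] = (m i ord0)%:E)%E.
Hypothesis hG : forall i j, covariance Pa (fun w => (Y w i ord0)%:R)
                             (fun w => (Y w j ord0)%:R) = (G i j)%:E.
Hypothesis pG : pos_def G.
Notation Nd := 'cV[nat]_d.
Notation Ex := (Ex Pa Y).
Notation tame := (@tame R d t).
Let B := invmx G.
Let Z (y : Nd) : 'cV[R]_d := toR R y - m.

Lemma coord_le_norm1 (y : Nd) i : (y i 0)%:R <= (norm1 y)%:R :> R.
Proof. by rewrite ler_nat /norm1 (bigD1 i)//= leq_addr. Qed.

Lemma tame_coord i : tame (fun y => (y i 0)%:R).
Proof.
by apply: tame_le (tame_norm1 _ t0) _ => y; rewrite !ger0_norm ?ler0n// coord_le_norm1.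
Qed.

Lemma Ex_coord i : Ex (fun y => (y i 0)%:R) = m i 0.
Proof. by have := hm i; rewrite -(EFin_Ex mY hexp (tame_coord i)) => -[]. Qed.

Definition poly_bounded (k : nat) (f : Nd -> R) := exists C : R, forall y,
  `|f y| <= C * (1 + (norm1 y)%:R) ^+ k.

Lemma tame_poly k f : poly_bounded k f -> tame f.
Proof.
move=> [C hC]; have C1 : C <= `|C| by exact: ler_norm.
exists (`|C| * ((k.+1`!%:R / t ^+ k.+1) * expR t)) => y.
apply: le_trans (hC y) _; set n : R := (norm1 y)%:R.
have n0 : 0 <= n by rewrite ler0n.
apply: (@le_trans _ _ (`|C| * (1 + n) ^+ k)).
  by rewrite ler_wpM2r// exprn_ge0//; lra.
rewrite -[leRHS]mulrA ler_wpM2l//.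
have tn : 0 <= t * (1 + n) by rewrite mulr_ge0 ?(ltW t0)//; lra.
have := pow_le_exp k tn; rewrite exprMn => h.
apply: (@le_trans _ _ ((1 + n) ^+ k.+1)).
  by rewrite exprSr ler_peMr ?exprn_ge0//; lra.
rewrite -[leRHS]mulrA -expRD (_ : t + t * n = t * (1 + n)); last by ring.
by rewrite mulrAC ler_pdivlMr ?exprn_gt0// mulrC.
Qed.

Lemma Z_bound : exists2 c : R, 0 <= c & forall y i, `|Z y i 0| <= c * (1 + (norm1 y)%:R).
Proof.
pose c := 1 + \sum_i `|m i 0|.
have s0 : 0 <= \sum_i `|m i 0| by apply: sumr_ge0.
exists c; first by rewrite /c; lra.
move=> y i; rewrite /Z !mxE (le_trans (ler_normB _ _))//.
have h1 := coord_le_norm1 y i; have h2 : (0 : R) <= (norm1 y)%:R by rewrite ler0n.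
have h3 : `|m i 0| <= \sum_i `|m i 0| by rewrite (bigD1 i)//= lerDl sumr_ge0.
rewrite ger0_norm ?ler0n// /c.
have := mulr_ge0 s0 h2; lra.
Qed.

Lemma tame_Z i : tame (fun y => Z y i 0).
Proof.
have [c c0 hc] := Z_bound; apply: (@tame_poly 1).
by exists c => y; rewrite expr1.
Qed.

Lemma tame_ZZ i j : tame (fun y => Z y i 0 * Z y j 0).
Proof.
have [c c0 hc] := Z_bound; apply: (@tame_poly 2).
exists (c ^+ 2) => y; rewrite normrM -exprMn expr2.
by apply: ler_pM.
Qed.

Lemma Ex_Z i : Ex (fun y => Z y i 0) = 0.
Proof.
rewrite (_ : Ex _ = Ex (fun y => (y i 0)%:R - m i 0)); last first.
  by apply: eq_Ex => y; rewrite /Z !mxE.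
by rewrite (ExB mY hexp (tame_coord i) (tame_cst _ t0 _)) Ex_cst Ex_coord subrr.
Qed.

Lemma Ex_ZZ i j : Ex (fun y => Z y i 0 * Z y j 0) = G i j.
Proof.
have := hG i j; rewrite unlock !hm /= => h.
apply: EFin_inj; rewrite -h (EFin_Ex mY hexp (tame_ZZ i j)).
by congr ('E_Pa[_])%E; apply/funext => w; rewrite /Z !mxE.
Qed.

Lemma tame_sum (I : Type) (s : seq I) (F : I -> Nd -> R) :
  (forall i, tame (F i)) -> tame (fun y => \sum_(i <- s) F i y).
Proof.
move=> hF; elim: s => [|j s IH].
  by apply: (tame_le (tame_cst _ t0 0)) => y; rewrite big_nil.
by apply: (tame_le (tameD (hF j) IH)) => y; rewrite big_cons.
Qed.

Lemma Ex_bil z : Ex (fun y => bil B z (Z y)) = 0.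
Proof.
have -> : Ex (fun y => bil B z (Z y)) =
   Ex (fun y => \sum_i \sum_j (z i 0 * B i j) * Z y j 0).
  by apply: eq_Ex => y; rewrite bil_sum.
rewrite (Ex_sum mY t0 hexp) => [|i].
  apply: big1 => i _; rewrite (Ex_sum mY t0 hexp) => [|j]; last exact/tameZ/tame_Z.
  by apply: big1 => j _; rewrite (ExZ mY hexp _ (tame_Z j)) Ex_Z mulr0.
by apply: tame_sum => j; exact/tameZ/tame_Z.
Qed.

Lemma Ex_quad : Ex (fun y => quad B (Z y)) = d%:R.
Proof.
have -> : Ex (fun y => quad B (Z y)) =
   Ex (fun y => \sum_i \sum_j B i j * (Z y i 0 * Z y j 0)).
  apply: eq_Ex => y; rewrite quadE bil_sum.
  by apply: eq_bigr => i _; apply: eq_bigr => j _; ring.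
rewrite (Ex_sum mY t0 hexp) => [|i]; last first.
  by apply: tame_sum => j; exact/tameZ/tame_ZZ.
transitivity (\sum_i (B *m G) i i).
  apply: eq_bigr => i _; rewrite (Ex_sum mY t0 hexp) => [|j]; last exact/tameZ/tame_ZZ.
  rewrite mxE; apply: eq_bigr => j _.
  rewrite (ExZ mY hexp _ (tame_ZZ i j)) Ex_ZZ; congr (_ * _).
  by rewrite -[in LHS]pG.1 mxE.
rewrite /B mulVmx ?(pos_def_unit pG)//.
rewrite (eq_bigr (fun=> 1)) ?sumr_const ?card_ord// => i _.
by rewrite mxE eqxx.
Qed.

Lemma Ex_bil2 z : Ex (fun y => bil B z (Z y) ^+ 2) = quad B z.
Proof.
pose c j := \sum_i z i 0 * B i j.
have e y : bil B z (Z y) = \sum_j c j * Z y j 0.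
  rewrite bil_sum exchange_big; apply: eq_bigr => j _ /=.
  by rewrite mulr_suml.
have -> : Ex (fun y => bil B z (Z y) ^+ 2) =
   Ex (fun y => \sum_j \sum_k (c j * c k) * (Z y j 0 * Z y k 0)).
  apply: eq_Ex => y; rewrite e expr2 mulr_suml; apply: eq_bigr => j _.
  by rewrite mulr_sumr; apply: eq_bigr => k _; ring.
rewrite (Ex_sum mY t0 hexp) => [|i]; last first.
  by apply: tame_sum => j; exact/tameZ/tame_ZZ.
transitivity (bil G (\col_j c j) (\col_j c j)).
  rewrite bil_sum; apply: eq_bigr => j _.
  rewrite (Ex_sum mY t0 hexp) => [|k]; last exact/tameZ/tame_ZZ.
  apply: eq_bigr => k _.
  by rewrite (ExZ mY hexp _ (tame_ZZ j k)) Ex_ZZ !mxE; ring.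
have sB : B^T = B := (pos_def_inv pG).1.
have -> : \col_j c j = B *m z.
  apply/colP => j; rewrite !mxE; apply: eq_bigr => i _.
  by rewrite mulrC -[in LHS]sB mxE.
rewrite /bil /quad trmx_mul sB.
by rewrite -!mulmxA (mulmxA G) /B mulmxV ?(pos_def_unit pG)// mul1mx.
Qed.

(** The Gaussian density with covariance matrix [s *: G], up to a constant
    factor that depends on [G] only. *)
Definition heat (s : R) (z : 'cV[R]_d) : R :=
  (Num.sqrt s)^-1 ^+ d * expR (- (quad B z / (2 * s))).

Lemma heat_ge0 s z : 0 <= heat s z.
Proof. by rewrite mulr_ge0 ?expR_ge0// exprn_ge0// invr_ge0 sqrtr_ge0. Qed.

Lemma quadB_ge0 z : 0 <= quad B z.
Proof. exact: quad_ge0 (pos_def_inv pG) z. Qed.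

Lemma heat_sup s z : 0 < s -> heat s z <= (Num.sqrt s)^-1 ^+ d.
Proof.
move=> s0; rewrite /heat ler_piMr ?exprn_ge0 ?invr_ge0 ?sqrtr_ge0//.
by rewrite expR_le1 oppr_le0 divr_ge0 ?quadB_ge0// mulr_ge0// ltW.
Qed.

(** The Gaussian kernels are evolved by the walk up to third order: both sides
    expand to [heat s z * (1 + (quad B z / s - d) / (2 s))], the left one
    because the first two moments of the step match those of the kernel. *)
Lemma heat_step : exists2 C : R, 0 <= C & forall s z, 1 <= s ->
  `|Ex (fun y => heat s (z - Z y)) - heat (s + 1) z| <= C * (Num.sqrt s)^-1 ^+ (d + 3).
Proof.
have [C1 C10 hC1] := gauss_space_taylor R.
have [C2 C20 hC2] := @gauss_time_taylor R d%:R (ler0n _ _).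
pose q (y : Nd) := Num.sqrt (quad B (Z y)).
have q0 y : 0 <= q y by exact: sqrtr_ge0.
have qq y : q y ^+ 2 = quad B (Z y) by rewrite sqr_sqrtr// quadB_ge0.
have tq : tame (fun y => q y ^+ 3).
  have [c c0 hc] := Z_bound; have [k k0 hk] := quad_bound B.
  apply: (@tame_poly 3); exists ((Num.sqrt k * c) ^+ 3) => y.
  rewrite ger0_norm ?exprn_ge0// -exprMn lerXn2r ?nnegrE//.
    by rewrite !mulr_ge0 ?sqrtr_ge0// addr_ge0.
  rewrite /q; apply: (@le_trans _ _ (Num.sqrt (k * (c * (1 + (norm1 y)%:R)) ^+ 2))).
    by rewrite ler_wsqrtr// (le_trans (ler_norm _))// hk.
  rewrite sqrtrM// sqrtr_sqr ger0_norm ?mulrA//.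
  by rewrite mulr_ge0// addr_ge0.
pose C3 := Ex (fun y => q y ^+ 3).
have C30 : 0 <= C3 by apply: Ex_ge0 => y; rewrite exprn_ge0.
exists (C1 * C3 + C2); first by rewrite addr_ge0// mulr_ge0.
move=> s z s1; set k := Num.sqrt s.
have s0 : 0 < s by lra.
have k0 : 0 < k by rewrite sqrtr_gt0.
have kk : k ^+ 2 = s by rewrite sqr_sqrtr// ltW.
have k1 : 1 <= k by rewrite -(@sqrtr1 R) ler_wsqrtr.
set al := quad B z; have al0 : 0 <= al by exact: quadB_ge0.
pose r := Num.sqrt al / k.
have r0 : 0 <= r by rewrite divr_ge0 ?sqrtr_ge0// ltW.
have rr : r ^+ 2 = al / s by rewrite /r exprMn exprVn sqr_sqrtr// kk.
pose u y := bil B z (Z y) / s; pose w y := q y / k; pose v y := quad B (Z y) / s.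
have w0 y : 0 <= w y by rewrite divr_ge0// ltW.
have vw y : v y = w y ^+ 2 by rewrite /w exprMn exprVn qq kk.
have hu y : `|u y| <= r * w y.
  have -> : r * w y = (Num.sqrt al * q y) / s.
    by rewrite /r /w -kk; field; rewrite gt_eqF.
  rewrite /u normrM [X in _ * X]gtr0_norm ?invr_gt0//.
  rewrite ler_wpM2r ?invr_ge0 ?(ltW s0)//.
  rewrite -(@ler_pXn2r _ 2)// ?nnegrE ?mulr_ge0 ?sqrtr_ge0//.
  by rewrite real_normK ?num_real// exprMn sqr_sqrtr// qq bil_cauchy//; exact: pos_def_inv.
have v0 y : 0 <= v y by rewrite vw exprn_ge0.
have heatE y : heat s (z - Z y) =
   k^-1 ^+ d * (expR (- (r ^+ 2 / 2)) * expR (u y - v y / 2)).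
  rewrite /heat -/k quadB ?(pos_def_inv pG).1// -expRD; congr (_ * expR _).
  by rewrite rr /u /v -/al; field; rewrite gt_eqF.
have hQ y : u y - v y / 2 <= r ^+ 2 / 2.
  have := quadB_ge0 (z - Z y); rewrite quadB ?(pos_def_inv pG).1// -/al => h.
  have -> : u y - v y / 2 = r ^+ 2 / 2 - (al - 2 * bil B z (Z y) + quad B (Z y)) / (2 * s).
    by rewrite rr /u /v; field; rewrite gt_eqF.
  by rewrite gerBl divr_ge0// mulr_ge0// ltW.
have k0d : 0 <= k^-1 ^+ d by rewrite exprn_ge0// invr_ge0 ltW.
pose E := k^-1 ^+ d * expR (- (r ^+ 2 / 2)).
pose T y := 1 + u y + (u y ^+ 2 - v y) / 2.
have tu : tame u.
  rewrite /u; apply: tame_le (tameZ s^-1 _) _; last first.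
    by move=> y; rewrite mulrC; exact: lexx.
  apply: tame_le (@tame_sum _ (index_enum 'I_d) (fun i y => \sum_j (z i 0 * B i j) * Z y j 0) _) _.
    by move=> i; apply: tame_sum => j; exact/tameZ/tame_Z.
  by move=> y; rewrite bil_sum.
have tv : tame v.
  rewrite /v; apply: tame_le (tameZ s^-1 _) _; last first.
    by move=> y; rewrite mulrC; exact: lexx.
  apply: tame_le (@tame_sum _ (index_enum 'I_d) (fun i y => \sum_j B i j * (Z y i 0 * Z y j 0)) _) _.
    by move=> i; apply: tame_sum => j; exact/tameZ/tame_ZZ.
  move=> y; rewrite quadE bil_sum le_eqVlt; apply/orP; left; apply/eqP; congr `|_|.
  by apply: eq_bigr => i _; apply: eq_bigr => j _; ring.
have tu2 : tame (fun y => u y ^+ 2).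
  apply: tame_le (tameZ (r ^+ 2) tv) _ => y.
  have -> : `|r ^+ 2 * v y| = (r * w y) ^+ 2.
    by rewrite vw -exprMn ger0_norm ?sqr_ge0.
  rewrite ger0_norm ?sqr_ge0//.
  rewrite -[u y ^+ 2]real_normK ?num_real//.
  by apply: lerXn2r; rewrite ?nnegrE ?(mulr_ge0 r0 (w0 y)) ?normr_ge0.
have tb : tame (fun y => bil B z (Z y)).
  apply: tame_le (tameZ s tu) _ => y.
  by rewrite /u mulrC divfK ?gt_eqF.
have tqd : tame (fun y => quad B (Z y)).
  apply: tame_le (tameZ s tv) _ => y.
  by rewrite /v mulrC divfK ?gt_eqF.
have tb2 : tame (fun y => bil B z (Z y) ^+ 2).
  apply: tame_le (tameZ (s ^+ 2) tu2) _ => y.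
  by rewrite /u exprMn exprVn mulrC divfK ?expf_neq0 ?gt_eqF.
have Eu : Ex u = 0.
  have := ExZ mY hexp s^-1 tb; rewrite Ex_bil mulr0 => <-.
  by apply: eq_Ex => y; rewrite mulrC.
have Ev : Ex v = d%:R / s.
  have := ExZ mY hexp s^-1 tqd; rewrite Ex_quad mulrC => <-.
  by apply: eq_Ex => y; rewrite mulrC.
have Eu2 : Ex (fun y => u y ^+ 2) = al / s ^+ 2.
  have := ExZ mY hexp (s ^+ 2)^-1 tb2; rewrite Ex_bil2 mulrC => <-.
  by apply: eq_Ex => y; rewrite /u exprMn exprVn mulrC.
have tT : tame T.
  apply: tame_le (tameD (tameD (tame_cst _ t0 1) tu) (tameZ 2^-1 (tameD tu2 (tameZ (-1) tv)))) _.
  by move=> y; rewrite /T mulN1r mulrC.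
have ET : Ex T = 1 + s^-1 * (al / s - d%:R) / 2.
  transitivity (Ex (fun y => (1 + u y) + 2^-1 * (u y ^+ 2 + -1 * v y))).
    by apply: eq_Ex => y; rewrite /T mulN1r; ring.
  rewrite (ExD mY hexp (tameD (tame_cst _ t0 1) tu) (tameZ 2^-1 (tameD tu2 (tameZ (-1) tv)))).
  rewrite (ExD mY hexp (tame_cst _ t0 1) tu) (ExZ mY hexp _ (tameD tu2 (tameZ (-1) tv))).
  rewrite (ExD mY hexp tu2 (tameZ (-1) tv)) (ExZ mY hexp _ tv) Ex_cst Eu Ev Eu2.
  by field; rewrite gt_eqF.
have th : tame (fun y => heat s (z - Z y)).
  apply: (@tame_bounded _ _ _ t0 _ (k^-1 ^+ d)) => y.
  by rewrite ger0_norm ?heat_ge0// heat_sup.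
have A1 : `|Ex (fun y => heat s (z - Z y)) - E * Ex T| <= C1 * C3 * k^-1 ^+ (d + 3).
  rewrite -(ExZ mY hexp _ tT) -(ExB mY hexp th (tameZ _ tT)).
  rewrite (_ : C1 * C3 * _ = C1 * k^-1 ^+ (d + 3) * C3); last by ring.
  rewrite /C3 -(ExZ mY hexp _ tq).
  apply: (Ex_norm_le mY hexp); first exact: tameZ.
  move=> y; rewrite heatE /E.
  have -> : k^-1 ^+ d * (expR (- (r ^+ 2 / 2)) * expR (u y - v y / 2))
     - k^-1 ^+ d * expR (- (r ^+ 2 / 2)) * T y =
     k^-1 ^+ d * (expR (- (r ^+ 2 / 2)) * (expR (u y - v y / 2) - T y)) by ring.
  rewrite normrM (ger0_norm k0d).
  have vw2 : v y <= w y ^+ 2 by rewrite vw.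
  have h := hC1 r (w y) (u y) (v y) r0 (w0 y) (hu y) (v0 y) vw2 (hQ y).
  apply: le_trans (ler_wpM2l k0d h) _.
  rewrite /w exprMn exprD le_eqVlt; apply/orP; left; apply/eqP; ring.
have A2 : `|heat (s + 1) z - E * Ex T| <= C2 * k^-1 ^+ (d + 3).
  have e01 : 0 <= s^-1 <= 1 by rewrite invr_ge0 (ltW s0) invf_le1.
  have al1 : 0 <= al / s by rewrite divr_ge0// ltW.
  have := hC2 (al / s) s^-1 al1 e01.
  rewrite -ET => h.
  have -> : heat (s + 1) z = k^-1 ^+ d *
     expR (- (d%:R / 2 * ln (1 + s^-1)) - al / s / (2 * (1 + s^-1))).
    have s1' : 0 < 1 + s^-1 by rewrite addr_gt0// invr_gt0.
    have -> : - (d%:R / 2 * ln (1 + s^-1)) = d%:R * (- (ln (1 + s^-1) / 2)) by ring.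
    rewrite expRD expRM_natl expRN.
    have -> : expR (ln (1 + s^-1) / 2) = Num.sqrt (1 + s^-1).
      apply/eqP; rewrite -(@eqrXn2 _ 2)// ?expR_ge0 ?sqrtr_ge0//.
      rewrite sqr_sqrtr ?(ltW s1')// -expRM_natl mulrC divfK// lnK//.
    rewrite mulrA -exprMn -invfM -sqrtrM ?(ltW s0)//.
    rewrite /heat; congr ((Num.sqrt _)^-1 ^+ d * expR _).
      by rewrite mulrDr mulr1 divff ?gt_eqF.
    rewrite -/al; field; rewrite !gt_eqF//; lra.
  set X1 := expR (- (d%:R / 2 * _) - _) in h *.
  have -> : k^-1 ^+ d * X1 - E * Ex T = k^-1 ^+ d * (X1 - expR (- (al / s / 2)) * Ex T).
    by rewrite /E rr; ring.
  rewrite normrM (ger0_norm k0d).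
  apply: le_trans (ler_wpM2l k0d h) _.
  rewrite mulrCA ler_wpM2l// exprD ler_wpM2l ?exprn_ge0 ?invr_ge0 ?(ltW k0)//.
  rewrite -kk -exprVn -exprM -[leLHS]mulr1 -(mulr1 (k^-1 ^+ 3)) mulr1 mulr1.
  by apply: ler_wiXn2l => //; rewrite ?invr_ge0 ?(ltW k0)// invf_le1.
rewrite distrC in A2.
have -> : Ex (fun y => heat s (z - Z y)) - heat (s + 1) z =
  (Ex (fun y => heat s (z - Z y)) - E * Ex T) + (E * Ex T - heat (s + 1) z) by ring.
by rewrite mulrDl (le_trans (ler_normD _ _))// lerD.
Qed.

End heat_kernel.

(** * Riemann sums of the Gaussian *)

Section riemann_sums.
Context (R : realType).
Import gauss_integral_proof.
Notation mu := (@lebesgue_measure R).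
Notation GI := (@integral0_gauss R).

Lemma gauss_fun_antitone (x y : R) : 0 <= x -> x <= y -> gauss_fun y <= gauss_fun x.
Proof.
move=> x0 xy; rewrite /gauss_fun ler_expR lerN2 lerXn2r ?nnegrE//.
exact: le_trans xy.
Qed.

Lemma GI_diff (x y : R) : 0 <= x -> x <= y ->
  (y - x) * gauss_fun y <= GI y - GI x <= (y - x) * gauss_fun x.
Proof.
move=> x0; rewrite le_eqVlt => /predU1P[->|xy].
  by rewrite !subrr !mul0r lexx.
have ig a b : mu.-integrable [set` Interval a b] (EFin \o @gauss_fun R).
  by apply: integrableS (@integrableT_gauss R).
have ic (a b : itv_bound R) (c : R) : (mu [set` Interval a b] < +oo)%E ->
   mu.-integrable [set` Interval a b] (EFin \o (fun=> c)).
  move=> h; apply/integrableP; split; first exact: measurable_cst.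
  by rewrite /= integral_cst//= lte_mul_pinfty.
have -> : GI y - GI x = (\int[mu]_(t in `]x, y]) gauss_fun t)%R.
  rewrite /integral0_gauss.
  have := @Rintegral_itvB R gauss_fun (BLeft 0) (BRight y) x (ig _ _).
  by rewrite !bnd_simp => ->//; exact: ltW.
have cst c : (\int[mu]_(t in `]x, y]) c)%R = (y - x) * c.
  by rewrite Rintegral_cst//= lebesgue_measure_itv /= lte_fin xy /= mulrC.
rewrite -!cst; apply/andP; split; apply: le_Rintegral => //.
- by apply: ic; rewrite /= lebesgue_measure_itv /= lte_fin xy ltry.
- move=> z /=; rewrite in_itv /= => /andP[xz zy].
  by apply: gauss_fun_antitone => //; apply: le_trans x0 (ltW xz).
- by apply: ic; rewrite /= lebesgue_measure_itv /= lte_fin xy ltry.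
- move=> z /=; rewrite in_itv /= => /andP[xz zy].
  by apply: gauss_fun_antitone => //; exact: ltW.
Qed.

Lemma GI0 : GI 0 = 0.
Proof. by rewrite /integral0_gauss set_itv1 Rintegral_set1. Qed.

Lemma GI_mono (x y : R) : 0 <= x -> x <= y -> GI x <= GI y.
Proof.
move=> x0 xy; have /andP[h _] := GI_diff x0 xy.
rewrite -subr_ge0 (le_trans _ h)// mulr_ge0 ?gauss_fun_ge0// subr_ge0//.
Qed.

Let L : R := Num.sqrt pi / 2.
Let L0 : 0 < L. Proof. by rewrite divr_gt0// sqrtr_gt0 pi_gt0. Qed.
Let LL : L ^+ 2 = pi / 4.
Proof. by rewrite exprMn sqr_sqrtr ?pi_ge0// exprVn -natrX. Qed.

Lemma GI_sqr_near (e : R) : 0 < e -> exists2 M : R, 0 < M &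
  forall x, M <= x -> `|L ^+ 2 - GI x ^+ 2| < e.
Proof.
move=> e0; have := @cvg_integral0_gauss_sqr R; rewrite -LL => /cvgrPdist_lt /(_ e e0).
move=> [M [_ hM]]; exists (`|M| + 1); first by rewrite ltr_wpDl.
by move=> x hx; apply: hM; have := ler_norm M; lra.
Qed.

Lemma GI_le (x : R) : 0 <= x -> GI x <= L.
Proof.
move=> x0; rewrite leNgt; apply/negP => h.
have e0 : 0 < GI x ^+ 2 - L ^+ 2 by rewrite subr_gt0 ltrXn2r ?nnegrE// ltW// (lt_trans L0).
have [M M0 hM] := GI_sqr_near e0.
have := hM (M + x); rewrite lerDl => /(_ x0).
have h1 : GI x <= GI (M + x) by apply: GI_mono => //; rewrite lerDr ltW.
have h2 : GI x ^+ 2 <= GI (M + x) ^+ 2.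
  by rewrite lerXn2r ?nnegrE//; apply: le_trans (ltW L0) _; [exact: ltW|lra].
rewrite distrC ltr_norml; lra.
Qed.

Lemma GI_near (e : R) : 0 < e -> exists2 M : R, 0 < M & L - e <= GI M.
Proof.
move=> e0; pose e' := Num.min e L.
have e'0 : 0 < e' by rewrite lt_min e0.
have e'L : e' <= L by rewrite ge_min lexx orbT.
have e'e : e' <= e by rewrite ge_min lexx.
have [M M0 hM] := GI_sqr_near (mulr_gt0 e'0 L0).
exists M => //; have := hM M (lexx _); rewrite ltr_norml => /andP[_ h].
apply: (@le_trans _ _ (L - e')); first lra.
rewrite leNgt; apply/negP => h'.
have G0 : 0 <= GI M := integral0_gauss_ge0 M.
have : GI M ^+ 2 <= (L - e') ^+ 2 by rewrite lerXn2r ?nnegrE// ?ltW//; lra.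
have : (L - e') ^+ 2 <= L ^+ 2 - e' * L.
  have : e' * e' <= e' * L by rewrite ler_wpM2l// ltW.
  rewrite !expr2; lra.
lra.
Qed.

(** A primitive of the Gaussian: monotone Riemann sums need only its
    increments, its bound and its limit, and the limit is the Gaussian
    integral. *)
Lemma gauss_primitive (b : R) : 0 < b -> exists Phi : R -> R,
  [/\ Phi 0 = 0,
   (forall x y : R, 0 <= x -> x <= y ->
      (y - x) * expR (- (b * y ^+ 2 / 2)) <= Phi y - Phi x
        <= (y - x) * expR (- (b * x ^+ 2 / 2))),
   (forall x : R, 0 <= x -> Phi x <= Num.sqrt (2 * pi / b) / 2) &
   forall e : R, 0 < e -> exists2 M : R, 0 < M & Num.sqrt (2 * pi / b) / 2 - e <= Phi M].
Proof.
move=> b0; pose c := Num.sqrt (b / 2).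
have c0 : 0 < c by rewrite sqrtr_gt0 divr_gt0.
have cc : c ^+ 2 = b / 2 by rewrite sqr_sqrtr// divr_ge0// ltW.
have eL : Num.sqrt (2 * pi / b) / 2 = L / c.
  apply/eqP; rewrite -(@eqrXn2 _ 2)// ?divr_ge0 ?sqrtr_ge0 ?(ltW L0) ?(ltW c0)//.
  rewrite (expr_div_n L) LL cc (expr_div_n (Num.sqrt _)) sqr_sqrtr; last first.
    by rewrite divr_ge0 ?mulr_ge0 ?pi_ge0// ltW.
  by apply/eqP; field; rewrite gt_eqF.
have ck x : gauss_fun (c * x) = expR (- (b * x ^+ 2 / 2)).
  by rewrite /gauss_fun exprMn cc; congr expR; field.
(* [integral0_gauss] integrates [exp (- u^2)]; substitute [u = sqrt (b / 2) x]. *)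
exists (fun x => GI (c * x) / c); split.
- by rewrite mulr0 GI0 mul0r.
- move=> x y x0 xy; rewrite -mulrBl.
  have cxy : c * x <= c * y by rewrite ler_wpM2l// ltW.
  have := GI_diff (mulr_ge0 (ltW c0) x0) cxy; rewrite !ck -mulrBr => /andP[h1 h2].
  by rewrite ler_pdivlMr// ler_pdivrMr// mulrC mulrA h1 -[leRHS]mulrC mulrA h2.
- by move=> x x0; rewrite eL ler_pM2r ?invr_gt0// GI_le// mulr_ge0// ltW.
- move=> e e0; have [M M0 hM] := GI_near (mulr_gt0 e0 c0).
  exists (M / c); first exact: divr_gt0.
  have -> : c * (M / c) = M by field; rewrite gt_eqF.
  by rewrite eL ler_pdivlMr// mulrBl divfK ?gt_eqF.
Qed.

Lemma sum_subset (I : eqType) (s s' : seq I) (F : I -> R) : uniq s ->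
  {subset s <= s'} -> (forall i, 0 <= F i) ->
  \sum_(i <- s) F i <= \sum_(i <- s') F i.
Proof.
move=> + + F0; elim: s s' => [|x s IH] s' /=.
  by move=> _ _; rewrite big_nil sumr_ge0.
move=> /andP[xs us] ss'.
have xs' : x \in s' by apply: ss'; rewrite mem_head.
rewrite (perm_big _ (perm_to_rem xs')) /= !big_cons lerD2l IH// => y ys.
have : y \in x :: rem x s'.
  by rewrite -(perm_mem (perm_to_rem xs')) ss'// inE ys orbT.
by rewrite inE => /predU1P[yx|//]; rewrite -yx ys in xs.
Qed.

Section one_dimension.
Variables (b : R) (Phi : R -> R) (Li : R).
Hypothesis b0 : 0 < b.
Let k x := expR (- (b * x ^+ 2 / 2)).
Hypothesis Phi0 : Phi 0 = 0.
Hypothesis Phid : forall x y : R, 0 <= x -> x <= y ->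
  (y - x) * k y <= Phi y - Phi x <= (y - x) * k x.
Hypothesis PhiL : forall x : R, 0 <= x -> Phi x <= Li.

Let k0 x : 0 <= k x. Proof. exact: expR_ge0. Qed.
Let k1 x : k x <= 1.
Proof. by rewrite /k expR_le1 oppr_le0 divr_ge0// mulr_ge0 ?sqr_ge0// ltW. Qed.

Lemma half_sum_le (s x0 : R) n : 0 < s -> 0 <= x0 ->
  \sum_(i < n) k (x0 + i%:R / s) <= 1 + s * Li.
Proof.
move=> s0 x00; case: n => [|n].
  rewrite big_ord0; have := PhiL (lexx 0); rewrite Phi0 => h.
  by rewrite addr_ge0 ?mulr_ge0// ltW.
rewrite big_ord_recl lerD ?k1//=.
have Phix0 : 0 <= Phi x0.
  have /andP[h _] := Phid (lexx 0) x00; rewrite Phi0 !subr0 in h.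
  by rewrite (le_trans _ h)// mulr_ge0.
have xi (i : nat) : 0 <= x0 + i%:R / s by rewrite addr_ge0// divr_ge0 ?ler0n// ltW.
have : \sum_(i < n) k (x0 + (lift ord0 i)%:R / s) <=
   s * (Phi (x0 + n%:R / s) - Phi x0).
  elim: n => [|n IH]; first by rewrite big_ord0 mul0r addr0 subrr mulr0.
  rewrite big_ord_recr /=.
  have e : x0 + n.+1%:R / s - (x0 + n%:R / s) = s^-1 by rewrite -natr1; ring.
  have h1 : x0 + n%:R / s <= x0 + n.+1%:R / s by rewrite -subr_ge0 e invr_ge0 ltW.
  have /andP[h2 _] := Phid (xi n) h1; rewrite e in h2.
  have := ler_wpM2l (ltW s0) h2; rewrite mulrA mulfV ?gt_eqF// mul1r.
  rewrite /bump /= add1n => h3.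
  apply: le_trans (lerD IH h3) _; lra.
move=> h; apply: le_trans h _; rewrite ler_wpM2l ?(ltW s0)//.
have := PhiL (xi n); lra.
Qed.

Lemma half_sum_ge (s x0 : R) n (rho : R) : 0 < s -> 0 <= x0 -> x0 <= s^-1 -> 0 <= rho ->
  rho <= x0 + n%:R / s ->
  s * Phi rho - 1 <= \sum_(i < n) k (x0 + i%:R / s).
Proof.
move=> s0 x00 x0s r0 rn.
have xi (i : nat) : 0 <= x0 + i%:R / s by rewrite addr_ge0// divr_ge0 ?ler0n// ltW.
have h : s * (Phi (x0 + n%:R / s) - Phi x0) <= \sum_(i < n) k (x0 + i%:R / s).
  elim: n {rn} => [|n IH]; first by rewrite big_ord0 mul0r addr0 subrr mulr0.
  rewrite big_ord_recr /=.
  have e : x0 + n.+1%:R / s - (x0 + n%:R / s) = s^-1 by rewrite -natr1; ring.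
  have h1 : x0 + n%:R / s <= x0 + n.+1%:R / s by rewrite -subr_ge0 e invr_ge0 ltW.
  have /andP[_ h2] := Phid (xi n) h1; rewrite e in h2.
  have := ler_wpM2l (ltW s0) h2; rewrite mulrA mulfV ?gt_eqF// mul1r => h3.
  by apply: le_trans (lerD IH h3); lra.
apply: le_trans h.
have h1 : Phi x0 <= s^-1.
  have /andP[_ h] := Phid (lexx 0) x00; rewrite Phi0 !subr0 in h.
  by rewrite (le_trans h)// (le_trans _ x0s)// ler_piMr.
have h2 : Phi rho <= Phi (x0 + n%:R / s).
  have /andP[h _] := Phid r0 rn.
  by rewrite -subr_ge0 (le_trans _ h)// mulr_ge0 ?k0// subr_ge0.
have := ler_wpM2l (ltW s0) h1; rewrite mulfV ?gt_eqF// => h3.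
have := ler_wpM2l (ltW s0) h2; lra.
Qed.

(* the least integer to the right of [- s * sg], and its offset *)
Let origin (s sg : R) : int := Num.ceil (- (s * sg)).

Let originP (s sg : R) : 0 < s -> 0 <= (origin s sg)%:~R / s + sg < s^-1.
Proof.
move=> s0; have := ceil_ge (- (s * sg)); have := ceilB1_lt (- (s * sg)).
rewrite -/(origin s sg) => h1 h2.
have -> : (origin s sg)%:~R / s + sg = ((origin s sg)%:~R + s * sg) / s.
  by field; rewrite gt_eqF.
rewrite divr_ge0 ?(ltW s0)//=; last lra.
by rewrite ltr_pdivrMr// mulVf ?gt_eqF//; lra.
Qed.

Lemma line_sum_le (s sg : R) (l : seq int) : 0 < s -> uniq l ->
  \sum_(z <- l) k (z%:~R / s + sg) <= 2 * (1 + s * Li).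
Proof.
move=> s0 ul; set o := origin s sg; set x0 := o%:~R / s + sg.
have /andP[x00 x0s] := originP sg s0; rewrite -/o -/x0 in x00 x0s.
pose n := (\max_(z <- l) `|z - o|%N).+1.
have hn z : z \in l -> (`|z - o|%N < n)%N.
  by move=> zl; rewrite ltnS; apply: leq_bigmax_seq.
pose l' := [seq o + i%:Z | i <- iota 0 n] ++ [seq o - 1 - i%:Z | i <- iota 0 n].
have sl : {subset l <= l'}.
  move=> z zl; have := hn z zl; rewrite mem_cat => h.
  have [zo|zo] := leP o z.
    apply/orP; left; apply/mapP; exists `|z - o|%N; last by lia.
    by rewrite mem_iota add0n.
  apply/orP; right; apply/mapP; exists `|(o - 1 - z)%R|%N; last by lia.
  by rewrite mem_iota add0n /=; lia.
apply: le_trans (sum_subset ul sl (fun z => k0 _)) _.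
have i1 : iota 0 n = index_iota 0 n by rewrite /index_iota subn0.
rewrite /l' big_cat !big_map i1 !big_mkord mulr2n mulrDl !mul1r lerD//.
  apply: le_trans (half_sum_le n s0 x00); apply: ler_sum => i _.
  by rewrite (_ : (o + _)%:~R / s + sg = x0 + i%:R / s)// /x0 intrD; ring.
have x0s' : 0 <= s^-1 - x0 by lra.
apply: le_trans (half_sum_le n s0 x0s'); apply: ler_sum => i _.
rewrite /k (_ : ((o - 1 - _)%:~R / s + sg) = - (s^-1 - x0 + i%:R / s)) ?sqrrN//.
by rewrite /x0 !intrD !intrN; ring.
Qed.

Lemma line_sum_ge (s sg : R) (l : seq int) (rho : R) : 0 < s -> uniq l -> 0 <= rho ->
  (forall z : int, `|z%:~R / s + sg| <= rho -> z \in l) ->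
  2 * (s * Phi rho - 1) <= \sum_(z <- l) k (z%:~R / s + sg).
Proof.
move=> s0 ul r0 hl; set o := origin s sg; set x0 := o%:~R / s + sg.
have /andP[x00 x0s] := originP sg s0; rewrite -/o -/x0 in x00 x0s.
(* number of points of an arithmetic progression of step [1 / s] before [rho] *)
have count (x : R) : 0 <= x -> exists n : nat, rho <= x + n%:R / s /\
    forall i, (i < n)%N -> x + i%:R / s <= rho.
  move=> xx; have [hx|hx] := leP rho x.
    by exists 0%N; rewrite mul0r addr0; split.
  have y0 : 0 <= s * (rho - x) by rewrite mulr_ge0 ?(ltW s0)// subr_ge0 ltW.
  exists (Num.truncn (s * (rho - x))).+1; split.
    have := truncnS_gt (s * (rho - x)); rewrite -ltr_pdivlMl// => h.
    rewrite -lerBlDl (le_trans (ltW h))// mulrC//.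
  move=> i; rewrite ltnS => hi.
  have : i%:R <= s * (rho - x) by rewrite -truncn_ge_nat.
  by rewrite -ler_pdivrMl// mulrC => ?; lra.
have [n1 [hn1 hi1]] := count _ x00.
have x0s' : 0 <= s^-1 - x0 by lra.
have [n2 [hn2 hi2]] := count _ x0s'.
pose l' := [seq o + i%:Z | i <- iota 0 n1] ++ [seq o - 1 - i%:Z | i <- iota 0 n2].
have e1 (i : nat) : (o + i%:Z)%:~R / s + sg = x0 + i%:R / s by rewrite /x0 intrD; ring.
have e2 (i : nat) : (o - 1 - i%:Z)%:~R / s + sg = - (s^-1 - x0 + i%:R / s).
  by rewrite /x0 !intrD !intrN; ring.
have ul' : uniq l'.
  rewrite cat_uniq !map_inj_uniq ?iota_uniq//=; first last.
  - by move=> i j /=; clear; lia.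
  - by move=> i j /=; clear; lia.
  by rewrite andbT; apply/hasPn => z /mapP[i _ ->]; apply/negP => /mapP[j _]; clear; lia.
have sl : {subset l' <= l}.
  move=> z; rewrite mem_cat => /orP[] /mapP[i]; rewrite mem_iota add0n /= => hi ->.
    apply: hl; rewrite e1 ger0_norm; first exact: hi1.
    by rewrite addr_ge0// divr_ge0 ?ler0n// ltW.
  apply: hl; rewrite e2 normrN ger0_norm; first exact: hi2.
  by rewrite addr_ge0// divr_ge0 ?ler0n// ltW.
apply: le_trans (sum_subset ul' sl (fun z => k0 _)).
have i1 n : iota 0 n = index_iota 0 n by rewrite /index_iota subn0.
rewrite /l' big_cat !big_map !i1 !big_mkord mulr2n mulrDl !mul1r lerD//.
  apply: le_trans (half_sum_ge s0 x00 (ltW x0s) r0 hn1) _.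
  by apply: ler_sum => i _; rewrite e1.
apply: le_trans (half_sum_ge s0 x0s' _ r0 hn2) _; first lra.
by apply: ler_sum => i _; rewrite e2 /k sqrrN.
Qed.

End one_dimension.

(** The Gaussian is monotone on both sides of the origin, so its sums over a
    shifted lattice of mesh [1 / s] differ from the integral by boundary
    terms, whatever the shift [sg]. *)
Lemma gauss_line_sum (b : R) : 0 < b ->
  (forall (s sg : R) (l : seq int), 0 < s -> uniq l ->
    \sum_(z <- l) expR (- (b * (z%:~R / s + sg) ^+ 2 / 2))
      <= s * Num.sqrt (2 * pi / b) + 2) /\
  (forall e : R, 0 < e -> exists2 rho : R, 0 < rho &
    forall (s sg : R) (l : seq int), 0 < s -> uniq l ->
    (forall z : int, `|z%:~R / s + sg| <= rho -> z \in l) ->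
    s * (Num.sqrt (2 * pi / b) - e) - 2 <=
    \sum_(z <- l) expR (- (b * (z%:~R / s + sg) ^+ 2 / 2))).
Proof.
move=> b0; have [Phi [P0 Pd PL Pe]] := gauss_primitive b0.
split=> [s sg l s0 ul|e e0].
  have h := line_sum_le b0 P0 Pd PL sg s0 ul.
  apply: (le_trans h); lra.
have [rho r0 hr] := Pe (e / 2) ltac:(lra).
exists rho => // s sg l s0 ul hl.
have h := line_sum_ge b0 P0 Pd s0 ul (ltW r0) hl.
apply: le_trans h; have := ler_wpM2l (ltW s0) hr; lra.
Qed.

End riemann_sums.

(** * Gaussian sums over Z^d *)

Section lattice_sums.
Context (R : realType).

Definition int_range (N : nat) : seq int := [seq i%:Z - N%:Z | i <- iota 0 N.*2.+1].

Lemma mem_int_range N z : (z \in int_range N) = (`|z| <= N%:Z).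
Proof.
apply/mapP/idP => [[i]|h]; first by rewrite mem_iota /= add0n => h ->; lia.
by exists `|(z + N%:Z)%R|%N; [rewrite mem_iota /= add0n; lia|lia].
Qed.

Lemma int_range_uniq N : uniq (int_range N).
Proof. by rewrite map_inj_uniq ?iota_uniq// => i j; lia. Qed.

Definition cons_cV (T : Type) d (z : T) (y : 'cV[T]_d) : 'cV[T]_d.+1 :=
  col_mx (const_mx z : 'cV_1) y.

Lemma cons_cV0 (T : Type) d (z : T) (y : 'cV[T]_d) : cons_cV z y 0 0 = z.
Proof.
have -> : (0 : 'I_d.+1) = lshift d (0 : 'I_1) by exact/val_inj.
by rewrite /cons_cV (@col_mxEu T 1 d 1) mxE.
Qed.

Lemma cons_cVS (T : Type) d (z : T) (y : 'cV[T]_d) i : cons_cV z y (lift 0 i) 0 = y i 0.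
Proof.
have -> : lift 0 i = rshift 1 i by exact/val_inj.
by rewrite /cons_cV (@col_mxEd T 1 d 1).
Qed.

Lemma cons_cV_inj (T : Type) d (z z' : T) (y y' : 'cV[T]_d) :
  cons_cV z y = cons_cV z' y' -> z = z' /\ y = y'.
Proof.
move=> h; split; first by rewrite -(cons_cV0 z y) h cons_cV0.
by apply/colP => i; rewrite -(cons_cVS z y) h cons_cVS.
Qed.

Lemma cV_cons (T : Type) d (x : 'cV[T]_d.+1) : x = cons_cV (x 0 0) (\col_i x (lift 0 i) 0).
Proof.
apply/colP => i; have [->|i0] := eqVneq i 0; first by rewrite cons_cV0.
have [j ->|e] := unliftP 0 i; last by rewrite e eqxx in i0.
by rewrite cons_cVS mxE.
Qed.

Fixpoint box (N d : nat) : seq 'cV[int]_d :=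
  if d is d'.+1 then [seq cons_cV z y | z <- int_range N, y <- box N d'] else [:: 0].

Lemma mem_box N d (x : 'cV[int]_d) : (x \in box N d) = [forall i, `|x i 0| <= N%:Z].
Proof.
elim: d x => [|d IH] x.
  rewrite inE; apply/eqP/forallP => [_ []//|_].
  by apply/colP => -[].
apply/allpairsP/forallP => [[[z y] /= [hz hy ->]] i|h].
  have [->|i0] := eqVneq i 0; first by rewrite cons_cV0 -mem_int_range.
  have [j ->] : exists j, i = lift 0 j.
    by have [j ->|] := unliftP 0 i; [exists j|move=> e; rewrite e eqxx in i0].
  by rewrite cons_cVS; move: hy; rewrite IH => /forallP.
exists (x 0 0, \col_i x (lift 0 i) 0); split => /=.
- by rewrite mem_int_range.
- by rewrite IH; apply/forallP => i; rewrite mxE.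
- exact: cV_cons.
Qed.

Lemma box_uniq N d : uniq (box N d).
Proof.
elim: d => [//|d IH].
apply: (@allpairs_uniq _ _ _ (@cons_cV int d)) => //; first exact: int_range_uniq.
by move=> [z y] [z' y'] _ _ /= h; have [-> ->] := cons_cV_inj h.
Qed.

Definition point d (s : R) (sg : 'cV[R]_d) (z : 'cV[int]_d) : 'cV[R]_d :=
  \col_i ((z i 0)%:~R / s + sg i 0).

Definition in_cube d (r : R) (w : 'cV[R]_d) := [forall i, `|w i 0| <= r].

Section schur.
Variables (d : nat) (B : 'M[R]_(1 + d)).
Hypothesis pB : pos_def B.
Let b := ulsubmx B 0 0.
Let be : 'cV[R]_d := dlsubmx B.
(** Completing the square in the first coordinate leaves the Schur complement
    as the quadratic form of the other coordinates; this reduces lattice sums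
    to the one-dimensional case by induction on the dimension. *)
Definition schur : 'M[R]_d := drsubmx B - (ulsubmx B 0 0)^-1 *: (dlsubmx B *m (dlsubmx B)^T).
Definition schur_shift (w : 'cV[R]_d) : R := (ulsubmx B 0 0)^-1 * ((dlsubmx B)^T *m w) 0 0.

Let ur : ursubmx B = be^T.
Proof. by rewrite /be -[in RHS]pB.1 trmx_dlsub trmxK. Qed.

Let ul : ulsubmx B = b%:M. Proof. exact: mx11_scalar. Qed.

Lemma schur_pivot : 0 < ulsubmx B 0 0.
Proof.
have h : (col_mx 1%:M 0 : 'cV[R]_(1 + d)) != 0.
  apply/eqP => /colP/(_ (lshift d 0)); rewrite col_mxEu !mxE eqxx /= => /eqP.
  by rewrite oner_eq0.
have := pB.2 _ h; rewrite /quad -(submxK B) tr_col_mx mul_row_block mul_row_col.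
by rewrite trmx1 trmx0 !mul1mx !mulmx1 !mulmx0 !mul0mx !addr0 ?block_mxKul.
Qed.

Let b0 : b != 0. Proof. by rewrite gt_eqF// schur_pivot. Qed.

Lemma quad_schur (u : R) (w : 'cV[R]_d) :
  quad B (cons_cV u w : 'cV_(1 + d)) = b * (u + schur_shift w) ^+ 2 + quad schur w.
Proof.
rewrite /quad /cons_cV (_ : const_mx u = u%:M :> 'cV_1); last first.
  by apply/matrixP => i j; rewrite !ord1 !mxE eqxx.
rewrite -[in LHS](submxK B) ul ur -/be.
rewrite tr_col_mx mul_row_block mul_row_col tr_scalar_mx.
rewrite /schur /schur_shift -/b -/be mulmxBr mulmxBl.
set p := (be^T *m w).
have ep : p = (p 0 0)%:M by exact: mx11_scalar.
have ep' : w^T *m be = p.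
  apply/matrixP => i j; rewrite !ord1 -[in LHS](trmxK (w^T *m be)) mxE.
  by rewrite trmx_mul trmxK.
have e3 : w^T *m (b^-1 *: (be *m be^T)) *m w = (b^-1 * (p 0 0 * p 0 0))%:M.
  rewrite -scalemxAr -scalemxAl.
  have -> : w^T *m (be *m be^T) *m w = (w^T *m be) *m (be^T *m w) by rewrite !mulmxA.
  by rewrite ep' -/p ep -scalar_mxM scale_scalar_mx !mxE !eqxx /= !mulr1n.
rewrite e3 !mulmxDl -!scalar_mxM ep' -(mulmxA u%:M) -/p ep -!scalar_mxM.
rewrite !mxE !eqxx /= !mulr1n; field.
exact: b0.
Qed.

Lemma schur_pos_def : pos_def schur.
Proof.
split.
  rewrite /schur linearB /= linearZ /= trmx_mul trmxK; congr (_ - _).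
  by rewrite -{1}pB.1 trmx_drsub trmxK.
move=> w w0; have h : (cons_cV (- schur_shift w) w : 'cV_(1 + d)) != 0.
  apply: contra_neq w0 => e; apply/colP => i.
  by rewrite -(cons_cVS (- schur_shift w) w i) [cons_cV _ _]e !mxE.
by have := pB.2 _ h; rewrite quad_schur addNr expr0n /= mulr0 add0r.
Qed.

Lemma det_schur : \det B = b * \det schur.
Proof.
have -> : B = block_mx b%:M 0 be schur *m block_mx 1%:M (b^-1 *: be^T) 0 1%:M.
  rewrite mulmx_block !mulmx1 !mulmx0 ?mul0mx !addr0.
  rewrite -scalemxAr mul_scalar_mx scalerA mulVf// scale1r.
  by rewrite -scalemxAr /schur addrC subrK -ul -ur submxK.
by rewrite det_mulmx det_lblock det_ublock !det1 !mulr1 det_scalar1.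
Qed.

Lemma schur_shift_bound : exists2 c : R, 0 <= c &
  forall (w : 'cV[R]_d) r, (forall i, `|w i 0| <= r) -> `|schur_shift w| <= c * r.
Proof.
exists (b^-1 * \sum_i `|be i 0|).
  by rewrite mulr_ge0 ?invr_ge0 ?sumr_ge0// ltW// schur_pivot.
move=> w r hw; rewrite /schur_shift normrM gtr0_norm ?invr_gt0 ?schur_pivot//.
rewrite -mulrA ler_wpM2l ?invr_ge0 ?(ltW schur_pivot)//.
rewrite mxE mulr_suml (le_trans (ler_norm_sum _ _ _))//.
by apply: ler_sum => i _; rewrite mxE normrM ler_wpM2l.
Qed.

End schur.

(** The integral of [gauss B] over R^d. *)
Definition gauss_const d (B : 'M[R]_d) : R := Num.sqrt ((2 * pi) ^+ d / \det B).

Lemma gauss_const_ge0 d (B : 'M[R]_d) : 0 <= gauss_const B.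
Proof. exact: sqrtr_ge0. Qed.

Lemma gauss_const_schur d (B : 'M[R]_(1 + d)) : pos_def B ->
  gauss_const B = Num.sqrt (2 * pi / ulsubmx B 0 0) * gauss_const (schur B).
Proof.
move=> pB; have b0 := schur_pivot pB.
rewrite /gauss_const -sqrtrM; last by rewrite divr_ge0 ?mulr_ge0 ?pi_ge0// ltW.
rewrite det_schur// exprS; congr Num.sqrt.
by rewrite invfM; ring.
Qed.

Definition gauss d (B : 'M[R]_d) (w : 'cV[R]_d) : R := expR (- (quad B w / 2)).

Lemma gauss_ge0 d (B : 'M[R]_d) w : 0 <= gauss B w. Proof. exact: expR_ge0. Qed.

Lemma point_cons d (s : R) (sg : 'cV[R]_d.+1) z (y : 'cV[int]_d) :
  point s sg (cons_cV z y) =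
  cons_cV (z%:~R / s + sg 0 0) (point s (\col_i sg (lift 0 i) 0) y).
Proof.
apply/colP => i; rewrite mxE; have [->|i0] := eqVneq i 0; first by rewrite !cons_cV0.
have [j ->] : exists j, i = lift 0 j.
  by have [j ->|] := unliftP 0 i; [exists j|move=> e; rewrite e eqxx in i0].
by rewrite !cons_cVS !mxE.
Qed.

Lemma gauss_cons d (B : 'M[R]_(1 + d)) (u : R) (w : 'cV[R]_d) : pos_def B ->
  gauss B (cons_cV u w) =
  expR (- (ulsubmx B 0 0 * (u + schur_shift B w) ^+ 2 / 2)) * gauss (schur B) w.
Proof.
move=> pB; rewrite /gauss quad_schur// -expRD; congr expR; by field.
Qed.

Lemma big_box N d (F : 'cV[int]_d.+1 -> R) :
  \sum_(x <- box N d.+1) F x = \sum_(y <- box N d) \sum_(z <- int_range N) F (cons_cV z y).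
Proof.
rewrite exchange_big.
rewrite -[box N d.+1]/[seq cons_cV z y | z <- int_range N, y <- box N d].
by rewrite big_allpairs_dep.
Qed.

(** Induction on the dimension: for fixed other coordinates the sum over the
    first one is at most [gauss_line_sum], uniformly in the shift that the
    square completion produces. *)
Lemma lattice_sum_le d (B : 'M[R]_d) (e : R) : pos_def B -> 0 < e ->
  exists2 s0 : R, 0 < s0 & forall s sg N, s0 <= s ->
  \sum_(z <- box N d) gauss B (point s sg z) <= (gauss_const B + e) * s ^+ d.
Proof.
elim: d B e => [|d IH] B e pB e0.
  exists 1 => // s sg N _; rewrite /= big_seq1 expr0 mulr1.
  rewrite /gauss /quad (_ : B = 0) ?mulmx0 ?mul0mx ?mxE ?mul0r ?oppr0 ?expR0.
    by rewrite /gauss_const expr0 det_mx00 divr1 sqrtr1 lerDl ltW.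
  by apply/matrixP => -[].
move: B pB; change (forall B : 'M[R]_(1 + d), pos_def B ->
  exists2 s0 : R, 0 < s0 & forall s sg N, s0 <= s ->
  \sum_(z <- box N d.+1) gauss B (point s sg z) <= (gauss_const B + e) * s ^+ d.+1).
move=> B pB; have b0 := schur_pivot pB; set b := ulsubmx B 0 0 in b0.
set k := Num.sqrt (2 * pi / b).
have k0 : 0 < k by rewrite sqrtr_gt0 divr_gt0// mulr_gt0// pi_gt0.
set c := gauss_const (schur B); have c0 : 0 <= c := gauss_const_ge0 _.
have e'0 : 0 < e / (2 * k) by rewrite divr_gt0// mulr_gt0.
have [s0 s00 hs] := IH (schur B) (e / (2 * k)) (schur_pos_def pB) e'0.
have [hline _] := gauss_line_sum b0.
pose s1 := 4 * (c + e / (2 * k)) / e.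
have s10 : 0 < s1 by rewrite divr_gt0// mulr_gt0// ltr_wpDl.
exists (s0 + s1); first exact: addr_gt0.
move=> s sg N hss; have ss0 : s0 <= s by lra.
have s_gt0 : 0 < s by lra.
rewrite (big_box N (fun z => gauss B (point s sg z))).
set sg' : 'cV[R]_d := \col_i sg (lift 0 i) 0.
apply: (@le_trans _ _ (\sum_(y <- box N d) (s * k + 2) * gauss (schur B) (point s sg' y))).
  apply: ler_sum => y _.
  under eq_bigr do rewrite point_cons gauss_cons//.
  rewrite -mulr_suml ler_wpM2r ?gauss_ge0//.
  have := hline s (sg 0 0 + schur_shift B (point s sg' y)) (int_range N) s_gt0 (int_range_uniq N).
  by under eq_bigr do rewrite addrA.
rewrite -mulr_sumr (gauss_const_schur pB) -/b -/k -/c.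
apply: le_trans (ler_wpM2l _ (hs s sg' N ss0)) _.
  by rewrite addr_ge0 ?mulr_ge0// ltW.
rewrite -/c mulrA exprS [leRHS]mulrA ler_wpM2r ?exprn_ge0 ?(ltW s_gt0)//.
have h1 : 4 * (c + e / (2 * k)) <= e * s.
  rewrite -ler_pdivrMl// mulrC -/s1; lra.
have -> : (s * k + 2) * (c + e / (2 * k)) = s * (k * c) + s * e / 2 + 2 * (c + e / (2 * k)).
  by field; rewrite gt_eqF.
lra.
Qed.

(** The same induction as in [lattice_sum_le]; the truncation to a large cube
    loses little once the interval of the first coordinate covers the bulk of
    every shifted Gaussian. *)
Lemma lattice_sum_ge d (B : 'M[R]_d) (e : R) : pos_def B -> 0 < e ->
  exists r0 s0 : R, 0 < r0 /\ 0 < s0 /\ forall r s sg, r0 <= r -> s0 <= s ->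
  exists N0 : nat, forall N, (N0 <= N)%N ->
  (gauss_const B - e) * s ^+ d <=
    \sum_(z <- box N d | in_cube r (point s sg z)) gauss B (point s sg z).
Proof.
elim: d B e => [|d IH] B e pB e0.
  exists 1, 1; split=> //; split=> // r s sg _ _; exists 0%N => N _.
  rewrite /= big_cons big_nil /in_cube; case: ifP => [_|/forallP[]]; last by case.
  rewrite expr0 mulr1 addr0.
  rewrite /gauss /quad (_ : B = 0) ?mulmx0 ?mul0mx ?mxE ?mul0r ?oppr0 ?expR0.
    by rewrite /gauss_const expr0 det_mx00 divr1 sqrtr1 gerBl ltW.
  by apply/matrixP => -[].
move: B pB; change (forall B : 'M[R]_(1 + d), pos_def B ->
  exists r0 s0 : R, 0 < r0 /\ 0 < s0 /\ forall r s sg, r0 <= r -> s0 <= s ->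
  exists N0 : nat, forall N, (N0 <= N)%N ->
  (gauss_const B - e) * s ^+ d.+1 <=
    \sum_(z <- box N d.+1 | in_cube r (point s sg z)) gauss B (point s sg z)).
move=> B pB; have b0 := schur_pivot pB; set b := ulsubmx B 0 0 in b0.
set k := Num.sqrt (2 * pi / b).
have k0 : 0 < k by rewrite sqrtr_gt0 divr_gt0// mulr_gt0// pi_gt0.
set c := gauss_const (schur B); have c0 : 0 <= c := gauss_const_ge0 _.
have e2 : 0 < e / (2 * k) by rewrite divr_gt0// mulr_gt0.
have [r1 [s1 [r10 [s10 hs]]]] := IH (schur B) (e / (2 * k)) (schur_pos_def pB) e2.
have [_ hline] := gauss_line_sum b0.
have [cs cs0 hcs] := schur_shift_bound pB.
pose e1 := Num.min (k / 2) (e / (4 * (c + 1))).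
have c1 : 0 < c + 1 by lra.
have e10 : 0 < e1 by rewrite lt_min !divr_gt0// mulr_gt0.
have e1k : e1 <= k / 2 by rewrite ge_min lexx.
have e1c : e1 * c <= e / 4.
  apply: (@le_trans _ _ (e1 * (c + 1))); first by rewrite ler_wpM2l ?(ltW e10)//; lra.
  rewrite -ler_pdivlMr// (_ : e / 4 / (c + 1) = e / (4 * (c + 1))); last first.
    by field; rewrite gt_eqF.
  by rewrite ge_min lexx orbT.
have [rho rho0 hrho] := hline e1 e10.
pose s2 := 4 / k + 8 * (c + 1) / e.
exists (rho + cs * r1 + r1), (s1 + s2); split.
  by rewrite ltr_wpDl// addr_ge0 ?mulr_ge0// ltW.
have s20 : 0 < s2 by rewrite addr_gt0 ?divr_gt0// mulr_gt0.
split; first exact: addr_gt0.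
move=> r s sg hr hss.
have csr : 0 <= cs * r1 by rewrite mulr_ge0// ltW.
have s_gt0 : 0 < s by lra.
have s1s : s1 <= s by lra.
set sg' : 'cV[R]_d := \col_i sg (lift 0 i) 0.
have [N0 hN0] := hs r1 s sg' (lexx _) s1s.
pose N1 := (Num.truncn (s * (r + `|sg 0 0|))).+1.
exists (maxn N0 N1) => N; rewrite geq_max => /andP[NN0 NN1].
rewrite big_mkcond (big_box N (fun z => if in_cube r (point s sg z) then gauss B (point s sg z) else 0)).
have cube_cons z y : in_cube r1 (point s sg' y) -> `|z%:~R / s + sg 0 0| <= r ->
    in_cube r (point s sg (cons_cV z y)).
  move=> /forallP hy hz; apply/forallP => i; rewrite point_cons.
  have [->|i0] := eqVneq i 0; first by rewrite cons_cV0.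
  have [j ->] : exists j, i = lift 0 j.
    by have [j ->|] := unliftP 0 i; [exists j|move=> ee; rewrite ee eqxx in i0].
  by rewrite cons_cVS (le_trans (hy j))//; lra.
apply: (@le_trans _ _ (\sum_(y <- box N d | in_cube r1 (point s sg' y))
   (s * (k - e1) - 2) * gauss (schur B) (point s sg' y))); last first.
  rewrite big_mkcond; apply: ler_sum => y _; case: ifP => hy; last first.
    by apply: sumr_ge0 => z _; case: ifP => // _; exact: gauss_ge0.
  rewrite -big_mkcond -big_filter.
  under eq_bigr do rewrite point_cons gauss_cons//.
  rewrite -mulr_suml ler_wpM2r ?gauss_ge0//.
  under eq_bigr do rewrite -addrA.
  apply: hrho => //; first by rewrite filter_uniq// int_range_uniq.
  move=> z hz; have hsh := hcs _ r1 (fun i => forallP hy i).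
  have hz' : `|z%:~R / s + sg 0 0| <= r.
    have -> : z%:~R / s + sg 0 0 = (z%:~R / s + (sg 0 0 + schur_shift B (point s sg' y)))
       - schur_shift B (point s sg' y) by ring.
    by rewrite (le_trans (ler_normB _ _))//; lra.
  rewrite mem_filter cube_cons//= mem_int_range.
  have hz2 : `|z%:~R| <= s * (r + `|sg 0 0|) :> R.
    rewrite -ler_pdivrMl// mulrC -[s^-1]gtr0_norm ?invr_gt0// -normrM.
    have -> : z%:~R / s = (z%:~R / s + sg 0 0) - sg 0 0 by ring.
    by rewrite (le_trans (ler_normB _ _))// lerD2r.
  rewrite -(@ler_int R) intr_norm (le_trans hz2)//.
  apply: (@le_trans _ _ N1%:R); last by rewrite ler_nat.
  by rewrite ltW// truncnS_gt.
rewrite -mulr_sumr (gauss_const_schur pB) -/b -/k -/c.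
have f0 : 0 <= s * (k - e1) - 2.
  have : 4 <= k * s.
    have h8 : 0 < 8 * (c + 1) / e by rewrite divr_gt0// mulr_gt0.
    rewrite -ler_pdivrMl// mulrC; move: hss h8; rewrite /s2.
    by move: (8 * (c + 1) / e) (4 / k) => x1 x2; lra.
  have := ler_wpM2l (ltW s_gt0) e1k; lra.
apply: (@le_trans _ _ ((s * (k - e1) - 2) * ((c - e / (2 * k)) * s ^+ d))); last first.
  by rewrite ler_wpM2l// hN0.
rewrite [leRHS]mulrA exprS mulrA ler_wpM2r ?exprn_ge0 ?(ltW s_gt0)//.
have h1 : 8 * (c + 1) <= e * s.
  rewrite -ler_pdivrMl// mulrC (le_trans _ hss)//.
  have := divr_gt0 (ltr0n R 4) k0; rewrite /s2.
  by move: (8 * (c + 1) / e) (4 / k) => x1 x2; lra.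
have -> : (s * (k - e1) - 2) * (c - e / (2 * k)) =
  s * (k * c) - s * (e1 * c) - s * e / 2 - 2 * c + (s * e1 + 2) * (e / (2 * k)).
  by field; rewrite gt_eqF.
have h2 : 0 <= (s * e1 + 2) * (e / (2 * k)).
  by rewrite mulr_ge0 ?(ltW e2)// addr_ge0// mulr_ge0 ?ltW.
have := ler_wpM2l (ltW s_gt0) e1c; lra.
Qed.

End lattice_sums.

(** * Point probabilities of the walk and the renewal series *)

Section exponential_sums.
Context (R : realType).

Lemma geometric_le (q : R) n : 0 <= q -> q < 1 -> \sum_(i < n) q ^+ i <= (1 - q)^-1.
Proof.
move=> q0 q1; have q1' : 0 < 1 - q by rewrite subr_gt0.
rewrite -[leRHS]mul1r ler_pdivlMr// mulrC.
have -> : (1 - q) * \sum_(i < n) q ^+ i = 1 - q ^+ n.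
  elim: n => [|n IH]; first by rewrite big_ord0 mulr0 expr0 subrr.
  by rewrite big_ord_recr /= mulrDr IH exprS; ring.
by rewrite gerBl exprn_ge0.
Qed.

Lemma exp_ratio (c s : R) : 0 < c -> 0 < s -> (1 - expR (- (c / s)))^-1 <= 1 + s / c.
Proof.
move=> c0 s0; have cs : 0 < c / s by exact: divr_gt0.
have h1 : expR (- (c / s)) <= (1 + c / s)^-1.
  rewrite expRN lef_pV2 ?posrE ?expR_gt0 ?expR_ge1Dx//; lra.
have h2 : 0 < 1 - expR (- (c / s)) by rewrite subr_gt0 expR_lt1 oppr_lt0.
have h3 : (1 + s / c)^-1 <= 1 - expR (- (c / s)).
  have -> : (1 + s / c)^-1 = 1 - (1 + c / s)^-1.
    by field; rewrite !gt_eqF ?addr_gt0.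
  by rewrite lerD2l lerN2.
rewrite -[leRHS]invrK lef_pV2 ?posrE// invr_gt0.
by have := divr_gt0 s0 c0; lra.
Qed.

(** Two geometric series with ratio [exp (- c / s)], starting at distance [A
    s] on both sides of [a]. *)
Lemma exp_sum_tail (c s a A : R) (N : nat) : 0 < c -> 1 <= s -> 0 <= a -> 0 <= A ->
  \sum_(n < N | A * s <= `|n%:R - a|) expR (- (c * `|n%:R - a| / s))
   <= 2 * expR c * (1 + s / c) * expR (- (c * A)).
Proof.
move=> c0 s1 a0 A0; have s0 : 0 < s by lra.
have cs : 0 < c / s by exact: divr_gt0.
set q := expR (- (c / s)).
have q0 : 0 <= q by exact: expR_ge0.
have q1 : q < 1 by rewrite expR_lt1 oppr_lt0.
have qn k : expR (- (c / s * k%:R)) = q ^+ k by rewrite -mulNr expRM_natr.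
set F := fun n : nat => expR (- (c * `|n%:R - a| / s)).
have F0 n : 0 <= F n by exact: expR_ge0.
have geo k : \sum_(i < k) q ^+ i <= 1 + s / c.
  by apply: le_trans (geometric_le k q0 q1) _; exact: exp_ratio.
have As : 0 <= A * s by rewrite mulr_ge0// ltW.
have up : \sum_(n < N | a + A * s <= n%:R) F n <= expR c * (1 + s / c) * expR (- (c * A)).
  pose p := Num.truncn (a + A * s).
  have pa : a + A * s < p%:R + 1 by rewrite natr1 truncnS_gt.
  have pp (n : nat) : a + A * s <= n%:R -> (p <= n)%N.
    by move=> h; rewrite -(@ler_nat R) (le_trans _ h)// truncn_le// addr_ge0.
  apply: (@le_trans _ _ (\sum_(n < N | (p <= n)%N) expR c * expR (- (c * A)) * q ^+ (n - p))).
    rewrite [leLHS]big_mkcond [leRHS]big_mkcond; apply: ler_sum => n _.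
    case: ifPn => h; last first.
      by case: ifP => // _; rewrite !mulr_ge0 ?expR_ge0// exprn_ge0.
    rewrite pp// -qn -!expRD ler_expR ger0_norm; last by lra.
    rewrite natrB ?pp//.
    have : A * s - 1 <= n%:R - a - (n%:R - p%:R) by lra.
    move=> /(ler_wpM2l (ltW cs)).
    have -> : c / s * (A * s - 1) = c * A - c / s by field; rewrite gt_eqF.
    have h2 : c / s <= c by rewrite ler_pdivrMr// ler_peMr// ltW.
    have -> : c * (n%:R - a) / s = c / s * (n%:R - a) by ring.
    rewrite !mulrBr; lra.
  rewrite -mulr_sumr mulrAC ler_wpM2r ?expR_ge0// ler_wpM2l ?expR_ge0//.
  apply: le_trans (geo N).
  rewrite -(big_mkord (fun n => (p <= n)%N) (fun n => q ^+ (n - p))).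
  have [pN|Np] := leqP p N; last first.
    rewrite big_nat_cond big1 ?sumr_ge0// => [n _|n]; first by rewrite exprn_ge0.
    by move=> /andP[/andP[_ nN] pn]; exfalso; clear -Np nN pn; lia.
  rewrite (big_cat_nat (leq0n p) pN)//= [X in X + _]big_nat_cond big1 ?add0r; last first.
    by move=> n /andP[/andP[_ np] pn]; exfalso; clear -np pn; lia.
  rewrite -{1}[p]add0n big_addn.
  rewrite (eq_bigr (fun i => q ^+ i)); last by move=> i _; rewrite addnK.
  apply: (@le_trans _ _ (\sum_(0 <= i < N - p) q ^+ i)).
    by rewrite big_mkcond; apply: ler_sum => i _; case: ifP => // _; rewrite exprn_ge0.
  rewrite -(big_mkord xpredT (fun i => q ^+ i)).
  rewrite [leRHS](big_cat_nat (leq0n (N - p)) (leq_subr p N))//= lerDl sumr_ge0// => i _.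
  by rewrite exprn_ge0.
have dn : \sum_(n < N | n%:R <= a - A * s) F n <= expR c * (1 + s / c) * expR (- (c * A)).
  pose p := Num.truncn (a - A * s).
  have pp (n : nat) : n%:R <= a - A * s -> (n <= p)%N /\ p%:R <= a - A * s.
    move=> h; have h0 : 0 <= a - A * s by apply: le_trans h; rewrite ler0n.
    by rewrite truncn_ge_nat// truncn_le.
  apply: (@le_trans _ _ (\sum_(n < N | (n <= p)%N) expR (- (c * A)) * q ^+ (p - n))).
    rewrite [leLHS]big_mkcond [leRHS]big_mkcond; apply: ler_sum => n _.
    case: ifPn => h; last first.
      by case: ifP => // _; rewrite !mulr_ge0 ?expR_ge0// exprn_ge0.
    have [np pas] := pp _ h.
    rewrite np -qn -!expRD ler_expR ler0_norm; last by lra.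
    rewrite natrB// opprB.
    have : A * s <= a - n%:R - (p%:R - n%:R) by lra.
    move=> /(ler_wpM2l (ltW cs)).
    have -> : c / s * (A * s) = c * A by field; rewrite gt_eqF.
    have -> : c * (a - n%:R) / s = c / s * (a - n%:R) by ring.
    rewrite !mulrBr; lra.
  rewrite -mulr_sumr mulrC ler_wpM2r ?expR_ge0//.
  have ec : 1 <= expR c by rewrite -[leLHS](@expR0 R) ler_expR ltW.
  have sc : 0 <= 1 + s / c by rewrite addr_ge0// divr_ge0// ltW.
  apply: (@le_trans _ _ (1 + s / c)); last by rewrite ler_peMl.
  apply: le_trans (geo p.+1).
  apply: (@le_trans _ _ (\sum_(n < p.+1) q ^+ (p - n))).
    rewrite -(big_mkord (fun n => (n <= p)%N) (fun n => q ^+ (p - n))).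
    rewrite -(big_mkord xpredT (fun n => q ^+ (p - n))).
    have -> : \sum_(0 <= i < N | (i <= p)%N) q ^+ (p - i) =
              \sum_(0 <= i < minn N p.+1) q ^+ (p - i).
      rewrite /minn; case: ltnP => h.
        rewrite big_nat_cond [RHS]big_nat_cond; apply: eq_bigl => i.
        by have [iN|] := ltnP i N; rewrite ?andbF// andbT /=; clear -h iN; lia.
      rewrite (big_cat_nat (leq0n _) h)//= [X in _ + X]big_nat_cond [X in _ + X]big1 ?addr0.
        rewrite big_nat_cond [RHS]big_nat_cond; apply: eq_bigl => i; clear -h; lia.
      by move=> i /andP[/andP[ip _] pn]; exfalso; clear -ip pn; lia.
    rewrite [leRHS](big_cat_nat (leq0n _) (geq_minr N p.+1))//= lerDl sumr_ge0// => i _.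
    by rewrite exprn_ge0.
  rewrite (reindex_inj rev_ord_inj) /= le_eqVlt; apply/orP; left; apply/eqP.
  by apply: eq_bigr => i _; rewrite subSS subKn// -ltnS.
apply: (@le_trans _ _ (\sum_(n < N | a + A * s <= n%:R) F n +
                       \sum_(n < N | n%:R <= a - A * s) F n)).
  rewrite !(big_mkcond (fun _ => _ <= _)) -big_split; apply: ler_sum => n _ /=.
  case: ifPn => h; last by rewrite addr_ge0//; case: ifP.
  have [na|na] := leP a n%:R.
    rewrite ger0_norm ?subr_ge0// in h.
    by rewrite (_ : a + A * s <= n%:R) ?lerDl; [case: ifP|lra].
  rewrite ltr0_norm ?subr_lt0// in h.
  by rewrite (_ : n%:R <= a - A * s) ?lerDr; [case: ifP|lra].
by apply: le_trans (lerD up dn) _; lra.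
Qed.

End exponential_sums.

Section walk_estimates.
Context (R : realType) (d : nat) (dO : measure_display)
  (Omega : measurableType dO) (Pa : probability Omega R).
Implicit Types (Y : Omega -> 'cV[nat]_d).

(** The hypotheses on the law of one step, with a full rank system [B] of
    vectors in the difference lattice. *)
Record nice_walk Y (t : R) (m : 'cV[R]_d) (G : 'M[R]_d) (B : 'M[int]_d) : Prop :=
  NiceWalk {
  nw_measurable : measurable_fun setT Y;
  nw_t : 0 < t;
  nw_exp : ('E_Pa[fun w => expR (t * (norm1 (Y w))%:R)] < +oo)%E;
  nw_mean : forall i, ('E_Pa[fun w => (Y w i ord0)%:R] = (m i ord0)%:E)%E;
  nw_cov : forall i j, covariance Pa (fun w => (Y w i ord0)%:R)
                             (fun w => (Y w j ord0)%:R) = (G i j)%:E;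
  nw_pos : forall i, 0 < m i ord0;
  nw_def : pos_def G;
  nw_col : forall j, diff_lattice (supp Pa Y) (col j B);
  nw_free : zfree B }.

Variables (Y : Omega -> 'cV[nat]_d) (t : R) (m : 'cV[R]_d) (G : 'M[R]_d)
  (B : 'M[int]_d).
Hypothesis W : nice_walk Y t m G B.
Hypothesis hd : (0 < d)%N.
Notation Zd := 'cV[int]_d.
Notation P := (step_op Pa Y).
Notation mu := (mu1 Pa Y).

(** The probability that the walk is at [x] after [n] steps. *)
Definition hit (n : nat) (x : Zd) : R := iter n (step_op Pa Y) (@delta0 R d) x.

Let hP : averaging P := averaging_step (nw_measurable W) (nw_t W) (nw_exp W).

Lemma hit_ge0 n x : 0 <= hit n x.
Proof.
apply: (avg_pos (averaging_iter hP n) (@delta0_bounded R d)) => z.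
by rewrite /delta0 ler0n.
Qed.

Lemma mu_sum : mu = \sum_i m i 0.
Proof.
have tc (i : 'I_d) : @tame R d t (fun y => (y i 0)%:R) := tame_coord (nw_t W) i.
rewrite /mu1 (_ : Ex Pa Y _ = Ex Pa Y (fun y => \sum_(i < d) (y i 0)%:R)); last first.
  by apply: eq_Ex => y; rewrite /norm1 natr_sum.
rewrite (Ex_sum (nw_measurable W) (nw_t W) (nw_exp W) _ tc).
apply: eq_bigr => i _.
exact: (Ex_coord (nw_measurable W) (nw_t W) (nw_exp W) (nw_mean W)).
Qed.

Lemma mu_gt0 : 0 < mu.
Proof.
rewrite mu_sum (bigD1 (Ordinal hd))//= ltr_wpDr ?(nw_pos W)// sumr_ge0// => i _.
exact/ltW/(nw_pos W).
Qed.

Lemma exp_le_pow (c : R) : 0 < c -> exists2 C : R, 0 < C &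
  forall s, 1 <= s -> expR (- (c * s)) <= C * s^-1 ^+ d.
Proof.
move=> c0; exists ((d.+1)`!%:R / c ^+ d.+1); first by rewrite divr_gt0 ?exprn_gt0// ltr0n fact_gt0.
move=> s s1; have s0 : 0 < s by lra.
have h := pow_le_exp d (mulr_ge0 (ltW c0) (ltW s0)).
have E0 := expR_gt0 (c * s).
have p0 : 0 < c ^+ d.+1 * s ^+ d by rewrite mulr_gt0// exprn_gt0.
rewrite expRN exprVn -(ler_pM2r E0) mulVf ?gt_eqF//.
set f : R := _`!%:R in h *.
have -> : f / c ^+ d.+1 / s ^+ d * expR (c * s) = f * expR (c * s) / (c ^+ d.+1 * s ^+ d).
  by rewrite invfM; ring.
rewrite ler_pdivlMr// mul1r (le_trans _ h)// exprMn ler_wpM2l ?exprn_ge0 ?(ltW c0)//.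
by rewrite exprS ler_peMl// exprn_ge0// ltW.
Qed.

(** [step_tail] with the decay [n^(-d/2)] replaced by [a^(-d/2)]: for [n] of
    smaller order than [a] half of the exponential factor pays for it. *)
Lemma hit_bound : exists2 c : R, 0 < c & forall D, 0 <= D -> exists2 C, 0 < C &
  forall a x, 1 <= a -> `|nrm R x - a * mu| <= D * Num.sqrt a ->
  forall n, hit n x <= C * (Num.sqrt a)^-1 ^+ d * expR (- (c * `|n%:R - a| / Num.sqrt a)).
Proof.
have [c [K [c0 K0] hT]] := step_tail (nw_measurable W) (nw_t W) (nw_exp W) mu_gt0
  (nw_col W) (nw_free W).
have c38 : 0 < 3 * c / 8 by rewrite divr_gt0// mulr_gt0.
have [C1 C10 hC1] := exp_le_pow c38.
exists (c / 2); first by rewrite divr_gt0.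
move=> D D0; have [C C0 hC] := hT D D0.
exists (C * (K * 2 ^+ d + C1)).
  by rewrite mulr_gt0// addr_gt0// mulr_gt0// exprn_gt0.
move=> a x a1 hx n; have a0 : 0 < a by lra.
have := hC a x a1 hx n; rewrite -/(hit n x).
set s := Num.sqrt a; have s0 : 0 < s by rewrite sqrtr_gt0.
have ss : s * s = a by rewrite -expr2 sqr_sqrtr// ltW.
have s1 : 1 <= s by rewrite -(@sqrtr1 R) ler_wsqrtr.
set e := `|_| => h; apply: le_trans h _.
have e0 : 0 <= e by exact: normr_ge0.
have r0 := rsqrt_gt0 R n.
have V0 : 0 <= s^-1 ^+ d by rewrite exprn_ge0// invr_ge0 ltW.
have half : expR (- (c * e / s)) = expR (- (c / 2 * e / s)) * expR (- (c / 2 * e / s)).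
  by rewrite -expRD; congr expR; field; rewrite gt_eqF.
rewrite half; set hh := expR (- (c / 2 * e / s)).
have eh1 : hh <= 1.
  by rewrite expR_le1 oppr_le0 divr_ge0 ?(ltW s0)// mulr_ge0// divr_ge0 ?(ltW c0).
have hh0 : 0 <= hh by exact: expR_ge0.
set mn := Num.min _ _.
have -> : C * mn * (hh * hh) = C * hh * (mn * hh) by ring.
have -> : C * (K * 2 ^+ d + C1) * s^-1 ^+ d * hh = C * hh * ((K * 2 ^+ d + C1) * s^-1 ^+ d) by ring.
rewrite ler_wpM2l ?mulr_ge0 ?(ltW C0)//.
have [na|na] := leP (a / 4) n%:R.
  apply: (@le_trans _ _ (K * rsqrt R n ^+ d * 1)).
    apply: ler_pM; [|exact: hh0| |exact: eh1].
      by rewrite le_min ler01 mulr_ge0 ?(ltW K0)// exprn_ge0// ltW.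
    by rewrite ge_min lexx orbT.
  rewrite mulr1 mulrDl ler_wpDr ?mulr_ge0 ?(ltW C10)//.
  rewrite -mulrA ler_wpM2l ?(ltW K0)// -exprMn lerXn2r ?nnegrE ?(ltW r0)//.
    by rewrite mulr_ge0// invr_ge0 ltW.
  rewrite /rsqrt -[leLHS]mul1r ler_pdivrMr ?sqrtr_gt0 ?ltr0n//.
  rewrite mulrAC ler_pdivlMr// mul1r.
  rewrite -(@ler_pXn2r _ 2)// ?nnegrE ?(ltW s0) ?mulr_ge0 ?sqrtr_ge0//.
  rewrite exprMn [s ^+ 2]expr2 ss sqr_sqrtr ?ler0n// -natr1; lra.
have he : 3 * a / 4 <= e.
  rewrite /e ltr0_norm; last by lra.
  lra.
apply: (@le_trans _ _ (1 * expR (- (3 * c / 8 * s)))).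
  apply: ler_pM; [|exact: hh0| |].
  - by rewrite le_min ler01 mulr_ge0 ?(ltW K0)// exprn_ge0// ltW.
  - by rewrite ge_min lexx.
  rewrite ler_expR lerN2.
  have h1 : 3 * s / 4 <= e / s.
    have e4 : 3 * s / 4 * s = 3 * (s * s) / 4 by ring.
    by rewrite ler_pdivlMr// e4 ss.
  have := ler_wpM2l (ltW c0) h1; lra.
rewrite mul1r (le_trans (hC1 s s1))// ler_wpM2r// lerDr.
by rewrite mulr_ge0 ?(ltW K0)// exprn_ge0.
Qed.

Definition renewal (x : Zd) : R := fine (\sum_(0 <= n <oo) (hit n x)%:E)%E.

(** Bounds on the partial sums also show that the renewal series is finite, so
    that [fine] is harmless. *)
Lemma renewal_le x M : (forall N, \sum_(n < N) hit n x <= M) ->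
  renewal x <= M /\ forall N, \sum_(n < N) hit n x <= renewal x.
Proof.
move=> hM.
have nd : nondecreasing_seq (fun N => \sum_(0 <= n < N) (hit n x)%:E)%E.
  by apply: ereal_nondecreasing_series => n _ _; rewrite lee_fin hit_ge0.
have e1 N : (\sum_(0 <= n < N) (hit n x)%:E = (\sum_(n < N) hit n x)%:E)%E.
  by rewrite sumEFin big_mkord.
have le1 : (\sum_(0 <= n <oo) (hit n x)%:E <= M%:E)%E.
  apply: lime_le; first exact: ereal_nondecreasing_is_cvgn.
  by apply: nearW => N; rewrite e1 lee_fin.
have ge1 N : ((\sum_(n < N) hit n x)%:E <= \sum_(0 <= n <oo) (hit n x)%:E)%E.
  by rewrite -e1; apply: nneseries_lim_ge => n _; rewrite lee_fin hit_ge0.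
have fin : (\sum_(0 <= n <oo) (hit n x)%:E)%E \is a fin_num.
  rewrite fin_numElt (lt_le_trans _ (ge1 0%N)) ?ltNyr//=.
  by rewrite (le_lt_trans le1)// ltry.
by split=> [|N]; rewrite -lee_fin /renewal fineK.
Qed.

End walk_estimates.

(** * Slow variation of the renewal window *)

Section renewal_window.
Context (R : realType) (d : nat) (dO : measure_display)
  (Omega : measurableType dO) (Pa : probability Omega R).
Variables (Y : Omega -> 'cV[nat]_d) (t : R) (m : 'cV[R]_d) (G : 'M[R]_d)
  (B : 'M[int]_d) (y0 : 'cV[nat]_d).
Hypothesis W : nice_walk Pa Y t m G B.
Hypothesis hd : (0 < d)%N.
Hypothesis Sy0 : supp Pa Y y0.
Notation Zd := 'cV[int]_d.
Notation S := (supp Pa Y).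
Notation P := (step_op Pa Y).
Notation hit := (hit Pa Y).
Notation Ls := (full_lattice S y0).

Let hP : averaging P := averaging_step (nw_measurable W) (nw_t W) (nw_exp W).

Lemma diff_lattice_subgroup : is_subgroup (diff_lattice S).
Proof.
split=> [M [sM _]|x y hx hy M [sM hM]]; first exact: sM.1.
by apply: sM.2; [apply: hx|apply: hy].
Qed.

Lemma diff_latticeP y y' : S y -> S y' -> diff_lattice S (toZ y - toZ y').
Proof. by move=> Sy Sy' M [_ hM]; apply: hM; exists y, y'. Qed.

Lemma full_lattice_subgroup : is_subgroup Ls.
Proof.
split; first by exists 0, 0; split; [exact: diff_lattice_subgroup.1|rewrite mulr0z addr0].
move=> _ _ [l [z [hl ->]]] [l' [z' [hl' ->]]]; exists (l - l'), (z - z'); split.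
  exact: diff_lattice_subgroup.2.
by rewrite mulrzBr opprD addrACA.
Qed.

Lemma full_lattice_diff v : diff_lattice S v -> Ls v.
Proof. by move=> h; exists v, 0; rewrite mulr0z addr0. Qed.

Lemma full_lattice_supp y : S y -> Ls (toZ y).
Proof.
move=> Sy; exists (toZ y - toZ y0), 1; split; first exact: diff_latticeP.
by rewrite mulr1z subrK.
Qed.

Lemma hit_lattice n x : hit n x != 0 -> Ls x.
Proof.
elim: n x => [|n IH] x.
  rewrite /hit /= /delta0; have [->|] := eqVneq x 0; last by rewrite eqxx.
  by move=> _; exact: full_lattice_subgroup.1.
apply: contra_neqP => nx; rewrite /hit /= /step_op.
rewrite (Ex_supp (nw_measurable W) (g := fun=> 0)) ?Ex_cst// => y Sy.
apply/eqP; apply: contraPT nx => /IH h.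
have hy : Ls (- toZ y).
  rewrite -sub0r; apply: full_lattice_subgroup.2; last exact: full_lattice_supp.
  exact: full_lattice_subgroup.1.
move=> hn; apply: hn; have -> : x = (x - toZ y) - (- toZ y) by rewrite opprK subrK.
exact: full_lattice_subgroup.2.
Qed.

Definition nlo (a A : R) := Num.truncn (a - A * Num.sqrt a).
Definition nhi (a A : R) := (Num.truncn (a + A * Num.sqrt a)).+1.

(** The part of the renewal series that carries its asymptotics: the times at
    distance at most [A sqrt a] from [a]. *)
Definition window_sum (a A : R) (x : Zd) : R := \sum_(nlo a A <= n < nhi a A) hit n x.

Section fixed_window.
Variables a A : R.
Hypothesis A1 : 1 <= A.
Hypothesis aA : 4 * A + 4 <= Num.sqrt a.
Notation s := (Num.sqrt a).

Lemma win_s0 : 0 < s. Proof. by move: A1 aA; lra. Qed.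
Lemma win_a0 : 0 < a. Proof. by rewrite -sqrtr_gt0 win_s0. Qed.
Lemma win_ss : s * s = a. Proof. by rewrite -expr2 sqr_sqrtr// ltW// win_a0. Qed.

Let As : A * s <= a / 4 - s.
Proof.
have := ler_wpM2r (ltW win_s0) aA; rewrite win_ss; lra.
Qed.

Lemma win_lo n : (nlo a A <= n)%N -> a - A * s - 1 <= n%:R /\ a / 4 <= n%:R.
Proof.
move=> h; have h1 : a - A * s - 1 <= n%:R.
  have := truncnS_gt (a - A * s); rewrite -/(nlo a A).
  have : (nlo a A)%:R <= n%:R :> R by rewrite ler_nat.
  rewrite -natr1; lra.
split=> //; have := win_a0; have := As; have := aA; have := A1; lra.
Qed.

Lemma win_hi n : (n < nhi a A)%N -> n%:R <= a + A * s /\ n%:R <= 2 * a.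
Proof.
have p : 0 <= a + A * s by rewrite addr_ge0 ?mulr_ge0 ?(ltW win_s0) ?(ltW win_a0)//; move: A1; lra.
rewrite ltnS => h; have h1 : n%:R <= a + A * s by rewrite -truncn_ge_nat.
by split=> //; have := win_a0; have := As; have := win_s0; lra.
Qed.

Lemma win_out n : (n < nlo a A)%N || (nhi a A <= n)%N -> A * s <= `|n%:R - a|.
Proof.
have p : 0 <= a - A * s by have := win_a0; have := As; have := win_s0; lra.
case/orP=> h.
  have : n.+1%:R <= a - A * s by rewrite -truncn_ge_nat.
  rewrite -natr1 distrC => h1; have := ler_norm (a - n%:R); lra.
have : (nhi a A)%:R <= n%:R :> R by rewrite ler_nat.
have := truncnS_gt (a + A * s); rewrite -/(nhi a A).
have := ler_norm (n%:R - a); lra.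
Qed.

Lemma win_in (n : nat) : `|n%:R - a| <= A * s -> (nlo a A <= n < nhi a A)%N.
Proof.
have p : 0 <= a - A * s by have := win_a0; have := As; have := win_s0; lra.
rewrite ler_norml => /andP[h1 h2]; apply/andP; split.
  have h3 : (nlo a A)%:R <= a - A * s by rewrite truncn_le.
  rewrite -(@ler_nat R); lra.
rewrite ltnS truncn_ge_nat//; first lra.
by rewrite addr_ge0 ?mulr_ge0 ?(ltW win_s0) ?(ltW win_a0)//; move: A1; lra.
Qed.

Lemma win_le : (nlo a A <= nhi a A)%N.
Proof.
have /andP[h1 h2] : (nlo a A <= Num.truncn a < nhi a A)%N.
  apply: win_in; have := truncn_itv (ltW win_a0) => /andP[h1 h2].
  rewrite -natr1 in h2; rewrite ler_norml; apply/andP; split; last first.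
    have : 0 <= A * s by rewrite mulr_ge0 ?(ltW win_s0)//; move: A1; lra.
    lra.
  have : 1 <= A * s by move: A1 aA => h3 h4; nra.
  lra.
exact: leq_trans h1 (ltnW h2).
Qed.

Lemma win_size : (nhi a A - nlo a A)%:R <= 4 * A * s.
Proof.
have [h1 _] := win_lo (leqnn _).
have [h2 _] := @win_hi (Num.truncn (a + A * s)) (ltnSn _).
rewrite natrB ?win_le// /nhi -natr1.
have : 2 <= A * s by move: A1 aA => h3 h4; nra.
lra.
Qed.

Lemma win_rsqrt n : (nlo a A <= n)%N -> rsqrt R n <= 2 / s.
Proof.
move=> /win_lo[_ h]; have s0 := win_s0.
rewrite /rsqrt -[leLHS]mul1r ler_pdivrMr ?sqrtr_gt0 ?ltr0n//.
rewrite mulrAC ler_pdivlMr// mul1r.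
rewrite -(@ler_pXn2r _ 2)// ?nnegrE ?(ltW s0) ?mulr_ge0 ?sqrtr_ge0//.
rewrite exprMn [s ^+ 2]expr2 win_ss sqr_sqrtr ?ler0n// -natr1; lra.
Qed.

End fixed_window.

(** There are of the order of [A sqrt a] terms, and each has a gradient
    [a^(-(d+1)/2)] by [gradient_decay]. *)
Lemma window_gradient v : diff_lattice S v -> exists2 K : R, 0 <= K &
  forall a A x, 1 <= A -> 4 * A + 4 <= Num.sqrt a ->
  `|window_sum a A x - window_sum a A (x - v)| <= K * (A * (Num.sqrt a)^-1 ^+ d).
Proof.
move=> Lv.
have avF := tilted_family_averaging (nw_measurable W) (nw_t W) (nw_exp W).
have doF := tilted_family_dominates (nw_measurable W) (nw_t W) (nw_exp W).
have [K K0 hK] := gradient_decay avF doF (nw_col W) (nw_free W) Lv.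
have FP : tilted_family Pa Y t P.
  by exists 0; rewrite ?normr0 ?(ltW (nw_t W))// tilted_opE0.
exists (K * 2 ^+ d.+1 * 4); first by rewrite !mulr_ge0// exprn_ge0.
move=> a A x A1 aA; have s0 := win_s0 A1 aA; set s := Num.sqrt a in s0 aA *.
rewrite /window_sum -sumrB (le_trans (ler_norm_sum _ _ _))//.
apply: (@le_trans _ _ (\sum_(nlo a A <= n < nhi a A) K * (2 / s) ^+ d.+1)).
  rewrite big_nat_cond [leRHS]big_nat_cond; apply: ler_sum => n /andP[/andP[n1 _] _].
  apply: le_trans (hK _ FP n x) _; rewrite ler_wpM2l//.
  rewrite lerXn2r ?nnegrE ?(ltW (rsqrt_gt0 _ _)) ?divr_ge0 ?(ltW s0)//.
  exact: win_rsqrt A1 aA _ n1.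
rewrite sumr_const_nat -[leLHS]mulr_natr.
apply: (@le_trans _ _ (K * (2 / s) ^+ d.+1 * (4 * A * s))).
  rewrite ler_wpM2l ?mulr_ge0 ?exprn_ge0 ?divr_ge0 ?(ltW s0)//.
  exact: win_size A1 aA.
rewrite le_eqVlt; apply/orP; left; apply/eqP.
rewrite exprMn [s^-1 ^+ d.+1]exprS; field.
by rewrite gt_eqF.
Qed.

Lemma window_bounded a A M : (forall n, bounded_by M (hit n)) ->
  bounded_by ((nhi a A - nlo a A)%:R * M) (window_sum a A).
Proof.
move=> hM x; rewrite /window_sum (le_trans (ler_norm_sum _ _ _))//.
apply: (@le_trans _ _ (\sum_(nlo a A <= n < nhi a A) M)).
  by apply: ler_sum => n _; exact: hM.
by rewrite sumr_const_nat mulr_natl.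
Qed.

Lemma hit_bounded n : bounded_by 1 (hit n).
Proof. exact: (iter_bounded n hP (@delta0_bounded R d)). Qed.

Lemma step_window a A : P (window_sum a A) =
  fun x => \sum_(nlo a A <= n < nhi a A) hit n.+1 x.
Proof.
rewrite /window_sum; elim: (index_iota _ _) => [|n l IH].
  rewrite (_ : (fun x => _) = fun=> 0); last by apply/funext => x; rewrite big_nil.
  by rewrite (avg_cst hP); apply/funext => x; rewrite big_nil.
have bl : exists M, bounded_by M (fun x => \sum_(n <- l) hit n x).
  elim: l {IH} => [|k l [M hM]].
    by exists 0 => x; rewrite big_nil normr0.
  exists (1 + M) => x; rewrite big_cons (le_trans (ler_normD _ _))// lerD//.
  exact: hit_bounded.
have [M hM] := bl.
rewrite (_ : (fun x => _) = fun x => hit n x + \sum_(n <- l) hit n x); last first.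
  by apply/funext => x; rewrite big_cons.
rewrite (avgD hP (@hit_bounded n) hM) IH.
by apply/funext => x; rewrite big_cons.
Qed.

Lemma l1_toZ (y : 'cV[nat]_d) : l1 R (toZ y) = (norm1 y)%:R.
Proof.
by rewrite /l1 /norm1 natr_sum; apply: eq_bigr => i _; rewrite mxE.
Qed.

(** Slow variation of the window sum along the full lattice. Along the
    difference lattice this is [window_gradient]. For a translation by [y0], a
    single term [hit n] may vary wildly, but the window sum [V] is close to
    its average [P V], whose value is close to a value of [V] translated by
    [y0]. *)
Lemma window_lipschitz : exists2 C : R, 0 <= C &
  forall a A, 1 <= A -> 4 * A + 4 <= Num.sqrt a ->
  forall v, Ls v -> forall x,
  `|window_sum a A x - window_sum a A (x - v)|
     <= C * (1 + l1 R v) * (A * (Num.sqrt a)^-1 ^+ d).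
Proof.
have mY := nw_measurable W; have hexp := nw_exp W; have t0 := nw_t W.
have dB := zfree_det (nw_free W).
have /choice[K hK] : forall v, exists K : R, 0 <= K /\ (diff_lattice S v ->
    forall a A x, 1 <= A -> 4 * A + 4 <= Num.sqrt a ->
  `|window_sum a A x - window_sum a A (x - v)| <= K * (A * (Num.sqrt a)^-1 ^+ d)).
  move=> v; have [Lv|nLv] := pselect (diff_lattice S v).
    by have [K K0 h] := window_gradient Lv; exists K.
  by exists 0.
have [C1 C10 hC1] := lipschitz_on_lattice diff_lattice_subgroup (nw_col W) dB
  (fun v => (hK v).1).
have L1 a A v x : 1 <= A -> 4 * A + 4 <= Num.sqrt a -> diff_lattice S v ->
  `|window_sum a A x - window_sum a A (x - v)|
     <= C1 * (1 + l1 R v) * (A * (Num.sqrt a)^-1 ^+ d).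
  move=> A1 aA Lv; apply: hC1 => //.
    by rewrite mulr_ge0 ?exprn_ge0 ?invr_ge0 ?sqrtr_ge0//; lra.
  by move=> w Lw z; apply: (hK w).2.
(* For a translation by [y0]: one step of the walk moves by [y0] up to the
   difference lattice, and changes the window sum by its two end terms only. *)
have avF := tilted_family_averaging mY t0 hexp.
have doF := tilted_family_dominates mY t0 hexp.
have [Ks Ks0 hKs] := sup_decay avF doF (nw_col W) (nw_free W).
have FP : tilted_family Pa Y t P.
  by exists 0; rewrite ?normr0 ?(ltW t0)// tilted_opE0.
pose C2 := 2 * Ks * 2 ^+ d + C1 * (1 + (norm1 y0)%:R + mu1 Pa Y).
have mu0 : 0 <= mu1 Pa Y by apply: Ex_ge0 => y; rewrite ler0n.
have C20 : 0 <= C2.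
  by rewrite addr_ge0 ?mulr_ge0 ?exprn_ge0// !addr_ge0.
have L2 a A x : 1 <= A -> 4 * A + 4 <= Num.sqrt a ->
  `|window_sum a A x - window_sum a A (x - toZ y0)|
     <= C2 * (A * (Num.sqrt a)^-1 ^+ d).
  move=> A1 aA; have s0 := win_s0 A1 aA.
  set V := window_sum a A; set e := A * _.
  have V0 : 0 <= (Num.sqrt a)^-1 ^+ d by rewrite exprn_ge0// invr_ge0 ltW.
  have e0 : 0 <= e by rewrite mulr_ge0//; lra.
  have h1 : `|V x - P V x| <= 2 * Ks * 2 ^+ d * e.
    rewrite step_window /V /window_sum -sumrB.
    rewrite (@telescope_sumr_eq _ _ _ (fun k => - hit k x)); last 2 first.
    - exact: win_le A1 aA.
    - by move=> k _; rewrite opprK addrC.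
    rewrite opprK addrC.
    have bd n : (nlo a A <= n)%N -> `|hit n x| <= Ks * 2 ^+ d * (Num.sqrt a)^-1 ^+ d.
      move=> hn; apply: le_trans (hKs _ FP n x) _; rewrite -mulrA ler_wpM2l// -exprMn.
      rewrite lerXn2r ?nnegrE ?(ltW (rsqrt_gt0 _ _)) ?divr_ge0 ?(ltW s0)//.
      exact: win_rsqrt A1 aA _ hn.
    rewrite (le_trans (ler_normB _ _))//.
    have := lerD (bd _ (leqnn _)) (bd _ (win_le A1 aA)).
    have : Ks * 2 ^+ d * (Num.sqrt a)^-1 ^+ d <= Ks * 2 ^+ d * e.
      by rewrite ler_wpM2l ?mulr_ge0 ?exprn_ge0// ler_peMl.
    by move=> ? ?; lra.
  have bV := window_bounded a A hit_bounded.
  have h2 : `|P V x - V (x - toZ y0)| <= C1 * (1 + (norm1 y0)%:R + mu1 Pa Y) * e.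
    pose g y := if `[< S y >] then V (x - toZ y) - V (x - toZ y0) else 0.
    have -> : P V x - V (x - toZ y0) = Ex Pa Y g.
      rewrite -[V (x - toZ y0)](Ex_cst Pa Y) -(ExB mY hexp); last 2 first.
      - exact: (tame_bounded t0 (M := (nhi a A - nlo a A)%:R * 1)).
      - exact: tame_cst.
      by apply: (Ex_supp mY) => y Sy; rewrite /g asboolT.
    have tn := tame_norm1 d t0.
    have -> : C1 * (1 + (norm1 y0)%:R + mu1 Pa Y) * e =
       Ex Pa Y (fun y => C1 * e * (1 + (norm1 y0)%:R) + C1 * e * (norm1 y)%:R).
      rewrite (ExD mY hexp (tame_cst _ t0 _) (tameZ _ tn)) Ex_cst (ExZ mY hexp _ tn).
      by rewrite /mu1; ring.
    apply: (Ex_norm_le mY hexp); first exact: (tameD (tame_cst _ t0 _) (tameZ _ tn)).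
    move=> y; rewrite /g; case: asboolP => Sy; last first.
      have ce : 0 <= C1 * e by exact: mulr_ge0.
      by rewrite normr0; apply: addr_ge0; apply: mulr_ge0; rewrite ?addr_ge0 ?ler0n.
    have e1 : x - toZ y = (x - toZ y0) - (toZ y - toZ y0).
      by rewrite opprB addrA subrK.
    rewrite distrC e1; apply: le_trans (L1 _ _ _ _ A1 aA (diff_latticeP Sy Sy0)) _.
    rewrite -/e; have := l1D R (toZ y) (- toZ y0); rewrite l1N !l1_toZ => h3.
    have := ler_wpM2l (mulr_ge0 C10 e0) h3; lra.
  have -> : V x - V (x - toZ y0) = (V x - P V x) + (P V x - V (x - toZ y0)) by ring.
  by rewrite /C2 mulrDl (le_trans (ler_normD _ _))// lerD.
(* A constant for each vector of the full lattice, before [lipschitz_on_lattice]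
   makes it linear in the vector. *)
have /choice[K' hK'] : forall v, exists K : R, 0 <= K /\ (Ls v ->
    forall a A x, 1 <= A -> 4 * A + 4 <= Num.sqrt a ->
  `|window_sum a A x - window_sum a A (x - v)| <= K * (A * (Num.sqrt a)^-1 ^+ d)).
  move=> v; have [[l [z [Ll ->]]]|nLv] := pselect (Ls v); last by exists 0.
  exists (C1 * (1 + l1 R l) + `|z|%:~R * C2); split.
    have z1 : 0 <= `|z|%:~R :> R by rewrite ler0z.
    have l0 : 0 <= 1 + l1 R l by rewrite addr_ge0 ?l1_ge0.
    by apply: addr_ge0; apply: mulr_ge0.
  move=> _ a A x A1 aA; set V := window_sum a A; set e := A * _.
  have hz (k : nat) w : `|V w - V (w - toZ y0 *+ k)| <= k%:R * C2 * e.
    elim: k => [|k IH]; first by rewrite mulr0n subr0 subrr normr0 !mul0r.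
    rewrite mulrSr opprD addrA.
    have -> : V w - V (w - toZ y0 *+ k - toZ y0) =
      (V w - V (w - toZ y0 *+ k)) + (V (w - toZ y0 *+ k) - V (w - toZ y0 *+ k - toZ y0)) by ring.
    rewrite -natr1 !mulrDl mul1r (le_trans (ler_normD _ _))// lerD//.
    exact: L2.
  have hzz w : `|V w - V (w - toZ y0 *~ z)| <= `|z|%:~R * C2 * e.
    case: z => k; first exact: hz.
    have := hz k.+1 (w - toZ y0 *~ Negz k).
    by rewrite NegzE mulrNz opprK -[_ *~ k.+1]/(_ *+ k.+1) addrK distrC normrN.
  have -> : V x - V (x - (l + toZ y0 *~ z)) =
     (V x - V (x - l)) + (V (x - l) - V (x - l - toZ y0 *~ z)).
    by rewrite opprD addrA; ring.
  rewrite mulrDl (le_trans (ler_normD _ _))// lerD//.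
  exact: L1.
have [C3 C30 hC3] := lipschitz_on_lattice full_lattice_subgroup
  (fun j => full_lattice_diff (nw_col W j)) dB (fun v => (hK' v).1).
exists C3 => // a A A1 aA v Lv x; apply: hC3 => //.
  by rewrite mulr_ge0 ?exprn_ge0 ?invr_ge0 ?sqrtr_ge0//; lra.
by move=> w Lw z; apply: (hK' w).2.
Qed.

End renewal_window.

(** * Gaussian smoothing of the walk *)

Section smoothing.
Context (R : realType) (d : nat) (dO : measure_display)
  (Omega : measurableType dO) (Pa : probability Omega R).
Variables (Y : Omega -> 'cV[nat]_d) (t : R) (m : 'cV[R]_d) (G : 'M[R]_d)
  (B : 'M[int]_d).
Hypothesis W : nice_walk Pa Y t m G B.
Notation Zd := 'cV[int]_d.
Notation P := (step_op Pa Y).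
Notation hit := (hit Pa Y).

Let hP : averaging P := averaging_step (nw_measurable W) (nw_t W) (nw_exp W).
Let pG := nw_def W.

Definition ofZ (x : Zd) : 'cV[R]_d := map_mx intr x.

(** The Gaussian approximation of the walk at time [tau]. *)
Definition gk (tau : R) (x : Zd) : R := heat G tau (ofZ x - tau *: m).

Lemma gk_ge0 tau x : 0 <= gk tau x. Proof. exact: heat_ge0. Qed.

Lemma gk_bounded tau : 0 < tau -> bounded_by ((Num.sqrt tau)^-1 ^+ d) (gk tau).
Proof. by move=> t0 x; rewrite ger0_norm ?gk_ge0// heat_sup. Qed.

Lemma step_gk tau x :
  P (gk tau) x = Ex Pa Y (fun y => heat G tau ((ofZ x - (tau + 1) *: m) - (toR R y - m))).
Proof.
apply: eq_Ex => y; congr heat; apply/colP => i; rewrite !mxE intrB.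
by rewrite -pmulrn; ring.
Qed.

(** Accumulates the error of [heat_step] over [n] steps. *)
Lemma evolve : exists2 C : R, 0 <= C & forall tau n x, 1 <= tau ->
  `|iter n P (gk tau) x - gk (tau + n%:R) x| <= n%:R * C * (Num.sqrt tau)^-1 ^+ (d + 3).
Proof.
have [C C0 hC] := heat_step (nw_measurable W) (nw_t W) (nw_exp W) (nw_mean W)
  (nw_cov W) pG.
exists C => // tau n x t1; have t0 : 0 < tau by lra.
have tn0 (k : nat) : 0 < tau + k%:R by rewrite ltr_wpDr ?ler0n.
elim: n x => [|n IH] x; first by rewrite addr0 subrr normr0 !mul0r.
rewrite iterS; set g := iter n P (gk tau).
have bg : bounded_by ((Num.sqrt tau)^-1 ^+ d) g by apply: iter_bounded => //; exact: gk_bounded.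
have h1 : `|P g x - P (gk (tau + n%:R)) x| <= n%:R * C * (Num.sqrt tau)^-1 ^+ (d + 3).
  have := avgB hP bg (gk_bounded (tn0 n)) => /(congr1 (@^~ x)) /= <-.
  exact: (avg_bounded hP (fun z => IH z)).
have h2 : `|P (gk (tau + n%:R)) x - gk (tau + n.+1%:R) x| <= C * (Num.sqrt tau)^-1 ^+ (d + 3).
  rewrite step_gk -natr1 addrA.
  have := hC (tau + n%:R) (ofZ x - (tau + n%:R + 1) *: m) _.
  have tt : 1 <= tau + n%:R by rewrite (le_trans t1)// lerDl ler0n.
  move=> /(_ tt) h; apply: le_trans h _; rewrite ler_wpM2l//.
  rewrite lerXn2r ?nnegrE ?invr_ge0 ?sqrtr_ge0//.
  rewrite lef_pV2 ?posrE ?sqrtr_gt0 ?tn0//.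
  by rewrite ler_wsqrtr// lerDl ler0n.
have -> : P g x - gk (tau + n.+1%:R) x =
  (P g x - P (gk (tau + n%:R)) x) + (P (gk (tau + n%:R)) x - gk (tau + n.+1%:R) x) by ring.
apply: le_trans (ler_normD _ _) _; apply: le_trans (lerD h1 h2) _.
by rewrite -[n.+1%:R]natr1 !mulrDl mul1r.
Qed.

Definition gpoint (tau : R) (x : Zd) : 'cV[R]_d :=
  point (Num.sqrt tau) (- Num.sqrt tau *: m) x.

Lemma gk_gauss tau x : 0 < tau ->
  gk tau x = (Num.sqrt tau)^-1 ^+ d * gauss (invmx G) (gpoint tau x).
Proof.
move=> t0; rewrite /gk /heat /gauss; congr (_ * expR (- _)).
set s := Num.sqrt tau; have s0 : 0 < s by rewrite sqrtr_gt0.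
have ss : s ^+ 2 = tau by rewrite sqr_sqrtr// ltW.
have -> : ofZ x - tau *: m = s *: gpoint tau x.
  apply/colP => i; rewrite !mxE -/s -ss; field.
  by rewrite gt_eqF.
by rewrite quadZ ss; field; rewrite gt_eqF.
Qed.

Definition gtrunc (tau r : R) (x : Zd) : R :=
  if in_cube r (gpoint tau x) then gk tau x else 0.

Definition gvar : R := 1 + \sum_i G i i.

Lemma diag_gt0 i : 0 < G i i.
Proof.
have := pG.2 (delta_mx i 0); rewrite quadE bil_sum (bigD1 i)//= (bigD1 i)//= big1.
  rewrite big1 ?addr0 ?mxE ?eqxx ?mul1r ?mulr1.
    apply; apply/eqP => /colP/(_ i); rewrite !mxE !eqxx => /eqP.
    by rewrite oner_eq0.
  by move=> j ji; apply: big1 => k _; rewrite !mxE (negbTE ji) mul0r mul0r.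
by move=> j ji; rewrite !mxE (negbTE ji) mulr0.
Qed.

Lemma gvar_gt0 : 0 < gvar.
Proof. by rewrite ltr_wpDr// sumr_ge0// => i _; rewrite ltW// diag_gt0. Qed.

Lemma coord_le_quad (p : 'cV[R]_d) i : p i 0 ^+ 2 <= gvar * quad (invmx G) p.
Proof.
have e : p i 0 = bil (invmx G) (G *m delta_mx i 0) p.
  rewrite /bil trmx_mul pG.1 -[_ *m G *m _]mulmxA mulmxV ?(pos_def_unit pG)// mulmx1.
  rewrite mxE (bigD1 i)//= big1 ?addr0 ?mxE ?eqxx ?mul1r// => j ji.
  by rewrite !mxE (negbTE ji) mul0r.
rewrite e; apply: le_trans (bil_cauchy (pos_def_inv pG) _ _) _.
have q0 := quad_ge0 (pos_def_inv pG) p.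
rewrite ler_wpM2r//.
have -> : quad (invmx G) (G *m delta_mx i 0) = G i i.
  rewrite /quad trmx_mul pG.1 -[_ *m G *m _]mulmxA mulmxV ?(pos_def_unit pG)// mulmx1.
  rewrite -colE mxE (bigD1 i)//= big1 ?addr0 ?mxE ?eqxx ?mul1r// => j ji.
  by rewrite !mxE (negbTE ji) mul0r.
rewrite /gvar (bigD1 i)//= ler_wpDl// lerDl sumr_ge0// => j _.
exact/ltW/diag_gt0.
Qed.

Lemma gtrunc_err tau r : 0 < tau -> 0 <= r ->
  bounded_by ((Num.sqrt tau)^-1 ^+ d * expR (- (r ^+ 2 / (2 * gvar))))
    (fun x => gk tau x - gtrunc tau r x).
Proof.
move=> t0 r0 x.
have V0 : 0 <= (Num.sqrt tau)^-1 ^+ d by rewrite exprn_ge0// invr_ge0 sqrtr_ge0.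
rewrite /gtrunc; case: ifPn => hx.
  by rewrite subrr normr0 mulr_ge0// expR_ge0.
rewrite subr0 ger0_norm ?gk_ge0// gk_gauss// ler_wpM2l// /gauss ler_expR lerN2.
move: hx; rewrite /in_cube negb_forall => /existsP[i]; rewrite -ltNge => hi.
have h1 : r ^+ 2 <= gpoint tau x i 0 ^+ 2.
  rewrite -[leRHS]real_normK ?num_real// lerXn2r ?nnegrE//; exact: ltW.
have := le_trans h1 (coord_le_quad _ i); have g0 := gvar_gt0 => h2.
rewrite ler_pdivrMr ?mulr_gt0//; lra.
Qed.

Lemma gtrunc_box tau r : 0 < tau -> exists N0 : nat, forall N, (N0 <= N)%N ->
  forall x, gtrunc tau r x =
    \sum_(y <- box N d | in_cube r (gpoint tau y)) gk tau y * delta0 R (x - y).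
Proof.
move=> t0; set s := Num.sqrt tau; have s0 : 0 < s by rewrite sqrtr_gt0.
pose M := s * (`|r| + \sum_i `|s * m i 0|).
exists (Num.truncn M).+1 => N hN x.
rewrite /gtrunc big_mkcond; case: ifPn => hx; last first.
  rewrite big1_seq// => y _; case: ifPn => hy//.
  rewrite /delta0 subr_eq0; have [xy|] := eqVneq x y; last by rewrite mulr0.
  by rewrite xy hy in hx.
have xb : x \in box N d.
  rewrite mem_box; apply/forallP => i.
  have := forallP hx i; rewrite /gpoint mxE -/s => hi.
  rewrite -(@ler_int R) intr_norm.
  have h1 : `|(x i 0)%:~R / s| <= `|r| + \sum_i `|s * m i 0| :> R.
    have -> : (x i 0)%:~R / s = ((x i 0)%:~R / s + (- s *: m) i 0) + s * m i 0.
      by rewrite mxE; ring.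
    rewrite (le_trans (ler_normD _ _))// lerD ?(le_trans hi (ler_norm _))//.
    by rewrite (bigD1 i)//= lerDl sumr_ge0.
  rewrite normrM [X in _ * X]gtr0_norm ?invr_gt0// ler_pdivrMr// mulrC in h1.
  apply: le_trans h1 _; apply: (@le_trans _ _ (Num.truncn M).+1%:R).
    exact/ltW/truncnS_gt.
  by rewrite ler_nat.
rewrite (bigD1_seq x)//=; last exact: box_uniq.
rewrite hx /delta0 subrr eqxx mulr1 big1 ?addr0// => y yx.
by case: ifP => // _; rewrite subr_eq0 eq_sym (negbTE yx) mulr0.
Qed.

Lemma iter_finite (l : seq Zd) (p : pred Zd) (f : Zd -> R) n x :
  iter n P (fun x => \sum_(y <- l | p y) f y * delta0 R (x - y)) x =
  \sum_(y <- l | p y) f y * hit n (x - y).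
Proof.
have hn := averaging_iter hP n.
elim: l x => [|y l IH] x.
  rewrite big_nil (_ : (fun x => _) = fun=> 0) ?(avg_cst hn)//.
  by apply/funext => z; rewrite big_nil.
have bl : exists M, bounded_by M (fun x => \sum_(y <- l | p y) f y * delta0 R (x - y)).
  elim: l {IH} => [|k l [M hM]].
    by exists 0 => z; rewrite big_nil normr0.
  exists (`|f k| + M) => z; rewrite big_cons; case: ifP => _; last first.
    by rewrite (le_trans (hM z))// lerDr.
  rewrite (le_trans (ler_normD _ _))// lerD// normrM ler_piMr//.
  exact: delta0_bounded.
have [M hM] := bl.
rewrite big_cons; case: ifP => py; last first.
  by rewrite -IH; congr (iter n P _ x); apply/funext => z; rewrite big_cons py.
have bs := bounded_byS y (@delta0_bounded R d).
rewrite (_ : (fun x => _) = fun x => f y * shift y (@delta0 R d) x +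
   \sum_(y <- l | p y) f y * delta0 R (x - y)); last first.
  by apply/funext => z; rewrite big_cons py.
by rewrite (avg_lin hn _ bs hM) IH (avg_shift hn).
Qed.

(** The law of the walk after [n] steps, smoothed by a truncated Gaussian of
    variance [tau], is the Gaussian of variance [tau + n]: the operator [P]
    commutes with translations, so averaging translates of [hit n] is the same
    as letting the walk evolve from the Gaussian, where [evolve] applies. *)
Lemma smoothed_hit : exists2 C : R, 0 <= C & forall tau r, 1 <= tau -> 0 <= r ->
  exists N0 : nat, forall N, (N0 <= N)%N -> forall n x,
  `|\sum_(y <- box N d | in_cube r (gpoint tau y)) gk tau y * hit n (x - y)
     - gk (tau + n%:R) x|
  <= (Num.sqrt tau)^-1 ^+ d * expR (- (r ^+ 2 / (2 * gvar)))
     + n%:R * C * (Num.sqrt tau)^-1 ^+ (d + 3).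
Proof.
have [C C0 hC] := evolve; exists C => // tau r t1 r0; have t0 : 0 < tau by lra.
have [N0 hN] := gtrunc_box r t0; exists N0 => N NN n x.
rewrite -iter_finite.
have -> : (fun x => \sum_(y <- box N d | in_cube r (gpoint tau y))
   gk tau y * delta0 R (x - y)) = gtrunc tau r.
  by apply/funext => z; rewrite (hN N NN).
have hn := averaging_iter hP n.
have bg := gk_bounded t0; have be := gtrunc_err t0 r0.
have bt : bounded_by ((Num.sqrt tau)^-1 ^+ d) (gtrunc tau r).
  move=> z; rewrite /gtrunc; case: ifP => _; first exact: bg.
  by rewrite normr0 exprn_ge0// invr_ge0 sqrtr_ge0.
have h1 : `|iter n P (gtrunc tau r) x - iter n P (gk tau) x| <=
    (Num.sqrt tau)^-1 ^+ d * expR (- (r ^+ 2 / (2 * gvar))).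
  rewrite distrC; have := avgB hn bg bt => /(congr1 (@^~ x)) /= <-.
  exact: (avg_bounded hn be).
have -> : iter n P (gtrunc tau r) x - gk (tau + n%:R) x =
  (iter n P (gtrunc tau r) x - iter n P (gk tau) x) +
  (iter n P (gk tau) x - gk (tau + n%:R) x) by ring.
by rewrite (le_trans (ler_normD _ _))// lerD// hC.
Qed.

(** The mass of the smoothing kernel is a Riemann sum of the Gaussian. *)
Lemma smoothing_mass (e : R) : 0 < e -> exists r0 s0 : R, 0 < r0 /\ 0 < s0 /\
  forall r tau, r0 <= r -> s0 <= Num.sqrt tau ->
  exists N0 : nat, forall N, (N0 <= N)%N ->
  `|\sum_(y <- box N d | in_cube r (gpoint tau y)) gk tau y
     - gauss_const (invmx G)| <= e.
Proof.
move=> e0; have pB := pos_def_inv pG.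
have [r0 [s0 [r00 [s00 hge]]]] := lattice_sum_ge pB e0.
have [s1 s10 hle] := lattice_sum_le pB e0.
exists r0, (s0 + s1); split=> //; split; first exact: addr_gt0.
move=> r tau hr hs; set s := Num.sqrt tau in hs *.
have ss0 : s0 <= s by lra.
have ss1 : s1 <= s by lra.
have sp : 0 < s by lra.
have tau0 : 0 < tau by rewrite -sqrtr_gt0.
have [N0 hN0] := hge r s (- s *: m) hr ss0.
exists N0 => N NN.
have -> : \sum_(y <- box N d | in_cube r (gpoint tau y)) gk tau y =
  s^-1 ^+ d * \sum_(y <- box N d | in_cube r (gpoint tau y)) gauss (invmx G) (gpoint tau y).
  by rewrite mulr_sumr; apply: eq_bigr => y _; rewrite gk_gauss.
set T := \sum_(y <- _ | _) _.
have h1 : (gauss_const (invmx G) - e) * s ^+ d <= T by exact: hN0.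
have h2 : T <= (gauss_const (invmx G) + e) * s ^+ d.
  apply: le_trans (hle s (- s *: m) N ss1).
  rewrite /T big_mkcond; apply: ler_sum => y _.
  by case: ifP => // _; exact: gauss_ge0.
have sd0 : 0 < s ^+ d by exact: exprn_gt0.
rewrite exprVn ler_distl; apply/andP; split.
  by rewrite mulrC ler_pdivlMr.
by rewrite mulrC ler_pdivrMr.
Qed.

End smoothing.

(** * The transverse Gaussian *)

Section gaussian_comparison.
Context (R : realType) (d : nat).
Variables (m : 'cV[R]_d) (G : 'M[R]_d).
Hypothesis pG : pos_def G.
Notation Bi := (invmx G).

Lemma bil_bound (A : 'M[R]_d) : exists2 c : R, 0 <= c &
  forall (z w : 'cV[R]_d) (M N : R), (forall i, `|z i 0| <= M) -> (forall i, `|w i 0| <= N) ->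
  `|bil A z w| <= c * M * N.
Proof.
exists (\sum_i \sum_j `|A i j|).
  by apply: sumr_ge0 => i _; apply: sumr_ge0.
move=> z w M N hz hw; rewrite bil_sum -mulrA mulr_suml (le_trans (ler_norm_sum _ _ _))//.
apply: ler_sum => i _; rewrite mulr_suml (le_trans (ler_norm_sum _ _ _))//.
apply: ler_sum => j _; rewrite !normrM mulrAC mulrC ler_wpM2l//.
by rewrite ler_pM.
Qed.

Lemma expRN_lip (x y : R) : 0 <= x -> 0 <= y -> `|expR (- x) - expR (- y)| <= `|x - y|.
Proof.
have h (u v : R) : 0 <= u -> u <= v -> `|expR (- u) - expR (- v)| <= `|u - v|.
  move=> u0 uv; rewrite distrC ler0_norm; last by rewrite subr_le0 ler_expR lerN2.
  rewrite distrC ger0_norm ?subr_ge0// opprB.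
  have -> : - v = - u + (u - v) by ring.
  have e1 : expR (- u) <= 1 by rewrite expR_le1 oppr_le0.
  rewrite expRD -[X in X - _]mulr1 -mulrBr.
  have h1 := expR_ge1Dx (u - v).
  have h2 : 1 - expR (u - v) <= v - u by lra.
  have h3 : 0 <= v - u by rewrite subr_ge0.
  apply: (@le_trans _ _ (expR (- u) * (v - u))).
    by rewrite ler_wpM2l ?expR_ge0.
  by rewrite ler_piMl.
move=> x0 y0; have [xy|yx] := leP x y; first exact: h.
by rewrite distrC [leRHS]distrC h// ltW.
Qed.

Lemma pow_near1 (q : R) k : 0 <= q <= 2 -> `|q ^+ k - 1| <= 4 ^+ k * `|q - 1|.
Proof.
move=> /andP[q0 q2]; elim: k => [|k IH].
  by rewrite !expr0 subrr normr0 mul1r.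
have -> : q ^+ k.+1 - 1 = q * (q ^+ k - 1) + (q - 1) by rewrite exprS; ring.
rewrite (le_trans (ler_normD _ _))// normrM (ger0_norm q0).
have h1 : q * `|q ^+ k - 1| <= 2 * (4 ^+ k * `|q - 1|) by rewrite ler_pM.
have p1 : 1 <= (4 : R) ^+ k by rewrite exprn_ege1// ler1n.
have h2 : `|q - 1| <= 4 ^+ k * `|q - 1| by rewrite ler_peMl.
have h3 : 0 <= 4 ^+ k * `|q - 1| by rewrite mulr_ge0// exprn_ge0.
rewrite [4 ^+ k.+1]exprS -mulrA; lra.
Qed.

(** Gaussian kernels at nearby times and points, in the scale [s]. *)
Lemma heat_compare (M e : R) : 0 <= M -> 0 < e -> exists2 del : R, 0 < del &
  forall s tau (p w : 'cV[R]_d), 0 < s -> 0 < tau -> `|tau / s ^+ 2 - 1| <= del ->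
  (forall i, `|p i 0| <= M) -> (forall i, `|w i 0 - p i 0| <= del) ->
  `|heat G tau (s *: w) - s^-1 ^+ d * gauss Bi p| <= e * s^-1 ^+ d.
Proof.
move=> M0 e0; have [c c0 hc] := bil_bound Bi.
pose K := 2 * 4 ^+ d + 2 * c * (M + 1) ^+ 2.
have K0 : 0 <= K.
  by rewrite addr_ge0// ?mulr_ge0 ?exprn_ge0//; lra.
pose del := Num.min 2^-1 (e / (K + 1)).
have del0 : 0 < del by rewrite lt_min invr_gt0 ltr0n divr_gt0//; lra.
have del2 : del <= 2^-1 by rewrite ge_min lexx.
have delK : del * K <= e.
  apply: (@le_trans _ _ (del * (K + 1))); first by rewrite ler_wpM2l ?(ltW del0)//; lra.
  by rewrite -ler_pdivlMr ?ge_min ?lexx ?orbT//; lra.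
exists del => // s tau p w s0 t0 ht hp hw.
pose th := s ^+ 2 / tau.
have th0 : 0 < th by rewrite divr_gt0// exprn_gt0.
have thV : tau / s ^+ 2 = th^-1 by rewrite /th invf_div.
rewrite thV in ht.
have th2 : th <= 2.
  have : 2^-1 <= th^-1 by move: ht; rewrite ler_norml => /andP[h1 _]; lra.
  by rewrite lef_pV2 ?posrE.
have th1 : `|th - 1| <= 2 * del.
  have -> : th - 1 = - (th * (th^-1 - 1)) by field; rewrite gt_eqF.
  by rewrite normrN normrM gtr0_norm// ler_pM// ltW.
set q := Num.sqrt th; have q0 : 0 < q by rewrite sqrtr_gt0.
have qq : q ^+ 2 = th by rewrite sqr_sqrtr// ltW.
have q2 : q <= 2 by rewrite -(@ler_pXn2r _ 2) ?nnegrE ?(ltW q0)// qq; lra.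
have q1 : `|q - 1| <= 2 * del.
  have e1 : `|th - 1| = `|q - 1| * (q + 1).
    by rewrite -qq -[q + 1 in RHS]gtr0_norm ?addr_gt0// -normrM; congr `|_|; ring.
  apply: le_trans th1; rewrite e1 ler_peMr//; lra.
have heatE : heat G tau (s *: w) = s^-1 ^+ d * (q ^+ d * expR (- (th * quad Bi w / 2))).
  rewrite /heat quadZ mulrA -exprMn; congr (_ ^+ d * expR (- _)).
    have -> : Num.sqrt tau = s / q.
      rewrite -[s / q]gtr0_norm ?divr_gt0// -sqrtr_sqr expr_div_n qq /th.
      by congr Num.sqrt; field; rewrite !gt_eqF.
    by rewrite invf_div mulrC.
  by rewrite /th; field; rewrite gt_eqF.
have V0 : 0 <= s^-1 ^+ d by rewrite exprn_ge0// invr_ge0 ltW.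
rewrite heatE -mulrBr normrM (ger0_norm V0) mulrC ler_wpM2r//.
have qw := quad_ge0 (pos_def_inv pG) w; have qp := quad_ge0 (pos_def_inv pG) p.
set X' := th * quad Bi w / 2; set X := quad Bi p / 2.
have X'0 : 0 <= X' by rewrite divr_ge0// mulr_ge0// ltW.
have X0 : 0 <= X by rewrite divr_ge0.
have w1 i : `|w i 0| <= M + 1.
  have -> : w i 0 = p i 0 + (w i 0 - p i 0) by ring.
  rewrite (le_trans (ler_normD _ _))//; have := hp i; have := hw i; lra.
have hqw : `|quad Bi w| <= c * (M + 1) * (M + 1) by rewrite quadE hc.
pose z := w - p; have hz i : `|z i 0| <= del by rewrite !mxE.
have qwp : `|quad Bi w - quad Bi p| <= 2 * (c * M * del) + c * del * del.
  have -> : quad Bi w - quad Bi p = 2 * bil Bi p z + quad Bi z.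
    have -> : w = p + z by rewrite /z addrC subrK.
    by rewrite quadD ?(pos_def_inv pG).1//; ring.
  by rewrite (le_trans (ler_normD _ _))// lerD ?normrM ?(ger0_norm (ler0n _ 2)) ?ler_wpM2l ?quadE ?hc.
have XX : `|X' - X| <= del * (2 * c * (M + 1) ^+ 2).
  have -> : X' - X = ((th - 1) * quad Bi w + (quad Bi w - quad Bi p)) / 2.
    by rewrite /X /X'; field.
  rewrite normrM [X in _ * X]gtr0_norm ?invr_gt0// ler_pdivrMr//.
  have h1 : `|(th - 1) * quad Bi w| <= 2 * del * (c * (M + 1) * (M + 1)).
    by rewrite normrM ler_pM.
  apply: le_trans (ler_normD _ _) _; apply: le_trans (lerD h1 qwp) _.
  have cd : 0 <= c * del by rewrite mulr_ge0// ltW.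
  have cdd : c * del * del <= c * del * 1 by rewrite ler_wpM2l//; lra.
  have := mulr_ge0 cd M0; have := mulr_ge0 cd (mulr_ge0 M0 M0).
  rewrite expr2; lra.
have -> : q ^+ d * expR (- X') - expR (- X) =
  (q ^+ d - 1) * expR (- X') + (expR (- X') - expR (- X)) by ring.
have e1 : `|expR (- X')| <= 1 by rewrite ger0_norm ?expR_ge0// expR_le1 oppr_le0.
have b1 : `|(q ^+ d - 1) * expR (- X')| <= 4 ^+ d * (2 * del).
  rewrite normrM -[leRHS]mulr1 ler_pM//.
  apply: le_trans (pow_near1 d _) _; first by rewrite (ltW q0).
  by rewrite ler_wpM2l ?exprn_ge0.
apply: le_trans (ler_normD _ _) _.
apply: le_trans (lerD b1 (le_trans (expRN_lip X'0 X0) XX)) _.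
by apply: le_trans delK; rewrite /K; lra.
Qed.

Lemma quad_transverse w : 0 < quad Bi m ->
  quad (transverse_form m G) w = quad Bi w - bil Bi w m ^+ 2 / quad Bi m.
Proof.
move=> b0; have sB := (pos_def_inv pG).1.
rewrite /quad /transverse_form mulmxBr mulmxBl mxE [in X in _ + X]mxE; congr (_ - _).
rewrite -scalemxAr -scalemxAl mxE mulrC; congr (_ / _).
have -> : w^T *m (Bi *m m *m m^T *m Bi) *m w = (w^T *m Bi *m m) *m (m^T *m Bi *m w).
  by rewrite !mulmxA.
rewrite mxE big_ord1 -/(bil Bi w m) -[X in _ * X]/(bil Bi m w).
by rewrite (bilC m w sB) expr2.
Qed.

(** Completing the square in the direction of the drift [m]: the transverse
    form is what remains. *)
Lemma gauss_split w (tau : R) : 0 < quad Bi m ->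
  gauss Bi (w - tau *: m) = expR (- (quad (transverse_form m G) w / 2)) *
    expR (- (quad Bi m * (tau - bil Bi w m / quad Bi m) ^+ 2 / 2)).
Proof.
move=> b0; rewrite /gauss quad_transverse// -expRD; congr expR.
rewrite quadB ?(pos_def_inv pG).1// bilZr quadZ.
by field; rewrite gt_eqF.
Qed.

(** By [gauss_split] the sum over the times is a one-dimensional Riemann sum
    of mesh [1 / sqrt a], and a wide window exhausts the Gaussian integral. *)
Lemma window_riemann (D e : R) : 0 < quad Bi m -> 0 <= D -> 0 < e ->
  exists2 A0 : R, 0 <= A0 &
  forall a A (w : 'cV[R]_d), 1 <= A -> A0 <= A -> 4 * A + 4 <= Num.sqrt a ->
  (forall i, `|w i 0| <= D) ->
  `|\sum_(nlo a A <= n < nhi a A) gauss Bi (w - ((n%:R - a) / Num.sqrt a) *: m)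
     - Num.sqrt a * (Num.sqrt (2 * pi / quad Bi m)
         * expR (- (quad (transverse_form m G) w / 2)))|
    <= e * Num.sqrt a + 2.
Proof.
move=> b0 D0 e0; set b := quad Bi m in b0 *.
have [c c0 hc] := bil_bound Bi.
have [hle hge] := gauss_line_sum b0; have [rho rho0 hrho] := hge e e0.
pose T := c * D * (\sum_i `|m i 0|) / b.
have T0 : 0 <= T by rewrite !mulr_ge0 ?invr_ge0 ?(ltW b0) ?sumr_ge0.
exists (rho + T); first by rewrite addr_ge0// ltW.
move=> a A w A1 AA aA hw; have s0 := win_s0 A1 aA; set s := Num.sqrt a in s0 aA *.
have ss := win_ss A1 aA; rewrite -/s in ss.
set E := expR (- (quad (transverse_form m G) w / 2)).
have E01 : 0 <= E <= 1.
  rewrite expR_ge0 /= expR_le1 oppr_le0 divr_ge0// quad_transverse// subr_ge0.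
  by rewrite ler_pdivrMr//; exact: (bil_cauchy (pos_def_inv pG)).
pose tau0 := bil Bi w m / b.
have htau : `|tau0| <= T.
  rewrite normrM [X in _ * X]gtr0_norm ?invr_gt0// ler_wpM2r ?invr_ge0 ?(ltW b0)//.
  by apply: hc => // i; rewrite (bigD1 i)//= lerDl sumr_ge0.
pose l : seq int := [seq n%:Z | n <- index_iota (nlo a A) (nhi a A)].
have ul : uniq l by rewrite map_inj_uniq ?iota_uniq// => i j [].
pose sg := - s - tau0.
have es (n : nat) : (n%:Z)%:~R / s + sg = (n%:R - a) / s - tau0.
  by rewrite /sg -pmulrn -ss; field; rewrite gt_eqF.
have -> : \sum_(nlo a A <= n < nhi a A) gauss Bi (w - ((n%:R - a) / s) *: m) =
   E * \sum_(z <- l) expR (- (b * (z%:~R / s + sg) ^+ 2 / 2)).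
  by rewrite big_map mulr_sumr; apply: eq_bigr => n _; rewrite gauss_split// es.
set T1 := \sum_(z <- l) _.
have h1 : T1 <= s * Num.sqrt (2 * pi / b) + 2 by exact: hle.
have h2 : s * (Num.sqrt (2 * pi / b) - e) - 2 <= T1.
  apply: hrho => // z hz.
  have hz2 : `|z%:~R / s - s| <= A.
    have -> : z%:~R / s - s = (z%:~R / s + sg) + tau0 by rewrite /sg; ring.
    rewrite (le_trans (ler_normD _ _))//; lra.
  have hz3 : `|z%:~R - a| <= A * s.
    have -> : z%:~R - a = (z%:~R / s - s) * s.
      by rewrite mulrBl divfK ?gt_eqF// ss.
    by rewrite normrM (gtr0_norm s0) ler_wpM2r// ltW.
  have z0 : 0 <= z.
    rewrite -(@ler_int R); move: hz3; rewrite ler_norml => /andP[h3 _].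
    have : 0 < a by rewrite -ss mulr_gt0.
    have := ler_wpM2r (ltW s0) aA; rewrite ss; lra.
  case: z z0 hz3 {hz hz2} => // n _; rewrite -pmulrn => hn.
  by rewrite map_f// mem_index_iota; apply: win_in A1 aA _ _.
have -> : E * T1 - s * (Num.sqrt (2 * pi / b) * E) = E * (T1 - s * Num.sqrt (2 * pi / b)) by ring.
move: E01 => /andP[E0 E1].
have h3 : `|T1 - s * Num.sqrt (2 * pi / b)| <= e * s + 2.
  have := mulr_gt0 e0 s0; rewrite ler_norml => ?; apply/andP; split; lra.
by rewrite normrM (ger0_norm E0) (le_trans _ h3)// ler_piMl.
Qed.

End gaussian_comparison.

(** * The local limit of the renewal masses *)

Section local_limit.
Context (R : realType) (d : nat) (dO : measure_display)
  (Omega : measurableType dO) (Pa : probability Omega R).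
Variables (Y : Omega -> 'cV[nat]_d) (t : R) (m : 'cV[R]_d) (G : 'M[R]_d)
  (B : 'M[int]_d) (y0 : 'cV[nat]_d).
Hypothesis W : nice_walk Pa Y t m G B.
Hypothesis hd : (0 < d)%N.
Hypothesis Sy0 : supp Pa Y y0.
Notation Zd := 'cV[int]_d.
Notation S := (supp Pa Y).
Notation hit := (hit Pa Y).
Notation renewal := (renewal Pa Y).
Notation Ls := (full_lattice S y0).
Notation window_sum := (window_sum Pa Y).
Notation mu := (mu1 Pa Y).
Notation Bi := (invmx G).
Notation ofZ := (@ofZ R d).
Notation gker := (gk m G).
Notation gpt := (gpoint m).
Let pG := nw_def W.

Lemma gauss_const_gt0 n (A : 'M[R]_n) : pos_def A -> 0 < gauss_const A.
Proof.
elim: n A => [|n IH] A pA.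
  by rewrite /gauss_const expr0 det_mx00 divr1 sqrtr1.
move: A pA; change (forall A : 'M[R]_(1 + n), pos_def A -> 0 < gauss_const A) => A pA.
rewrite gauss_const_schur// mulr_gt0 ?IH//; last exact: schur_pos_def.
by rewrite sqrtr_gt0 divr_gt0 ?mulr_gt0 ?pi_gt0// schur_pivot.
Qed.

Lemma drift_gt0 : 0 < quad Bi m.
Proof.
apply: (pos_def_inv pG).2; apply/eqP => /colP /(_ (Ordinal hd)); rewrite mxE => h.
by have := nw_pos W (Ordinal hd); rewrite h ltxx.
Qed.

Lemma window_support a A x : ~ Ls x -> window_sum a A x = 0.
Proof.
move=> nx; rewrite /window_sum big1// => n _.
by apply: contra_notP nx => /eqP; exact: (hit_lattice W Sy0).
Qed.

Lemma renewal_support x : ~ Ls x -> renewal x = 0.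
Proof.
move=> nx; rewrite /renewal eseries0//= => n _ _; congr (_%:E).
by apply: contra_notP nx => /eqP; exact: (hit_lattice W Sy0).
Qed.

Lemma nrm_dist a (k : Zd) D : (forall i, `|(k i 0)%:~R - a * m i 0| <= D) ->
  `|nrm R k - a * mu| <= d%:R * D.
Proof.
move=> h; rewrite (mu_sum W) /nrm mulr_sumr -sumrB (le_trans (ler_norm_sum _ _ _))//.
apply: (@le_trans _ _ (\sum_(i < d) D)); first by apply: ler_sum => i _; exact: h.
by rewrite sumr_const card_ord mulr_natl.
Qed.

Lemma nrm_le_l1 (x : Zd) : `|nrm R x| <= l1 R x.
Proof.
rewrite /nrm /l1 (le_trans (ler_norm_sum _ _ _))//.
by apply: ler_sum => i _; rewrite intr_norm.
Qed.

(** [hit_bound] summed over the times at distance at least [A sqrt a] from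
    [a]. *)
Lemma hit_sums : exists2 c : R, 0 < c & forall D : R, 0 <= D -> exists2 C : R, 0 < C &
  forall (a : R) x (A : R) N, 1 <= a -> 0 <= A -> `|nrm R x - a * mu| <= D * Num.sqrt a ->
  Num.sqrt a ^+ d * (\sum_(n < N | A * Num.sqrt a <= `|n%:R - a|) hit n x)
    <= C * Num.sqrt a * expR (- (c * A)).
Proof.
have [c c0 hC] := hit_bound W hd; exists c => // D D0.
have [C C0 h] := hC D D0.
exists (C * (2 * expR c * (1 + c^-1))).
  by rewrite !mulr_gt0 ?expR_gt0// addr_gt0 ?invr_gt0.
move=> a x A N a1 A0 hx; set s := Num.sqrt a.
have s1 : 1 <= s by rewrite -(@sqrtr1 R) ler_wsqrtr.
have s0 : 0 < s by lra.
have sd : s ^+ d * s^-1 ^+ d = 1 by rewrite -exprMn mulfV ?expr1n// gt_eqF.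
apply: (@le_trans _ _ (C * \sum_(n < N | A * s <= `|n%:R - a|) expR (- (c * `|n%:R - a| / s)))).
  rewrite mulr_sumr mulr_sumr; apply: ler_sum => n _.
  apply: (@le_trans _ _ (s ^+ d * (C * s^-1 ^+ d * expR (- (c * `|n%:R - a| / s))))).
    by rewrite ler_wpM2l ?exprn_ge0 ?(ltW s0)// h.
  rewrite le_eqVlt; apply/orP; left; apply/eqP.
  rewrite -[RHS]mul1r -sd; ring.
have a0 : 0 <= a by lra.
have h2 := exp_sum_tail N c0 s1 a0 A0.
apply: (le_trans (ler_wpM2l (ltW C0) h2)).
have h1 : 1 + s / c <= s * (1 + c^-1) by have := invr_gt0 c; lra.
have -> : C * (2 * expR c * (1 + s / c) * expR (- (c * A))) =
  (C * (2 * expR c) * expR (- (c * A))) * (1 + s / c) by ring.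
have -> : C * (2 * expR c * (1 + c^-1)) * s * expR (- (c * A)) =
  (C * (2 * expR c) * expR (- (c * A))) * (s * (1 + c^-1)) by ring.
by rewrite ler_wpM2l// !mulr_ge0 ?expR_ge0// ltW.
Qed.

Lemma window_sub a A x N : (nhi a A <= N)%N -> 1 <= A -> 4 * A + 4 <= Num.sqrt a ->
  0 <= \sum_(n < N) hit n x - window_sum a A x <=
   \sum_(n < N | A * Num.sqrt a <= `|n%:R - a|) hit n x.
Proof.
move=> hN A1 aA.
have le1 := win_le A1 aA.
have -> : \sum_(n < N) hit n x - window_sum a A x =
  \sum_(0 <= n < nlo a A) hit n x + \sum_(nhi a A <= n < N) hit n x.
  rewrite -(big_mkord xpredT (fun n => hit n x)).
  rewrite (big_cat_nat (leq0n (nlo a A)) (leq_trans le1 hN)) /=.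
  rewrite (big_cat_nat le1 hN) /= /window_sum; ring.
have h0 n := hit_ge0 W n x.
rewrite addr_ge0 ?sumr_ge0//=.
rewrite -(big_mkord (fun n => A * Num.sqrt a <= `|n%:R - a|) (fun n => hit n x)).
rewrite (big_cat_nat (leq0n (nlo a A)) (leq_trans le1 hN)) /=.
rewrite (big_cat_nat le1 hN) /=.
have e1 : \sum_(0 <= n < nlo a A | A * Num.sqrt a <= `|n%:R - a|) hit n x =
          \sum_(0 <= n < nlo a A) hit n x.
  rewrite big_nat_cond [RHS]big_nat_cond; apply: eq_bigl => n.
  have [h1|] := ltnP n (nlo a A); rewrite ?andbF// andbT /=.
  by apply: (win_out A1 aA); rewrite h1.
have e2 : \sum_(nhi a A <= n < N | A * Num.sqrt a <= `|n%:R - a|) hit n x =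
          \sum_(nhi a A <= n < N) hit n x.
  rewrite big_nat_cond [RHS]big_nat_cond; apply: eq_bigl => n.
  have [h1|] := leqP (nhi a A) n; rewrite ?andbF//=.
  by rewrite (win_out A1 aA) ?h1 ?orbT.
rewrite e1 e2 lerD2l lerDr sumr_ge0// => n _; exact: h0.
Qed.

Variable cs : seq Zd.
Hypothesis hcs : forall x, exists2 i, (i < size cs)%N /\ Ls (x - cs`_i) &
    forall j, (j < size cs)%N -> Ls (x - cs`_j) -> j = i.
Let Cc : R := \sum_(c <- cs) l1 R c.

(** The window sum is supported by the full lattice. Summing its translates by
    representatives of the cosets gives a function that varies slowly on all
    of Z^d and coincides with a translate of the window sum at each point
    ([spread_pick]), so that averages over Z^d can be compared with its
    values. *)
Definition spread (a A : R) (x : Zd) : R := \sum_(c <- cs) window_sum a A (x - c).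

Let Cc0 : 0 <= Cc. Proof. by apply: sumr_ge0 => c _; exact: l1_ge0. Qed.

Let l1_cs c : c \in cs -> l1 R c <= Cc.
Proof.
move=> hc; rewrite /Cc (big_rem _ hc) /= lerDl.
by apply: sumr_ge0 => z _; exact: l1_ge0.
Qed.

Lemma spread_pick x : exists2 c, c \in cs & Ls (x - c) /\
  forall a A, spread a A x = window_sum a A (x - c).
Proof.
have [i [hi Li] hj] := hcs x; exists cs`_i; first exact: mem_nth.
split=> // a A; rewrite /spread (big_nth 0) big_mkord (bigD1 (Ordinal hi))//=.
rewrite big1 ?addr0// => j ji; apply: window_support => Lj.
by move/eqP: ji; apply; apply/val_inj => /=; apply: hj.
Qed.

Lemma spread_lipschitz : exists2 C : R, 0 <= C &
  forall a A, 1 <= A -> 4 * A + 4 <= Num.sqrt a ->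
  (forall x x', `|spread a A x - spread a A x'|
     <= C * (1 + l1 R (x - x')) * (A * (Num.sqrt a)^-1 ^+ d)) /\
  (forall x, Ls x -> `|window_sum a A x - spread a A x| <= C * (A * (Num.sqrt a)^-1 ^+ d)).
Proof.
have [C C0 hC] := window_lipschitz W Sy0.
exists (C * (1 + 2 * Cc)).
  by rewrite mulr_ge0// addr_ge0// mulr_ge0.
move=> a A A1 aA; set e := A * _.
have s0 := win_s0 A1 aA.
have e0 : 0 <= e by rewrite mulr_ge0 ?exprn_ge0 ?invr_ge0 ?(ltW s0)//; lra.
have sL := full_lattice_subgroup Pa Y y0.
split=> [x x'|x Lx].
  have [c hc [Lc ->]] := spread_pick x; have [c' hc' [Lc' ->]] := spread_pick x'.
  have := hC a A A1 aA _ (sL.2 _ _ Lc Lc') (x - c).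
  have -> : x - c - (x - c - (x' - c')) = x' - c' by rewrite subKr.
  move=> h; apply: le_trans h _; rewrite -/e ler_wpM2r//.
  have h1 : l1 R (x - c - (x' - c')) <= l1 R (x - x') + (l1 R c + l1 R c').
    have -> : x - c - (x' - c') = (x - x') + (- c + c').
      by rewrite opprD opprK addrACA.
    apply: le_trans (l1D _ _ _) _; rewrite lerD2l (le_trans (l1D _ _ _))//.
    by rewrite l1N.
  have := l1_cs hc; have := l1_cs hc' => h2 h3.
  rewrite -mulrA ler_wpM2l//; have := l1_ge0 R (x - x').
  have := mulr_ge0 Cc0 (l1_ge0 R (x - x')); lra.
have [c hc [Lc ->]] := spread_pick x.
have Lc' : Ls c by rewrite -(subKr x c); exact: sL.2.
have := hC a A A1 aA c Lc' x; rewrite -/e => h; apply: le_trans h _.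
rewrite ler_wpM2r// ler_wpM2l//; have := l1_cs hc; have := Cc0; lra.
Qed.

Let LT : R := Num.sqrt (2 * pi / quad Bi m).
Let cB : R := gauss_const Bi.
Let h : R := (size cs)%:R.

(** The transverse Gaussian, with its constant as it comes out of the proof: a
    one-dimensional integral along the drift divided by a d-dimensional one. *)
Definition profile (w : 'cV[R]_d) : R :=
  LT * expR (- (quad (transverse_form m G) w / 2)) / cB.

Ltac cl := clear - R d dO Omega Pa Y t m G B y0 W hd Sy0 pG cs hcs Cc Cc0 l1_cs LT cB h.
Ltac lr := cl; lra.

(** The local limit theorem for the renewal masses. The value [v] of [spread],
    rescaled, is compared with its average over the truncated Gaussian of
    variance [tau = T^2]: [spread] varies slowly at the scale [T]. This
    average is the sum, over the [h] cosets and the times of the window, of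
    smoothed laws of the walk, that is of Gaussians ([smoothed_hit]), and the
    sum over the times is [window_riemann]. The constants are chosen in the
    order [A] (width of the window), [r] (truncation, and ratio [r^2 = s / T]
    of the scales), [s1]. *)
Lemma main_limit (D e : R) : 0 <= D -> 0 < e -> exists2 s1 : R, 1 <= s1 &
  forall a (k : Zd), s1 <= Num.sqrt a ->
  (forall i, `|(k i 0)%:~R - a * m i 0| <= D * Num.sqrt a) -> Ls k ->
  `|renewal k * Num.sqrt a ^+ d
     - h * profile ((Num.sqrt a)^-1 *: (ofZ k - a *: m)) * Num.sqrt a| <= e * Num.sqrt a.
Proof.
move=> D0 e0.
have b0 := drift_gt0; have cB0 : 0 < cB := gauss_const_gt0 (pos_def_inv pG).
have h0 : 0 <= h by exact: ler0n.
have Ccp : 0 <= Cc by exact: Cc0.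
have d0 : (0 : R) <= d%:R by exact: ler0n.
have LT0 : 0 <= LT by exact: sqrtr_ge0.
have [c1 c10 hsums] := hit_sums.
have D10 : 0 <= d%:R * D + Cc by rewrite addr_ge0// mulr_ge0.
have [CT CT0 hCT] := hsums _ D10.
have [CL CL0 hCL] := spread_lipschitz.
have [CE CE0 hCE] := smoothed_hit W.
pose eta := e / 10; have eta0 : 0 < eta by rewrite divr_gt0.
pose etaB := eta * cB; have etaB0 : 0 < etaB by rewrite mulr_gt0.
have [A0 A00 hA0] := window_riemann pG b0 D0 (divr_gt0 etaB0 (ltr_wpDl h0 ltr01)).
have q1 : 0 <= CT / (c1 * eta) by rewrite divr_ge0 ?(ltW CT0)// ltW// mulr_gt0.
pose A := 1 + A0 + CT / (c1 * eta).
have A1 : 1 <= A by rewrite /A; move: A00 q1; lr.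
have AA0 : A0 <= A by rewrite /A; move: A00 q1; lr.
have Ap : 0 < A by move: A1; lr.
have Ap1 : 0 <= A + 1 by move: A1; lr.
have tailA : CT * expR (- (c1 * A)) <= eta.
  have hA : CT / (c1 * eta) <= A by rewrite /A; move: A00 q1; lr.
  rewrite ler_pdivrMr ?mulr_gt0// in hA.
  rewrite expRN ler_pdivrMr ?expR_gt0//; apply: le_trans hA _.
  have := ler_wpM2l (ltW eta0) (expR_ge1Dx (c1 * A)); move: eta0; lr.
pose ms := \sum_i `|m i 0|; have ms0 : 0 <= ms by apply: sumr_ge0.
(* [M] bounds the rescaled distance of [k] from [n *: m] for the times of the window. *)
pose M := D + (A + 1) * ms.
have M0 : 0 <= M by rewrite addr_ge0// mulr_ge0.
have hA4 : 0 <= h * 4 * A by rewrite !mulr_ge0// ltW.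
pose e5 := etaB / (h * 4 * A + 1).
have e50 : 0 < e5 by rewrite divr_gt0// ltr_wpDl.
have [del del0 hdel] := heat_compare pG M0 e50.
pose e2 := Num.min 1 (etaB / (CT + 1)).
have e20 : 0 < e2 by rewrite lt_min ltr01 divr_gt0// addr_gt0.
have e21 : e2 <= 1 by rewrite ge_min lexx.
have e2CT : e2 * CT <= etaB.
  apply: (@le_trans _ _ (e2 * (CT + 1))); first by rewrite ler_wpM2l ?(ltW e20)// lerDl.
  by rewrite -ler_pdivlMr ?addr_gt0// ge_min lexx orbT.
have [r0 [s0 [r00 [s00 hmass]]]] := smoothing_mass W e20.
set g := gvar G; have g0 : 0 < g := gvar_gt0 W.
pose K3b := (cB + 1) * CL * A * d%:R.
pose K3a := (cB + 1) * CL * A * (1 + d%:R).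
have cB1 : 0 <= cB + 1 by rewrite addr_ge0// ltW.
have K3b0 : 0 <= K3b by rewrite !mulr_ge0// ltW.
have K3a0 : 0 <= K3a by rewrite !mulr_ge0 ?(ltW Ap)// addr_ge0.
pose K4a := h * 4 * A * ((d.+1)`!%:R * (2 * g) ^+ d.+1).
have K4a0 : 0 <= K4a by rewrite mulr_ge0// mulr_ge0 ?ler0n// exprn_ge0// mulr_ge0// ltW.
have q2 : 0 < 2 / del by exact: divr_gt0.
have q3 : 0 <= K3b / etaB by rewrite divr_ge0// ltW.
have q4 : 0 <= K4a / etaB by rewrite divr_ge0// ltW.
pose r := 1 + r0 + 2 / del + K3b / etaB + K4a / etaB.
have [r1 rr0 rdel rK3' rK4'] : [/\ 1 <= r, r0 <= r, 2 / del <= r, K3b / etaB <= r & K4a / etaB <= r].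
  rewrite /r; move: (ltW r00) (ltW q2) q3 q4; move: (2 / del) (K3b / etaB) (K4a / etaB); cl; move=> *; split; lra.
have rp : 0 < r := lt_le_trans ltr01 r1.
have rK3 : K3b / r <= etaB by rewrite ler_pdivrMr// mulrC -ler_pdivrMr.
have rK4 : K4a / r <= etaB by rewrite ler_pdivrMr// mulrC -ler_pdivrMr.
pose K4b := h * 4 * A * (2 * CE * (r ^+ 2) ^+ (d + 3)).
have K4b0 : 0 <= K4b by rewrite mulr_ge0// !mulr_ge0// !exprn_ge0// ltW.
pose K2 := CL * A; have K20 : 0 <= K2 by rewrite mulr_ge0// ltW.
have q5 : 0 <= 2 * (A + 1) / del by rewrite divr_ge0 ?(ltW del0)// mulr_ge0.
have q6 : 0 <= (1 + Cc) / del by rewrite divr_ge0 ?(ltW del0)// addr_ge0.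
have q7 : 0 <= K2 / eta by rewrite divr_ge0// ltW.
have q8 : 0 <= K3a / etaB by rewrite divr_ge0// ltW.
have q9 : 0 <= K4b / etaB by rewrite divr_ge0// ltW.
have q10 : 0 <= 2 * h / etaB by rewrite divr_ge0 ?mulr_ge0// ltW.
have q11 : 0 < r ^+ 2 * (1 + s0) by rewrite mulr_gt0 ?exprn_gt0// addr_gt0.
pose s1 := (4 * A + 4) + r ^+ 2 * (1 + s0) + 2 * (A + 1) / del + (1 + Cc) / del
  + K2 / eta + K3a / etaB + K4b / etaB + 2 * h / etaB.
have [s1A s1r s1d1 s1d2] : [/\ 4 * A + 4 <= s1, r ^+ 2 * (1 + s0) <= s1,
    2 * (A + 1) / del <= s1 & (1 + Cc) / del <= s1].
  rewrite /s1; move: q5 q6 q7 q8 q9 q10 (ltW q11) A1.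
  move: (r ^+ 2 * (1 + s0)) (2 * (A + 1) / del) ((1 + Cc) / del) (K2 / eta) (K3a / etaB)
    (K4b / etaB) (2 * h / etaB); cl; move=> *; split; lra.
have [s1K2 s1K3 s1K4 s1h] : [/\ K2 / eta <= s1, K3a / etaB <= s1, K4b / etaB <= s1
    & 2 * h / etaB <= s1].
  rewrite /s1; move: q5 q6 q7 q8 q9 q10 (ltW q11) A1.
  move: (r ^+ 2 * (1 + s0)) (2 * (A + 1) / del) ((1 + Cc) / del) (K2 / eta) (K3a / etaB)
    (K4b / etaB) (2 * h / etaB); cl; move=> *; split; lra.
clear q1 q2 q3 q4 q5 q6 q7 q8 q9 q10 q11; clearbody s1.
exists s1; first by move: s1A A1; lr.
move=> a k; set s := Num.sqrt a => hs hk Lk.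
have aA := le_trans s1A hs; have sr := le_trans s1r hs.
have sdel1 := le_trans s1d1 hs; have sdel2 := le_trans s1d2 hs.
have sK2 : K2 <= eta * s by rewrite [leRHS]mulrC -ler_pdivrMr// (le_trans s1K2).
have sK3 : K3a <= etaB * s by rewrite [leRHS]mulrC -ler_pdivrMr// (le_trans s1K3).
have sK4 : K4b <= etaB * s by rewrite [leRHS]mulrC -ler_pdivrMr// (le_trans s1K4).
have sh : 2 * h <= etaB * s by rewrite [leRHS]mulrC -ler_pdivrMr// (le_trans s1h).
clear s1A s1r s1d1 s1d2 s1K2 s1K3 s1K4 s1h.
have s11 : 1 <= s by move: aA A1; lr.
have sp : 0 < s := lt_le_trans ltr01 s11.
have a0 := win_a0 A1 aA; have ss := win_ss A1 aA; rewrite -/s in ss.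
have a1 : 1 <= a by rewrite -ss; rewrite -?expr2 ?exprn_ege1// mulr_ege1.
clear hs.
pose V := s^-1 ^+ d; have V0 : 0 <= V by rewrite exprn_ge0// invr_ge0 ltW.
have sdV : s ^+ d * V = 1 by rewrite /V -exprMn mulfV ?expr1n// gt_eqF.
have sd0 : 0 < s ^+ d by exact: exprn_gt0.
have [hlip hwin] := hCL a A A1 aA; rewrite -/s -/V in hlip hwin.
have near_c c : c \in cs -> `|nrm R (k - c) - a * mu| <= (d%:R * D + Cc) * s.
  move=> hc; rewrite nrmD nrmN.
  have -> : nrm R k - nrm R c - a * mu = (nrm R k - a * mu) - nrm R c by ring.
  rewrite (le_trans (ler_normB _ _))// mulrDl lerD//.
    by rewrite -mulrA; exact: nrm_dist.
  by rewrite (le_trans (nrm_le_l1 _))// (le_trans (l1_cs hc))// ler_peMr.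
have near_k : `|nrm R k - a * mu| <= (d%:R * D + Cc) * s.
  by rewrite (le_trans (nrm_dist hk))// mulrA [leRHS]mulrDl lerDl mulr_ge0// ltW.
pose v := spread a A k * s ^+ d.
have v_le : `|v| <= CT * s.
  have [c hc [_ ec]] := spread_pick k.
  have w0 : 0 <= window_sum a A (k - c).
    by apply: sumr_ge0 => n _; exact: (hit_ge0 W).
  rewrite /v ec ger0_norm ?mulr_ge0 ?(ltW sd0)// mulrC.
  have := hCT a (k - c) 0 (nhi a A) a1 (lexx 0) (near_c c hc).
  rewrite mulr0 oppr0 expR0 mulr1 mul0r; apply: le_trans.
  rewrite ler_wpM2l ?(ltW sd0)//.
  have /andP[+ _] := window_sub (k - c) (leqnn _) A1 aA.
  rewrite subr_ge0 => h'; apply: le_trans h' _.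
  by rewrite le_eqVlt; apply/orP; left; apply/eqP; apply: eq_bigl => n; rewrite normr_ge0.
(* The decay in [hit_sums] makes the times outside the window negligible. *)
have I1 : `|renewal k * s ^+ d - window_sum a A k * s ^+ d| <= eta * s.
  have hN N : (nhi a A <= N)%N -> \sum_(n < N) hit n k <= window_sum a A k + eta * s * V.
    move=> NN; have /andP[_ h2] := window_sub k NN A1 aA.
    have := hCT a k A N a1 (ltW Ap) near_k; rewrite -/s => h3.
    have h4 : \sum_(n < N | A * s <= `|n%:R - a|) hit n k <= eta * s * V.
      rewrite -(ler_pM2l sd0) (le_trans h3)//.
      have -> : s ^+ d * (eta * s * V) = (s ^+ d * V) * (eta * s) by ring.
      rewrite sdV mul1r; move: (ler_wpM2r (ltW sp) tailA); lr.
    move: h2 h4; lr.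
  have hN' N : \sum_(n < N) hit n k <= window_sum a A k + eta * s * V.
    apply: le_trans (hN (maxn N (nhi a A)) (leq_maxr _ _)).
    rewrite -!(big_mkord xpredT (fun n => hit n k)).
    rewrite [leRHS](big_cat_nat (leq0n N) (leq_maxl _ _))//= lerDl sumr_ge0// => n _.
    exact: (hit_ge0 W).
  have [U1 U2] := renewal_le W hN'.
  have /andP[U3 _] := window_sub k (leqnn _) A1 aA.
  have := U2 (nhi a A) => U4.
  rewrite -mulrBl normrM (gtr0_norm sd0) ger0_norm; last by move: U3 U4; lr.
  have -> : eta * s = (eta * s * V) * s ^+ d.
    by rewrite -mulrA [V * _]mulrC sdV mulr1.
  rewrite ler_pM2r//; move: U1 U3; lr.
have I2 : `|window_sum a A k * s ^+ d - v| <= eta * s.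
  rewrite /v -mulrBl normrM (gtr0_norm sd0).
  apply: le_trans (ler_wpM2r (ltW sd0) (hwin k Lk)) _.
  have -> : CL * (A * V) * s ^+ d = K2 * (s ^+ d * V) by rewrite /K2; ring.
  by rewrite sdV mulr1.
(* [spread] is nearly constant at the scale [T], which is small with respect to
   [s] but still large enough for the Gaussian approximation. *)
pose T := s / r ^+ 2; pose tau := T ^+ 2.
have T1 : 1 + s0 <= T by rewrite /T ler_pdivlMr ?exprn_gt0// mulrC.
have Tp : 0 < T by move: T1 s00; lr.
have sqT : Num.sqrt tau = T by rewrite /tau sqrtr_sqr gtr0_norm.
have tau1 : 1 <= tau by rewrite /tau exprn_ege1//; move: T1 s00; lr.
have tau0 : 0 < tau := lt_le_trans ltr01 tau1.
have s0T : s0 <= Num.sqrt tau by rewrite sqT; move: T1; lr.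
have [N1 hN1] := hmass r tau rr0 s0T.
have [N2 hN2] := hCE tau r tau1 (ltW rp).
pose N := maxn N1 N2.
have {}hN1 := hN1 N (leq_maxl _ _); have {}hN2 := hN2 N (leq_maxr _ _).
set F := \sum_(y <- _ | _) _ in hN1.
have F0 : 0 <= F by apply: sumr_ge0 => y _; exact: gk_ge0.
have F1 : F <= cB + 1 by move: hN1; rewrite -/cB ler_norml => /andP[_]; move: e21; lr.
pose ys : Zd := \col_i Num.floor (tau * m i 0).
have hys i : `|(ys i 0)%:~R - tau * m i 0| <= 1.
  rewrite mxE; have := floor_le (tau * m i 0); have := floorD1_gt (tau * m i 0).
  by rewrite intrD; cl; move=> ? ?; rewrite ler_norml; apply/andP; split; lra.
clearbody ys; pose x := k + ys.
pose Bd := CL * (1 + d%:R * (s / r + 1)) * (A * V).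
have hBd y : in_cube r (gpt tau y) -> `|spread a A (x - y) - spread a A k| <= Bd.
  move=> /forallP hy; apply: le_trans (hlip _ _) _.
  rewrite ler_wpM2r ?mulr_ge0 ?(ltW Ap)// ler_wpM2l// lerD2l.
  have -> : x - y - k = ys - y by rewrite /x addrAC [k + _]addrC addrK.
  rewrite /l1; apply: (@le_trans _ _ (\sum_(i < d) (s / r + 1))); last first.
    by rewrite sumr_const card_ord mulr_natl.
  apply: ler_sum => i _; rewrite intr_norm.
  have -> : ((ys - y) i 0)%:~R = ((ys i 0)%:~R - tau * m i 0) - ((y i 0)%:~R - tau * m i 0) :> R.
    by rewrite !mxE intrD intrN; ring.
  rewrite (le_trans (ler_normB _ _))// addrC lerD//.
  have := hy i; rewrite /gpoint !mxE sqT => hyi.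
  have -> : (y i 0)%:~R - tau * m i 0 = T * ((y i 0)%:~R / T + - T * m i 0).
    by rewrite /tau; field; rewrite gt_eqF.
  rewrite normrM (gtr0_norm Tp).
  have -> : s / r = T * r by rewrite /T; field; rewrite gt_eqF.
  by rewrite ler_wpM2l// ltW.
pose S1 := \sum_(y <- box N d | in_cube r (gpt tau y)) gker tau y * spread a A (x - y).
have J1 : `|S1 - F * spread a A k| <= F * Bd.
  rewrite /S1 /F mulr_suml -sumrB (le_trans (ler_norm_sum _ _ _))// mulr_suml.
  apply: ler_sum => y hy; rewrite -mulrBr normrM (ger0_norm (gk_ge0 _ _ _ _)).
  by rewrite ler_wpM2l ?gk_ge0// hBd.
pose Q c n := \sum_(y <- box N d | in_cube r (gpt tau y)) gker tau y * hit n (x - c - y).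
have S1E : S1 = \sum_(c <- cs) \sum_(nlo a A <= n < nhi a A) Q c n.
  rewrite /S1 /Q.
  under [RHS]eq_bigr do rewrite exchange_big.
  rewrite exchange_big; apply: eq_bigr => y _; rewrite /spread mulr_sumr.
  apply: eq_bigr => c _; rewrite /window_sum mulr_sumr; apply: eq_bigr => n _.
  by rewrite addrAC.
pose w := s^-1 *: (ofZ k - a *: m).
pose gn (n : nat) := gauss Bi (w - ((n%:R - a) / s) *: m).
have hw i : `|w i 0| <= D.
  rewrite !mxE mulrC normrM [X in _ * X]gtr0_norm ?invr_gt0//.
  by rewrite ler_pdivrMr//; exact: hk.
pose E3 := T^-1 ^+ d * expR (- (r ^+ 2 / (2 * g))) + 2 * a * CE * T^-1 ^+ (d + 3).
have Tv0 : 0 <= T^-1 by rewrite invr_ge0 ltW.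
have J2 c n : c \in cs -> (nlo a A <= n < nhi a A)%N -> `|Q c n - V * gn n| <= E3 + e5 * V.
  move=> hc /andP[n1 n2].
  have [lo1 lo2] := win_lo A1 aA n1; have [hi1 hi2] := win_hi A1 aA n2.
  have nA : `|n%:R - a| <= (A + 1) * s.
    rewrite ler_norml; rewrite -/s in lo1 hi1 *; move: lo1 lo2 hi1 hi2 s11; cl; move=> *; apply/andP; split; lra.
  have tn0 : 0 < tau + n%:R by rewrite ltr_wpDr// ler0n.
  have K1 : `|Q c n - gker (tau + n%:R) (x - c)| <= E3.
    apply: le_trans (hN2 n (x - c)) _; rewrite sqT -/g lerD2l.
    rewrite ler_wpM2r ?exprn_ge0// ler_wpM2r//.
  have K2' : `|gker (tau + n%:R) (x - c) - V * gn n| <= e5 * V.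
    rewrite /gk (_ : ofZ (x - c) - (tau + n%:R) *: m =
      s *: (w - ((n%:R - a) / s) *: m + s^-1 *: (ofZ (ys - c) - tau *: m))); last first.
      apply/colP => i; rewrite /x !mxE !intrD !intrN.
      by field; rewrite gt_eqF.
    apply: hdel => //.
    - have -> : (tau + n%:R) / s ^+ 2 - 1 = (r ^+ 2)^-1 ^+ 2 + (n%:R - a) / s / s.
        by rewrite /tau /T -ss; field; rewrite !gt_eqF.
      have u1 : `|(r ^+ 2)^-1 ^+ 2| <= del / 2.
        rewrite ger0_norm ?exprn_ge0 ?invr_ge0 ?exprn_ge0 ?(ltW rp)//.
        apply: (@le_trans _ _ r^-1).
          rewrite -exprVn -exprM -[leRHS]expr1; apply: ler_wiXn2l => //.
            by rewrite invr_ge0 ltW.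
          by rewrite invf_le1.
        rewrite -[leRHS]invrK lef_pV2 ?posrE ?invr_gt0 ?divr_gt0//.
        by rewrite invf_div.
      have u2 : `|(n%:R - a) / s / s| <= del / 2.
        rewrite !normrM [ `|s^-1| ]gtr0_norm ?invr_gt0//.
        rewrite ler_pdivrMr//; apply: (@le_trans _ _ (A + 1)); first by rewrite ler_pdivrMr.
        by move: sdel1; rewrite ler_pdivrMr//; lr.
      rewrite (le_trans (ler_normD _ _))//; move: u1 u2; lr.
    - move=> i; rewrite !mxE -/(w i 0) (le_trans (ler_normB _ _))// lerD ?hw//.
        by have := hw i; rewrite !mxE.
      rewrite normrM ler_pM//.
        rewrite normrM [X in _ * X]gtr0_norm ?invr_gt0// ler_pdivrMr//.
      by rewrite /ms (bigD1 i)//= lerDl sumr_ge0.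
    - move=> i; rewrite [X in `|X|](_ : _ = s^-1 * ((ys i 0)%:~R - tau * m i 0 - (c i 0)%:~R)); last first.
        by rewrite !mxE intrD intrN; ring.
      rewrite normrM [ `|s^-1| ]gtr0_norm ?invr_gt0// mulrC ler_pdivrMr//.
      apply: (@le_trans _ _ (1 + Cc)); last first.
        by move: sdel2; rewrite ler_pdivrMr// mulrC.
      rewrite (le_trans (ler_normB _ _))// lerD ?hys// -intr_norm.
      exact: le_trans (coord_le_l1 R c i) (l1_cs hc).
  have -> : Q c n - V * gn n =
    (Q c n - gker (tau + n%:R) (x - c)) + (gker (tau + n%:R) (x - c) - V * gn n) by ring.
  by rewrite (le_trans (ler_normD _ _))// lerD.
pose GS := \sum_(nlo a A <= n < nhi a A) gn n.
have E30 : 0 <= E3.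
  apply: addr_ge0; first by rewrite mulr_ge0 ?expR_ge0// exprn_ge0.
  by rewrite !mulr_ge0 ?exprn_ge0// ltW.
have EV0 : 0 <= E3 + e5 * V by rewrite addr_ge0// mulr_ge0// ltW.
have J3 : `|S1 - h * (V * GS)| <= h * ((4 * A * s) * (E3 + e5 * V)).
  have -> : h * (V * GS) = \sum_(c <- cs) \sum_(nlo a A <= n < nhi a A) V * gn n.
    by rewrite big_const_seq count_predT -Monoid.iteropE /GS mulr_sumr /h mulr_natl.
  have -> : h * ((4 * A * s) * (E3 + e5 * V)) = \sum_(c <- cs) ((4 * A * s) * (E3 + e5 * V)).
    by rewrite big_const_seq count_predT -Monoid.iteropE /h mulr_natl.
  rewrite S1E -sumrB (le_trans (ler_norm_sum _ _ _))// big_seq [leRHS]big_seq.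
  apply: ler_sum => c hc; rewrite -sumrB (le_trans (ler_norm_sum _ _ _))//.
  apply: (@le_trans _ _ (\sum_(nlo a A <= n < nhi a A) (E3 + e5 * V))).
    rewrite big_nat [leRHS]big_nat; apply: ler_sum => n hn; exact: J2.
  rewrite sumr_const_nat -[leLHS]mulr_natl ler_wpM2r//; exact: win_size A1 aA.
have J4 := hA0 a A w A1 AA0 aA hw; rewrite -/s -/LT -/GS in J4.
set Ew := expR _ in J4.
have I3 : `|F * v - h * (s * (LT * Ew))| <= 7 * etaB * s.
  have -> : F * v - h * (s * (LT * Ew)) =
    - (S1 - F * spread a A k) * s ^+ d + (S1 - h * (V * GS)) * s ^+ d
    + h * (GS - s * (LT * Ew)) + h * GS * (s ^+ d * V - 1).
    by rewrite /v; ring.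
  rewrite sdV subrr mulr0 addr0.
  have L1 : `|- (S1 - F * spread a A k) * s ^+ d| <= 2 * (etaB * s).
    rewrite normrM normrN (gtr0_norm sd0).
    apply: le_trans (ler_wpM2r (ltW sd0) J1) _.
    have -> : F * Bd * s ^+ d = F * (CL * (1 + d%:R * (s / r + 1)) * A) * (s ^+ d * V).
      by rewrite /Bd; ring.
    rewrite sdV mulr1.
    have sr0 : 0 <= s / r by rewrite divr_ge0// ltW.
    apply: (@le_trans _ _ ((cB + 1) * (CL * (1 + d%:R * (s / r + 1)) * A))).
      rewrite ler_wpM2r// !mulr_ge0 ?(ltW Ap)//; apply: addr_ge0 => //.
      by rewrite mulr_ge0// addr_ge0.
    have -> : (cB + 1) * (CL * (1 + d%:R * (s / r + 1)) * A) = K3a + (K3b / r) * s.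
      by rewrite /K3a /K3b; ring.
    move: (ler_wpM2r (ltW sp) rK3) sK3; lr.
  have L2 : `|(S1 - h * (V * GS)) * s ^+ d| <= 3 * (etaB * s).
    rewrite normrM (gtr0_norm sd0).
    apply: le_trans (ler_wpM2r (ltW sd0) J3) _.
    have rT : s * T^-1 = r ^+ 2 by rewrite /T; field; rewrite !gt_eqF.
    have a1' : s ^+ d * T^-1 ^+ d = (r ^+ 2) ^+ d by rewrite -exprMn rT.
    have a2 : s ^+ d * (2 * a * CE * T^-1 ^+ (d + 3)) = 2 * CE * (r ^+ 2) ^+ (d + 3) / s.
      have -> : (r ^+ 2) ^+ (d + 3) = s ^+ (d + 3) * T^-1 ^+ (d + 3) by rewrite -exprMn rT.
      move: (T^-1 ^+ (d + 3)) => z; rewrite -ss [s ^+ (d + 3)]exprD; field; by rewrite gt_eqF.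
    have -> : h * (4 * A * s * (E3 + e5 * V)) * s ^+ d =
      h * 4 * A * s * ((s ^+ d * T^-1 ^+ d) * expR (- (r ^+ 2 / (2 * g)))
         + s ^+ d * (2 * a * CE * T^-1 ^+ (d + 3)) + e5 * (s ^+ d * V)).
      by rewrite /E3; ring.
    rewrite a1' a2 sdV mulr1.
    have x0 : 0 <= r ^+ 2 / (2 * g) by rewrite divr_ge0 ?exprn_ge0 ?(ltW rp)// mulr_ge0// ltW.
    have b1 : (r ^+ 2) ^+ d * expR (- (r ^+ 2 / (2 * g))) <= (d.+1)`!%:R * (2 * g) ^+ d.+1 / r.
      have := pow_le_exp d x0; rewrite expr_div_n => hx.
      have g2 : 0 < (2 * g) ^+ d.+1 by rewrite exprn_gt0// mulr_gt0.
      rewrite expRN ler_pdivrMr ?expR_gt0//.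
      rewrite ler_pdivrMr// in hx.
      rewrite -(ler_pM2r rp).
      have -> : (d.+1)`!%:R * (2 * g) ^+ d.+1 / r * expR (r ^+ 2 / (2 * g)) * r =
         (d.+1)`!%:R * expR (r ^+ 2 / (2 * g)) * (2 * g) ^+ d.+1.
        by set f : R := _`!%:R; set ex := expR _; field; rewrite gt_eqF.
      apply: le_trans hx; rewrite [(r ^+ 2) ^+ d.+1]exprSr ler_wpM2l ?exprn_ge0 ?(ltW rp)//.
      by rewrite expr2 ler_peMr// ltW.
    have b2 := ler_wpM2l (mulr_ge0 hA4 (ltW sp)) b1.
    have b3 : h * 4 * A * s * ((d.+1)`!%:R * (2 * g) ^+ d.+1 / r) = (K4a / r) * s.
      by rewrite /K4a; ring.
    have b4 : h * 4 * A * s * (2 * CE * (r ^+ 2) ^+ (d + 3) / s) = K4b.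
      by rewrite /K4b; field; rewrite gt_eqF.
    have b5 : h * 4 * A * s * e5 <= etaB * s.
      rewrite mulrAC ler_wpM2r ?(ltW sp)// /e5 mulrA ler_pdivrMr ?ltr_wpDl//.
      by rewrite mulrC ler_wpM2l ?(ltW etaB0)// lerDl.
    have b6 := ler_wpM2r (ltW sp) rK4.
    rewrite b3 in b2; rewrite 2!(mulrDr (h * 4 * A * s)); rewrite b4; move: b2 b5 b6 sK4; lr.
  have L3 : `|h * (GS - s * (LT * Ew))| <= 2 * (etaB * s).
    rewrite normrM (ger0_norm h0); apply: le_trans (ler_wpM2l h0 J4) _.
    have : h * (etaB / (h + 1)) <= etaB.
      by rewrite mulrA ler_pdivrMr ?ltr_wpDl// mulrC ler_wpM2l ?(ltW etaB0)// lerDl.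
    move=> /(ler_wpM2r (ltW sp)); rewrite mulrDr; move: sh; lr.
  apply: le_trans (ler_normD _ _) _.
  move: (lerD (le_trans (ler_normD _ _) (lerD L1 L2)) L3); lr.
have I4 : `|cB * v - h * (s * (LT * Ew))| <= 8 * etaB * s.
  have -> : cB * v - h * (s * (LT * Ew)) =
    (F * v - h * (s * (LT * Ew))) - (F - cB) * v by ring.
  have u1 : `|(F - cB) * v| <= etaB * s.
    rewrite normrM; apply: (@le_trans _ _ (e2 * (CT * s))); first by rewrite ler_pM.
    by rewrite mulrA ler_wpM2r// ltW.
  apply: le_trans (ler_normB _ _) _; move: I3 u1; lr.
have I5 : `|v - h * profile w * s| <= 8 * eta * s.
  have -> : v - h * profile w * s = (cB * v - h * (s * (LT * Ew))) / cB.
    by rewrite /profile -/Ew; field; rewrite gt_eqF.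
  rewrite normrM [X in _ * X]gtr0_norm ?invr_gt0// ler_pdivrMr//.
  by apply: le_trans I4 _; rewrite /etaB; lr.
have -> : renewal k * s ^+ d - h * profile w * s =
  (renewal k * s ^+ d - window_sum a A k * s ^+ d) + (window_sum a A k * s ^+ d - v)
   + (v - h * profile w * s) by ring.
apply: le_trans (ler_normD _ _) _.
apply: le_trans (lerD (le_trans (ler_normD _ _) (lerD I1 I2)) I5) _.
by rewrite /eta; lr.
Qed.

End local_limit.

(** * From cycles to the convolution iterates *)

Section renewal_masses.
Local Open Scope ereal_scope.
Context (R : realType) (d : nat) (dO : measure_display)
  (Omega : measurableType dO) (Pa : probability Omega R).
Variable Y : nat -> Omega -> 'cV[nat]_d.
Notation Nd := 'cV[nat]_d.
Notation Zd := 'cV[int]_d.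
Hypothesis mY : forall n y, measurable (Y n @^-1` [set y]).
Hypothesis mC : forall n v, measurable [set w | psum Y n w = v].
Hypothesis hY : forall n (j k : Nd),
  Pa ([set w | psum Y n w = j] `&` [set w | psum Y n.+1 w = j + k]%R) =
  Pa [set w | psum Y n w = j] * Pa (Y 1%N @^-1` [set k]).
Notation hit := (hit Pa (Y 1%N)).

Lemma hitS n x : hit n.+1 x = Ex Pa (Y 1%N) (fun y => hit n (x - toZ y)%R).
Proof. by []. Qed.

Lemma toZ_inj : injective (@toZ d).
Proof.
move=> k l /matrixP h; apply/matrixP => i j.
by have := h i j; rewrite !mxE => -[].
Qed.

Lemma toZ_sub (k y : Nd) : leNd y k -> (toZ k - toZ y = toZ (subNd k y))%R.
Proof.
move=> /forallP h; apply/colP => i; rewrite /toZ /subNd !mxE.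
by rewrite subzn ?h.
Qed.

Lemma hit_out n (x : Zd) : ~~ [forall i, (0 <= x i ord0)%R] -> hit n x = 0%R.
Proof.
elim: n x => [|n IH] x /forallPn[i xi].
  rewrite /hit /= /delta0; case: eqP => // x0.
  by move: xi; rewrite x0 mxE lexx.
rewrite hitS /Ex (_ : (fun w => _) = cst 0%R); first by rewrite /Rintegral integral0_eq.
apply/funext => w /=; apply: IH; apply/forallPn; exists i.
rewrite -ltNge (le_lt_trans _ (_ : x i ord0 < 0)%R) ?ltNge//.
by rewrite !mxE lerBlDr lerDl.
Qed.

(** Both sides satisfy the same recursion, the left one by definition and the
    right one because the next cycle is independent of the previous ones. *)
Lemma hit_law n (k : Nd) : (hit n (toZ k))%:E = Pa [set w | psum Y n w = k].
Proof.
elim: n k => [|n IH] k.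
  rewrite /hit /= /delta0 (_ : (toZ k == 0%R) = (k == 0%R)); last first.
    have -> : 0%R = toZ (0%R : Nd) by apply/colP => i; rewrite !mxE.
    exact: (inj_eq toZ_inj).
  case: eqP => [->|k0].
    by rewrite (_ : mkset _ = setT) ?probability_setT//; apply/seteqP; split => w //= _; exact: psum0.
  by rewrite (_ : mkset _ = set0) ?measure0//; apply/seteqP; split => w //=; rewrite psum0 => /esym.
pose g (t : Nd) := hit n (toZ k - toZ t)%R.
have gE t : (g t)%:E = if leNd t k then Pa [set w | psum Y n w = subNd k t] else 0.
  case: ifPn => tk; first by rewrite -IH /g toZ_sub.
  rewrite /g hit_out//; move: tk => /forallPn[i ti]; apply/forallPn; exists i.
  by rewrite !mxE subr_ge0 lez_nat.
have g0 t : (0 <= g t)%R by rewrite -lee_fin gE; case: ifP.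
suff h : \int[Pa]_w (g (Y 1%N w))%:E = Pa [set w | psum Y n.+1 w = k].
  by rewrite hitS /Ex /Rintegral -[X in fine X]/(\int[Pa]_w (g (Y 1%N w))%:E) h fineK// fin_num_measure.
rewrite (integral_discrete Pa (mY 1%N) g0) (measure_split Pa (mY n.+1) (mC n.+1 k)).
apply: eq_eseriesr => i _; case: choice.pickle_inv => // t.
rewrite gE; case: ifPn => tk.
  rewrite -hY addrC subNdK//; congr (Pa _); apply/seteqP; split => w [/= h1 h2].
    split=> //=; apply: (@addNd_inj d (subNd k t)) => /=.
    by rewrite -{1}h1 -psumS h2 addrC subNdK.
  split=> //=; move: h1; rewrite psumS h2 addrC.
  by move=> /(congr1 (fun v => subNd v t)); rewrite addNdK.
rewrite mul0e (_ : _ `&` _ = set0) ?measure0//; apply/seteqP; split => w //= [h1 h2].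
by move/negP: tk; apply; rewrite -h2 -h1 psumS addrC; exact: leNd_addr.
Qed.

Lemma renewal_massE (v : Zd) : renewal_mass Pa Y v = renewal Pa (Y 1%N) v.
Proof.
rewrite /renewal_mass /renewal; case: ifPn => hv; last first.
  by rewrite eseries0// => n _ _; rewrite hit_out.
congr fine; apply: eq_eseriesr => n _.
pose k : Nd := map_mx absz v.
have vk : v = toZ k.
  by apply/colP => i; rewrite !mxE gez0_abs//; exact: (forallP hv i).
rewrite vk hit_law; congr (Pa _); apply/seteqP; split => w /= h.
  exact: toZ_inj.
by rewrite h.
Qed.

End renewal_masses.

(** * Finite sums of masses of a signed measure *)

Section charges.
Context (R : realType) (d : nat) (r : {charge set 'cV[nat]_d -> \bar R}).
Notation Nd := 'cV[nat]_d.

Definition first_points n : seq Nd := pmap (@choice.pickle_inv Nd) (iota 0 n).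

Lemma first_points_uniq n : uniq (first_points n).
Proof.
apply: (@pmap_uniq _ _ (@choice.pickle_inv Nd) choice.pickle); first exact: choice.pickle_invK.
exact: iota_uniq.
Qed.

Lemma first_pointsS n : first_points n.+1 =
  first_points n ++ (if choice.pickle_inv n is Some u then [:: u] else [::]).
Proof.
rewrite /first_points -[n.+1]addn1 iotaD pmap_cat add0n /=.
by case: choice.pickle_inv.
Qed.

Lemma mem_first_points n u : (choice.pickle u < n)%N -> u \in first_points n.
Proof.
move=> h; rewrite mem_pmap; apply/mapP; exists (choice.pickle u).
  by rewrite mem_iota.
by rewrite choice.pickleK_inv.
Qed.

(** The value of a signed measure on an infinite set is approximated by finite
    sums of masses; the list can be enlarged at will. *)
Lemma charge_approx (B : set Nd) (L : seq Nd) (e : R) : 0 < e ->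
  exists us : seq Nd, [/\ uniq us, {subset L <= us} &
    `|fine (r B) - \sum_(u <- us | u \in B) mass r u| <= e].
Proof.
move=> e0; pose F := opt_set (fun u : Nd => if u \in B then [set u] else set0).
have tF : trivIset setT F.
  by apply: (@trivIset_opt Nd Nd id) => u v; case: ifP.
have UF : \bigcup_i F i = B.
  rewrite -bigcup_opt; apply/seteqP; split => [u [v _]|u Bu].
    by case: ifP => // /set_mem Bv ->.
  by exists u => //; rewrite mem_set.
have fin A : r A \is a fin_num by exact: fin_num_measure.
have sumF n : (\sum_(0 <= i < n) r (F i))%E = (\sum_(u <- first_points n | u \in B) mass r u)%:E.
  elim: n => [|n IH]; first by rewrite big_geq// big_nil.
  rewrite big_nat_recr //= IH first_pointsS big_cat /= EFinD; congr (_ + _)%E.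
  rewrite /F /opt_set; case: choice.pickle_inv => [u|]; last by rewrite big_nil charge0.
  rewrite big_cons big_nil; case: ifP => _; last by rewrite charge0.
  by rewrite addr0 /mass fineK.
have := @charge_semi_sigma_additive _ _ _ r F (fun _ => I) tF I.
rewrite UF -[r B]fineK//.
rewrite (_ : (fun n => _) = (fun n => (\sum_(u <- first_points n | u \in B) mass r u)%:E)); last first.
  by apply/funext => n; exact: sumF.
move=> /fine_cvg /cvgrPdist_le /(_ e e0) [N _ hN].
pose n := maxn N (\max_(u <- L) (choice.pickle u).+1).
exists (first_points n); split; first exact: first_points_uniq.
  move=> u uL; apply: mem_first_points; rewrite /n leq_max; apply/orP; right.
  exact: (@leq_bigmax_seq _ L xpredT (fun u => (choice.pickle u).+1) u).
by apply: (hN n); rewrite /= leq_maxl.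
Qed.

Lemma exp_summable_sum : exp_summable r -> exists2 eta : R, 0 < eta &
  exists2 M : R, 0 <= M & forall us : seq Nd, uniq us ->
    \sum_(u <- us) expR (eta * (norm1 u)%:R) * `|mass r u| <= M.
Proof.
move=> [eta eta0]; set E := esum _ _ => Efin; exists eta => //.
have E0 : (0 <= E)%E.
  by apply: esum_ge0 => u _; rewrite lee_fin mulr_ge0 ?expR_ge0.
exists (fine E); first exact: fine_ge0.
move=> us uus; rewrite -lee_fin fineK; last by rewrite ge0_fin_numE.
apply: esum_ge; exists [set` us]; first by split => //; exact: finite_seq.
by rewrite -fsbig_seq// -sumEFin.
Qed.

End charges.

(** * Convolution with a signed measure *)

Section convolution.
Context (R : realType) (d : nat) (dO : measure_display)
  (Omega : measurableType dO) (Pa : probability Omega R).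
Variables (Y : Omega -> 'cV[nat]_d) (t : R) (m : 'cV[R]_d) (G : 'M[R]_d)
  (B : 'M[int]_d) (y0 : 'cV[nat]_d).
Hypothesis W : nice_walk Pa Y t m G B.
Hypothesis hd : (0 < d)%N.
Hypothesis Sy0 : supp Pa Y y0.
Notation Nd := 'cV[nat]_d.
Notation Zd := 'cV[int]_d.
Notation Ls := (full_lattice (supp Pa Y) y0).
Notation renewal := (renewal Pa Y).
Notation profile := (profile m G).
Notation Bi := (invmx G).
Notation Tr := (transverse_form m G).
Notation mu := (mu1 Pa Y).
Let pG := nw_def W.
Let b0 : 0 < quad Bi m := drift_gt0 W hd.

Lemma quad_transverse_ge0 w : 0 <= quad Tr w.
Proof.
rewrite (quad_transverse pG)// subr_ge0 ler_pdivrMr//.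
exact: bil_cauchy (pos_def_inv pG) _ _.
Qed.

Let P0 : R := Num.sqrt (2 * pi / quad Bi m) / gauss_const Bi.
Let P00 : 0 <= P0.
Proof. by rewrite divr_ge0 ?sqrtr_ge0. Qed.

Lemma profileE w : profile w = P0 * expR (- (quad Tr w / 2)).
Proof. by rewrite /profile /P0; ring. Qed.

Lemma profile_bound w : 0 <= profile w <= P0.
Proof.
rewrite profileE mulr_ge0 ?expR_ge0//= ler_piMr// -[leRHS](@expR0 R) ler_expR oppr_le0.
by rewrite divr_ge0 ?quad_transverse_ge0.
Qed.

Lemma profile_lip (D : R) : 0 <= D -> exists2 C : R, 0 <= C &
  forall (w w' : 'cV[R]_d) (del : R), (forall i, `|w i 0| <= D) ->
  (forall i, `|w' i 0| <= D) -> (forall i, `|w i 0 - w' i 0| <= del) ->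
  `|profile w - profile w'| <= C * del.
Proof.
move=> D0; have [c c0 hc] := bil_bound Tr.
exists (P0 * (c * D)); first exact: mulr_ge0 P00 (mulr_ge0 c0 D0).
move=> w w' del hw hw' hd'; rewrite !profileE -mulrBr normrM (ger0_norm P00) -mulrA ler_wpM2l//.
apply: le_trans (expRN_lip _ _) _; rewrite ?divr_ge0 ?quad_transverse_ge0//.
have -> : quad Tr w / 2 - quad Tr w' / 2 = (bil Tr (w - w') w + bil Tr w' (w - w')) / 2.
  rewrite !quadE !bil_sum -mulrBl; congr (_ / 2); rewrite -sumrB -big_split.
  apply: eq_bigr => i _ /=; rewrite -sumrB -big_split; apply: eq_bigr => j _ /=.
  by rewrite !mxE; ring.
have e w1 : (w - w') w1 0 = w w1 0 - w' w1 0 by rewrite !mxE.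
have h1 : `|bil Tr (w - w') w| <= c * del * D.
  by apply: hc => // i; rewrite e.
have h2 : `|bil Tr w' (w - w')| <= c * D * del.
  by apply: hc => // i; rewrite e.
rewrite normrM [ `|2^-1| ]gtr0_norm ?invr_gt0// ler_pdivrMr//.
apply: le_trans (ler_normD _ _) _; apply: le_trans (lerD h1 h2) _; lra.
Qed.

Lemma renewal_out (x : Zd) : ~~ [forall i, 0 <= x i ord0] -> renewal x = 0.
Proof. by move=> hx; rewrite /renewal eseries0// => n _ _; rewrite hit_out. Qed.

(** [hit_sums] with [A = 0], at the time at which the walk reaches the height
    of [x]; for the points below the height of one step that time is taken to
    be 1. *)
Lemma renewal_bounded : exists2 C : R, 0 < C & forall x, 0 <= renewal x <= C.
Proof.
have mu0 := mu_gt0 W hd.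
have [c c0 h] := hit_sums W hd; have [C C0 hC] := h mu (ltW mu0).
exists C => // x.
case: (boolP [forall i, 0 <= x i ord0]) => hx; last by rewrite renewal_out// lexx ltW.
have n0 : 0 <= nrm R x.
  by apply: sumr_ge0 => i _; rewrite ler0z; exact: (forallP hx i).
(* The maximum with 1 keeps the hypothesis [1 <= a] of [hit_sums]; the height of [x] is then off by at most [mu]. *)
pose a := Num.max 1 (nrm R x / mu).
have a1 : 1 <= a by rewrite le_max lexx.
have s1 : 1 <= Num.sqrt a by rewrite -(@sqrtr1 R) ler_wsqrtr.
have s0 : 0 < Num.sqrt a := lt_le_trans ltr01 s1.
have hx' : `|nrm R x - a * mu| <= mu * Num.sqrt a.
  rewrite /a; have [l|g] := leP (nrm R x / mu) 1.
    rewrite sqrtr1 mulr1 mul1r ler_pdivrMr// mul1r in l *.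
    by rewrite ler0_norm ?subr_le0// opprB lerBlDr lerDl.
  by rewrite mulfVK ?gt_eqF// subrr normr0 mulr_ge0 ?sqrtr_ge0 ?ltW.
have hN N : \sum_(n < N) hit Pa Y n x <= C.
  have := hC a x 0 N a1 (lexx 0) hx'.
  rewrite mulr0 oppr0 expR0 mulr1 mul0r => h1.
  have e : \sum_(n < N | 0 <= `|n%:R - a|) hit Pa Y n x = \sum_(n < N) hit Pa Y n x.
    by apply: eq_bigl => n; rewrite normr_ge0.
  rewrite e in h1; have S0 : 0 <= \sum_(n < N) hit Pa Y n x.
    by apply: sumr_ge0 => n _; exact: (hit_ge0 W).
  rewrite -(ler_pM2l s0) [leRHS]mulrC; apply: le_trans h1.
  by rewrite ler_wpM2r// ler_eXnr.
have [h1 h2] := renewal_le W hN.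
by have := h2 0%N; rewrite big_ord0 => ->.
Qed.

Variable cs : seq Zd.
Hypothesis hcs : forall x, exists2 i, (i < size cs)%N /\ Ls (x - cs`_i) &
    forall j, (j < size cs)%N -> Ls (x - cs`_j) -> j = i.
Let h : R := (size cs)%:R.
Let h0 : 0 <= h. Proof. exact: ler0n. Qed.
Notation point a k := ((Num.sqrt a)^-1 *: (ofZ R k - a *: m)).

(** [main_limit] for the points [k - u], all compared with the profile at [k],
    which varies little at this scale. *)
Lemma limit_nearby (D e : R) : 0 <= D -> 0 < e -> exists2 del : R, 0 < del &
  exists2 s1 : R, 1 <= s1 & forall a (k : Zd) (u : Nd), s1 <= Num.sqrt a ->
  (forall i, `|(k i 0)%:~R - a * m i 0| <= D * Num.sqrt a) ->
  (norm1 u)%:R <= del * Num.sqrt a -> Ls (k - toZ u) ->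
  `|renewal (k - toZ u) * Num.sqrt a ^+ d.-1 - h * profile (point a k)| <= e.
Proof.
move=> D0 e0; have D1 : 0 <= D + 1 by rewrite addr_ge0.
have [Cp Cp0 hCp] := profile_lip D1.
have e2 : 0 < e / 2 by rewrite divr_gt0.
have hC1 : 0 < h * Cp + 1 by rewrite ltr_wpDl// mulr_ge0.
pose del := Num.min 1 (e / 2 / (h * Cp + 1)).
have del0 : 0 < del by rewrite lt_min ltr01 divr_gt0.
have del1 : del <= 1 by rewrite ge_min lexx.
have delC : h * Cp * del <= e / 2.
  have : del <= e / 2 / (h * Cp + 1) by rewrite ge_min lexx orbT.
  rewrite ler_pdivlMr// mulrDr mulr1 mulrC => /(le_trans _); apply.
  by rewrite lerDl ltW.
exists del => //; have [s1 s11 hs1] := main_limit W hd Sy0 hcs D1 e2.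
exists s1 => // a k u hs hk hu Lk; set s := Num.sqrt a in hs hk hu *.
have s0 : 0 < s := lt_le_trans ltr01 (le_trans s11 hs).
have ui i : ((u i 0)%:R : R) <= del * s.
  by apply: le_trans hu; rewrite ler_nat /norm1 (bigD1 i)//= leq_addr.
have kE i : ((k - toZ u) i 0)%:~R = (k i 0)%:~R - (u i 0)%:R :> R.
  by rewrite /toZ !mxE intrB.
have hk' i : `|((k - toZ u) i 0)%:~R - a * m i 0| <= (D + 1) * s.
  rewrite kE addrAC (le_trans (ler_normB _ _))// mulrDl mul1r lerD//.
  by rewrite ger0_norm// (le_trans (ui i))// -[leRHS]mul1r ler_wpM2r// ltW.
have := hs1 a (k - toZ u) hs hk' Lk; rewrite -/s -/h.
have sd : s ^+ d = s ^+ d.-1 * s by rewrite -exprSr prednK.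
rewrite sd mulrA -mulrBl normrM (gtr0_norm s0) ler_pM2r// => h1.
have hp : `|profile (point a (k - toZ u)) - profile (point a k)| <= Cp * del.
  have bd (w : Zd) (i : 'I_d) D' : `|(w i 0)%:~R - a * m i 0| <= D' * s -> `|(point a w) i 0| <= D'.
    move=> hw; rewrite !mxE -/s mulrC normrM [X in _ * X]gtr0_norm ?invr_gt0//.
    by rewrite ler_pdivrMr.
  apply: hCp => i.
  - exact: bd (hk' i).
  - by apply: bd; rewrite (le_trans (hk i))// ler_wpM2r ?(ltW s0)// lerDl.
  - have -> : (point a (k - toZ u)) i 0 - (point a k) i 0 = - ((u i 0)%:R / s).
      by rewrite !mxE -/s intrD intrN -[(Posz _)%:~R]/((u i 0)%:R : R); ring.
    by rewrite normrN ger0_norm ?divr_ge0 ?(ltW s0)// ler_pdivrMr.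
have hp2 : `|h * profile (point a (k - toZ u)) - h * profile (point a k)| <= e / 2.
  rewrite -mulrBr normrM (ger0_norm h0); apply: le_trans delC.
  by rewrite -mulrA ler_wpM2l.
set p := h * profile _ in h1 hp2; set p' := h * profile _ in hp2 *.
have -> : renewal (k - toZ u) * s ^+ d.-1 - p' =
  (renewal (k - toZ u) * s ^+ d.-1 - p) + (p - p') by ring.
by rewrite (le_trans (ler_normD _ _))// [leRHS]splitr lerD.
Qed.

Lemma exp_tail (c K e : R) : 0 < c -> 0 <= K -> 0 < e -> exists2 s1 : R, 1 <= s1 &
  forall s, s1 <= s -> K * s ^+ d.-1 * expR (- (c * s)) <= e.
Proof.
move=> c0 K0 e0; pose f : R := d`!%:R / c ^+ d.
have f0 : 0 <= f by rewrite divr_ge0// exprn_ge0// ltW.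
exists (Num.max 1 (K * f / e)) => [|s]; first by rewrite le_max lexx.
rewrite ge_max => /andP[s1 sK]; have s0 : 0 < s := lt_le_trans ltr01 s1.
have cs0 : 0 <= c * s by rewrite mulr_ge0 ?ltW.
have := pow_le_exp d.-1 cs0; rewrite prednK// => hx.
have ed : s ^+ d.-1 * expR (- (c * s)) <= f / s.
  rewrite expRN ler_pdivrMr ?expR_gt0// -(ler_pM2l s0) -exprS prednK//.
  have cd0 : 0 < c ^+ d by exact: exprn_gt0.
  move: hx; rewrite exprMn /f; set E := expR _; set g : R := _`!%:R => hx.
  have -> : s * (g / c ^+ d / s * E) = g * E / c ^+ d by field; rewrite !gt_eqF.
  by rewrite ler_pdivlMr// mulrC.
rewrite -mulrA (le_trans (ler_wpM2l K0 ed))// mulrA ler_pdivrMr// [leRHS]mulrC.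
by rewrite -ler_pdivrMr.
Qed.

Variable r : {charge set Nd -> \bar R}.

Lemma vectors_below (k : Nd) : exists L : seq Nd, forall u, leNd u k -> u \in L.
Proof.
pose N := norm1 k.
exists [seq (\col_i (f i : nat) : Nd) | f : {ffun 'I_d -> 'I_N.+1}] => u /forallP hu.
have uN i : (u i 0%R < N.+1)%N.
  by rewrite ltnS (leq_trans (hu i))// /N /norm1 (bigD1 i)//= leq_addr.
apply/mapP; exists [ffun i => Ordinal (uN i)]; first by rewrite mem_enum.
by apply/colP => i; rewrite mxE ffunE.
Qed.

(** Each mass of [r] contributes its share of the limit. For [u] small with
    respect to [sqrt a] this is [limit_nearby], or both terms vanish if [k -
    u] is not in the lattice. The other points carry an exponentially small
    part of [r], which beats the power of [a] that multiplies the bounded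
    renewal masses. *)
Lemma convolution_limit (D e : R) : exp_summable r -> 0 <= D -> 0 < e ->
  exists2 s1 : R, 1 <= s1 & forall a (k : Nd), s1 <= Num.sqrt a ->
  (forall i, `|(k i 0)%:R - a * m i 0| <= D * Num.sqrt a) ->
  `|Num.sqrt a ^+ d.-1 * (\sum_(u \in [set: Nd]) renewal (toZ k - toZ u) * mass r u)
     - class_mass Ls r (coset_class Ls (toZ k)) * (h * profile (point a (toZ k)))| <= e.
Proof.
move=> /exp_summable_sum [eta eta0 [M M0 hM]] D0 e0.
have [C C0 hC] := renewal_bounded.
pose H := h * P0; have H0 : 0 <= H by exact: mulr_ge0.
have M1 : 0 < M + 1 by rewrite ltr_wpDl.
have e1 : 0 < e / (3 * (M + 1)) by rewrite divr_gt0// mulr_gt0.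
have [del del0 [s1 s11 hs1]] := limit_nearby D0 e1.
have CH : 0 <= C + H by rewrite addr_ge0// ltW.
have [s2 s21 hs2] := exp_tail (mulr_gt0 eta0 del0) CH e1.
exists (Num.max s1 s2); first by rewrite le_max s11.
move=> a k; set s := Num.sqrt a; rewrite ge_max => /andP[hss1 hss2] hk.
have s0 : 0 < s := lt_le_trans ltr01 (le_trans s11 hss1).
have sd1 : 1 <= s ^+ d.-1 by rewrite exprn_ege1// (le_trans s11).
have sd0 : 0 <= s ^+ d.-1 := le_trans ler01 sd1.
have e2 : 0 < e / (3 * (H + 1)) by rewrite divr_gt0// mulr_gt0// ltr_wpDl.
have [L hL] := vectors_below k.
set Bk := [set u | coset_class Ls (toZ u) = coset_class Ls (toZ k)].
have [us [uus Lus hus]] := charge_approx r Bk L e2.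
set p := h * profile _.
have pH : 0 <= p <= H.
  have /andP[p0 p1] := profile_bound (point a (toZ k)).
  by rewrite mulr_ge0//= ler_wpM2l.
have sL := full_lattice_subgroup Pa Y y0.
have inB u : (u \in Bk) = `[< Ls (toZ k - toZ u) >].
  apply/idP/asboolP => [|hu]; first by rewrite inE => /esym /(coset_classE sL).
  by rewrite inE; apply/esym/(coset_classE sL).
pose b u := renewal (toZ k - toZ u) * s ^+ d.-1 - (if u \in Bk then p else 0).
have hb u : `|b u| <= 2 * (e / (3 * (M + 1))) * expR (eta * (norm1 u)%:R).
  have ex1 : 1 <= expR (eta * (norm1 u)%:R) by rewrite -expR0 ler_expR mulr_ge0// ltW.
  have ex0 : 0 <= expR (eta * (norm1 u)%:R) by exact: expR_ge0.
  move: (ltW e1) hs1 hs2; set e' := e / _ => e'0 {}hs1 {}hs2.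
  have [hu|hu] := leP (norm1 u)%:R (del * s).
    apply: (@le_trans _ _ e').
      rewrite /b inB; case: asboolP => Lu.
        by apply: hs1 => // i; rewrite /toZ mxE; exact: hk.
      by rewrite (renewal_support W Sy0)// mul0r subrr normr0.
    rewrite -mulrA -[leLHS]mul1r ler_pM// ?ler1n// -[leLHS]mulr1 ler_wpM2l//.
  have b1 : `|b u| <= (C + H) * s ^+ d.-1.
    have /andP[r0 r1] := hC (toZ k - toZ u).
    rewrite /b (le_trans (ler_normB _ _))// mulrDl lerD//.
      by rewrite ger0_norm ?mulr_ge0// ler_wpM2r.
    case: ifP => _; last by rewrite normr0 mulr_ge0.
    by case/andP: pH => p0 p1; rewrite ger0_norm// (le_trans p1)// ler_peMr.
  apply: le_trans b1 _.
  have h3 := hs2 s hss2.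
  have h4 : expR (eta * (norm1 u)%:R) >= expR (eta * del * s).
    by rewrite ler_expR -mulrA ler_wpM2l ?(ltW eta0)// ltW.
  apply: (@le_trans _ _ (e' * expR (eta * del * s))).
    by rewrite -ler_pdivrMr ?expR_gt0// -expRN.
  apply: le_trans (ler_wpM2l e'0 h4) _.
  by rewrite -[leRHS]mulrA ler_peMl ?(mulr_ge0 e'0 ex0)// ler1n.
have convE : \sum_(u \in [set: Nd]) renewal (toZ k - toZ u) * mass r u =
    \sum_(u <- us) renewal (toZ k - toZ u) * mass r u.
  rewrite (fsbigE us)//; first by apply: eq_bigl => u; exact: mem_set.
  move=> u _ hu.
  rewrite renewal_out ?mul0r//; apply/negP => h'; move/negP: hu; apply.
  apply/Lus/hL/forallP => i; have := forallP h' i.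
  by rewrite !mxE subr_ge0 lez_nat.
rewrite convE /class_mass -/Bk.
have -> : s ^+ d.-1 * (\sum_(u <- us) renewal (toZ k - toZ u) * mass r u) - fine (r Bk) * p =
   \sum_(u <- us) b u * mass r u - (fine (r Bk) - \sum_(u <- us | u \in Bk) mass r u) * p.
  rewrite mulrBl opprB addrA; congr (_ - _); rewrite mulr_sumr mulr_suml.
  rewrite [X in _ + X]big_mkcond -big_split; apply: eq_bigr => u _ /=.
  by rewrite /b; case: ifP => _; ring.
have t1 : `|\sum_(u <- us) b u * mass r u| <= 2 * (e / 3).
  apply: le_trans (ler_norm_sum _ _ _) _.
  apply: (@le_trans _ _ (2 * (e / (3 * (M + 1))) *
      \sum_(u <- us) expR (eta * (norm1 u)%:R) * `|mass r u|)).
    rewrite mulr_sumr; apply: ler_sum => u _; rewrite normrM mulrA ler_wpM2r//.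
  apply: (@le_trans _ _ (2 * (e / (3 * (M + 1))) * (M + 1))).
    apply: ler_wpM2l; first by apply: mulr_ge0 (ltW e1).
    by rewrite (le_trans (hM us uus))// lerDl.
  by rewrite le_eqVlt; apply/orP; left; apply/eqP; field; rewrite gt_eqF.
have t2 : `|(fine (r Bk) - \sum_(u <- us | u \in Bk) mass r u) * p| <= e / 3.
  case/andP: pH => p0 p1; rewrite normrM (ger0_norm p0).
  apply: (@le_trans _ _ (e / (3 * (H + 1)) * (H + 1))).
    by rewrite ler_pM// (le_trans p1)// lerDl.
  by rewrite le_eqVlt; apply/orP; left; apply/eqP; field; rewrite gt_eqF// ltr_wpDl.
rewrite (le_trans (ler_normB _ _))//; apply: le_trans (lerD t1 t2) _; lra.
Qed.

End convolution.

(** * Constants of the transverse density *)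

Section constants.
Context (R : realType).

Lemma sqrtrX (x : R) n : 0 <= x -> Num.sqrt (x ^+ n) = Num.sqrt x ^+ n.
Proof.
move=> x0; by rewrite -[in LHS](sqr_sqrtr x0) exprAC sqrtr_sqr ger0_norm// exprn_ge0.
Qed.

Lemma powR_half_pred (x : R) d : 0 <= x -> (0 < d)%N ->
  x `^ ((d%:R - 1) / 2) = Num.sqrt x ^+ d.-1.
Proof.
move=> x0 d0; have -> : (d%:R - 1) / 2 = 2^-1 * d.-1%:R :> R.
  by rewrite -[in LHS](prednK d0) -natr1 addrK mulrC.
by rewrite powRrM powR_mulrn ?powR_ge0// powR12_sqrt.
Qed.

Lemma powR_half_inv (x : R) : 0 <= x -> x `^ (- 2^-1) = (Num.sqrt x)^-1.
Proof. by move=> x0; rewrite powRN powR12_sqrt. Qed.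

(** A computation of constants; the determinant of [G] is positive because
    [gauss_const] is. *)
Lemma profile_density d (m : 'cV[R]_d) (G : 'M[R]_d) w : (0 < d)%N -> pos_def G ->
  0 < quad (invmx G) m -> profile m G w = transverse_density m G w.
Proof.
move=> d0 pG b0.
have p0 : 0 < 2 * pi :> R by rewrite mulr_gt0// pi_gt0.
have dI : 0 < \det (invmx G).
  have := gauss_const_gt0 (pos_def_inv pG); rewrite /gauss_const sqrtr_gt0.
  by rewrite pmulr_rgt0 ?exprn_gt0// invr_gt0.
have dG : 0 < \det G by move: dI; rewrite det_inv invr_gt0.
rewrite /profile /transverse_density powRN powR_half_pred// ?ltW//.
rewrite !powR_half_inv ?(ltW dG) ?(ltW b0)//.
rewrite /gauss_const det_inv invrK.
rewrite [Num.sqrt ((2 * pi) ^+ d * _)]sqrtrM ?exprn_ge0 ?(ltW p0)// sqrtrX ?(ltW p0)//.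
rewrite [Num.sqrt (2 * pi / _)]sqrtrM ?(ltW p0)// sqrtrV ?(ltW b0)//.
have ed : Num.sqrt (2 * pi : R) ^+ d = Num.sqrt (2 * pi) * Num.sqrt (2 * pi) ^+ d.-1.
  by rewrite -exprS prednK.
rewrite ed [_ / 2]mulrC.
have h1 : 0 < Num.sqrt (2 * pi : R) by rewrite sqrtr_gt0.
have h2 : 0 < Num.sqrt (\det G) by rewrite sqrtr_gt0.
have h3 : 0 < Num.sqrt (quad (invmx G) m) by rewrite sqrtr_gt0.
have h4 : 0 < Num.sqrt (2 * pi : R) ^+ d.-1 by exact: exprn_gt0.
move: h1 h2 h3 h4; set u := Num.sqrt (2 * pi); set v := Num.sqrt (\det G).
set z := Num.sqrt (quad _ _); set y := _ ^+ d.-1; set E := expR _ => h1 h2 h3 h4.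
by field; rewrite !gt_eqF.
Qed.

End constants.

(** * The local renewal theorem *)

Theorem theorem6p7 (R : realType) (d : nat) (hd : (1 <= d)%N)
  (dX : measure_display) (X : measurableType dX) (hX : standard_borel R X)
  (q : 'cV[nat]_d -> R.-ker X ~> X)
  (hq : renewal_kernel q) (hq0 : strict_kernel q)
  (mu : probability X R) (hP : positive_harris (kerP q) mu)
  (hmean : forall i : 'I_d, (0 < mean_step q mu i < +oo)%E)
  (C : set X) (hC : measurable C) (hmuC : (0 < mu C)%E)
  (eps : R) (heps0 : 0 < eps) (heps1 : eps <= 1)
  (theta : probability (X * 'cV[nat]_d)%type R)
  (hminor : minorized q C eps theta)
  (dO : measure_display) (Omega : measurableType dO) (Pa : probability Omega R)
  (J : nat -> Omega -> X) (chi : nat -> Omega -> bool)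
  (Xi : nat -> Omega -> 'cV[nat]_d)
  (hchain : split_chain_from_atom q mu C eps theta Pa J chi Xi)
  (m : 'cV[R]_d) (G : 'M[R]_d) (y0 : 'cV[nat]_d) :
  let Y := cycle_incr C J chi Xi in
  let S := supp Pa (Y 1%N) in
  let Ls := full_lattice S y0 in
  S y0 ->
  (exists2 t : R, 0 < t &
     ('E_Pa[fun w => expR (t * (norm1 (Y 1%N w))%:R)] < +oo)%E) ->
  (forall i, 'E_Pa[fun w => (Y 1%N w i ord0)%:R] = (m i ord0)%:E)%E ->
  (forall i, 0 < m i ord0) ->
  (forall i j, covariance Pa (fun w => (Y 1%N w i ord0)%:R)
                             (fun w => (Y 1%N w j ord0)%:R) = (G i j)%:E) ->
  pos_def G ->
  has_rank (diff_lattice S) d ->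
  forall (r : {charge set 'cV[nat]_d -> \bar R}) (K : set 'cV[R]_d),
  exp_summable r -> compact K ->
  sup [set `| a `^ ((d%:R - 1) / 2) * renewal_mass_conv Pa Y r k
              - class_mass Ls r (coset_class Ls (toZ k))
                * transverse_density_star Ls m G (rescaled m a k) |
      | k in window m K a] @[a --> +oo] --> (0 : R).
Proof.
move=> Y S Ls Sy0 [t t0 hexp] hm mpos hcov pG [[B [colB freeB]] _] r K hr Kc.
have mYn := measurable_cycle_incr hC hchain.
have W : nice_walk Pa (Y 1%N) t m G B.
  split=> //; move=> _ D _; rewrite setTI.
  exact: (measurable_discrete (mYn 1%N)).
have mCn n v : measurable [set w | psum Y n w = v].
  rewrite (_ : [set _ | _] = [set w | psum Xi (cycle_time C J chi n w) w = v]).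
    exact: (measurable_cycle_place hC hchain n v).
  by apply/seteqP; split => w /=; rewrite psum_cycles.
have hYn := cycle_increments hC heps0 heps1 hminor hchain hP.2 hmuC.
have sL : is_subgroup Ls := full_lattice_subgroup Pa (Y 1%N) y0.
have colL j : Ls (col j B) := full_lattice_diff y0 (colB j).
have [cs csE hcs] := coset_transversal R sL colL (zfree_det freeB).
(* Compactness enters only through the boundedness of the coordinates on [K]. *)
have [D D0 hD] : exists2 D : R, 0 <= D & forall w, K w -> forall i, `|w i 0| <= D.
  have /boolp.choice [b hb] : forall i : 'I_d, exists b : R, forall w, K w -> `|w i 0| <= b.
    move=> i; have /compact_bounded [M [_ hM]] : compact ((fun w : 'cV[R]_d => w i 0) @` K).
      apply: continuous_compact => //; apply: continuous_subspaceT => w.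
      exact: coord_continuous.
    exists (M + 1) => w Kw; apply: (hM (M + 1)); first by rewrite ltrDl.
    by exists w.
  exists (\sum_i `|b i|); first by apply: sumr_ge0.
  move=> w Kw i; rewrite (le_trans (hb i w Kw))// (bigD1 i)//=.
  by rewrite (le_trans (ler_norm _))// lerDl sumr_ge0.
apply/cvgrPdist_le => e e0.
have [s1 s11 hs1] := convolution_limit W hd Sy0 hcs hr D0 e0.
exists (s1 ^+ 2); split; first exact: num_real.
move=> a sa; have s0 : 0 < s1 := lt_le_trans ltr01 s11.
have a0 : 0 < a by apply: lt_trans sa; rewrite exprn_gt0.
have hs : s1 <= Num.sqrt a.
  by rewrite -[leLHS](ger0_norm (ltW s0)) -sqrtr_sqr ler_wsqrtr// ltW.
have sq0 : 0 < Num.sqrt a by rewrite sqrtr_gt0.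
set E := [set _ | _ in _].
have hE x : E x -> 0 <= x <= e.
  move=> [k Kk <-]; rewrite normr_ge0 /=.
  have hk i : `|(k i 0)%:R - a * m i 0| <= D * Num.sqrt a.
    have := hD _ Kk i; rewrite /rescaled /toR !mxE normrM [X in X * _]gtr0_norm ?invr_gt0//.
    by rewrite mulrC ler_pdivrMr.
  have := hs1 a k hs hk; rewrite csE powR_half_pred ?(ltW a0)//.
  have -> : renewal_mass_conv Pa Y r k =
      \sum_(u \in [set: 'cV[nat]_d]) renewal Pa (Y 1%N) (toZ k - toZ u) * mass r u.
    by apply: eq_fsbigr => u _; rewrite (renewal_massE mYn mCn hYn).
  have -> : rescaled m a k = (Num.sqrt a)^-1 *: (ofZ R (toZ k) - a *: m).
    by rewrite /rescaled; congr (_ *: (_ - _)); apply/colP => i; rewrite !mxE.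
  by rewrite (profile_density _ hd pG (drift_gt0 W hd)).
rewrite sub0r normrN.
have [->|/set0P [x Ex]] := eqVneq E set0; first by rewrite sup0 normr0 ltW.
have bE : has_ubound E by exists e => y /hE /andP[].
have /andP[x0 _] := hE x Ex.
rewrite ger0_norm; last exact: le_trans x0 (ub_le_sup bE Ex).
by apply: ge_sup; [exists x|move=> y /hE /andP[]].
Qed.
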